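(* Let $\alpha_0>1$ be an integer and let $P:\mathbb{C}^2\to\mathbb{C}^2$ be the map $$P(z,w)=\left(z-z^2,\;w+w^2+\left(\frac14+\frac{\pi^2}{(\ln\alpha_0)^2}\right)z^2\right).$$ Then $P$ has countably infinitely many distinct grand orbits of rank $1$ wandering domains.
   Context: The Fatou set of $P$ is the largest open subset of $\mathbb{C}^2$ on which the family of iterates $(P^n)_{n\in\mathbb{N}}$ is normal; a Fatou component is a connected component of it. A Fatou component $\Omega$ is wandering (a wandering domain) if $P^{k+m}(\Omega)\cap P^k(\Omega)=\emptyset$ for all integers $k\ge0$, $m\ge1$. The rank of a Fatou component $\Omega$ is the maximal rank of $\mathrm{d}h_x$, where $x\in\Omega$ and $h$ ranges over all Fatou limit functions (locally uniform limits of subsequences of $(P^n)_{n\ge0}$) on $\Omega$. Two Fatou components $\Omega_1,\Omega_2$ are in the same grand orbit for $P$ if there exist $n_1,n_2\in\mathbb{N}$ with $P^{n_1}(\Omega_1)=P^{n_2}(\Omega_2)$. *)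

(* Defs.v *)
From HB Require Import structures.
From mathcomp Require Import all_boot all_order all_algebra.
From mathcomp Require Export complex.
From mathcomp Require Import all_classical all_reals all_analysis.
Set Implicit Arguments.
Unset Strict Implicit.
Unset Printing Implicit Defensive.
Import Order.TTheory GRing.Theory Num.Theory.
Import numFieldNormedType.Exports.
Local Open Scope classical_set_scope.
Local Open Scope ring_scope.

Definition strictly_increasing (u : nat -> nat) := {homo u : m n / (m < n)%N}.

Section Normality.
Variables (K : numFieldType) (d : nat).
Local Notation X := 'rV[K]_d.
Implicit Types (U : set X) (f : nat -> X -> X) (h : X -> X).

(* The values of h outside U are irrelevant when U is open. *)
Definition locally_uniform_cvg U f h :=
  forall x, U x ->
    exists2 V, nbhs x V & {uniform V, f n @[n --> \oo] --> h}.

Definition compactly_divergent U f :=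
  forall K L : set X, compact K -> K `<=` U -> compact L ->
    \forall n \near \oo, f n @` K `&` L = set0.

(* Normality of the family {f n : n in nat}. The sequence u of members of the
   family is arbitrary, so a member may be repeated. Locally uniform divergence
   to infinity is allowed, as usual for maps into a non-compact space. *)
Definition normal_on U f :=
  forall u : nat -> nat, exists2 phi, strictly_increasing phi &
    (exists h, locally_uniform_cvg U (fun n => f (u (phi n))) h) \/
    compactly_divergent U (fun n => f (u (phi n))).

End Normality.

Section FatouComponents.
Variables (K : numFieldType) (d : nat).
Local Notation X := 'rV[K]_d.
Variable P : X -> X.
Implicit Types (Om : set X).

(* Normality is a local property: the Fatou set consists of the points having
   an open neighbourhood on which the iterates are normal. (On a disconnected
   union, some pieces may converge while others diverge.) *)
Definition fatou_set : set X :=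
  \bigcup_(U in [set U | open U /\ normal_on U (fun n => iter n P)]) U.

Definition fatou_component Om :=
  exists2 x, fatou_set x & Om = connected_component fatou_set x.

Definition wandering_domain Om :=
  fatou_component Om /\
  forall k m, (1 <= m)%N -> iter (k + m) P @` Om `&` iter k P @` Om = set0.

Definition fatou_limit Om (h : X -> X) :=
  exists2 phi, strictly_increasing phi &
    locally_uniform_cvg Om (fun n => iter (phi n) P) h.

Definition same_grand_orbit Om1 Om2 :=
  exists n1 n2, iter n1 P @` Om1 = iter n2 P @` Om2.

Definition grand_orbit Om : set (set X) :=
  [set Om' | fatou_component Om' /\ same_grand_orbit Om Om'].

(* 'J h x is the matrix of the K-linear differential of h at x, hence the rank
   is a complex rank when K is the field of complex numbers. *)
Definition has_rank Om (r : nat) :=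
  (exists h x, [/\ fatou_limit Om h, Om x & \rank ('J h x) = r]) /\
  (forall h x, fatou_limit Om h -> Om x -> (\rank ('J h x) <= r)%N).

End FatouComponents.

(* A point (z, w) of C^2 is the row vector with entries z and w. *)
Definition skew_map (R : realType) (alpha : int) (p : 'rV[R[i]]_2) :
    'rV[R[i]]_2 :=
  let z := p 0 0 in
  let w := p 0 1 in
  let c : R := 1 / 4%:R + pi ^+ 2 / ln (alpha%:~R) ^+ 2 in
  \row_(j < 2) if j == 0 then z - z ^+ 2 else w + w ^+ 2 + c%:C%C * z ^+ 2.

(* Main.v *)
Require Import Defs.
From HB Require Import structures.
From mathcomp Require Import all_boot all_order all_algebra.
From mathcomp Require Import all_classical all_reals all_analysis.
From mathcomp Require Import ring lra zify.
Import Order.TTheory GRing.Theory Num.Theory.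
Import numFieldNormedType.Exports.
Set Implicit Arguments.
Unset Strict Implicit.
Unset Printing Implicit Defensive.
Local Open Scope classical_set_scope.
Local Open Scope ring_scope.

(* In the coordinate [1/z] the first component is a perturbed translation, so [z_n] is about [1/(n + ln n + tau)] and
  slowly opens the gate of the parabolic map [w + w^2 + 1/4]. With [kappa = pi/ln alpha] and [u = (w + z/2)/z], the
  angle [atan (u/kappa)/kappa] grows by [z + O(z^2)] at each step, so an orbit with [w] near [-1/2] at a time about
  [alpha^k] crosses the gate before the time [alpha^(k+1)], and by second order asymptotics its exit position has
  a limit depending only on [Y = (alpha - 1)*tau - alpha*entry w]. The limits [E j Y] of the [j]-th last points before
  time [alpha^(k+1)] form a backward orbit of [quad]. When [tau] makes [-1/2] a fixed point of [w |-> E 0 Y], it is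
  superattracting; the points near it lie in a Fatou component whose limit functions depend on [tau] alone, effectively,
  hence have rank 1. The backward orbit of [-1/2] can be prescribed to turn up, make [m] steps on the left and then tend
  to 0. This [m] is constant on the component, because the separation of such backward orbits keeps the limit of [w]
  inside the disc around [-1/2], and it is determined by the grand orbit. *)

(** For [v = w + z/2] the second coordinate becomes [v(1-z) + v^2 + kappa^2 z^2], so [u = v/z] makes
    an exact discrete Riccati step. Crossing the gate costs the angle [pi/kappa = ln alpha], and
    this is also the asymptotic sum of [z] between the times [n] and [alpha n]: hence the shape of
    the coefficient. The obstacle is precision. The exit is read in the coordinate [1/v], which
    multiplies angle errors by [n], so terms of order [1/n] must be followed and shown to have
    limits. The limits are only proved to exist, and only for one real orbit started at [-1/2];
    complex orbits are compared with it through the tangent of an angle difference, whose recursion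
    is exact. Nothing is known about the shape of a Fatou component, so each property is spread over
    it by connectedness; the complex analysis behind this consists of Cauchy estimates, as iterates
    are polynomial along complex lines. A long left run makes the offset [Y] of a chain vary little
    with its first point. Together with the expansion of [entry] off its critical point this
    excludes limits on a boundary circle, and it also recovers [tau] from the limit. *)

Notation Re := complex.Re.
Notation Im := complex.Im.
Notation "x %:C" := (real_complex _ x) : ring_scope.
Ltac clra := clear; lra.
Ltac clia := clear; lia.
Ltac clear_props := repeat match goal with H : ?T |- _ => match type of T with Prop => clear H end end.
Ltac plra := clear_props; lra.
Ltac plia := clear_props; lia.
Ltac posnz := by do ?[apply/andP; split]; rewrite gt_eqF //; lra.

Lemma natr_gt0 (R : numDomainType) n : (0 < n)%N -> 0 < n%:R :> R.
Proof. by rewrite ltr0n. Qed.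
Lemma leqDl m n k : (m + n <= k)%N -> (m <= k)%N.
Proof. exact: leq_trans (leq_addr _ _). Qed.
Lemma leqDr m n k : (m + n <= k)%N -> (n <= k)%N.
Proof. exact: leq_trans (leq_addl _ _). Qed.

(** * Complex modulus with real values *)

Section Modulus.
Variable R : realType.
Local Notation C := R[i].
Implicit Types x y z : C.

(** [|z|] lives in [R[i]], whose order is only partial; its real part is a modulus in [R], where
    inequalities are total. *)
Definition cn (z : C) : R := Re `|z|.

Lemma cnE z : `|z| = (cn z)%:C.
Proof. by rewrite /cn normc_def. Qed.
Lemma cn_ge0 z : 0 <= cn z.
Proof. by rewrite /cn normc_def /= sqrtr_ge0. Qed.

Lemma cnM x y : cn (x*y) = cn x*cn y.
Proof.
by apply: complexI; rewrite rmorphM /= -!cnE normrM.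
Qed.

Lemma cnD x y : cn (x+y) <= cn x + cn y.
Proof. by rewrite -lecR rmorphD /= -!cnE ler_normD. Qed.
Lemma cnN x : cn (- x) = cn x.
Proof. by rewrite /cn normrN. Qed.
Lemma cnB x y : cn (x-y) <= cn x + cn y.
Proof. by rewrite -(cnN y) cnD. Qed.
Lemma cnD_le x y e : cn x + cn y <= e -> cn (x+y) <= e.
Proof. exact: le_trans (cnD x y). Qed.
Lemma cnB_le x y e : cn x + cn y <= e -> cn (x-y) <= e.
Proof. exact: le_trans (cnB x y). Qed.
Lemma cn_tri x y z : cn (x+z) <= cn (x-y) + cn (y+z).
Proof. by have := cnD (x-y) (y+z); rewrite addrA subrK. Qed.

Lemma cn_via x y x' y' : cn (x-y) <= cn (x-x') + cn (y-y') + cn (x'-y').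
Proof.
have -> : x - y = (x-x') - (y-y') + (x'-y') by ring.
by apply: le_trans (cnD _ _) _; rewrite lerD2r cnB.
Qed.

Lemma cnBC x y : cn (x-y) = cn (y-x).
Proof. by rewrite -cnN opprB. Qed.
Lemma cn_sub_ge x y : cn x - cn y <= cn (x-y).
Proof. by rewrite lerBlDr; have := cnD (x-y) y; rewrite subrK. Qed.

Lemma cnV x : cn x^-1 = (cn x)^-1.
Proof.
by apply: complexI; rewrite fmorphV /= -!cnE normfV.
Qed.

Lemma cn_div x y : cn (x/y) = cn x/cn y.
Proof. by rewrite cnM cnV. Qed.

Lemma cnX x n : cn (x^+n) = cn x^+n.
Proof.
by apply: complexI; rewrite rmorphXn /= -!cnE normrX.
Qed.

Lemma cn0 : cn 0 = 0.
Proof. by rewrite /cn normr0. Qed.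
Lemma cn1 : cn 1 = 1.
Proof. by rewrite /cn normr1. Qed.
Lemma cn_eq0 x : (cn x == 0) = (x == 0).
Proof. by rewrite -[RHS]normr_eq0 cnE (inj_eq (@complexI _)). Qed.
Lemma cn_gt0 x : (0 < cn x) = (x != 0).
Proof. by rewrite lt_def cn_ge0 andbT cn_eq0. Qed.
Lemma cn_real (a : R) : cn a%:C = `|a|.
Proof. by rewrite /cn normc_def /= expr0n addr0 sqrtr_sqr. Qed.
Lemma cn_nat n : cn n%:R = n%:R.
Proof. by rewrite -(rmorph_nat (real_complex R)) cn_real ger0_norm. Qed.
Lemma cn_ge_Re x : `|Re x| <= cn x.
Proof. by rewrite -lecR -cnE normc_ge_Re. Qed.
Lemma cn_sqr x : cn x^+2 = Re x^+2 + Im x^+2.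
Proof. by apply: complexI; rewrite rmorphXn /= -cnE add_Re2_Im2. Qed.

Lemma cn_ge_Im x : `|Im x| <= cn x.
Proof.
rewrite -(ler_pXn2r (n := 2)) ?nnegrE ?cn_ge0 // cn_sqr real_normK ?num_real //.
by rewrite lerDr sqr_ge0.
Qed.

Lemma cn_le_ReIm x : cn x <= `|Re x| + `|Im x|.
Proof.
rewrite -(ler_pXn2r (n := 2)) ?nnegrE ?cn_ge0 ?addr_ge0 // cn_sqr.
rewrite sqrrD !real_normK ?num_real // addrAC lerDl.
by rewrite mulrn_wge0 // mulr_ge0.
Qed.

Lemma cReD x y : Re (x+y) = Re x + Re y.
Proof. by case: x; case: y. Qed.
Lemma cImD x y : Im (x+y) = Im x + Im y.
Proof. by case: x; case: y. Qed.
Lemma cReN x : Re (- x) = - Re x.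
Proof. by case: x. Qed.
Lemma cImN x : Im (- x) = - Im x.
Proof. by case: x. Qed.
Lemma cReB x y : Re (x-y) = Re x - Re y.
Proof. by rewrite cReD cReN. Qed.
Lemma cImB x y : Im (x-y) = Im x - Im y.
Proof. by rewrite cImD cImN. Qed.
Lemma cReM x y : Re (x*y) =
 Re x*Re y - Im x*Im y.
Proof. by case: x; case: y. Qed.
Lemma cImM x y : Im (x*y) =
 Re x*Im y + Im x*Re y.
Proof. by case: x => a b; case: y. Qed.
Lemma cReV x : Re x^-1 = Re x/cn x^+2.
Proof. by rewrite cn_sqr; case: x. Qed.
Lemma complex_ext x y : Re x = Re y ->
 Im x = Im y -> x = y.
Proof. by case: x => a b; case: y => c d /= -> ->. Qed.

(** Square root in the closed right half-plane. This branch later separates right from left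
    preimages under [quad], whose critical point is [-1/2]. *)
Definition csqrt (z : C) : C :=
 if 0 <= Re (sqrtc z) then sqrtc z else - sqrtc z.

Lemma csqrt_sqr z : csqrt z^+2 = z.
Proof. by rewrite /csqrt; case: ifP => _; rewrite ?sqrrN sqr_sqrtc. Qed.

Lemma csqrt_ge0 z : 0 <= Re (csqrt z).
Proof.
rewrite /csqrt; case: ifPn => //; rewrite -ltNge cReN => h.
by rewrite oppr_ge0 ltW.
Qed.


Lemma real_cauchy_lim (x : nat -> R) :
 (forall e, 0 < e -> exists N, forall m n, (N <= m)%N -> (N <= n)%N ->
   `|x m - x n| <= e) ->
 exists l, forall e, 0 < e -> exists N, forall n, (N <= n)%N -> `|x n - l| <= e.
Proof.
move=> xC.
have /cauchy_cvgP cx : cauchy (x n @[n --> \oo]).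
 apply/cauchy_ballP => e e0.
 have e2 : 0 < e/2%:R by rewrite divr_gt0.
 have [N HN] := xC _ e2.
 exists (x @` [set n | (N <= n)%N], x @` [set n | (N <= n)%N]) => /=.
  by split; exists N => // n /= Nn; exists n.
 move=> [a b] /= [[m Nm <-] [n Nn <-]].
 rewrite /ball /=; apply: le_lt_trans (HN _ _ Nm Nn) _.
 by rewrite ltr_pdivrMr // ltr_pMr // ltr1n.
exists (lim (x n @[n --> \oo])) => e e0.
have /cvgrPdist_le/(_ e e0) [N _ HN] := cx.
by exists N => n /HN /=; rewrite distrC.
Qed.

Lemma complex_cauchy_lim (x : nat -> C) :
 (forall e, 0 < e -> exists N, forall m n, (N <= m)%N -> (N <= n)%N ->
   cn (x m - x n) <= e) ->
 exists l, forall e, 0 < e -> exists N, forall n, (N <= n)%N ->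
   cn (x n - l) <= e.
Proof.
move=> xC.
have [|a Ha] := @real_cauchy_lim (fun n => Re (x n)).
 move=> e /xC [N HN]; exists N => m n Nm Nn.
 by rewrite -cReB (le_trans (cn_ge_Re _)) ?HN.
have [|b Hb] := @real_cauchy_lim (fun n => Im (x n)).
 move=> e /xC [N HN]; exists N => m n Nm Nn.
 by rewrite -cImB (le_trans (cn_ge_Im _)) ?HN.
exists (a +i* b)%C => e e0.
have e2 : 0 < e/2%:R by rewrite divr_gt0.
have [N HN] := Ha _ e2; have [N' HN'] := Hb _ e2.
exists (maxn N N') => n; rewrite geq_max => /andP[/HN h /HN' h'].
apply: le_trans (cn_le_ReIm _) _; rewrite cReB cImB /=.
by apply: le_trans (lerD h h') _; rewrite -splitr.
Qed.

End Modulus.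

(** * Inequalities for logarithm and arctangent *)

Section RealCalculus.
Variable R : realType.
Implicit Types x y : R.

Lemma derive_ge0_le (f df : R -> R) (a b : R) : a <= b ->
 (forall x, a <= x <= b -> is_derive x 1 f (df x)) ->
 (forall x, a <= x <= b -> 0 <= df x) -> f a <= f b.
Proof.
move=> ab fd dge.
have cf : {within `[a, b], continuous f}.
 apply: derivable_within_continuous => x; rewrite in_itv /= => xab.
 by have [] := fd x xab.
have fd' x : x \in `]a, b[%R -> is_derive x 1 f (df x).
 by rewrite in_itv /= => /andP[/ltW h /ltW h']; apply: fd; rewrite h h'.
have [c] := MVT_segment ab fd' cf.
rewrite in_itv /= => cab e; rewrite -subr_ge0 e mulr_ge0 ?dge // subr_ge0 //.
Qed.

Lemma ln_le_sub1 x : 0 < x -> ln x <= x - 1.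
Proof. by move=> x0; have := @le_ln1Dx R (x-1); rewrite subrKC; apply; lra. Qed.

Lemma ln1D_ge x : -1 < x -> x/(1+x) <= ln (1+x).
Proof.
move=> x1; have h : 0 < 1 + x by lra.
have := @ln_le_sub1 (1+x)^-1; rewrite lnV ?posrE // invr_gt0 => /(_ h) h2.
suff -> : x/(1+x) = 1 - (1+x)^-1 by lra.
by field; lra.
Qed.

Lemma ln1D_bound x : -(1/2) <= x -> `|ln (1+x) - x| <= 2*x^+2.
Proof.
move=> hx; rewrite ler_norml; apply/andP; split; last first.
 by have := @le_ln1Dx R x; have := sqr_ge0 x; move=> ? h; have := h ltac:(lra); lra.
have := @ln1D_ge x ltac:(lra).
suff : x - 2*x^+2 <= x/(1+x) by lra.
rewrite ler_pdivlMr; last lra.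
have := sqr_ge0 x; nra.
Qed.

Lemma ln1B_bound3 x : 0 <= x -> x <= 1/2 ->
 `|ln (1-x) + x + x^+2/2| <= x^+3.
Proof.
move=> x0 x2; rewrite ler_norml; apply/andP; split.
- have := @derive_ge0_le (fun y => ln (1-y) + y + y^+2/2 + y^+3)
  (fun y => - (1-y)^-1 + 1 + y + 3*y^+2) 0 x x0.
 rewrite subr0 ln1 !expr0n /= mul0r !addr0 => H.
 have : 0 <= ln (1-x) + x + x^+2/2 + x^+3; last by lra.
 apply: H => y /andP[y0 yx].
  have h : 0 < 1 - y by lra.
  have d := is_derive1_ln h.
  apply: is_derive_eq; rewrite /GRing.scale /=; lra.
 have h : 0 < 1 - y by lra.
 suff : (1-y)^-1 <= 1 + y + 3*y^+2 by lra.
 rewrite -[X in X <= _]mul1r ler_pdivrMr //.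
 have : 0 <= y^+2*(2-3*y); last by nra.
 by rewrite mulr_ge0 ?sqr_ge0 //; lra.
- have := @derive_ge0_le (fun y => - (ln (1-y) + y + y^+2/2))
  (fun y => (1-y)^-1 - 1 - y) 0 x x0.
 rewrite subr0 ln1 !expr0n /= mul0r !addr0 oppr0 => H.
 have : 0 <= - (ln (1-x) + x + x^+2/2); last first.
  by have := exprn_ge0 3 x0; lra.
 apply: H => y /andP[y0 yx].
  have h : 0 < 1 - y by lra.
  have d := is_derive1_ln h.
  apply: is_derive_eq; rewrite /GRing.scale /=; lra.
 have h : 0 < 1 - y by lra.
 suff : 1 + y <= (1-y)^-1 by lra.
 by rewrite -[X in _ <= X]mul1r ler_pdivlMr //; nra.
Qed.

Lemma atan_le_id x : 0 <= x -> atan x <= x.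
Proof.
move=> x0.
have := @derive_ge0_le (fun y => - atan y + y) (fun y => - (1+y^+2)^-1 + 1) 0 x x0.
rewrite atan0 oppr0 add0r => H.
suff : 0 <= - atan x + x by lra.
apply: H => y /andP[y0 _].
 suff : (1+y^+2)^-1 <= 1 by lra.
 have := sqr_ge0 y => ?; rewrite invf_le1; lra.
Qed.

Lemma atan_ge_cubic x : 0 <= x -> x - x^+3 <= atan x.
Proof.
move=> x0.
have := @derive_ge0_le (fun y => atan y - y + y^+3)
 (fun y => (1+y^+2)^-1 - 1 + 3*y^+2) 0 x x0.
rewrite atan0 expr0n /= subrr addr0 => H.
suff : 0 <= atan x - x + x^+3 by lra.
apply: H => y /andP[y0 _].
 by apply: is_derive_eq; rewrite /GRing.scale /=; lra.
have h := sqr_ge0 y; have h1 : 0 < 1 + y^+2 by lra.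
have : 1 - 3*y^+2 <= (1+y^+2)^-1; last by lra.
by rewrite -[X in _ <= X]mul1r ler_pdivlMr //; nra.
Qed.

Lemma atan_ge0 x : 0 <= x -> 0 <= atan x.
Proof. by move=> x0; rewrite -(@atan0 R) le_atan. Qed.

(** The condition [0 < 1 + x*y] makes the cosine of the difference positive, so the difference lies
    in [[0, pi/2)] and no multiple of [pi] enters the addition formula. *)
Lemma atan_sub x y : x <= y -> 0 < 1 + x*y ->
 atan y - atan x = atan ((y-x)/(1+x*y)).
Proof.
move=> xy h.
set p := atan y; set q := atan x.
have [p1 p2] : -(pi/2) < p /\ p < pi/2 by rewrite atan_gtNpi2 atan_ltpi2.
have [q1 q2] : -(pi/2) < q /\ q < pi/2 by rewrite atan_gtNpi2 atan_ltpi2.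
have pq : q <= p by apply: le_atan.
have cp : 0 < cos p by apply: cos_gt0_pihalf; rewrite p1 p2.
have cq : 0 < cos q by apply: cos_gt0_pihalf; rewrite q1 q2.
have sp : sin p = y*cos p by rewrite -[y in RHS](atanK y) /tan divfK // gt_eqF.
have sq : sin q = x*cos q by rewrite -[x in RHS](atanK x) /tan divfK // gt_eqF.
have c : cos (p-q) = cos p*cos q*(1+x*y).
 by rewrite cosB sp sq; ring.
have s : sin (p-q) = cos p*cos q*(y-x) by rewrite sinB sp sq; ring.
have c0 : 0 < cos (p-q) by rewrite c !mulr_gt0.
have pi0 := pi_gt0 R.
have lt2 : p - q < pi/2.
 rewrite ltNge; apply/negP => h2.
 suff : cos (p-q) <= 0 by rewrite leNgt c0.
 have -> : p - q = (p-q-pi/2) + pi/2 by ring.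
 rewrite cosDpihalf oppr_le0 sin_ge0_pi //; apply/andP; split; lra.
rewrite -[LHS]tanK; last by rewrite in_itv /=; apply/andP; split; lra.
congr atan; rewrite /tan c s invfM mulrA; congr (_/_).
by rewrite mulrAC divff ?mul1r // mulf_neq0 ?gt_eqF.
Qed.

Lemma atanV x : 0 < x -> atan x^-1 = pi/2 - atan x.
Proof.
move=> x0; set q := atan x.
have [q1 q2] : -(pi/2) < q /\ q < pi/2 by rewrite atan_gtNpi2 atan_ltpi2.
have q0 : 0 < q by rewrite -(@atan0 R) lt_atan.
have cq : 0 < cos q by apply: cos_gt0_pihalf; rewrite q1 q2.
have sq : sin q = x*cos q by rewrite -[x in RHS](atanK x) /tan divfK // gt_eqF.
rewrite -[RHS]tanK; last by rewrite in_itv /=; apply/andP; split; lra.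
congr atan; rewrite /tan.
have -> : pi/2 - q = - (q-pi/2) by ring.
rewrite sinN cosN sinBpihalf cosBpihalf opprK sq invfM.
by rewrite mulrC -mulrA mulVf ?mulr1 // gt_eqF.
Qed.

End RealCalculus.

(** * The slow variable of the gate *)

Section SlowVariable.
Variables (R : realType) (ka : R).
Hypothesis ka0 : 0 < ka.
Implicit Types z u v : R.

(** Primitive of [1/(u^2 + ka^2)]: the time of the flow [u' = u^2 + ka^2], which needs the total
    time [pi/ka] to cross the real line. *)
Definition angle u := atan (u/ka)/ka.
(** Logarithm of [|u + i ka|], a primitive of [u/(u^2 + ka^2)]: along the same flow its derivative
    is [u], the second-order coefficient in the increments of the angle. *)
Definition logmod u := ln (u^+2+ka^+2)/2.
(** Up to third order the angle grows by [z + z^2 - z^2 u] and [ln z] by [- z - z^2/2]. The term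
    [z*logmod] cancels [z^2 u], the term [z/2] cancels the remaining [z^2/2], and only
    [- z^2 logmod] survives. *)
Definition slow z u := angle u + ln z + z*(logmod u + 1/2).

Lemma sqka_gt0 u : 0 < u^+2 + ka^+2.
Proof. by have := sqr_ge0 u; have := exprn_gt0 2 ka0; lra. Qed.

(** No expansion is involved: in the subtraction formula [1 + (u/ka)(u'/ka)] factors as
    [(u^2+ka^2)(1+h*u)/ka^2], so the tangent of the increment is exactly [ka*h/(1+h*u)]. *)
Lemma angle_step u h : 0 <= h -> 0 < 1 + h*u ->
 angle (u + h*(u^+2+ka^+2)) - angle u = atan (ka*h/(1+h*u))/ka.
Proof.
move=> h0 hu; rewrite /angle -mulrBl; congr (_/_).
have Q0 := sqka_gt0 u.
have e : 1 + u/ka*((u + h*(u^+2+ka^+2))/ka) =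
  (u^+2+ka^+2)*(1+h*u)/ka^+2 by field; posnz.
rewrite atan_sub.
- by rewrite e; congr atan; field; posnz.
- rewrite ler_pM2r ?invr_gt0 // lerDl mulr_ge0 //; lra.
- by rewrite e divr_gt0 ?mulr_gt0 // exprn_gt0.
Qed.

Lemma atan_div_bound h : 0 <= h ->
 `|atan (ka*h)/ka - h| <= ka^+2*h^+3.
Proof.
move=> h0; have kh : 0 <= ka*h by rewrite mulr_ge0 // ltW.
have -> : atan (ka*h)/ka - h = (atan (ka*h) - ka*h)/ka by field; posnz.
rewrite normrM normfV (gtr0_norm ka0) ler_pdivrMr //.
have -> : ka^+2*h^+3*ka = (ka*h)^+3 by ring.
have := atan_le_id kh; have := atan_ge_cubic kh => h1 h2.
by rewrite ler_norml; apply/andP; split; have := exprn_ge0 3 kh; lra.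
Qed.

Lemma logmod_step u h : `|h*u| <= 1/9 -> `|h*ka| <= 1/9 ->
 `|logmod (u + h*(u^+2+ka^+2)) - logmod u - h*u|
  <= 10*(h^+2*(u^+2+ka^+2)).
Proof.
move=> hu hk; rewrite /logmod.
set Q := u^+2 + ka^+2; have Q0 : 0 < Q := sqka_gt0 u.
set x := 2*(h*u) + h^+2*Q.
have -> : (u+h*Q)^+2 + ka^+2 = Q*(1+x) by rewrite /x /Q; ring.
have sq : h^+2*Q = (h*u)^+2 + (h*ka)^+2 by rewrite /Q; ring.
have b1 : (h*u)^+2 <= 1/81.
 by rewrite -real_normK ?num_real //; have := normr_ge0 (h*u); nra.
have b2 : (h*ka)^+2 <= 1/81.
 by rewrite -real_normK ?num_real //; have := normr_ge0 (h*ka); nra.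
have [l1 l2] : -(1/9) <= h*u /\ h*u <= 1/9.
 by move: hu; rewrite ler_norml => /andP[].
have s0 : 0 <= h^+2*Q by rewrite mulr_ge0 ?sqr_ge0 // ltW.
have s1 : h^+2*Q <= 2/81 by lra.
have x2 : x^+2 <= 9*(h^+2*Q).
 have := sqr_ge0 (h*ka); rewrite /x; set p := h*u in l1 l2 sq *.
 set s := h^+2*Q in sq s0 s1 *; nra.
have xb : -(1/2) <= x by rewrite /x; lra.
have := ln1D_bound xb; rewrite ler_norml => /andP[c1 c2].
rewrite lnM ?posrE //; last by lra.
have e : (ln Q + ln (1+x))/2 - ln Q/2 - h*u =
  h^+2*Q/2 + (ln (1+x) - x)/2 by rewrite {3}/x; field.
by rewrite e ler_norml; clear -c1 c2 x2 s0; apply/andP; split; lra.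
Qed.

(** All other terms up to second order cancel. What is left has the size [z^3*(u^2 + ka^2)], and
    this is at most [z^2*(u' - u)], a form in which errors can be summed by telescoping. *)
Lemma slow_step z u u' : 0 < z -> z <= 1/10 -> `|z*u| <= 1/10 ->
 z*ka <= 1/10 -> u' = u + z/(1-z)*(u^+2+ka^+2) ->
 `|slow (z-z^+2) u' - slow z u + z^+2 * logmod u|
  <= (30+5/ka^+2)*(z^+2*(u'-u)).
Proof.
move=> z0 z1 zu zk u'E.
have [h hdef] : exists h, h = z/(1-z) by eexists.
set Q := u^+2 + ka^+2.
have Q0 : 0 < Q := sqka_gt0 u.
have k20 : 0 < ka^+2 := exprn_gt0 2 ka0.
have hE : h*(1-z) = z by rewrite hdef divfK //; lra.
have h1 : z <= h by rewrite hdef ler_pdivlMr; nra.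
have h2 : h <= 10/9*z by rewrite hdef ler_pdivrMr; nra.
have h0 : 0 < h by lra.
have hu : `|h*u| <= 1/9.
 move: zu; rewrite !normrM (gtr0_norm z0) (gtr0_norm h0) => zu.
 apply: (@le_trans _ _ (10/9*z * `|u|)); first by rewrite ler_wpM2r.
 by rewrite -mulrA; lra.
have hk : `|h*ka| <= 1/9.
 rewrite ger0_norm; last by rewrite mulr_ge0 ?ltW.
 by have := ler_wpM2r (ltW ka0) h2; lra.
have [l1 l2] : -(1/9) <= h*u /\ h*u <= 1/9.
 by move: hu; rewrite ler_norml => /andP[].
have hu0 : 0 < 1 + h*u by clear -l1; lra.
(* Common unit for the errors; both [z^3*ka^2] and [z^3*u^2] are below it. *)
set q := z^+3*Q.
have q0 : 0 <= q by rewrite mulr_ge0 ?exprn_ge0 1?ltW.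
have z30 : 0 <= z^+3 by rewrite exprn_ge0 // ltW.
have z3q : z^+3*ka^+2 <= q.
 by rewrite ler_pM2l ?exprn_gt0 // lerDr sqr_ge0.
have z3u : z^+3*u^+2 <= q.
 by rewrite ler_pM2l ?exprn_gt0 // lerDl sqr_ge0.
have h3 : h^+3 <= 3/2*z^+3.
 have : h^+3 <= (10/9*z)^+3 by rewrite lerXn2r ?nnegrE //; clear -h0 z0 h2; lra.
 by rewrite exprMn; clear -z30; lra.
have A : `|angle u' - angle u - (h-h^+2*u)| <= 5*q.
 rewrite u'E -hdef (angle_step (ltW h0) hu0) -mulrA.
 set y := h/(1+h*u).
 have y0 : 0 <= y by rewrite divr_ge0 // ltW.
 have y1 : y <= 9/8*h by rewrite /y ler_pdivrMr; clear -l1 h0; nra.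
 have y3 : y^+3 <= 5/2*z^+3.
  have : y^+3 <= (9/8*h)^+3 by rewrite lerXn2r ?nnegrE //; clear -h0 y1; lra.
  by move: h3; clear -z30; rewrite exprMn; lra.
 have := atan_div_bound y0; rewrite ler_norml => /andP[a1 a2].
 have a3 : ka^+2*y^+3 <= 5/2*q.
  by apply: le_trans (_ : ka^+2*(5/2*z^+3) <= _);
   rewrite ?ler_pM2l //; clear -y3 z3q; lra.
 have e : y - (h-h^+2*u) = y*(h^+2*u^+2).
  by rewrite /y; field; clear -hu0; lra.
 have f : 0 <= y*(h^+2*u^+2) by rewrite mulr_ge0 // mulr_ge0 ?sqr_ge0.
 have f2 : y*(h^+2*u^+2) <= 2*q.
  apply: (@le_trans _ _ (9/8*h*(h^+2*u^+2))).
   by rewrite ler_wpM2r // mulr_ge0 ?sqr_ge0.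
  have -> : 9/8*h*(h^+2*u^+2) = 9/8*(h^+3*u^+2) by ring.
  have : h^+3*u^+2 <= 3/2*z^+3*u^+2 by rewrite ler_wpM2r ?sqr_ge0.
  by clear -z3u q0; lra.
 by rewrite ler_norml; clear -a1 a2 a3 e f f2 q0; apply/andP; split; lra.
have B : `|ln (z-z^+2) - ln z + z + z^+2/2| <= z^+3.
 have -> : z - z^+2 = z*(1-z) by ring.
 rewrite lnM ?posrE //; last by clear -z1; lra.
 have -> : ln z + ln (1-z) - ln z = ln (1-z) by ring.
 by apply: ln1B_bound3; clear -z0 z1; lra.
have D := logmod_step hu hk; rewrite -/Q hdef -u'E -hdef in D.
have D' : `|(z-z^+2)*(logmod u' - logmod u) - z^+2*u| <= 14*q.
 have -> : (z-z^+2)*(logmod u' - logmod u) - z^+2*u =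
  z*(1-z)*(logmod u' - logmod u - h*u).
  have -> : z^+2*u = z*(h*(1-z))*u by rewrite hE; ring.
  ring.
 rewrite normrM ger0_norm; last by rewrite mulr_ge0; clear -z0 z1; lra.
 apply: (@le_trans _ _ (z*(10*(h^+2*Q)))).
  apply: ler_pM => //; last by rewrite ler_piMr //; clear -z0 z1; lra.
  by rewrite mulr_ge0; clear -z0 z1; lra.
 have : h^+2 <= (10/9*z)^+2 by rewrite lerXn2r ?nnegrE //; clear -h0 z0 h2; lra.
 rewrite exprMn => h22.
 have : h^+2*Q <= (10/9)^+2*z^+2*Q by rewrite ler_wpM2r // ltW.
 move=> /(ler_wpM2l (ltW z0)); have -> : z*((10/9)^+2*z^+2*Q) =
  100/81*q by rewrite /q; field.
 by clear -q0; lra.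
have E1 : 0 <= h - z - z^+2 <= 2*z^+3.
 have -> : h - z - z^+2 = z^+3/(1-z) by rewrite hdef; field; clear -z1; lra.
 rewrite divr_ge0 //; last by clear -z1; lra.
 by rewrite ler_pdivrMr; clear -z30 z1; [nra|lra].
have E2 : `|(h^+2-z^+2)*u| <= 3/2*q + 3/2*z^+3.
 have e : h^+2 - z^+2 = z^+3*((2-z)/(1-z)^+2).
  by rewrite hdef; field; clear -z1; lra.
 have f : 0 <= (2-z)/(1-z)^+2 <= 3.
  rewrite divr_ge0 ?sqr_ge0 //=; last by clear -z1; lra.
  by rewrite ler_pdivrMr ?exprn_gt0 //; clear -z0 z1; [nra|lra].
 rewrite e -mulrA normrM (ger0_norm z30).
 have : `|(2-z)/(1-z)^+2*u| <= 3/2*u^+2 + 3/2.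
  rewrite normrM ger0_norm; last by case/andP: f.
  rewrite -[u^+2]real_normK ?num_real //.
  have := normr_ge0 u; case/andP: f.
  move: (_/(1-z)^+2) (`|u|) => p n p0 p3 n0; by have := sqr_ge0 (n-1); clear -p0 p3 n0; nra.
 by move=> /(ler_wpM2l z30); clear -z3u; lra.
(* Pure [z^3] errors lack the factor [u^2 + ka^2]; the price [1/ka^2] for inserting it is the second
   summand of the constant. *)
have F : 5*z^+3 <= 5/ka^+2*q.
 rewrite -mulrA [X in _ <= _*X]mulrC ler_pM2l // ler_pdivlMr //.
have G : q <= z^+2*(u'-u).
 rewrite u'E addrAC subrr add0r -hdef mulrA /q ler_pM2r // exprSr.
 by rewrite ler_pM2l // exprn_gt0.
have -> : slow (z-z^+2) u' - slow z u + z^+2 * logmod u =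
 (angle u' - angle u - (h-h^+2*u)) +
 (ln (z-z^+2) - ln z + z + z^+2/2) +
 ((z-z^+2)*(logmod u' - logmod u) - z^+2*u) +
 (h-z-z^+2) - (h^+2-z^+2)*u.
 by rewrite /slow; field.
have G' : (30+5/ka^+2)*q <= (30+5/ka^+2)*(z^+2*(u'-u)).
 by apply: ler_wpM2l G; apply: addr_ge0 => //; apply: divr_ge0 => //; apply: ltW.
move: F G' A B D' E1 E2; rewrite !ler_norml; clear => ? ? /andP[? ?] /andP[? ?] /andP[? ?] /andP[? ?] /andP[? ?].
by apply/andP; split; lra.
Qed.

(* [logmod] has slope [u] with respect to [angle]. *)
Lemma logmod_lip_angle (c u u' : R) : `|u| <= c -> `|u'| <= c ->
 `|logmod u' - logmod u| <= c * `|angle u' - angle u|.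
Proof.
wlog uu : u u' / u <= u'.
 move=> H; case: (leP u u') => [/H|/ltW /H]; first exact.
 by move=> H' hu hu'; rewrite distrC [X in _*X]distrC; apply: H'.
move=> hu hu'.
have b x : u <= x <= u' -> - c <= x <= c.
 move: hu hu'; rewrite !ler_norml => /andP[? ?] /andP[? ?] /andP[? ?].
 by apply/andP; split; lra.
have dang (x : R) : is_derive x (1 : R) angle (x^+2+ka^+2)^-1.
 rewrite /angle; apply: is_derive_eq; rewrite /GRing.scale /=.
 by have := sqka_gt0 x => ?; field; posnz.
have dlog (x : R) : is_derive x (1 : R) logmod (x/(x^+2+ka^+2)).
 rewrite /logmod; have d := is_derive1_ln (sqka_gt0 x).
 apply: is_derive_eq; rewrite /GRing.scale /=.
 by have := sqka_gt0 x => ?; field; posnz.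
have L : logmod u' - logmod u <= c*(angle u' - angle u).
 have := @derive_ge0_le _ (fun x => c*angle x - logmod x)
  (fun x => c*(x^+2+ka^+2)^-1 - x/(x^+2+ka^+2)) u u' uu.
 move=> H; suff : c*angle u - logmod u <= c*angle u' - logmod u' by lra.
 apply: H => x /b /andP[? ?].
 rewrite -mulrBl mulr_ge0 ?subr_ge0 // invr_ge0; exact: ltW (sqka_gt0 x).
have L' : - (c*(angle u' - angle u)) <= logmod u' - logmod u.
 have := @derive_ge0_le _ (fun x => c*angle x + logmod x)
  (fun x => c*(x^+2+ka^+2)^-1 + x/(x^+2+ka^+2)) u u' uu.
 move=> H; suff : c*angle u + logmod u <= c*angle u' + logmod u' by lra.
 apply: H => x /b /andP[? ?].
 rewrite -mulrDl mulr_ge0 ?invr_ge0; [by []|lra|exact: ltW (sqka_gt0 x)].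
have a0 : 0 <= angle u' - angle u.
 rewrite subr_ge0 ler_pM2r ?invr_gt0 // le_atan // ler_pM2r ?invr_gt0 //.
by rewrite (ger0_norm a0) ler_norml L L'.
Qed.

End SlowVariable.

Lemma inv_small (R : realType) (C e : R) : 0 < e ->
 exists2 N, (0 < N)%N & forall n, (N <= n)%N -> C/n%:R <= e.
Proof.
move=> e0; exists (Num.bound (`|C| / e)).+1 => // n hn.
have n0 : 0 < n%:R :> R by rewrite ltr0n (leq_trans _ hn).
rewrite ler_pdivrMr // mulrC -ler_pdivrMr //.
apply: le_trans (_ : `|C| / e <= _); first by rewrite ler_pM2r ?invr_gt0 ?ler_norm.
have h : 0 <= `|C| / e by rewrite divr_ge0 // ltW.
by apply: ltW; apply: lt_trans (archi_boundP h) _; rewrite ltr_nat.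
Qed.

(** * Asymptotics of the reference orbit of [z - z^2] *)

Section ReferenceOrbit.
Variable R : realType.

Fixpoint refz (t : nat) : R :=
 if t is s.+1 then refz s - refz s^+2 else 1/2.

Definition refX t : R := (refz t)^-1.

Lemma refz_bound t : 0 < refz t <= 1/2.
Proof.
elim: t => [|t /andP[h1 h2]] /=; first by apply/andP; split; lra.
by apply/andP; split; have := sqr_ge0 (refz t); nra.
Qed.

Lemma refz_gt0 t : 0 < refz t.
Proof. by have /andP[] := refz_bound t. Qed.
Lemma refX_gt0 t : 0 < refX t.
Proof. by rewrite invr_gt0 refz_gt0. Qed.
Lemma refzE t : refz t = (refX t)^-1.
Proof. by rewrite invrK. Qed.

Lemma refX_ge2 t : 2 <= refX t.
Proof.
have /andP[h1 h2] := refz_bound t.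
by rewrite /refX -[2]invrK lef_pV2 ?posrE ?invr_gt0 //; lra.
Qed.

Lemma refXS t : refX t.+1 = refX t + 1 + (refX t - 1)^-1.
Proof.
have h := refX_ge2 t; rewrite {1}/refX /= refzE.
by field; posnz.
Qed.

Lemma refX_ge t : t%:R + 2 <= refX t.
Proof.
elim: t => [|t IH]; first by have := refX_ge2 0; lra.
have h := refX_ge2 t; rewrite refXS -natr1.
have : 0 <= (refX t - 1)^-1 by rewrite invr_ge0; lra.
lra.
Qed.

Lemma refX_gtn t : t%:R < refX t.
Proof. by have := refX_ge t; lra. Qed.

Lemma refz_ltV t : (0 < t)%N -> refz t <= t%:R^-1.
Proof.
move=> t0; rewrite refzE lef_pV2 ?posrE ?ltr0n ?refX_gt0 //.
exact: ltW (refX_gtn t).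
Qed.

Lemma refz_leS t : refz t.+1 <= refz t.
Proof. by have := sqr_ge0 (refz t) => /=; lra. Qed.

Lemma refz_le s t : (s <= t)%N -> refz t <= refz s.
Proof.
move=> /subnKC <-; elim: (t-s)%N => [|i IH]; first by rewrite addn0.
by rewrite addnS (le_trans (refz_leS _)).
Qed.

Lemma refX_le s t : (s <= t)%N -> refX s <= refX t.
Proof. by move=> h; rewrite /refX lef_pV2 ?posrE ?refz_gt0 ?refz_le. Qed.

Lemma sum_refz_sqr s i :
 \sum_(j < i) refz (s+j)^+2 = refz s - refz (s+i).
Proof.
elim: i => [|i IH]; first by rewrite big_ord0 addn0 subrr.
by rewrite big_ord_recr /= IH addnS /=; ring.
Qed.

(** Approximate Fatou coordinate compared with time: one step adds [1 + 1/(X-1)] to [X], and [ln X]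
    absorbs the reciprocal, leaving summable increments. *)
Definition psi t := refX t - ln (refX t) - t%:R.

Lemma psi_step t : 0 <= psi t.+1 - psi t <= 2/t.+1%:R^+2.
Proof.
have h := refX_ge t; have h2 := refX_ge2 t.
have t0 : 0 <= t%:R :> R by [].
set y := (refX t - 1)^-1.
have y0 : 0 < y by rewrite invr_gt0; lra.
have e : refX t.+1 = refX t*(1+y) by rewrite refXS /y; field; posnz.
have -> : psi t.+1 - psi t = - (ln (1+y) - y).
 rewrite /psi {2}e lnM ?posrE ?refX_gt0 //; last by lra.
 by rewrite refXS -/y -[in X in X - _](natr1 t); ring.
have y1 : y <= t.+1%:R^-1.
 by rewrite lef_pV2 ?posrE ?ltr0n // -?natr1; lra.
have := @ln1D_bound _ y ltac:(lra); rewrite ler_norml => /andP[b1 b2].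
have := @le_ln1Dx R y ltac:(lra) => b3.
have y2 : y^+2 <= t.+1%:R^-1^+2.
 by rewrite lerXn2r ?nnegrE ?invr_ge0 //; lra.
move: y2; rewrite exprVn; move: (_^+2)^-1 => w y2; apply/andP; split; lra.
Qed.

Lemma psi_tail s t : (0 < s)%N -> (s <= t)%N ->
 0 <= psi t - psi s <= 2/s%:R.
Proof.
move=> s0 /subnKC <-; move: (t-s)%N => i.
have H : 0 <= psi (s+i) - psi s <= 2/s%:R - 2/(s+i)%:R.
 elim: i => [|i /andP[h1 h2]]; first by rewrite addn0 !subrr lexx.
 have /andP[p1 p2] := psi_step (s+i).
 rewrite addnS; apply/andP; split; first by lra.
 have x0 : 0 < (s+i)%:R :> R by rewrite ltr0n addn_gt0 s0.
 move: p2; rewrite -(natr1 (s+i)); set x := (s+i)%:R in x0 h2 * => p2.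
 suff : 2/(x+1)^+2 <= 2/x - 2/(x+1) by lra.
 have -> : 2/x - 2/(x+1) = 2/(x*(x+1)) by field; posnz.
 have x1 : 0 < x*(x+1) by rewrite mulr_gt0 //; lra.
 rewrite ler_pM2l // lef_pV2 ?posrE ?exprn_gt0 //; [nra|lra].
have /andP[h1 h2] := H; apply/andP; split=> //.
have : 0 <= 2/(s+i)%:R :> R by rewrite divr_ge0.
lra.
Qed.

(** The constant of the expansion [X = t + ln X + c + O(1/t)]. The rate is kept explicit because it
    becomes an [O(1/M)] error at the exit. *)
Definition psi_lim_spec (c : R) :=
 forall t, (0 < t)%N -> `|psi t - c| <= 2/t%:R.

Lemma psi_lim : exists c, psi_lim_spec c.
Proof.
have [|c Hc] := @real_cauchy_lim R psi.
 move=> e e0; have [N N0 HN] := inv_small 2 e0.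
 have tail m : (N <= m)%N -> forall n, (m <= n)%N -> `|psi n - psi m| <= e.
  move=> Nm n mn; have m0 : (0 < m)%N by apply: leq_trans Nm.
  have /andP[p1 p2] := psi_tail m0 mn; rewrite ger0_norm //.
  by apply: le_trans p2 _; apply: HN.
 exists N => m n hm hn.
 by case/orP: (leq_total m n) => h; [rewrite distrC|]; apply: tail.
exists c => t t0; apply/ler_addgt0Pl => e e0.
have [N HN] := Hc e e0.
have h := HN (maxn N t) (leq_maxl _ _).
have /andP[p1 p2] := psi_tail t0 (leq_maxr N t).
move: h; rewrite !ler_norml => /andP[? ?]; apply/andP; split; lra.
Qed.

Lemma ln_le_half (x : R) : 0 < x -> ln x <= x/2.
Proof.
move=> x0; have := @ln_le_sub1 R (x/2) ltac:(by rewrite divr_gt0).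
have l2 : ln 2 <= 1 :> R by have := @ln_le_sub1 R 2 ltac:(lra); lra.
by rewrite [in X in X -> _]lnM ?posrE // ?invr_gt0 // lnV ?posrE //; lra.
Qed.

Lemma refX_asymp : exists2 C : R, 0 < C &
 forall t, (0 < t)%N -> `|refX t - t%:R| <= C + ln t%:R.
Proof.
have [c Hc] := psi_lim.
have b t : (0 < t)%N -> `|psi t| <= `|c| + 2.
 move=> t0; have h := Hc t t0; rewrite -(subrK c (psi t)).
 apply: le_trans (ler_normD _ _) _.
 have : 2/t%:R <= 2 :> R.
  by rewrite ler_pdivrMr ?ltr0n // ler_peMr // ler1n.
 lra.
have X t : (0 < t)%N -> refX t <= (2 * `|c| + 6)*t%:R.
 move=> t0; have := b t t0; rewrite ler_norml => /andP[_].
 have := ln_le_half (refX_gt0 t); have : 1 <= t%:R :> R by rewrite ler1n.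
 have := normr_ge0 c.
 rewrite /psi => h1 h2 h3 h4; nra.
exists (`|c| + 2 + `|ln (2 * `|c| + 6)|).
 have := normr_ge0 c; have := normr_ge0 (ln (2 * `|c| + 6)); lra.
move=> t t0; have := b t t0; have t1 := natr_gt0 R t0.
have c0 := normr_ge0 c.
have l1 : ln (refX t) <= ln (2 * `|c| + 6) + ln t%:R.
 have c6 : 0 < 2 * `|c| + 6 by lra.
 by rewrite -lnM ?posrE // ler_ln ?posrE ?refX_gt0 ?X // mulr_gt0.
have l0 : 0 <= ln (refX t) by apply: ln_ge0; have := refX_ge2 t; lra.
have l2 := ler_norm (ln (2 * `|c| + 6)).
have h0 := refX_gtn t.
rewrite /psi ler_norml => /andP[h1 h2].
rewrite ger0_norm; lra.
Qed.

End ReferenceOrbit.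

(** * Logarithmic factors and the ends of the gate *)

Section SmallQuantities.
Variable R : realType.

(** The logarithm is shifted to be at least 1, so that it absorbs bounded terms. *)
Definition ell (n : nat) : R := 1 + ln n%:R.

Lemma ell_ge1 n : 1 <= ell n.
Proof.
rewrite /ell lerDl; case: n => [|n]; first by rewrite ln0.
by apply: ln_ge0; rewrite ler1n.
Qed.

Lemma ell_gt0 n : 0 < ell n.
Proof. by have := ell_ge1 n; lra. Qed.

Lemma inv_ell_small (C e : R) : 0 < e ->
 exists2 N, (0 < N)%N & forall n, (N <= n)%N -> C/ell n <= e.
Proof.
move=> e0; have [N N0 HN] := inv_small (expR (`|C| / e)) (ltr01 : 0 < 1 :> R).
exists N => // n Nn; have := HN n Nn; have n0 : 0 < n%:R :> R.
 by rewrite ltr0n (leq_trans N0).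
rewrite ler_pdivrMr // mul1r => h.
have h2 : `|C| / e <= ell n.
 rewrite -(@expRK R (`|C| / e)) /ell.
 have := ler_ln (R := R) (x := expR (`|C| / e)) (y := n%:R).
 by rewrite !posrE expR_gt0 n0 => /(_ isT isT); rewrite h => ?; lra.
rewrite ler_pdivrMr ?ell_gt0 // mulrC -ler_pdivrMr //.
by apply: le_trans h2; rewrite ler_pM2r ?invr_gt0 ?ler_norm.
Qed.

Lemma ell_pow_small p (C e : R) : 0 < e ->
 exists2 N, (0 < N)%N & forall n, (N <= n)%N -> C*ell n^+p/n%:R <= e.
Proof.
move=> e0.
have [N N0 HN] := inv_ell_small (`|C| * (expR 1 * p.+1`!%:R)) e0.
exists N => // n Nn; apply: le_trans (HN n Nn).
have n0 : 0 < n%:R :> R by rewrite ltr0n (leq_trans N0).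
have l0 := ell_gt0 n.
have h : ell n^+p.+1/p.+1`!%:R <= expR 1*n%:R.
 have := expR_ge1Dxn p (ltW l0); rewrite {2}/ell expRD lnK ?posrE // => h.
 by apply: le_trans h; rewrite lerDr.
have f0 : 0 < p.+1`!%:R :> R by rewrite ltr0n fact_gt0.
move: h; rewrite ler_pdivrMr // => h.
rewrite ler_pdivrMr // mulrAC ler_pdivlMr //.
apply: le_trans (_ : `|C| * ell n^+p*ell n <= _).
 by rewrite ler_pM2r // ler_pM2r ?exprn_gt0 // ler_norm.
by rewrite -!mulrA -exprSr ler_wpM2l //; lra.
Qed.

Lemma near_le_small p (C e : R) : 0 < e ->
 \forall n \near \oo, C*ell n^+p/n%:R <= e.
Proof. by move=> /(ell_pow_small p C)[N _ HN]; exists N. Qed.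

Lemma refX_lin : exists2 C : R, 1 <= C &
 forall t, (0 < t)%N -> refX R t <= C*t%:R.
Proof.
have [C C0 HC] := refX_asymp R; exists (C+2) => [|t t0]; first by lra.
have t1 : 1 <= t%:R :> R by rewrite ler1n.
have := HC t t0; rewrite ler_norml => /andP[_].
have : ln t%:R <= t%:R/2 :> R by apply: ln_le_half; lra.
nra.
Qed.

Local Notation X := (refX R).

(** The part of [- slow] that depends on time only, at either end of the gate: [- ln z] is [ln X],
    and [z*logmod] contributes [ln X/X] because [|u|] is [X] divided by a bounded position. *)
Definition Lam t : R := ln (X t) - ln (X t)/X t.

Definition lamdev t : R := t%:R*(Lam t - ln t%:R).

Lemma Lam_dev t : (0 < t)%N -> Lam t = ln t%:R + lamdev t/t%:R.
Proof.
by move=> t0; rewrite /lamdev mulrC mulKf ?subrKC // pnatr_eq0 -lt0n.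
Qed.

Lemma psi_bounded : exists2 B : R, 0 < B & forall t, (0 < t)%N -> `|psi R t| <= B.
Proof.
have [c Hc] := psi_lim R; exists (`|c|+2) => [|t t0].
 by have := normr_ge0 c; lra.
have h := Hc t t0; rewrite -(subrK c (psi R t)).
apply: le_trans (ler_normD _ _) _.
have : 2/t%:R <= 2 :> R.
 by rewrite ler_pdivrMr ?ltr0n // ler_peMr // ler1n.
lra.
Qed.

(* The logarithmic terms of [Lam] cancel: [Lam t = ln t + c/t + o(1/t)]. *)
Lemma lamdev_lim c : psi_lim_spec c -> forall e : R, 0 < e ->
 \forall t \near \oo, `|lamdev t - c| <= e.
Proof.
move=> Hc e e0; have [B B0 HB] := psi_bounded; have [C C1 HC] := refX_lin.
have e3 : 0 < e/3 by lra.
have l0 : 0 <= ln C by apply: ln_ge0.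
near=> t.
have t0 : (0 < t)%N by near: t; exact: nbhs_infty_gt.
have T0 := natr_gt0 R t0.
have H1 : 2/t%:R <= e/3.
 by near: t; have [N _ HN] := inv_small 2 e3; exists N.
have H2 : 2*B^+2/t%:R <= e/3.
 by near: t; have [N _ HN] := inv_small (2*B^+2) e3; exists N.
have H3 : (2*(1 + ln C)^+2)*ell t^+2/t%:R <= e/3.
 by near: t; exact: near_le_small.
have H4 : B/t%:R <= 1/2.
 by near: t; have [N _ HN] := inv_small B (ltac:(lra) : 0 < 1/2 :> R); exists N.
have X0 := refX_gt0 R t; have tX := refX_gtn R t.
have X2 := refX_ge2 R t.
set y := ln (X t)/X t.
have lX : 0 <= ln (X t) by apply: ln_ge0; move: X2; clra.
have y0 : 0 <= y by rewrite divr_ge0 // ltW.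
have y2 : y <= 1/2 by rewrite ler_pdivrMr //; have := ln_le_half X0; clra.
have pb := HB t t0.
(* The definition of [psi] rewritten as a product; taking logarithms expresses [ln X - y] by
   [ln t + psi/t], up to squares of [y] and of [psi/t]. *)
have eX : X t*(1-y) = t%:R*(1 + psi R t/t%:R).
 by rewrite /y /psi; field; posnz.
have pt : - (1/2) <= psi R t/t%:R /\ `|psi R t/t%:R| <= B/t%:R.
 have : `|psi R t/t%:R| <= B/t%:R.
  by rewrite normrM normfV (gtr0_norm T0) ler_pM2r ?invr_gt0.
 by move=> a; split=> //; move: a; rewrite ler_norml => /andP[+ _]; move: H4; clra.
have lE : ln (X t) + ln (1-y) = ln t%:R + ln (1 + psi R t/t%:R).
 by rewrite -!lnM ?posrE ?eX //; move: y2 pt.1; clra.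
have b1 := ln1D_bound pt.1.
have b2 := @ln1D_bound _ (- y) ltac:(move: y2; clra).
have E : lamdev t - c = (psi R t - c) + t%:R*(ln (1 + psi R t/t%:R) - psi R t/t%:R)
  - t%:R*(ln (1-y) - - y).
 have -> : lamdev t = t%:R*(ln (X t) - y - ln t%:R) by [].
 have -> : ln (X t) = ln t%:R + ln (1 + psi R t/t%:R) - ln (1-y) by move: lE; clra.
 by field; posnz.
have c1 : `|t%:R*(ln (1 + psi R t/t%:R) - psi R t/t%:R)| <= e/3.
 rewrite normrM (gtr0_norm T0); apply: le_trans H2.
 have -> : 2*B^+2/t%:R = t%:R*(2*(B/t%:R)^+2) by field; posnz.
 rewrite ler_pM2l //; apply: le_trans b1 _.
 by rewrite ler_pM2l // -real_normK ?num_real // lerXn2r ?nnegrE ?normr_ge0 ?pt.2 // divr_ge0 // ltW.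
have c2 : `|t%:R*(ln (1-y) - - y)| <= e/3.
 rewrite normrM (gtr0_norm T0); apply: le_trans H3.
 rewrite ler_pdivlMr //.
 have s : ln (X t) <= (1 + ln C)*ell t.
  have : ln (X t) <= ln C + ln t%:R.
   have C0 : 0 < C := lt_le_trans ltr01 C1.
   by rewrite -lnM ?posrE // ler_ln ?posrE ?HC // mulr_gt0.
  have : 0 <= ln t%:R :> R by apply: ln_ge0; rewrite ler1n.
  by rewrite /ell; move: (ln_ge0 C1); clear; nra.
 have s2 : ln (X t)^+2 <= (1 + ln C)^+2*ell t^+2.
  by rewrite -exprMn lerXn2r ?nnegrE // (le_trans lX).
 have s3 : (t%:R*y)^+2 <= ln (X t)^+2.
  have s4 : t%:R*y <= ln (X t).
   by rewrite /y mulrCA ler_piMr // ler_pdivrMr // mul1r ltW.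
  have s5 : 0 <= t%:R*y by rewrite mulr_ge0 // ltW.
  by rewrite lerXn2r ?nnegrE.
 have := ler_wpM2l (ltW T0) b2; rewrite sqrrN => b3.
 have : t%:R*(2*y^+2)*t%:R = 2*(t%:R*y)^+2 by ring.
 move=> b4; have := ler_wpM2r (ltW T0) b3; by rewrite b4; move: s2 s3; clra.
have c0 := Hc t t0; rewrite E.
apply: le_trans (ler_normB _ _) _; apply: le_trans (lerD (ler_normD _ _) (lexx _)) _.
by move: c0 H1 c1 c2; clra.
Unshelve. all: by end_near. Qed.

Lemma Lam_bound : exists2 E : R, 0 < E &
 forall t, (0 < t)%N -> `|Lam t - ln t%:R| <= E/t%:R.
Proof.
have [c Hc] := psi_lim R.
have [N _ HN] := lamdev_lim Hc ltr01.
pose E := `|c| + 1 + \sum_(i < N) `|lamdev i|.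
have s0 : 0 <= \sum_(i < N) `|lamdev i| by apply: sumr_ge0.
exists E => [|t t0]; first by rewrite /E; have := normr_ge0 c; lra.
have T0 : 0 < t%:R :> R by rewrite ltr0n.
have -> : Lam t - ln t%:R = lamdev t/t%:R by rewrite Lam_dev //; ring.
rewrite normrM normfV (gtr0_norm T0) ler_pM2r ?invr_gt0 //.
case: (leqP N t) => [/HN /= h|tN].
 rewrite -(subrK c (lamdev t)); apply: le_trans (ler_normD _ _) _.
 by rewrite /E; lra.
rewrite /E (bigD1 (Ordinal tN)) //=.
have : 0 <= \sum_(i < N | i != Ordinal tN) `|lamdev i| by apply: sumr_ge0.
have := normr_ge0 c; lra.
Qed.

End SmallQuantities.

(** * The real orbit through the gate *)

Section RealStage.
Variables (R : realType) (ka : R).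
Hypothesis ka0 : 0 < ka.
Local Notation X := (refX R).
Local Notation z := (refz R).

(* The real orbit of [v = w + z/2] entering the gate at time [n] from the
  critical point [w = -1/2], over the reference orbit [refz]. *)
Fixpoint vs (n i : nat) : R :=
 if i is j.+1 then
  vs n j*(1 - z (n+j)) + vs n j^+2 + ka^+2*z (n+j)^+2
 else - (1/2) + z n/2.

Definition us n i := vs n i*X (n+i).

Lemma vsE n i : vs n i = z (n+i)*us n i.
Proof. by rewrite /us refzE mulrC mulfK // gt_eqF // refX_gt0. Qed.

Lemma us_step n i : us n i.+1 =
 us n i + z (n+i)/(1 - z (n+i))*(us n i^+2 + ka^+2).
Proof.
have /andP[z0 z2] := refz_bound R (n+i).
have : 0 < 1 - z (n+i) by lra.
rewrite /us addnS /refX /=; move: (z _) z0 (vs n i) => y y0 v y1.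
have y2 : 0 < y - y^+2 by clear -y0 y1; nra.
by field; posnz.
Qed.

Lemma us_le_S n i : us n i <= us n i.+1.
Proof.
rewrite us_step lerDl mulr_ge0 ?(ltW (sqka_gt0 _ _)) //.
have /andP[z0 z2] := refz_bound R (n+i).
by rewrite divr_ge0 ?ltW //; lra.
Qed.

Lemma us_le n i j : (i <= j)%N -> us n i <= us n j.
Proof.
move=> /subnKC <-; elim: (j-i)%N => [|d IH]; first by rewrite addn0.
by rewrite addnS (le_trans IH) ?us_le_S.
Qed.

Lemma refz_small_near e : 0 < e -> \forall n \near \oo, z n <= e.
Proof.
move=> e0; have [N N0 HN] := inv_small 1 e0; exists N => // n /= Nn.
have n0 : (0 < n)%N := leq_trans N0 Nn.
by apply: le_trans (refz_ltV _ n0) _; have := HN n Nn; rewrite div1r.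
Qed.

Lemma refz_cvg0 i : z (n+i) @[n --> \oo] --> (0 : R).
Proof.
apply/cvgrPdist_le => e e0; have [N _ HN] := refz_small_near e0.
exists N => // n /= Nn; rewrite sub0r normrN ger0_norm ?(ltW (refz_gt0 _ _)) //.
by apply: HN; rewrite /= (leq_trans Nn) ?leq_addr.
Qed.

Lemma refz_cvg : z n @[n --> \oo] --> (0 : R).
Proof. by have := refz_cvg0 0; under eq_fun do rewrite addn0. Qed.

(** For fixed [i] the terms with [z] vanish and leave the orbit of [-1/2] under [v + v^2]; the
    substitution [v = -z] turns that map into [z - z^2], so the limit is again the reference
    orbit. *)
Lemma vs_cvg i : vs n i @[n --> \oo] --> - z i.
Proof.
elim: i => [|i IH].
 rewrite /= -[X in _ --> - X]addr0 opprD oppr0.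
 apply: cvgD; first exact: cvg_cst.
 by rewrite -[X in _ --> X](mul0r 2^-1); apply: cvgM; [exact: refz_cvg|exact: cvg_cst].
have -> : - z i.+1 = - z i*(1-0) + (- z i)^+2 + ka^+2*0^+2.
 by rewrite /=; ring.
apply: cvgD; first apply: cvgD.
- by apply: cvgM => //; apply: cvgB; [exact: cvg_cst|exact: refz_cvg0].
- rewrite expr2; under eq_fun do rewrite expr2.
 by apply: cvgM.
- apply: cvgM; first exact: cvg_cst.
 rewrite expr2; under eq_fun do rewrite expr2.
 by apply: cvgM; exact: refz_cvg0.
Unshelve. all: by end_near. Qed.

(** The surviving drift of [slow]. It is a priori of size [ln n/n], and the exit coordinate
    multiplies it by [n], so it cannot be dropped: the rescaled sum must be shown to converge. *)
Definition gatesum n M i := \sum_(M <= j < i) z (n+j)^+2 * logmod ka (us n j).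

Definition slowconst := 30 + 5/ka^+2.

Lemma slowconst_gt0 : 0 < slowconst.
Proof. by rewrite /slowconst addr_gt0 // divr_gt0 // exprn_gt0. Qed.

(* The error terms telescope, since they are dominated by increments of [us]. *)
Lemma slow_sum n M i : (M <= i)%N -> z (n+M) <= 1/10 -> z (n+M)*ka <= 1/10 ->
 (forall j, (M <= j < i)%N -> `|vs n j| <= 1/10) ->
 `|slow ka (z (n+i)) (us n i) - slow ka (z (n+M)) (us n M) + gatesum n M i|
  <= slowconst*(z (n+M)^+2*(us n i - us n M)).
Proof.
move=> Mi zM zk; move: Mi => /subnKC <-; elim: (i-M)%N => [|d IH] Hv.
 by rewrite addn0 /gatesum big_geq // !subrr addr0 normr0 !mulr0.
have {}IH := IH _.
have h1 : forall j, (M <= j < M + d)%N -> `|vs n j| <= 1/10.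
 by move=> j /andP[? h]; apply: Hv; rewrite addnS ltnS (ltnW h) andbT.
have {}IH := IH h1.
have zl : z (n + (M+d)) <= z (n+M) by apply: refz_le; rewrite leq_add2l leq_addr.
have zp := refz_gt0 R (n + (M+d)).
have vd : `|z (n + (M+d))*us n (M+d)| <= 1/10.
 by rewrite -vsE Hv // leq_addr addnS ltnS leqnn.
have zz : z (n + (M+d)) <= 1/10 by exact: le_trans zM.
have zk' : z (n + (M+d))*ka <= 1/10.
 by apply: le_trans zk; rewrite ler_pM2r.
have S := slow_step ka0 zp zz vd zk' (us_step n (M+d)).
rewrite !addnS.
have -> : gatesum n M (M+d).+1 = gatesum n M (M+d) +
  z (n + (M+d))^+2 * logmod ka (us n (M+d)).
 by rewrite /gatesum big_nat_recr //= leq_addr.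
have m : slowconst*(z (n + (M+d))^+2*(us n (M+d).+1 - us n (M+d)))
  <= slowconst*(z (n+M)^+2*(us n (M+d).+1 - us n (M+d))).
 rewrite ler_pM2l ?slowconst_gt0 // ler_wpM2r ?subr_ge0 ?us_le_S //.
 by rewrite lerXn2r ?nnegrE ?(ltW (refz_gt0 _ _)).
rewrite -/slowconst in S.
move: IH S m; rewrite [z (_).+1]/=; clear.
rewrite !ler_norml !mulrBr => /andP[? ?] /andP[? ?] ?; apply/andP; split; lra.
Qed.

Lemma vs_ge_ent n M i : (M <= i)%N -> us n M < 0 -> vs n M <= vs n i.
Proof.
move=> Mi uM; rewrite !vsE.
apply: (@le_trans _ _ (z (n+i)*us n M)).
 by rewrite ler_nM2r // refz_le // leq_add2l.
by rewrite ler_pM2l ?refz_gt0 // us_le.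
Qed.

Lemma logmod_ge_ln u : 0 < u -> ln u <= logmod ka u.
Proof.
move=> u0; rewrite /logmod ler_pdivlMr // mulr_natr -lnXn //.
by rewrite ler_ln ?posrE ?exprn_gt0 // ?sqka_gt0 // lerDl sqr_ge0.
Qed.

Lemma logmod_le_ln u : 0 < u -> logmod ka u <= ln u + ka^+2/(2*u^+2).
Proof.
move=> u0; rewrite /logmod ler_pdivrMr // mulrDl mulr_natr -lnXn //.
have u20 : 0 < u^+2 by rewrite exprn_gt0.
have -> : u^+2 + ka^+2 = u^+2*(1+ka^+2/u^+2) by field; posnz.
have k0 : 0 <= ka^+2/u^+2 by rewrite divr_ge0 ?sqr_ge0.
rewrite lnM ?posrE //; last by clear -k0; lra.
rewrite lerD2l; have := @le_ln1Dx R (ka^+2/u^+2) ltac:(clear -k0; lra).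
have -> : ka^+2/(2*u^+2)*2 = ka^+2/u^+2 by field; posnz.
by [].
Qed.

Lemma logmod_ge u : ln ka <= logmod ka u.
Proof.
rewrite /logmod ler_pdivlMr // mulr_natr -lnXn //.
by rewrite ler_ln ?posrE ?exprn_gt0 // ?sqka_gt0 // lerDr sqr_ge0.
Qed.

Lemma logmodN u : logmod ka (- u) = logmod ka u.
Proof. by rewrite /logmod sqrrN. Qed.
Lemma angleN u : angle ka (- u) = - angle ka u.
Proof. by rewrite /angle mulNr atanN mulNr. Qed.

Lemma angle_compl u : 0 < u ->
 pi/(2*ka) - angle ka u = atan (ka*u^-1)/ka.
Proof.
move=> u0; rewrite -[ka/u]invf_div atanV ?divr_gt0 // /angle.
by field; posnz.
Qed.

End RealStage.

#[global] Opaque refX.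

(** * A priori bound for the passage *)

Section GatePassage.
Variable R : realType.
Implicit Types (a : nat) (ka : R).
Local Notation X := (refX R).
Local Notation z := (refz R).

Lemma a_gt0 a : (1 < a)%N -> 0 < a%:R :> R.
Proof. by move=> a1; rewrite ltr0n (ltn_trans _ a1). Qed.

(** Entrance position in the coordinate [-1/v], read [M] steps after the start. *)
Definition went ka n M := - (vs ka n M)^-1.

Lemma went_cvg ka M : went ka n M @[n --> \oo] --> X M.
Proof.
rewrite -[X M]opprK; apply: cvgN; rewrite -invrN; apply: cvgV; last exact: vs_cvg.
by rewrite oppr_eq0 gt_eqF // refz_gt0.
Qed.

Lemma went_near ka M e : 0 < e -> \forall n \near \oo,
 [/\ vs ka n M < 0, 0 < went ka n M & `|went ka n M - X M| <= e].
Proof.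
move=> e0; have X0 := refX_ge2 R M.
near=> n.
have h : `|went ka n M - X M| <= e.
 by near: n; have /cvgrPdistC_le/(_ e e0) := @went_cvg ka M.
have h1 : `|went ka n M - X M| <= 1.
 by near: n; have /cvgrPdistC_le/(_ 1 ltr01) := @went_cvg ka M.
have w0 : 0 < went ka n M by move: h1; rewrite ler_norml => /andP[h1 _]; clear -X0 h1; lra.
by split=> //; move: w0; rewrite /went oppr_gt0 invr_lt0.
Unshelve. all: by end_near. Qed.

Lemma us_ent ka n M : vs ka n M < 0 -> us ka n M = - (X (n+M)/went ka n M).
Proof. by move=> v0; rewrite /us /went invrN invrK mulrN opprK mulrC. Qed.

(** An orbit that leaves the disc of radius [1/M] at time [t] has used the whole angle [ln a] up to
    [O(M/n)], so [ln (t/n)] is within [O(M/n)] of [ln a]. This is impossible when [t] is at least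
    [c2*M] steps before [a*n] and [c2] is large. *)
Lemma gate_bound a ka : (1 < a)%N -> 0 < ka -> pi/ka = ln a%:R -> exists M0 c2 : nat, (0 < M0)%N /\ forall M, (M0 <= M)%N ->
 \forall n \near \oo, forall i, (M <= i)%N -> (n + i + c2*M <= a*n)%N ->
  `|vs ka n i| <= M%:R^-1.
Proof.
move=> a1 ka0 pi_div_kappa.
have [C C1 HC] := refX_lin R; have [E E0 HE] := Lam_bound R.
pose sc := slowconst ka; have sc0 : 0 < sc := slowconst_gt0 ka0.
pose K1 := 4 + 2*C + `|ln ka| + 2*sc*C*a%:R.
(* [K1] collects the errors of the slow variable and [2*E] those of [Lam] at both ends; the factor
   [a] appears because the gap is measured relative to [a*n]. *)
have [c2 c20 Hc2] : exists2 c2, (0 < c2)%N & a%:R*(K1+2*E) < c2%:R.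
 exists (Num.bound `|a%:R*(K1+2*E)|).+1 => //.
 apply: le_lt_trans (ler_norm _) _.
 by apply: lt_trans (archi_boundP (normr_ge0 _)) _; rewrite ltr_nat.
have t10 : 0 < 1/10 :> R by clear -sc0; lra.
have tk : 0 < 1/10/ka by rewrite divr_gt0 ?ka0.
exists 20%N, c2; split=> // M M20.
have M0 : (0 < M)%N by apply: leq_trans M20.
have Mr : 20 <= M%:R :> R by rewrite (ler_nat R 20).
near=> n.
have n0 : (0 < n)%N by near: n; exact: nbhs_infty_gt.
have nr := natr_gt0 R n0.
have [v0 w0 wX] : [/\ vs ka n M < 0, 0 < went ka n M & `|went ka n M - X M| <= 1].
 by near: n; exact: went_near.
have zn : z n <= 1/10 by near: n; exact: refz_small_near.
have zk : z n <= 1/10/ka by near: n; exact: refz_small_near.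
have nM : ka*(2*C*M%:R) <= n%:R.
 near: n; exists (Num.bound (ka*(2*C*M%:R))) => // n /= h.
 have p0 : 0 <= ka*(2*C*M%:R).
  by rewrite mulr_ge0 ?(ltW ka0) // mulr_ge0 //; clear -C1; lra.
 by apply: ltW; apply: lt_le_trans (archi_boundP p0) _; rewrite ler_nat.
have Mn : (M <= n)%N by near: n; exact: nbhs_infty_ge.
have zMn : z (n+M) <= z n by rewrite refz_le // leq_addr.
have {zn} zM : z (n+M) <= 1/10 by apply: le_trans zn.
have {}zk : z (n+M)*ka <= 1/10.
 by rewrite -ler_pdivlMr ?ka0 //; apply: le_trans zk.
have W1 : M%:R + 1 <= went ka n M.
 have := refX_ge R M; move: wX; rewrite ler_norml => /andP[h _] h2.
 by clear -h h2; lra.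
have W2 : went ka n M <= 2*C*M%:R.
 have := HC M M0; move: wX; rewrite ler_norml => /andP[_ h] h2.
 by clear -h h2 Mr C1; nra.
have uE := us_ent v0.
have uM : us ka n M < 0.
 by rewrite uE oppr_lt0 divr_gt0 // refX_gt0.
have vM : - M%:R^-1 <= vs ka n M.
 have -> : vs ka n M = - (went ka n M)^-1 by rewrite /went invrN invrK opprK.
 rewrite lerN2 lef_pV2 ?posrE ?ltr0n //.
 by clear -W1; lra.
have lb i : (M <= i)%N -> - M%:R^-1 <= vs ka n i.
 by move=> Mi; apply: le_trans vM _; exact: (vs_ge_ent ka0).
have M10 : M%:R^-1 <= 1/20 :> R.
 by rewrite div1r lef_pV2 ?posrE ?ltr0n.
have slow_e : slow ka (z (n+M)) (us ka n M) <= - (pi/(2*ka)) +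
  went ka n M/X (n+M) - Lam R (n+M) + 3/2/n%:R.
 have E0' := refX_gt0 R (n+M); have En := refX_gtn R (n+M).
 have nE : n%:R <= X (n+M).
  by apply: le_trans (ltW En); rewrite ler_nat leq_addr.
 have q0 : 0 < X (n+M)/went ka n M by rewrite divr_gt0.
 rewrite /slow uE angleN logmodN.
 have := angle_compl ka0 q0; rewrite invf_div => A.
 have := atan_le_id (_ : 0 <= ka*(went ka n M/X (n+M))).
 rewrite mulr_ge0 ?(ltW ka0) ?divr_ge0 ?(ltW w0) ?(ltW E0') // => /(_ isT) B.
 have {}A : - angle ka (X (n+M)/went ka n M) <= - (pi/(2*ka)) + went ka n M/X (n+M).
  have : pi/(2*ka) - angle ka (X (n+M)/went ka n M) <= went ka n M/X (n+M).
   by rewrite A ler_pdivrMr ?ka0 // [leRHS]mulrC.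
  by clra.
 have L := logmod_le_ln ka q0.
 have lnq : ln (X (n+M)/went ka n M) = ln (X (n+M)) - ln (went ka n M).
  by rewrite ln_div ?posrE.
 rewrite lnq in L.
 have lw : 0 <= ln (went ka n M) by apply: ln_ge0; clear -W1 Mr; lra.
 have small : ka^+2/(2*(X (n+M)/went ka n M)^+2) <= 1/2.
  have kq : ka <= X (n+M)/went ka n M.
   rewrite ler_pdivlMr //; apply: le_trans nE; apply: le_trans nM.
   by rewrite ler_pM2l ?ka0.
  have q2 : 0 < 2*(X (n+M)/went ka n M)^+2 by rewrite mulr_gt0 // exprn_gt0.
  rewrite ler_pdivrMr //.
  have -> : 1/2*(2*(X (n+M)/went ka n M)^+2) = (X (n+M)/went ka n M)^+2 by field; posnz.
  by rewrite lerXn2r ?nnegrE ?(ltW ka0) // ltW.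
 have zE : ln (z (n+M)) = - ln (X (n+M)) by rewrite refzE lnV ?posrE.
 have P : z (n+M)*(logmod ka (X (n+M)/went ka n M) + 1/2) <=
    z (n+M) * ln (X (n+M)) + 3/2/n%:R.
  apply: (@le_trans _ _ (z (n+M)*(ln (X (n+M)) + 3/2))).
   by rewrite ler_pM2l ?refz_gt0 //; clear -L small lw; lra.
  rewrite mulrDr lerD2l [leLHS]mulrC ler_wpM2l ?divr_ge0 //.
  by rewrite refzE lef_pV2 ?posrE.
 rewrite zE /Lam; move: P; rewrite {1 2}refzE => P.
 rewrite refzE; clear -A P; lra.
(* At a first exit index all earlier [v] are below [1/M], which is what [slow_sum] asks for, and a
   single step from there stays below 1. *)
move=> i; elim/ltn_ind: i => i IH.
rewrite leq_eqVlt => /predU1P[<- _|Mi ti].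
 by rewrite ltr0_norm // lerNl.
have vj j : (M <= j < i)%N -> `|vs ka n j| <= M%:R^-1.
 move=> /andP[Mj ji]; apply: IH => //; apply: leq_trans ti.
 by rewrite leq_add2r leq_add2l ltnW.
rewrite ler_norml lb ?(ltnW Mi) //= leNgt; apply/negP => hv.
have vi1 : vs ka n i <= 1.
 case: i Mi {IH ti hv} vj => // i Mi vj.
 have := vj i; rewrite -ltnS Mi ltnSn => /(_ isT).
 have zi0 := refz_gt0 R (n+i).
 have ziM : z (n+i) <= z (n+M) by rewrite refz_le // leq_add2l -ltnS.
 have zki : (z (n+i)*ka)^+2 <= 1/100.
  have -> : 1/100 = (1/10)^+2 :> R by field.
  have p0 : 0 <= z (n+i)*ka by rewrite mulr_ge0 // ltW.
  have p1 : z (n+i)*ka <= 1/10 by apply: le_trans zk; rewrite ler_pM2r.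
  by rewrite lerXn2r ?nnegrE // divr_ge0.
 rewrite /= -exprMn [ka*_]mulrC ler_norml => /andP[b1 b2].
 have : z (n+i) <= 1/10 by apply: le_trans zM.
 move: (vs ka n i) (z (n+i)) ((_*_)^+2) zki zi0 b1 b2 M10 => v y w.
 move: (M%:R^-1) => m; clear; nra.
have v0i : 0 < vs ka n i by apply: lt_trans hv; rewrite invr_gt0 ltr0n.
set t := (n+i)%N in ti.
have tN : (t <= a*n)%N := leqDl ti.
have T0 := refX_gt0 R t; have nt : (n <= t)%N by rewrite leq_addr.
have t0 : (0 < t)%N by apply: leq_trans nt.
have nT : n%:R <= X t.
 by apply: le_trans (ltW (refX_gtn R t)); rewrite ler_nat.
have TC : X t <= C*a%:R*n%:R.
 by apply: le_trans (HC t t0) _; rewrite -mulrA ler_pM2l -?natrM ?ler_nat //; clear -C1; lra.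
have uiE : us ka n i = X t/(vs ka n i)^-1 by rewrite invrK mulrC.
have ui0 : 0 < us ka n i by rewrite mulr_gt0.
have S := @slow_sum R ka ka0 n M i (ltnW Mi) zM zk _.
have {}S := S (fun j hj => le_trans (vj j hj) (le_trans M10 _)).
have {}S := S ltac:(clear -sc0; lra).
rewrite -/sc in S.
set x := (vs ka n i)^-1 in uiE.
have x0 : 0 < x by rewrite invr_gt0.
have xM : x < M%:R.
 by rewrite -[M%:R]invrK ltf_pV2 ?posrE ?invr_gt0 ?ltr0n.
have slow_t : pi/(2*ka) - x/X t - Lam R t - ln x/X t <= slow ka (z t) (us ka n i).
 rewrite /slow.
 have := angle_compl ka0 ui0.
 have B := atan_le_id (_ : 0 <= ka*(us ka n i)^-1).
 have {}B := B ltac:(by rewrite mulr_ge0 ?(ltW ka0) ?invr_ge0 ?(ltW ui0)).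
 move=> A; have {B}A : pi/(2*ka) - angle ka (us ka n i) <= x/X t.
  rewrite A ler_pdivrMr ?ka0 //; apply: le_trans B _.
  by rewrite uiE invf_div mulrC.
 have lnq : ln (us ka n i) = ln (X t) - ln x by rewrite uiE ln_div ?posrE.
 have L := logmod_ge_ln ka0 ui0; rewrite lnq in L.
 have P : z t*(ln (X t) - ln x) <= z t*(logmod ka (us ka n i) + 1/2).
  by rewrite ler_pM2l ?refz_gt0 //; clear -L; lra.
 have zE : ln (z t) = - ln (X t) by rewrite refzE lnV ?posrE.
 rewrite zE /Lam; move: P; rewrite [X in X*_ <= _]refzE => P.
 by clear -A P; lra.
have gs : - (`|ln ka| / n%:R) <= gatesum ka n M i.
 rewrite /gatesum.
 apply: (@le_trans _ _ (\sum_(M <= j < i) z (n+j)^+2 * - `|ln ka|)); last first.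
  apply: ler_sum_nat => j _; rewrite ler_pM2l ?exprn_gt0 ?refz_gt0 //.
  apply: le_trans (logmod_ge ka0 _); have := ler_norm (- ln ka); rewrite normrN.
  by clra.
 rewrite -mulr_suml mulrN lerN2 mulrC ler_wpM2l //.
 have -> : \sum_(M <= j < i) z (n+j)^+2 = z (n+M) - z (n+i).
  have := sum_refz_sqr R (n+M) (i-M).
  rewrite -addnA subnKC ?(ltnW Mi) // => <-.
  rewrite -{1}[M]add0n big_addn big_mkord; apply: eq_bigr => j _.
  by rewrite [(j+M)%N]addnC addnA.
 have := refz_gt0 R (n+i); have := refz_ltV R n0.
 by clear -zMn; lra.
have er : sc*(z (n+M)^+2*(us ka n i - us ka n M)) <= 2*sc*C*a%:R/n%:R.
 have uu : us ka n i - us ka n M <= 2*(C*a%:R*n%:R).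
  have h1 : us ka n i <= X t by rewrite -[X in _ <= X]mul1r ler_pM2r.
  have h2 : - us ka n M <= X t.
   rewrite uE opprK; apply: le_trans (_ : X (n+M) <= _).
    rewrite ler_pdivrMr // ler_peMr ?(ltW (refX_gt0 _ _)) //.
    by clear -W1 Mr; lra.
   by rewrite refX_le // leq_add2l ltnW.
  by clear -h1 h2 TC; lra.
 have zn : z (n+M)^+2 <= n%:R^-1^+2.
  rewrite lerXn2r ?nnegrE ?invr_ge0 ?(ltW (refz_gt0 _ _)) //.
  exact: le_trans zMn (refz_ltV R n0).
 have -> : 2*sc*C*a%:R/n%:R = sc*(n%:R^-1^+2*(2*(C*a%:R*n%:R))).
  by field; posnz.
 rewrite ler_pM2l // ler_pM ?sqr_ge0 // subr_ge0 us_le ?ka0 //.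
 exact: ltnW.
(* Upper bound for the angle still missing at time [t]; it will be confronted with the lower bound
   [1 - t/(a*n)] that [ln x <= x - 1] provides. *)
have La : ln a%:R + Lam R (n+M) - Lam R t <= K1*M%:R/n%:R.
 move: S; rewrite ler_norml => /andP[_ S].
 have D : ln a%:R = pi/(2*ka) + pi/(2*ka).
  by rewrite -pi_div_kappa; field; rewrite gt_eqF // ka0.
 have xx : x/X t + ln x/X t <= 2*M%:R/n%:R.
  have iT : (X t)^-1 <= n%:R^-1 by rewrite lef_pV2.
  have iT0 : 0 <= (X t)^-1 by rewrite invr_ge0 ltW.
  rewrite -mulrDl; apply: (@le_trans _ _ (2*M%:R/X t)).
   apply: ler_wpM2r iT0 _ _ _; have := ln_le_sub1 x0.
   by clear -xM; lra.
  by apply: ler_wpM2l iT; rewrite mulr_ge0.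
 have wx : went ka n M/X (n+M) <= 2*C*M%:R/n%:R.
  have iX := refX_gt0 R (n+M).
  have iX0 : 0 <= (X (n+M))^-1 by rewrite invr_ge0 ltW.
  apply: ler_pM (ltW w0) iX0 W2 _.
  rewrite lef_pV2 //.
  by apply: le_trans (ltW (refX_gtn R _)); rewrite ler_nat leq_addr.
 have final : 2*M%:R/n%:R + 2*C*M%:R/n%:R + 3/2/n%:R +
   `|ln ka| / n%:R + 2*sc*C*a%:R/n%:R <= K1*M%:R/n%:R.
  rewrite -!mulrDl ler_pM2r ?invr_gt0 // /K1.
  have p1 : 0 <= `|ln ka| by [].
  have p2 : 0 <= 2*sc*C*a%:R.
   by rewrite !mulr_ge0 //; clear -sc0 C1; lra.
  move: (`|ln ka|) (2*sc*C*a%:R) p1 p2 => p q p1 p2.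
  by clear -Mr p1 p2; nra.
 by move: S slow_t slow_e er gs D xx wx final; clra.
have Lt := HE t t0; have Le := HE (n+M)%N (leq_trans n0 (leq_addr _ _)).
have nM0 : 0 < (n+M)%:R :> R by rewrite ltr0n (leq_trans n0 (leq_addr _ _)).
have tr0 := natr_gt0 R t0.
have E1 : E/t%:R <= E/n%:R by rewrite ler_pM2l // lef_pV2 ?posrE ?ler_nat.
have E2 : E/(n+M)%:R <= E/n%:R.
 by rewrite ler_pM2l // lef_pV2 ?posrE ?ler_nat ?leq_addr.
have N0 : 0 < (a*n)%:R :> R by rewrite natrM mulr_gt0 ?(a_gt0 a1).
have lnt : 1 - t%:R/(a*n)%:R <= ln a%:R + ln (n+M)%:R - ln t%:R :> R.
 have h := @ln_le_sub1 R (t%:R/(a*n)%:R) ltac:(by rewrite divr_gt0).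
 rewrite ln_div ?posrE // natrM lnM ?posrE ?(a_gt0 a1) // -natrM in h.
 have : ln n%:R <= ln (n+M)%:R :> R by rewrite ler_ln ?posrE ?ler_nat ?leq_addr.
 by clear -h; lra.
have cM : c2%:R*M%:R/(a*n)%:R <= 1 - t%:R/(a*n)%:R :> R.
 have -> : 1 - t%:R/(a*n)%:R = ((a*n)%:R - t%:R)/(a*n)%:R :> R.
  by rewrite mulrBl divff // gt_eqF.
 rewrite ler_pM2r ?invr_gt0 // lerBrDl -natrM -natrD ler_nat.
 exact: ti.
have F : c2%:R*M%:R/(a*n)%:R <= (K1+2*E)*M%:R/n%:R.
 have : 2*(E/n%:R) <= 2*E*M%:R/n%:R.
  rewrite mulrA ler_pM2r ?invr_gt0 // ler_peMr //; clear -E0 Mr; lra.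
 have -> : (K1+2*E)*M%:R/n%:R = K1*M%:R/n%:R + 2*E*M%:R/n%:R.
  by ring.
 move: Lt Le; rewrite !ler_norml => /andP[q1 q2] /andP[q3 q4].
 by move: La E1 E2 lnt cM q1 q2 q3 q4; clra.
move: F; rewrite natrM invfM [_*(_^-1*_)]mulrA ler_pM2r ?invr_gt0 //.
rewrite ler_pdivrMr ?(a_gt0 a1) // => F; move: (F); rewrite leNgt => /negP; apply.
rewrite mulrAC ltr_pM2r ?ltr0n // mulrC; exact: Hc2.
Unshelve. all: by end_near. Qed.

End GatePassage.

(** * Estimates inside the gate *)

Section GateCore.
Variable R : realType.
Implicit Types (a M c : nat) (ka : R).
Local Notation X := (refX R).
Local Notation z := (refz R).

(** The conclusion of [gate_bound] turned into a hypothesis, so that [c] may later be enlarged. *)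
Definition in_gate a ka M c := \forall n \near \oo, forall i,
 (M <= i)%N -> (n + i + c*M <= a*n)%N -> `|vs ka n i| <= M%:R^-1.

Lemma refX_step t : X t.+1 <= X t + 2.
Proof.
have X2 := refX_ge2 R t.
have : (X t - 1)^-1 <= 1 by rewrite invf_le1; clear -X2; lra.
by rewrite refXS; clra.
Qed.

Lemma refX_steps t i : X (t+i) <= X t + 2 * i%:R.
Proof.
elim: i => [|i IH]; first by rewrite addn0 mulr0 addr0.
rewrite addnS (le_trans (refX_step _)) // -[i.+1%:R]natr1.
by clear -IH; lra.
Qed.

Lemma ln_diff_bound (x y m : R) : 0 < m -> m <= x -> m <= y ->
 `|ln x - ln y| <= `|x - y| / m.
Proof.
wlog xy : x y / x <= y.
 move=> H m0 mx my; case: (leP x y) => [/H|/ltW /H]; first exact.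
 by rewrite distrC [`|x - y|]distrC; apply.
move=> m0 mx my; have x0 : 0 < x by apply: lt_le_trans mx.
have y0 : 0 < y by apply: lt_le_trans my.
have h := @ln_le_sub1 R (y/x) ltac:(by rewrite divr_gt0).
rewrite ln_div ?posrE // in h.
have l0 : ln x - ln y <= 0 by rewrite subr_le0 ler_ln ?posrE.
rewrite ler0_norm // ler0_norm ?subr_le0 // !opprB.
apply: le_trans h _.
have -> : y/x - 1 = (y-x)/x by field; posnz.
by rewrite ler_wpM2l ?subr_ge0 // lef_pV2 ?posrE.
Qed.

Lemma ell_mul a n : (0 < a)%N -> (0 < n)%N -> ell R (a*n) = ell R n + ln a%:R.
Proof.
move=> a0 n0; rewrite /ell natrM lnM ?posrE ?ltr0n //; ring.
Qed.

(** The squares of [z] are the decrements of [z], so they sum to at most [z (n+M) <= 1/n]. *)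
Lemma sum_refz_le n M i (b : nat -> R) B : (M <= i)%N -> 0 <= B -> (0 < n)%N ->
 (forall j, (M <= j < i)%N -> `|b j| <= B) ->
 `|\sum_(M <= j < i) z (n+j)^+2*b j| <= B/n%:R.
Proof.
move=> Mi B0 n0 Hb; apply: le_trans (ler_norm_sum _ _ _) _.
apply: (@le_trans _ _ (\sum_(M <= j < i) z (n+j)^+2*B)).
 rewrite !big_seq; apply: ler_sum => j; rewrite mem_index_iota => h.
 by rewrite normrM ger0_norm ?sqr_ge0 // ler_wpM2l ?sqr_ge0 // Hb.
rewrite -mulr_suml mulrC ler_wpM2l //.
have -> : \sum_(M <= j < i) z (n+j)^+2 = z (n+M) - z (n+i).
 have := sum_refz_sqr R (n+M) (i-M).
 rewrite -addnA subnKC // => <-.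
 rewrite -{1}[M]add0n big_addn big_mkord; apply: eq_bigr => j _.
 by rewrite [(j+M)%N]addnC addnA.
apply: le_trans (_ : z (n+M) <= _); first by rewrite gerBl ltW ?refz_gt0.
by apply: le_trans (refz_ltV R n0); rewrite refz_le // leq_addr.
Qed.

(** The last estimate is the leading-order law: the angle, counted from its lowest value, is the
    logarithm of the ratio of times. It identifies points of different stages with each other. *)
Definition gate_est a ka M c K n := forall i,
 (M <= i)%N -> (n + i + c*M <= a*n)%N ->
 [/\ `|us ka n i| <= K*n%:R, `|logmod ka (us ka n i)| <= K*ell R n,
  `|gatesum ka n M i| <= K*ell R n/n%:R,
  `|slow ka (z (n+i)) (us ka n i) - slow ka (z (n+M)) (us ka n M)
    + gatesum ka n M i|
  <= slowconst ka*(z (n+M)^+2*(us ka n i - us ka n M)) &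
  `|angle ka (us ka n i) + pi/(2*ka) - (ln (X (n+i)) - ln (X n))|
   <= K*ell R n/n%:R].

Lemma gate_core a ka M c : (1 < a)%N -> 0 < ka -> pi/ka = ln a%:R ->
 (20 <= M)%N -> in_gate a ka M c ->
 exists2 K, 0 < K & \forall n \near \oo, gate_est a ka M c K n.
Proof.
move=> a1 ka0 pik M20 G; have [C C1 HC] := refX_lin R.
have a0 := a_gt0 R a1.
have M0 : (0 < M)%N by apply: leq_trans M20.
have Mr : 20 <= M%:R :> R by rewrite (ler_nat R 20).
have sc0 := slowconst_gt0 ka0.
pose K1 := C*a%:R.
have K10 : 1 <= K1.
 have : 1 <= a%:R :> R by rewrite ler1n ltnW.
 by rewrite /K1; clear -C1; nra.
have K1p : 0 <= K1 by clear -K10; lra.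
pose K2 := 1 + `|ln ka| + `|ln (K1+ka)| + ln 2 + K1.
have l20 : 0 <= ln 2 :> R by apply: ln_ge0; clear -Mr; lra.
have K20 : 1 <= K2.
 rewrite /K2; have := normr_ge0 (ln ka); have := normr_ge0 (ln (K1+ka)).
 by clear -l20 K10; lra.
pose K3 := 4*K2 + 2 + 2*C*M%:R + 2*M%:R + 2*slowconst ka*K2.
have K30 : K2 <= K3.
 rewrite /K3; have : 0 <= slowconst ka*K2.
  by rewrite mulr_ge0 ?(ltW sc0) //; clear -K20; lra.
 have : 0 <= C*M%:R by rewrite mulr_ge0 //; clear -C1; lra.
 by move=> h1 h2; rewrite -!mulrA; clear -K20 Mr h1 h2; lra.
have t10 : 0 < 1/10 :> R by clear -sc0; lra.
have tk : 0 < 1/10/ka by rewrite divr_gt0.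
exists K3; first by clear -K20 K30; lra.
near=> n.
have n0 : (0 < n)%N by near: n; exact: nbhs_infty_gt.
have nr := natr_gt0 R n0.
have nr1 : 1 <= n%:R :> R by rewrite ler1n.
have [v0 w0 wX] : [/\ vs ka n M < 0, 0 < went ka n M & `|went ka n M - X M| <= 1].
 by near: n; exact: went_near.
have zn : z n <= 1/10 by near: n; exact: refz_small_near.
have zk : z n <= 1/10/ka by near: n; exact: refz_small_near.
have nG : forall i, (M <= i)%N -> (n + i + c*M <= a*n)%N -> `|vs ka n i| <= M%:R^-1.
 by near: n.
have zMn : z (n+M) <= z n by rewrite refz_le // leq_addr.
have {zn} zM : z (n+M) <= 1/10 by apply: le_trans zn.
have {}zk : z (n+M)*ka <= 1/10.
 by rewrite -ler_pdivlMr //; apply: le_trans zk.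
have l1 := ell_ge1 R n; have l0 := ell_gt0 R n.
have W2 : went ka n M <= 2*C*M%:R.
 have := HC M M0; move: wX; rewrite ler_norml => /andP[_ h] h2.
 by clear -h h2 Mr C1; nra.
have W1 : 1 <= went ka n M.
 have := refX_ge R M; move: wX; rewrite ler_norml => /andP[h _] h2.
 by clear -h h2 Mr; lra.
have uE := us_ent v0.
have M10 : M%:R^-1 <= 1/20 :> R.
 by rewrite div1r lef_pV2 ?posrE ?ltr0n.
move=> i Mi ti.
have vj j : (M <= j <= i)%N -> `|vs ka n j| <= 1/10.
 move=> /andP[Mj ji]; apply: le_trans (_ : 1/20 <= _); last by clra.
 apply: le_trans M10; apply: nG => //; apply: leq_trans ti.
 by rewrite leq_add2r leq_add2l.
have Xj j : (j <= i)%N -> X (n+j) <= K1*n%:R.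
 move=> ji; apply: le_trans (HC _ _) _; first by rewrite addn_gt0 n0.
 rewrite /K1 -mulrA -natrM ler_wpM2l ?ler_nat //; first by clear -C1; lra.
 by apply: leq_trans ti; rewrite -addnA leq_add2l (leq_trans ji) ?leq_addr.
have uj j : (M <= j <= i)%N -> `|us ka n j| <= K1*n%:R.
 move=> /[dup] /vj h /andP[_ ji]; rewrite /us normrM (gtr0_norm (refX_gt0 _ _)).
 apply: le_trans (Xj j ji); rewrite ler_piMl ?(ltW (refX_gt0 _ _)) //.
 by clear -h; lra.
have lj j : (M <= j <= i)%N -> `|logmod ka (us ka n j)| <= K2*ell R n.
 move=> hj; rewrite ler_norml; apply/andP; split.
  apply: le_trans (logmod_ge ka0 _).
  have := ler_norm (- ln ka); rewrite normrN => q.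
  have : `|ln ka| <= K2*ell R n.
   apply: le_trans (_ : K2*1 <= _).
    rewrite /K2; have := normr_ge0 (ln (K1+ka)).
    by clear -l20 K10; lra.
   by rewrite ler_pM2l //; clear -K20; lra.
  by clear -q; lra.
 have q : us ka n j^+2 + ka^+2 <= ((K1+ka)*n%:R)^+2.
  rewrite mulrDl sqrrD -real_normK ?num_real //.
  have p1 : `|us ka n j| ^+ 2 <= (K1*n%:R)^+2.
   by rewrite lerXn2r ?nnegrE ?uj //; apply: mulr_ge0 K1p (ltW nr).
  have p2 : ka^+2 <= (ka*n%:R)^+2.
   by rewrite lerXn2r ?nnegrE ?mulr_ge0 ?(ltW ka0) // ler_peMr // ltW.
  have p3 : 0 <= K1*n%:R*(ka*n%:R) *+ 2.
   apply: mulrn_wge0; apply: mulr_ge0; first exact: mulr_ge0 K1p (ltW nr).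
   exact: mulr_ge0 (ltW ka0) (ltW nr).
  by clear -p1 p2 p3; lra.
 have Kka : 0 < K1 + ka by clear -K10 ka0; lra.
 have Kn : 0 < (K1+ka)*n%:R by rewrite mulr_gt0.
 rewrite /logmod ler_pdivrMr //.
 apply: (@le_trans _ _ (ln (((K1+ka)*n%:R)^+2))).
  by rewrite ler_ln ?posrE ?exprn_gt0 ?sqka_gt0.
 rewrite lnXn // mulr2n lnM ?posrE //.
 have q1 := ler_norm (ln (K1+ka)); have q2 := normr_ge0 (ln ka).
 have q3 : ell R n = 1 + ln n%:R by [].
 have q4 : `|ln (K1+ka)| + (ell R n - 1) <= K2*ell R n.
  have : 0 <= `|ln (K1+ka)| * (ell R n - 1) by rewrite mulr_ge0 // subr_ge0.
  have : 0 <= `|ln ka| * ell R n by rewrite mulr_ge0 // ltW.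
  have : 0 <= ln 2*ell R n by rewrite mulr_ge0 // ltW.
  have : 0 <= K1*ell R n by rewrite mulr_ge0 ?(ltW l0) //; clear -K10; lra.
  rewrite /K2; move: (`|ln (K1+ka)|) (`|ln ka|) (ln 2) (ell R n) => A B D E.
  by clra.
 by clear -q1 q3 q4; lra.
have gs : `|gatesum ka n M i| <= K2*ell R n/n%:R.
 apply: sum_refz_le => //.
  by rewrite mulr_ge0 ?(ltW l0) //; clear -K20; lra.
 by move=> j /andP[h1 h2]; apply: lj; rewrite h1 ltnW.
have ui := uj i; rewrite Mi leqnn in ui; have {}ui := ui isT.
have uM := uj M; rewrite Mi leqnn in uM; have {}uM := uM isT.
have li := lj i; rewrite Mi leqnn in li; have {}li := li isT.
have lM := lj M; rewrite Mi leqnn in lM; have {}lM := lM isT.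
have S := slow_sum ka0 Mi zM zk _.
have {}S : `|slow ka (z (n+i)) (us ka n i) - slow ka (z (n+M)) (us ka n M) +
   gatesum ka n M i| <= slowconst ka*(z (n+M)^+2*(us ka n i - us ka n M)).
 by apply: S => j /andP[h1 h2]; apply: vj; rewrite h1 ltnW.
have K3l : K2*ell R n <= K3*ell R n by rewrite ler_pM2r.
have K13 : K1 <= K3.
 apply: le_trans K30; rewrite /K2; have := normr_ge0 (ln ka).
 by have := normr_ge0 (ln (K1+ka)); clear -l20; lra.
split=> //.
- by apply: le_trans ui _; rewrite ler_pM2r.
- exact: le_trans K3l.
- by apply: le_trans gs _; rewrite ler_pM2r // invr_gt0.
have er : slowconst ka*(z (n+M)^+2*(us ka n i - us ka n M)) <=
  2*slowconst ka*K2/n%:R.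
 have p1 : us ka n i - us ka n M <= 2*(K2*n%:R).
  have K12 : K1*n%:R <= K2*n%:R.
   rewrite ler_pM2r // /K2; have := normr_ge0 (ln ka).
   by have := normr_ge0 (ln (K1+ka)); clear -l20; lra.
  move: ui uM; rewrite !ler_norml => /andP[_ q1] /andP[q2 _].
  by clear -K12 q1 q2; lra.
 have p2 : z (n+M)^+2 <= n%:R^-1^+2.
  rewrite lerXn2r ?nnegrE ?invr_ge0 ?(ltW (refz_gt0 _ _)) //.
  exact: le_trans zMn (refz_ltV R n0).
 have -> : 2*slowconst ka*K2/n%:R = slowconst ka*(n%:R^-1^+2*(2*(K2*n%:R))).
  by field; posnz.
 rewrite ler_pM2l //; apply: ler_pM => //; first exact: sqr_ge0.
 by rewrite subr_ge0 us_le.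
have E0' := refX_gt0 R (n+M); have En := refX_gtn R (n+M).
have nE : n%:R <= X (n+M).
 by apply: le_trans (ltW En); rewrite ler_nat leq_addr.
have aM : 0 <= angle ka (us ka n M) + pi/(2*ka) <= 2*C*M%:R/n%:R.
 have q0 : 0 < X (n+M)/went ka n M by rewrite divr_gt0.
 rewrite uE angleN addrC (angle_compl ka0 q0) invf_div.
 have p0 : 0 <= ka*(went ka n M/X (n+M)).
  by rewrite mulr_ge0 ?(ltW ka0) // divr_ge0 // ltW.
 rewrite divr_ge0 ?atan_ge0 ?(ltW ka0) //= ler_pdivrMr //.
 apply: le_trans (atan_le_id p0) _; rewrite mulrC ler_pM2r //.
 have iX0 : 0 <= (X (n+M))^-1 by rewrite invr_ge0 ltW.
 by apply: ler_pM (ltW w0) iX0 W2 _; rewrite lef_pV2.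
have lnE : 0 <= ln (X (n+M)) - ln (X n) <= 2*M%:R/n%:R.
 have X0 := refX_gt0 R n; have XX : X n <= X (n+M) by rewrite refX_le // leq_addr.
 rewrite subr_ge0 ler_ln ?posrE // XX /=.
 have nX := ltW (refX_gtn R n).
 have := ln_diff_bound nr nE nX; rewrite ger0_norm; last first.
  by rewrite subr_ge0 ler_ln ?posrE.
 move=> h; apply: le_trans h _; rewrite ler_pM2r ?invr_gt0 //.
 by rewrite ger0_norm ?subr_ge0 // lerBlDl refX_steps.
have zl (t : nat) (u : R) : (n <= t)%N -> `|logmod ka u| <= K2*ell R n ->
  `|z t*(logmod ka u + 1/2)| <= (K2+1)*ell R n/n%:R.
 move=> nt hu; rewrite normrM (gtr0_norm (refz_gt0 _ _)) mulrC.
 apply: ler_pM => //; first exact: ltW (refz_gt0 _ _).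
  apply: le_trans (ler_normD _ _) _; rewrite (ger0_norm (_ : 0 <= 1/2)) ?divr_ge0 //.
  by rewrite mulrDl mul1r; clear -hu l1; lra.
 by apply: le_trans (refz_le R nt) (refz_ltV R n0).
have z1 := zl _ _ (leq_addr i n) li; have z2 := zl _ _ (leq_addr M n) lM.
have lz (t : nat) : ln (z t) = - ln (X t).
 by rewrite refzE lnV ?posrE ?refX_gt0.
have fin : 2*(K2+1)*ell R n/n%:R + 2*C*M%:R/n%:R + 2*M%:R/n%:R +
  2*slowconst ka*K2/n%:R + K2*ell R n/n%:R <= K3*ell R n/n%:R.
 have f0 : 0 <= 2*C*M%:R + 2*M%:R + 2*slowconst ka*K2.
  have f1 : 0 <= C*M%:R by rewrite mulr_ge0 //; clear -C1; lra.
  have f2 : 0 <= slowconst ka*K2.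
   by rewrite mulr_ge0 ?(ltW sc0) //; clear -K20; lra.
  by rewrite -!mulrA; clear -f1 f2 Mr; lra.
 have {f0} := ler_wpM2l f0 l1; rewrite mulr1 => f0.
 have f3 : 0 <= K2*ell R n by rewrite mulr_ge0 ?(ltW l0) //; clear -K20; lra.
 rewrite -!mulrDl ler_pM2r ?invr_gt0 // /K3.
 move: f0; move: (2*C*M%:R) (2*M%:R) (2*slowconst ka*K2) => p q r f0.
 by clear -f0 f3; lra.
move: S z1 z2 gs er aM lnE fin; rewrite /slow !lz.
move: (z _*_) (z _*_) => p q.
rewrite !ler_norml.
move=> /andP[S1 S2] /andP[h1 h2] /andP[h3 h4] /andP[h5 h6] h7 /andP[h8 h9].
move=> /andP[h10 h11] h12.
by apply/andP; split; clear -S1 S2 h1 h2 h3 h4 h5 h6 h7 h8 h9 h10 h11 h12; lra.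
Unshelve. all: by end_near. Qed.
End GateCore.

(** * Convergence of the rescaled gate sums *)

Section GateSum.
Variable R : realType.
Implicit Types (a M c : nat) (ka : R).
Local Notation X := (refX R).
Local Notation z := (refz R).

Lemma big_nat_block (V : zmodType) a A B (F : nat -> V) : (A <= B)%N ->
 \sum_(a*A <= t < a*B) F t =
 \sum_(A <= j < B) \sum_(i < a) F (a*j+i)%N.
Proof.
move=> /subnKC <-; elim: (B-A)%N => [|d IH].
 by rewrite addn0 !big_geq.
rewrite addnS big_nat_recr ?leq_addr //= -IH.
rewrite mulnS addnC (big_cat_nat _ (n := (a*(A+d))%N)) ?leq_addr ?leq_mul2l ?leq_addr ?orbT //=.
congr (_+_); rewrite -{1}[(a*(A+d))%N]add0n big_addn addKn big_mkord.
by apply: eq_bigr => i _; rewrite addnC.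
Qed.

(* By AM-GM with weight [sqrt n]: the squares telescope. *)
Lemma sum_abs_bound ka (K : R) n M i : 0 < ka -> (0 < n)%N -> (M <= i)%N ->
 `|us ka n M| <= K*n%:R -> `|us ka n i| <= K*n%:R ->
 \sum_(M <= j < i) z (n+j)^+2 * `|us ka n j| <= (1+K)/Num.sqrt n%:R.
Proof.
move=> ka0 n0 Mi uM ui.
have nr : 0 < n%:R :> R by rewrite ltr0n.
set s := Num.sqrt n%:R; have s0 : 0 < s by rewrite sqrtr_gt0.
have ss : s^+2 = n%:R by rewrite sqr_sqrtr // ltW.
have T j : z (n+j)^+2 * `|us ka n j| <= s/2*(z (n+j)^+2) +
   (us ka n j.+1 - us ka n j)/(2*s*n%:R).
 have z0 := refz_gt0 R (n+j).
 have /andP[_ zh] := refz_bound R (n+j).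
 have du : z (n+j) * `|us ka n j| ^+ 2 <= us ka n j.+1 - us ka n j.
  rewrite real_normK ?num_real // us_step addrAC subrr add0r.
  have := sqka_gt0 ka0 (us ka n j); have := sqr_ge0 (us ka n j).
  have k2 := sqr_ge0 ka.
  move: (us ka n j^+2) => q q0 Q.
  apply: ler_pM => //; first exact: ltW.
   by rewrite ler_pdivlMr ?ler_piMr ?(ltW z0) //; clear -z0 zh; lra.
  by clear -k2; lra.
 have zn : z (n+j) <= n%:R^-1.
  by apply: le_trans (refz_ltV R n0); rewrite refz_le // leq_addr.
 have du' : z (n+j)^+2 * `|us ka n j| ^+ 2 <= (us ka n j.+1 - us ka n j)/n%:R.
  rewrite expr2 -mulrA mulrC; apply: ler_pM => //; last exact: ltW.
  by rewrite mulr_ge0 ?sqr_ge0 // ltW.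
 have amgm : z (n+j)^+2 * `|us ka n j| <=
   s/2*(z (n+j)^+2) + z (n+j)^+2 * `|us ka n j| ^+ 2/(2*s).
  rewrite -subr_ge0.
  have -> : s/2*z (n+j)^+2 + z (n+j)^+2 * `|us ka n j| ^+ 2/(2*s) -
   z (n+j)^+2 * `|us ka n j| = (z (n+j)*(s - `|us ka n j|))^+2/(2*s).
   by field; posnz.
  by rewrite divr_ge0 ?sqr_ge0 // mulr_ge0 // ltW.
 apply: le_trans amgm _; rewrite lerD2l.
 have -> : (us ka n j.+1 - us ka n j)/(2*s*n%:R) =
   (us ka n j.+1 - us ka n j)/n%:R/(2*s) by field; posnz.
 by rewrite ler_pM2r // invr_gt0 mulr_gt0.
apply: le_trans (ler_sum _ (fun j _ => T j)) _.
rewrite big_split /= -mulr_sumr -mulr_suml telescope_sumr //.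
have z2 : \sum_(M <= j < i) z (n+j)^+2 <= 1/n%:R.
 have := @sum_refz_le R n M i (fun => 1) 1 Mi ler01 n0.
 under eq_bigr do rewrite mulr1.
 have n1 : 0 <= \sum_(M <= j < i) z (n+j)^+2.
  by apply: sumr_ge0 => j _; exact: sqr_ge0.
 by rewrite (ger0_norm n1); apply=> j _; rewrite normr1.
have du : us ka n i - us ka n M <= 2*(K*n%:R).
 move: ui uM; rewrite !ler_norml => /andP[_ q1] /andP[q2 _].
 by clear -q1 q2; lra.
have e1 : s/2*(\sum_(M <= j < i) z (n+j)^+2) <= 1/2/s.
 have -> : 1/2/s = s/2*(1/s^+2) by field; posnz.
 by rewrite ss ler_pM2l // divr_gt0.
have e2 : (us ka n i - us ka n M)/(2*s*n%:R) <= K/s.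
 have -> : K/s = 2*(K*n%:R)/(2*s*n%:R) by field; posnz.
 by rewrite ler_pM2r // invr_gt0 !mulr_gt0.
have : 1/2/s <= 1/s by rewrite ler_pM2r ?invr_gt0 //; clra.
by rewrite mulrDl; clear -e1 e2; lra.
Qed.

(** Index of the point [c*M] steps before time [a*n], the last one that [in_gate] controls. With the
    arguments [1] and [j] it is the [j]-th step before that time. *)
Definition gatelen a M c n := (a*n-n-c*M)%N.

(** Time [t] of stage [n] is compared with the [a] consecutive times [a*t + i] of stage [a*n]. There
    the angle is the same up to [O(ell n/n)], and [z^2] is smaller by [a^2], which the block length
    and the prefactor compensate. *)
Lemma gatesum_diff a ka M c : (1 < a)%N -> 0 < ka -> pi/ka = ln a%:R ->
 (20 <= M)%N -> in_gate a ka M c ->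
 exists2 K, 0 < K & \forall n \near \oo,
 `|(a*n)%:R*gatesum ka (a*n) M (gatelen a M c (a*n)) -
  n%:R*gatesum ka n M (gatelen a M c n)|
  <= K*ell R n^+2/Num.sqrt n%:R.
Proof.
move=> a1 ka0 pik M20 G.
have [K K0 [N _ HN]] := gate_core a1 ka0 pik M20 G.
have [C C1 HC] := refX_lin R; have [C0 C00 HC0] := refX_asymp R.
have ar := a_gt0 R a1; have ar1 : 1 <= a%:R :> R by rewrite ler1n ltnW.
have aN0 : (0 < a)%N by apply: ltnW.
have la0 : 0 <= ln a%:R :> R by apply: ln_ge0.
have Mr : 20 <= M%:R :> R by rewrite (ler_nat R 20).
pose K4 : R := (1+a%:R)*(C0 + 2 * ln a%:R + 1) + a%:R.
have K40 : 0 < K4.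
 by rewrite /K4; apply: ltr_pwDr => //; apply: mulr_ge0; clear -ar C00 la0; lra.
pose L : R := 1 + ln a%:R; have L1 : 1 <= L by rewrite /L; clear -la0; lra.
have KL0 : 0 <= K*L by rewrite mulr_ge0 ?(ltW K0) //; clear -L1; lra.
pose K5 := K + K*L + 2*K4.
pose D : R := 4*a%:R^+2*C^+2.
have K50 : 0 < K5.
 have : 0 < K*L by rewrite mulr_gt0 //; clear -L1; lra.
 by rewrite /K5; clear -K0 K40; lra.
have D0 : 0 <= D by rewrite /D mulr_ge0 ?sqr_ge0 // mulr_ge0 ?sqr_ge0.
pose Kf := 2*K4*(K*L) + K5*(a%:R*(1+K) + D*(1+K)) +
  (a%:R*M%:R + a%:R*(c*M)%:R)*(K*L).
exists Kf.
 have p1 : 0 < 2*K4*(K*L).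
  by rewrite mulr_gt0 ?mulr_gt0 //; clear -L1; lra.
 have p2 : 0 <= K5*(a%:R*(1+K) + D*(1+K)).
  rewrite mulr_ge0 ?(ltW K50) // addr_ge0 // mulr_ge0 //; clear -K0 ar; lra.
 have p3 : 0 <= (a%:R*M%:R + a%:R*(c*M)%:R)*(K*L).
  by rewrite mulr_ge0 ?addr_ge0 ?mulr_ge0 // ?(ltW K0) //; clear -L1; lra.
 by rewrite /Kf; clear -p1 p2 p3; lra.
exists (N + (c*M+M).+1)%N => // n /= Nn.
have Nn1 : (N <= n)%N := leqDl Nn.
have Nan : (N <= a*n)%N by apply: leq_trans Nn1 _; rewrite leq_pmull.
have Mn : (c*M + M < n)%N := leqDr Nn.
have n0 : (0 < n)%N by apply: leq_ltn_trans Mn.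
have nr := natr_gt0 R n0.
have nr1 : 1 <= n%:R :> R by rewrite ler1n.
have an0 : (0 < a*n)%N by rewrite muln_gt0 aN0.
have l1 := ell_ge1 R n; have l0 := ell_gt0 R n.
have HN1 := HN n Nn1; have HN2 := HN (a*n)%N Nan.
set I := gatelen a M c n; set I' := gatelen a M c (a*n).
have twon : (n + n <= a*n)%N by rewrite addnn -mul2n leq_mul2r a1 orbT.
have IE : (n + I + c*M = a*n)%N by move: Mn twon; rewrite /I /gatelen; clia.
have IE' : (a*n + I' + c*M = a*(a*n))%N.
 have : (a*n + a*n <= a*(a*n))%N by rewrite addnn -mul2n leq_mul2r a1 orbT.
 have : (n <= a*n)%N by rewrite leq_pmull.
 by move: Mn twon; rewrite /I' /gatelen; clia.
have MI : (M <= I)%N by move: Mn twon; rewrite /I /gatelen; clia.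
have aIE : (a*n + a*I + a*(c*M) = a*(a*n))%N by rewrite -!mulnDr IE.
have caM : (c*M <= a*(c*M))%N by rewrite leq_pmull.
have aII : (a*I <= I')%N by move: IE' aIE caM; clia.
have MaM : (M <= a*M)%N by rewrite leq_pmull.
have aMaI : (a*M <= a*I)%N by rewrite leq_mul2l MI orbT.
have ella : ell R (a*n) <= L*ell R n.
 rewrite ell_mul // /L mulrDl mul1r lerD2l ler_peMr //.
have ellan0 := ell_gt0 R (a*n).
have nar : 0 < (a*n)%:R :> R by rewrite ltr0n.
have R1 j : (M <= j <= I)%N -> (n + j + c*M <= a*n)%N.
 by move=> /andP[_ h]; rewrite -IE leq_add2r leq_add2l.
have R2 j : (M <= j <= I')%N -> (a*n + j + c*M <= a*(a*n))%N.
 by move=> /andP[_ h]; rewrite -IE' leq_add2r leq_add2l.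
have g2 j : (M <= j <= I')%N -> `|logmod ka (us ka (a*n) j)| <= K*L*ell R n.
 move=> h; have /andP[h1 _] := h; have [_ q _ _ _] := HN2 j h1 (R2 j h).
 by apply: le_trans q _; rewrite -mulrA ler_pM2l.
(* The blocks only cover the indices from [a*M] to [a*I]; the two remaining pieces have bounded
   length and contribute [O(ell n/n)]. *)
have edge A B : (M <= A)%N -> (A <= B)%N -> (B <= I')%N ->
  `|(a*n)%:R * \sum_(A <= j < B) z (a*n+j)^+2 * logmod ka (us ka (a*n) j)|
  <= (B-A)%:R*(K*L)*ell R n/n%:R.
 move=> MA AB BI; rewrite normrM gtr0_norm //.
 have t j : (A <= j < B)%N ->
  `|z (a*n+j)^+2 * logmod ka (us ka (a*n) j)| <= (a*n)%:R^-1^+2*(K*L*ell R n).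
  move=> /andP[Aj jB]; rewrite normrM ger0_norm ?sqr_ge0 //.
  apply: ler_pM => //; first exact: sqr_ge0.
   rewrite lerXn2r ?nnegrE ?invr_ge0 ?(ltW (refz_gt0 _ _)) //.
   by apply: le_trans (refz_ltV R an0); rewrite refz_le // leq_addr.
  by apply: g2; rewrite (leq_trans MA) //= (leq_trans (ltnW jB)).
 have s : `|\sum_(A <= j < B) z (a*n+j)^+2 * logmod ka (us ka (a*n) j)| <=
   (B-A)%:R*((a*n)%:R^-1^+2*(K*L*ell R n)).
  apply: le_trans (ler_norm_sum _ _ _) _.
  rewrite mulr_natl -sumr_const_nat; rewrite !big_seq; apply: ler_sum => j.
  by rewrite mem_index_iota; apply: t.
 apply: le_trans (ler_wpM2l (ltW nar) s) _.
 have -> : (a*n)%:R*((B-A)%:R*((a*n)%:R^-1^+2*(K*L*ell R n))) =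
   ((B-A)%:R*(K*L)*ell R n)*(a*n)%:R^-1 by field; posnz.
 apply: ler_wpM2l.
  by rewrite !mulr_ge0 ?(ltW K0) ?(ltW l0) //; clear -L1; lra.
 by rewrite lef_pV2 ?posrE // ler_nat leq_pmull.
pose u := us ka n; pose u' := us ka (a*n).
have term j i : (M <= j < I)%N -> (i < a)%N ->
 `|(a*n)%:R*(z (a*n + (a*j+i))^+2 * logmod ka (u' (a*j+i)%N)) -
  n%:R/a%:R*(z (n+j)^+2 * logmod ka (u j))| <=
 2*K4*(K*L)*ell R n^+2/(a*n)%:R^+2 +
 K5*ell R n*(z (n+j)^+2 * `|u j| +
  D*(z (a*n + (a*j+i))^+2 * `|u' (a*j+i)%N|)).
 move=> /andP[Mj jI] ia.
 set t := (n+j)%N; set j' := (a*j+i)%N.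
 have tE : (a*n + j' = a*t + i)%N by rewrite /j' /t addnA -mulnDr.
 have nt : (n <= t)%N by rewrite leq_addr.
 have t0 : (0 < t)%N by apply: leq_trans nt.
 have tan : (t <= a*n)%N by rewrite -IE /t -addnA leq_add2l (leq_trans (ltnW jI)) ?leq_addr.
 have j'I : (j' < a*I)%N.
  apply: leq_trans (_ : a*j.+1 <= _)%N; last by rewrite leq_mul2l jI orbT.
  by rewrite /j' mulnS addnC ltn_add2r.
 have Mj' : (M <= j' <= I')%N.
  rewrite (leq_trans (ltnW j'I)) // andbT /j'.
  by apply: leq_trans MaM _; apply: leq_trans (leq_addr _ _); rewrite leq_mul2l Mj orbT.
 have Mj1 : (M <= j <= I)%N by rewrite Mj ltnW.
 have [uj gj _ _ aj] := HN1 j Mj (R1 j Mj1).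
 have [uj' _ _ _ aj'] := HN2 j' (andP Mj').1 (R2 j' Mj').
 have gj' := g2 j' Mj'.
 rewrite -/(u j) -/(u' j') in uj gj aj uj' aj' gj' *.
 rewrite tE in aj' *.
 have at0 : (0 < a*t + i)%N by rewrite addn_gt0 muln_gt0 aN0 t0.
 have tr := natr_gt0 R t0.
 have X0 := refX_gt0 R t; have X0' := refX_gt0 R (a*t+i).
 have atan : (a*n <= a*t + i)%N.
  by apply: leq_trans (leq_addr _ _); rewrite leq_mul2l nt orbT.
 have X1' : (a*n)%:R <= X (a*t+i).
  by apply: le_trans (ltW (refX_gtn R _)); rewrite ler_nat.
 have X1 : (a*n)%:R <= a%:R*X t.
  rewrite natrM ler_pM2l //; apply: le_trans (ltW (refX_gtn R _)).
  by rewrite ler_nat.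
 have lt : ln t%:R <= ln n%:R + ln a%:R :> R.
  by rewrite addrC -lnM ?posrE // -natrM ler_ln ?posrE ?ler_nat.
 have lat : ln (a*t+i)%:R <= ln n%:R + 2 * ln a%:R :> R.
  have -> : ln n%:R + 2 * ln a%:R = ln (a*(a*n))%:R :> R.
   by rewrite !natrM !lnM ?posrE ?mulr_gt0 //; ring.
  rewrite ler_ln ?posrE ?ltr0n ?muln_gt0 ?aN0 // ler_nat.
  apply: leq_trans (_ : a*t.+1 <= _)%N; first by rewrite mulnS addnC leq_add2r ltnW.
  rewrite leq_mul2l -IE /t -addnS; apply/orP; right.
  by rewrite -addnA leq_add2l (leq_trans jI) ?leq_addr.
 have XX x (x0 : (0 < x)%N) : ln x%:R <= ln n%:R + 2 * ln a%:R :> R ->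
   `|X x - x%:R| <= (C0 + 2 * ln a%:R + 1)*ell R n.
  move=> lx; apply: le_trans (HC0 x x0) _; rewrite /ell.
  have : 0 <= ln n%:R :> R by apply: ln_ge0.
  by clear -lx C00 la0; nra.
 have DX : `|X (a*t+i) - a%:R*X t| <= K4*ell R n.
  have h1 := XX _ at0 lat.
  have h2 := XX _ t0 _.
  have {}h2 := h2 ltac:(clear -lt la0; lra).
  have h3 : i%:R <= a%:R*ell R n.
   apply: (@le_trans _ _ (a%:R*1)); last by rewrite ler_pM2l.
   by rewrite mulr1 ler_nat ltnW.
  have h4 := ler_wpM2l (ltW ar) h2.
  have -> : X (a*t+i) - a%:R*X t = (X (a*t+i) - (a*t+i)%:R) -
    a%:R*(X t - t%:R) + i%:R by rewrite natrD natrM; ring.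
  apply: le_trans (ler_normD _ _) _; rewrite normr_nat.
  have := ler_normB (X (a*t+i) - (a*t+i)%:R) (a%:R*(X t - t%:R)).
  rewrite [X in _ <= _ + X]normrM normr_nat.
  by rewrite /K4; clear -h1 h3 h4; lra.
 have lnX : `|ln (X (a*t+i)) - ln (a%:R*X t)| <= K4*ell R n/n%:R.
  have := ln_diff_bound nar X1' X1 => h; apply: le_trans h _.
  apply: ler_pM => //.
  by rewrite lef_pV2 ?posrE // ler_nat leq_pmull.
 have DX0 : `|X (a*n) - a%:R*X n| <= K4*ell R n.
  have la : ln (a*n)%:R <= ln n%:R + 2 * ln a%:R :> R.
   by rewrite natrM lnM ?posrE //; clear -la0; lra.
  have h1 := XX _ an0 la.
  have h2 := XX _ n0 _.
  have {}h2 := h2 ltac:(clear -la0; lra).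
  have h4 := ler_wpM2l (ltW ar) h2.
  have -> : X (a*n) - a%:R*X n = (X (a*n) - (a*n)%:R) -
    a%:R*(X n - n%:R) by rewrite natrM; ring.
  have := ler_normB (X (a*n) - (a*n)%:R) (a%:R*(X n - n%:R)).
  rewrite [X in _ <= _ + X]normrM normr_nat.
  have : 0 <= a%:R*ell R n by rewrite mulr_ge0 // ltW.
  by rewrite /K4; clear -h1 h4; lra.
 have lnX0 : `|ln (X (a*n)) - ln (a%:R*X n)| <= K4*ell R n/n%:R.
  have Xa : (a*n)%:R <= X (a*n) by exact: ltW (refX_gtn R _).
  have Xb : (a*n)%:R <= a%:R*X n.
   by rewrite natrM ler_pM2l //; exact: ltW (refX_gtn R _).
  have := ln_diff_bound nar Xa Xb => h; apply: le_trans h _.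
  apply: ler_pM => //.
  by rewrite lef_pV2 ?posrE // ler_nat leq_pmull.
 rewrite !lnM ?posrE ?refX_gt0 // in lnX lnX0.
 have dang : `|angle ka (u' j') - angle ka (u j)| <= K5*ell R n/n%:R.
  have q : K*ell R (a*n)/(a*n)%:R <= K*L*ell R n/n%:R.
   apply: ler_pM => //; first by rewrite mulr_ge0 // ltW.
   - by rewrite -mulrA ler_pM2l.
   - by rewrite lef_pV2 ?posrE // ler_nat leq_pmull.
  have -> : K5*ell R n/n%:R = K*ell R n/n%:R + K*L*ell R n/n%:R +
   K4*ell R n/n%:R + K4*ell R n/n%:R by rewrite /K5; ring.
  move: aj aj' lnX lnX0 q; rewrite !ler_norml; clear.
  move=> /andP[? ?] /andP[? ?] /andP[? ?] /andP[? ?] ?.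
  by apply/andP; split; lra.
 (* [logmod] has slope [u] in the angle, and [u] may be of order [n] near the ends; the bound
    therefore keeps [|u|], to be summed by [sum_abs_bound]. *)
 have dlog : `|logmod ka (u' j') - logmod ka (u j)| <=
   (`|u j| + `|u' j'|)*(K5*ell R n/n%:R).
  apply: (le_trans (logmod_lip_angle ka0 (c := `|u j| + `|u' j'|) _ _)).
  - by rewrite lerDl.
  - by rewrite lerDr.
  by rewrite ler_wpM2l // addr_ge0.
 have zz : z t <= 2*a%:R*C*z (a*t+i).
  rewrite !refzE ler_pdivlMr // mulrC ler_pdivrMr //.
  apply: le_trans (HC _ at0) _; rewrite natrD natrM.
  have h1 : i%:R <= a%:R*t%:R :> R.
   rewrite -natrM ler_nat; apply: leq_trans (ltnW ia) _; exact: leq_pmulr.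
  have h2 := ltW (refX_gtn R t).
  have h3 : a%:R*t%:R <= a%:R*X t by rewrite ler_pM2l.
  have : C*(a%:R*t%:R+i%:R) <= C*(2*(a%:R*X t)).
   by rewrite ler_pM2l //; clear -h1 h3 C1; lra.
  by clra.
 have zz2 : z t^+2 <= D*z (a*t+i)^+2.
  have -> : D*z (a*t+i)^+2 = (2*a%:R*C*z (a*t+i))^+2.
   by rewrite /D; ring.
  have zp := refz_gt0 R t.
  by rewrite lerXn2r ?nnegrE ?(ltW zp) // (le_trans (ltW zp)).
 have zd : `|z (a*t+i)^+2 - (z t/a%:R)^+2| <= 2*K4*ell R n/(a*n)%:R^+3.
  have e : z (a*t+i)^+2 - (z t/a%:R)^+2 =
   (a%:R*X t - X (a*t+i))*((X (a*t+i))^-1*(a%:R*X t)^-1) *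
   ((X (a*t+i))^-1 + (a%:R*X t)^-1).
   by rewrite !refzE; field; posnz.
  have i1 : (X (a*t+i))^-1 <= (a*n)%:R^-1 by rewrite lef_pV2 ?posrE.
  have aX0 : 0 < a%:R*X t by rewrite mulr_gt0.
  have i2 : (a%:R*X t)^-1 <= (a*n)%:R^-1 by rewrite lef_pV2 ?posrE.
  have p1 : 0 < (X (a*t+i))^-1 by rewrite invr_gt0.
  have p2 : 0 < (a%:R*X t)^-1 by rewrite invr_gt0.
  rewrite e !normrM distrC (gtr0_norm p1) (gtr0_norm p2) (gtr0_norm (addr_gt0 p1 p2)).
  have -> : 2*K4*ell R n/(a*n)%:R^+3 = K4*ell R n *
    ((a*n)%:R^-1*(a*n)%:R^-1)*(2*(a*n)%:R^-1) by field; posnz.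
  apply: ler_pM => //.
  - by rewrite !mulr_ge0 // ltW.
  - by rewrite addr_ge0 // ltW.
  - by apply: ler_pM; rewrite ?mulr_ge0 ?(ltW p1) ?(ltW p2) // ler_pM ?(ltW p1) ?(ltW p2).
  - by clear -i1 i2; lra.
 have split_e : (a*n)%:R*(z (a*t+i)^+2 * logmod ka (u' j')) -
  n%:R/a%:R*(z t^+2 * logmod ka (u j)) =
  (a*n)%:R*((z (a*t+i)^+2 - (z t/a%:R)^+2) * logmod ka (u' j')) +
  n%:R/a%:R*(z t^+2*(logmod ka (u' j') - logmod ka (u j))).
  by rewrite natrM; field; posnz.
 rewrite split_e; apply: le_trans (ler_normD _ _) _; apply: lerD.
  rewrite normrM (gtr0_norm nar) normrM.
  have -> : 2*K4*(K*L)*ell R n^+2/(a*n)%:R^+2 =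
   (a*n)%:R*(2*K4*ell R n/(a*n)%:R^+3*(K*L*ell R n)) by field; posnz.
  by rewrite ler_pM2l // ler_pM.
 have na : n%:R/a%:R <= n%:R :> R by rewrite ler_pdivrMr // ler_peMr.
 rewrite normrM [`|_^+2*_|]normrM (ger0_norm (sqr_ge0 _)).
 rewrite [`|n%:R/_|]ger0_norm; last by rewrite divr_ge0 ?(ltW ar).
 apply: (@le_trans _ _ (n%:R*(z t^+2*((`|u j| + `|u' j'|)*(K5*ell R n/n%:R))))).
  have q1 : 0 <= n%:R/a%:R :> R by rewrite divr_ge0 ?(ltW ar).
  have q2 : 0 <= z t^+2 * `|logmod ka (u' j') - logmod ka (u j)|.
   by rewrite mulr_ge0 ?sqr_ge0.
  by apply: ler_pM q1 q2 na _; rewrite ler_wpM2l ?sqr_ge0.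
 have -> : n%:R*(z t^+2*((`|u j| + `|u' j'|)*(K5*ell R n/n%:R))) =
  K5*ell R n*(z t^+2 * `|u j| + z t^+2 * `|u' j'|) by field; posnz.
 rewrite ler_pM2l; last by rewrite mulr_gt0.
 by rewrite lerD2l [D*_]mulrA ler_wpM2r.
have RM : (M <= a*M <= I')%N by rewrite MaM (leq_trans aMaI aII).
have RI : (M <= a*I <= I')%N by rewrite aII (leq_trans MaM aMaI).
have [uM1 _ _ _ _] := HN1 M (leqnn M) (R1 M ltac:(by rewrite leqnn)).
have [uI1 _ _ _ _] := HN1 I MI (R1 I ltac:(by rewrite leqnn MI)).
have [uM2 _ _ _ _] := HN2 (a*M)%N MaM (R2 _ RM).
have [uI2 _ _ _ _] := HN2 (a*I)%N (leq_trans MaM aMaI) (R2 _ RI).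
have B1 := sum_abs_bound ka0 n0 MI uM1 uI1.
have B2 := sum_abs_bound ka0 an0 aMaI uM2 uI2.
have sq0 : 0 < Num.sqrt n%:R :> R by rewrite sqrtr_gt0.
have sqa : (Num.sqrt (a*n)%:R)^-1 <= (Num.sqrt n%:R)^-1 :> R.
 by rewrite lef_pV2 ?posrE ?sqrtr_gt0 // ler_sqrt ?ler_nat ?leq_pmull // ltW.
have sqn : n%:R^-1 <= (Num.sqrt n%:R)^-1 :> R.
 rewrite lef_pV2 ?posrE // -[X in _ <= X]sqr_sqrtr ?(ltW nr) // expr2.
 have s1 : 1 <= Num.sqrt n%:R :> R by have := ler_wsqrtr nr1; rewrite sqrtr1.
 by rewrite ler_peMr // ltW.
rewrite big_nat_block // in B2.
have E1 := edge M (a*M)%N (leqnn _) MaM (leq_trans aMaI aII).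
have E2 := edge (a*I)%N I' (leq_trans MaM aMaI) aII (leqnn _).
have gE : (a*n)%:R*gatesum ka (a*n) M I' - n%:R*gatesum ka n M I =
 (a*n)%:R * \sum_(M <= j < a*M) z (a*n+j)^+2 * logmod ka (u' j) +
 (a*n)%:R * \sum_(a*I <= j < I') z (a*n+j)^+2 * logmod ka (u' j) +
 \sum_(M <= j < I) \sum_(i < a)
  ((a*n)%:R*(z (a*n + (a*j+i))^+2 * logmod ka (u' (a*j+i)%N)) -
  n%:R/a%:R*(z (n+j)^+2 * logmod ka (u j))).
 rewrite {1}/gatesum (big_cat_nat _ (n := (a*M)%N)) ?(leq_trans aMaI) //=.
 rewrite (big_cat_nat _ (n := (a*I)%N) (m := (a*M)%N)) //=.
 rewrite big_nat_block //.
 have -> : \sum_(M <= j < I) \sum_(i < a)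
  ((a*n)%:R*(z (a*n + (a*j+i))^+2 * logmod ka (u' (a*j+i)%N)) -
  n%:R/a%:R*(z (n+j)^+2 * logmod ka (u j))) =
  (a*n)%:R*(\sum_(M <= j < I) \sum_(i < a)
   z (a*n + (a*j+i))^+2 * logmod ka (u' (a*j+i)%N)) - n%:R*gatesum ka n M I.
  rewrite /gatesum !mulr_sumr -sumrB; apply: eq_bigr => j _.
  rewrite sumrB sumr_const card_ord mulr_sumr; congr (_-_).
  by rewrite -mulr_natl; field; posnz.
 by ring.
rewrite gE; apply: le_trans (ler_normD _ _) _.
have S : `|\sum_(M <= j < I) \sum_(i < a)
  ((a*n)%:R*(z (a*n + (a*j+i))^+2 * logmod ka (u' (a*j+i)%N)) -
  n%:R/a%:R*(z (n+j)^+2 * logmod ka (u j)))| <=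
  (I*a)%:R*(2*K4*(K*L)*ell R n^+2/(a*n)%:R^+2) +
  K5*ell R n*(a%:R*((1+K)/Num.sqrt n%:R) + D*((1+K)/Num.sqrt (a*n)%:R)).
 apply: le_trans (ler_norm_sum _ _ _) _.
 apply: (@le_trans _ _ (\sum_(M <= j < I) \sum_(i < a)
  (2*K4*(K*L)*ell R n^+2/(a*n)%:R^+2 +
  K5*ell R n*(z (n+j)^+2 * `|u j| +
  D*(z (a*n + (a*j+i))^+2 * `|u' (a*j+i)%N|))))).
  rewrite !big_seq; apply: ler_sum => j; rewrite mem_index_iota => hj.
  by apply: le_trans (ler_norm_sum _ _ _) _; apply: ler_sum => i _; apply: term.
 under eq_bigr do rewrite big_split /= sumr_const card_ord -mulr_sumr big_split /= sumr_const card_ord -mulr_sumr.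
 rewrite big_split /= sumr_const_nat -mulrnA -mulr_sumr big_split /= -mulr_sumr.
 apply: lerD.
  rewrite -[leLHS]mulr_natl ler_wpM2r //.
   rewrite mulr_ge0 ?invr_ge0 ?sqr_ge0 // mulr_ge0 ?sqr_ge0 // mulr_ge0 //.
   by rewrite mulr_ge0 // ltW.
  by rewrite ler_nat mulnC leq_mul2r leq_subr orbT.
 rewrite ler_pM2l; last by rewrite mulr_gt0.
 apply: lerD; last by rewrite ler_wpM2l.
 by under eq_bigr do rewrite -mulr_natl; rewrite -mulr_sumr ler_pM2l.
have S1 : (I*a)%:R*(2*K4*(K*L)*ell R n^+2/(a*n)%:R^+2) <=
  2*K4*(K*L)*ell R n^+2/Num.sqrt n%:R.
 have Ia : (I*a)%:R <= a%:R*(a*n)%:R :> R.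
  rewrite -natrM ler_nat mulnC leq_mul2l -IE addnAC addnC.
  by rewrite leq_addr orbT.
 set P := 2*K4*(K*L)*ell R n^+2.
 have P0 : 0 <= P.
  by rewrite /P mulr_ge0 ?sqr_ge0 // mulr_ge0 // mulr_ge0 // ltW.
 apply: (@le_trans _ _ (a%:R*(a*n)%:R*(P/(a*n)%:R^+2))).
  by rewrite ler_wpM2r // divr_ge0 // sqr_ge0.
 have -> : a%:R*(a*n)%:R*(P/(a*n)%:R^+2) = P/n%:R.
  by rewrite natrM; field; posnz.
 by rewrite ler_wpM2l.
have S2 : K5*ell R n*(a%:R*((1+K)/Num.sqrt n%:R) + D*((1+K)/Num.sqrt (a*n)%:R))
 <= K5*(a%:R*(1+K) + D*(1+K))*ell R n^+2/Num.sqrt n%:R.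
 have -> : K5*(a%:R*(1+K) + D*(1+K))*ell R n^+2/Num.sqrt n%:R =
  K5*ell R n*(ell R n*(a%:R*((1+K)/Num.sqrt n%:R) + D*((1+K)/Num.sqrt n%:R))).
  by ring.
 rewrite ler_pM2l; last by rewrite mulr_gt0.
 have p1 : 0 <= 1 + K by clear -K0; lra.
 have p2 : 0 <= (Num.sqrt n%:R)^-1 :> R by rewrite invr_ge0 ltW.
 apply: (@le_trans _ _ (a%:R*((1+K)/Num.sqrt n%:R) + D*((1+K)/Num.sqrt n%:R))).
  by rewrite lerD2l ler_wpM2l // ler_wpM2l.
 rewrite ler_peMl // addr_ge0 // mulr_ge0 ?(ltW ar) // mulr_ge0 //.
have S3 : (a*M-M)%:R*(K*L)*ell R n/n%:R + (I'-a*I)%:R*(K*L)*ell R n/n%:R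
 <= (a%:R*M%:R + a%:R*(c*M)%:R)*(K*L)*ell R n^+2/Num.sqrt n%:R.
 have q1 : (a*M-M)%:R <= a%:R*M%:R :> R by rewrite -natrM ler_nat leq_subr.
 have q2 : (I'-a*I)%:R <= a%:R*(c*M)%:R :> R.
  by rewrite -natrM ler_nat; move: IE' aIE; clia.
 rewrite -!mulrDl.
 apply: ler_pM => //; rewrite ?invr_ge0 ?(ltW nr) //.
  by rewrite mulr_ge0 ?(ltW l0) // mulr_ge0 // addr_ge0.
 apply: ler_pM; first by rewrite mulr_ge0 // addr_ge0.
 - exact: ltW.
 - by rewrite ler_wpM2r // lerD.
 by rewrite expr2 ler_peMl // ltW.
apply: le_trans (lerD (ler_normD _ _) S) _.
have -> : Kf*ell R n^+2/Num.sqrt n%:R =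
 2*K4*(K*L)*ell R n^+2/Num.sqrt n%:R +
 K5*(a%:R*(1+K) + D*(1+K))*ell R n^+2/Num.sqrt n%:R +
 (a%:R*M%:R + a%:R*(c*M)%:R)*(K*L)*ell R n^+2/Num.sqrt n%:R.
 by rewrite /Kf; ring.
by move: E1 E2 S1 S2 S3; clra.
Qed.
End GateSum.

Section GateExit.
Variable R : realType.
Implicit Types (a M c : nat) (ka : R).
Local Notation X := (refX R).
Local Notation z := (refz R).

(* [1/ell] telescopes along powers of [a] and dominates [ell^2/sqrt n]. *)
Lemma gatesum_lim a ka M c : (1 < a)%N -> 0 < ka -> pi/ka = ln a%:R ->
 (20 <= M)%N -> in_gate a ka M c ->
 exists S : R, forall e : R, 0 < e -> exists K, forall k, (K <= k)%N ->
  `|(a^k)%:R*gatesum ka (a^k) M (gatelen a M c (a^k)) - S| <= e.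
Proof.
move=> a1 ka0 pik M20 G.
have [K K0 [N _ HN]] := gatesum_diff a1 ka0 pik M20 G.
have [N8 N80 H8] := ell_pow_small 8 (1 : R) (ltr01 : 0 < (1 : R)).
have la0 : 0 < ln a%:R :> R by apply: ln_gt0; rewrite ltr1n.
have a0 : (0 < a)%N by apply: ltnW.
pose D n := n%:R*gatesum ka n M (gatelen a M c n).
pose L : R := 1 + ln a%:R; have L0 : 0 < L by rewrite /L; clear -la0; lra.
(* Chosen so that [K'/ell n - K'/ell (a*n)] equals [K*L/(ell n*ell (a*n))]. *)
pose K' := K*L/ln a%:R.
have K'0 : 0 < K' by rewrite divr_gt0 ?mulr_gt0.
have step n : (N <= n)%N -> (N8 <= n)%N ->
  `|D (a*n)%N - D n| <= K'/ell R n - K'/ell R (a*n).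
 move=> Nn N8n; apply: le_trans (HN n Nn) _.
 have n0 : (0 < n)%N by apply: leq_trans N8n.
 have nr := natr_gt0 R n0.
 have l0 := ell_gt0 R n; have l1 := ell_ge1 R n.
 have s0 : 0 < Num.sqrt n%:R :> R by rewrite sqrtr_gt0.
 have h8 := H8 n N8n; rewrite mul1r ler_pdivrMr // mul1r in h8.
 (* Two powers of [ell] serve the error, the other two the denominators of the telescoping
    difference. *)
 have h4 : ell R n^+4 <= Num.sqrt n%:R.
  rewrite -(ler_pXn2r (n := 2)) ?nnegrE ?exprn_ge0 ?(ltW l0) ?(ltW s0) //.
  by rewrite -exprM sqr_sqrtr // ltW.
 have eE : ell R (a*n) = ell R n + ln a%:R by rewrite ell_mul.
 have e2 : ell R (a*n) <= L*ell R n.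
  by rewrite eE /L; clear -la0 l1; nra.
 have -> : K'/ell R n - K'/ell R (a*n) = K*L/(ell R n*ell R (a*n)).
  rewrite /K' eE; field.
  by do ?[apply/andP; split]; rewrite gt_eqF //; clear -la0 l0; lra.
 have ea0 := ell_gt0 R (a*n).
 rewrite ler_pdivlMr ?mulr_gt0 // mulrAC ler_pdivrMr //.
 rewrite -!mulrA ler_pM2l // mulrA.
 apply: (@le_trans _ _ (ell R n^+3*(L*ell R n))).
  have -> : ell R n*ell R n*(ell R n*ell R (a*n)) = ell R n^+3*ell R (a*n).
   by ring.
  by rewrite ler_pM2l ?exprn_gt0.
 have -> : ell R n^+3*(L*ell R n) = L*ell R n^+4 by ring.
 by rewrite ler_pM2l.
pose K0' := (N+N8)%N.
have big k : (K0' <= k)%N -> (N <= a^k)%N /\ (N8 <= a^k)%N.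
 move=> kk; have kak : (k <= a^k)%N by apply: ltnW; apply: ltn_expl.
 have := leq_trans kk kak; rewrite /K0'; clia.
have tele k d : (K0' <= k)%N ->
  `|D (a^(k+d))%N - D (a^k)%N| <= K'/ell R (a^k) - K'/ell R (a^(k+d)).
 move=> kk; elim: d => [|d IH]; first by rewrite addn0 !subrr normr0.
 have [h1 h2] := big (k+d)%N (leq_trans kk (leq_addr _ _)).
 have := step _ h1 h2; rewrite addnS expnS.
 move: IH; rewrite !ler_norml; clear=> /andP[? ?] /andP[? ?].
 by apply/andP; split; lra.
have ek k : (k <= a^k)%N by apply: ltnW; apply: ltn_expl.
have [|S HS] := @real_cauchy_lim R (fun k => D (a^k)%N).
 move=> e e0; have [N1 N10 HN1] := inv_ell_small K' e0.
 have tl k d : (K0' + N1 <= k)%N -> `|D (a^(k+d))%N - D (a^k)%N| <= e.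
  move=> kk; apply: le_trans (tele k d _) _.
   exact: leqDl kk.
  have h := HN1 (a^k)%N _.
  apply: le_trans (h _); last first.
   by apply: leq_trans (ek k); exact: leqDr kk.
  by rewrite gerBl divr_ge0 ?(ltW K'0) // ltW // ell_gt0.
 exists (K0'+N1)%N => m n hm hn.
 by case/orP: (leq_total m n) => /subnKC <-; [rewrite distrC|]; apply: tl.
by exists S.
Qed.

Lemma refX_ratio_cvg : X t/t%:R @[t --> \oo] --> (1 : R).
Proof.
have [C C0 HC] := refX_asymp R.
apply/cvgrPdist_le => e e0.
have [N N0 HN] := ell_pow_small 1 (C+1) e0.
exists N => // t /= Nt; have t0 : (0 < t)%N by apply: leq_trans Nt.
have tr := natr_gt0 R t0.
apply: le_trans (HN t Nt).
have -> : 1 - X t/t%:R = - ((X t - t%:R)/t%:R) by field; posnz.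
rewrite normrN normrM normfV (gtr0_norm tr) ler_pM2r ?invr_gt0 // expr1.
apply: le_trans (HC t t0) _; rewrite /ell.
have : 0 <= ln t%:R :> R by apply: ln_ge0; rewrite ler1n.
by clear -C0; nra.
Qed.

Lemma ratio_cvg (p q r : nat) :
 (p*n+q)%:R/(n+r)%:R @[n --> \oo] --> (p%:R : R).
Proof.
apply/cvgrPdist_le => e e0.
have [N N0 HN] := inv_small (p%:R*r%:R+q%:R) e0.
exists N => // n /= Nn; have n0 : (0 < n)%N by apply: leq_trans Nn.
have nr := natr_gt0 R n0.
have nrr : 0 < (n+r)%:R :> R by rewrite ltr0n addn_gt0 n0.
have -> : p%:R - (p*n+q)%:R/(n+r)%:R = (p%:R*r%:R-q%:R)/(n+r)%:R :> R.
 rewrite [(p*n+q)%:R]natrD natrM; move: nrr; rewrite natrD => nrr; field; posnz.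
rewrite normrM normfV (gtr0_norm nrr); apply: le_trans (HN n Nn).
apply: ler_pM => //.
 apply: le_trans (ler_normB _ _) _.
 by rewrite !ger0_norm // mulr_ge0.
by rewrite lef_pV2 ?posrE // ler_nat leq_addr.
Qed.

End GateExit.

(** * Second-order formula for the exit position *)

Section ExitFormula.
Variable R : realType.
Implicit Types (a M c : nat) (ka : R).
Local Notation X := (refX R).
Local Notation z := (refz R).

Lemma near_cvg_le (u : nat -> R) (l e : R) : 0 < e -> u n @[n --> \oo] --> l ->
 \forall n \near \oo, `|u n - l| <= e.
Proof. by move=> e0 ul; have /cvgrPdistC_le/(_ e e0) := ul. Qed.

Lemma cvg_near_le (u : nat -> R) (l : R) :
 (forall e, 0 < e -> \forall n \near \oo, `|u n - l| <= e) -> u n @[n --> \oo] --> l.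
Proof. by move=> H; apply/cvgrPdistC_le. Qed.

Lemma ln1D_cvg (b : R) (t : nat -> nat) : (forall n, (n <= t n)%N) ->
 (t n)%:R * ln (1 + b/(t n)%:R) @[n --> \oo] --> b.
Proof.
move=> ht; apply: cvg_near_le => e e0.
have [N N0 HN] := inv_small (2*b^+2) e0.
have [N1 N10 HN1] := inv_small `|b| (ltac:(lra) : 0 < 1/2 :> R).
exists (N+N1)%N => // n /= Nn.
have h1 := HN (t n) (leq_trans (leqDl Nn) (ht n)).
have h2 := HN1 (t n) (leq_trans (leqDr Nn) (ht n)).
have t0 : (0 < t n)%N.
 by apply: leq_trans (ht n); apply: leq_trans Nn; apply: leq_trans N0 (leq_addr _ _).
have tr : 0 < (t n)%:R :> R by rewrite ltr0n.
have h3 : `|b/(t n)%:R| <= 1/2 by rewrite normrM normfV (gtr0_norm tr).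
have h4 : - (1/2) <= b/(t n)%:R by move: h3; rewrite ler_norml => /andP[].
have := ln1D_bound h4 => h5.
have -> : (t n)%:R * ln (1 + b/(t n)%:R) - b =
 (t n)%:R*(ln (1 + b/(t n)%:R) - b/(t n)%:R) by field; posnz.
rewrite normrM (gtr0_norm tr); apply: le_trans h1.
have -> : 2*b^+2/(t n)%:R = (t n)%:R*(2*(b/(t n)%:R)^+2).
 by field; posnz.
by rewrite ler_pM2l.
Qed.

Lemma cvg_shift (t : nat -> nat) (u : nat -> R) (l : R) N :
 (forall n, (n <= t n + N)%N) -> u n @[n --> \oo] --> l -> u (t n) @[n --> \oo] --> l.
Proof.
move=> ht ul; apply: cvg_near_le => e e0.
have [N1 _ HN] := near_cvg_le e0 ul.
exists (N1+N)%N => // n /= Nn; apply: HN; rewrite /=.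
by have := leq_trans Nn (ht n); rewrite leq_add2r.
Qed.

Lemma cvg_near_eq (u v : nat -> R) (l : R) : (\forall n \near \oo, v n = u n) ->
 v n @[n --> \oo] --> l -> u n @[n --> \oo] --> l.
Proof.
move=> h vl; apply: cvg_near_le => e e0; near=> n.
have <- : v n = u n by near: n.
by near: n; exact: near_cvg_le.
Unshelve. all: by end_near. Qed.

(** The available angle [ln a] against the time-dependent ends of [slow], in the scale of the exit
    coordinate. The bracket is [O(1/n)], so the limit needs the coefficient of [1/t] in [Lam]. *)
Definition gatemain a M c (n : nat) : R :=
 X (a*n-c*M)*(ln a%:R + Lam R (n+M) - Lam R (a*n-c*M)).

Lemma gatemain_cvg a M c (c0 : R) : (1 < a)%N -> psi_lim_spec c0 ->
 [/\ gatemain a M c n @[n --> \oo] --> (c*M)%:R + a%:R*M%:R + (a%:R-1)*c0,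
  X (a*n-c*M)/X (n+M) @[n --> \oo] --> (a%:R : R) &
  X (a*n-c*M)/(a*n)%:R @[n --> \oo] --> (1 : R)].
Proof.
move=> a1 Hc.
have ar := a_gt0 R a1.
pose t n := (a*n-c*M)%N.
have tn n : (n <= t n + c*M)%N.
 have : (n <= a*n)%N by rewrite leq_pmull // ltnW.
 by rewrite /t; clia.
have r1 : X (t n)/(t n)%:R @[n --> \oo] --> (1 : R).
 apply: (@cvg_shift t (fun n => X n/n%:R) 1 _ tn); exact: refX_ratio_cvg.
have tM n : (n <= n + M + 0)%N by rewrite addn0 leq_addr.
have r2 : X (n+M)/(n+M)%:R @[n --> \oo] --> (1 : R).
 apply: (@cvg_shift (fun n => n + M)%N (fun n => X n/n%:R) 1 _ tM).
 exact: refX_ratio_cvg.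
have ld : lamdev R n @[n --> \oo] --> c0 by apply: cvg_near_le; exact: lamdev_lim.
have r3 : lamdev R (t n) @[n --> \oo] --> c0 by exact: (cvg_shift tn ld).
have r4 : lamdev R (n+M) @[n --> \oo] --> c0.
 exact: (@cvg_shift (fun n => n + M)%N _ _ _ tM ld).
have r5 : (t n)%:R/(n+M)%:R @[n --> \oo] --> (a%:R : R).
 apply: (@cvg_near_eq _ (fun n => (a*n+0)%:R/(n+M)%:R - (0*n+c*M)%:R/(n+M)%:R)).
  exists (c*M)%N => // n /= hn; rewrite mul0n add0n addn0 -mulrBl -natrB //.
  by apply: leq_trans hn _; rewrite leq_pmull // ltnW.
 rewrite -[X in _ --> X]subr0; apply: cvgB; exact: ratio_cvg.
have r6 : (t n)%:R * ln (1 + ((c*M)%:R + a%:R*M%:R)/(t n)%:R) @[n --> \oo] -->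
  ((c*M)%:R + a%:R*M%:R : R).
 have h := @ln1D_cvg ((c*M)%:R + a%:R*M%:R) id (fun n => leqnn n).
 exact: (cvg_shift tn h).
have r7 : (t n)%:R/(a*n)%:R @[n --> \oo] --> (1 : R).
 have ia : a%:R^-1*(a%:R-0) = 1 :> R by rewrite subr0 mulVf // gt_eqF.
 apply: (@cvg_near_eq _ (fun n => a%:R^-1 *
   ((a*n+0)%:R/(n+0)%:R - (0*n+c*M)%:R/(n+0)%:R))).
  exists (c*M).+1%N => // n /= hn; rewrite mul0n add0n !addn0 -mulrBl -natrB //; last first.
   by apply: leq_trans (ltnW hn) _; rewrite leq_pmull // ltnW.
  have nr : 0 < n%:R :> R by rewrite ltr0n (leq_ltn_trans _ hn).
  by rewrite natrM -/(t n); field; posnz.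
 rewrite -[X in _ --> X]ia; apply: cvgM; first exact: cvg_cst.
 by apply: cvgB; exact: ratio_cvg.
have big n : (c*M < n)%N -> (0 < t n)%N.
 move=> hn; have : (n <= a*n)%N by rewrite leq_pmull // ltnW.
 by rewrite /t; move: hn; clia.
split.
- have -> : (c*M)%:R + a%:R*M%:R + (a%:R-1)*c0 =
  1*((c*M)%:R + a%:R*M%:R) + 1*a%:R*c0 - 1*c0 by ring.
 apply: (@cvg_near_eq _ (fun n =>
   X (t n)/(t n)%:R*((t n)%:R * ln (1 + ((c*M)%:R + a%:R*M%:R)/(t n)%:R)) +
   X (t n)/(t n)%:R*((t n)%:R/(n+M)%:R) * lamdev R (n+M) -
   X (t n)/(t n)%:R * lamdev R (t n))); last first.
  apply: cvgB; last exact: cvgM.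
  by apply: cvgD; apply: cvgM => //; apply: cvgM.
 exists (c*M).+1%N => // n /= hn; have t0 := big n hn.
 have n0 : (0 < n)%N by apply: leq_ltn_trans hn.
 have tr : 0 < (t n)%:R :> R by rewrite ltr0n.
 have nM : (0 < n + M)%N by rewrite addn_gt0 n0.
 have nr : 0 < (n+M)%:R :> R by rewrite ltr0n.
 rewrite /gatemain -/(t n) (Lam_dev R t0) (Lam_dev R nM).
 have e : 1 + ((c*M)%:R + a%:R*M%:R)/(t n)%:R = a%:R*(n+M)%:R/(t n)%:R :> R.
  have : (t n + c*M = a*n)%N.
   have : (n <= a*n)%N by rewrite leq_pmull // ltnW.
   by rewrite /t; move: hn; clia.
  move=> /(congr1 (fun x => x%:R : R)); rewrite !natrD !natrM => e.
  apply: (mulIf (lt0r_neq0 tr)); rewrite divfK ?gt_eqF // mulrDl divfK ?gt_eqF //.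
  by rewrite mul1r ?natrM ?natrD mulrDr; move: e; rewrite ?natrM; clra.
 rewrite e ln_div ?posrE ?mulr_gt0 // lnM ?posrE //.
 by field; posnz.
- apply: (@cvg_near_eq _ (fun n =>
   X (t n)/(t n)%:R*((t n)%:R/(n+M)%:R)*(X (n+M)/(n+M)%:R)^-1)); last first.
  have -> : a%:R = 1*a%:R*1^-1 :> R by rewrite mul1r invr1 mulr1.
  by apply: cvgM; [exact: cvgM|apply: cvgV].
 exists (c*M).+1%N => // n /= hn; have t0 := big n hn.
 have tr : 0 < (t n)%:R :> R by rewrite ltr0n.
 have nr : 0 < (n+M)%:R :> R by rewrite ltr0n addn_gt0 (leq_ltn_trans _ hn).
 have Xr := refX_gt0 R (n+M).
 by rewrite -/(t n); field; posnz.
- apply: (@cvg_near_eq _ (fun n =>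
   X (t n)/(t n)%:R*((t n)%:R/(a*n)%:R))); last first.
  by rewrite -[X in _ --> X]mulr1; apply: cvgM.
 exists (c*M).+1%N => // n /= hn; have t0 := big n hn.
 have tr : 0 < (t n)%:R :> R by rewrite ltr0n.
 have nr : 0 < (a*n)%:R :> R.
  by rewrite ltr0n muln_gt0 (ltnW a1) (leq_ltn_trans _ hn).
 by rewrite -/(t n) mulrA divfK // gt_eqF.
Qed.

Lemma atan_small_inv (y : R) : 0 <= y -> atan y <= 3/8 -> y <= 4/3*atan y.
Proof.
move=> y0 h.
have y2 : y <= 1/2.
 rewrite leNgt; apply/negP => hy.
 have := lt_atan hy; have := @atan_ge_cubic R (1/2) ltac:(lra).
 by clear -h; lra.
have := atan_ge_cubic y0; clear -y0 y2; nra.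
Qed.


(** The balance of [slow] between entrance and exit, multiplied by [X] at the exit, is an equation
    for [x + ln x] with [x = 1/v]. As [n] grows two errors of order [1/M] remain: the telescoped
    one, through [|u| <= X/M], and that of [psi] at [M]. *)
Lemma exit_formula a ka c (c0 : R) : (1 < a)%N -> 0 < ka -> pi/ka = ln a%:R ->
 psi_lim_spec c0 -> exists C7 : R, forall M, (20 <= M)%N -> in_gate a ka M c ->
 \forall n \near \oo,
  let v := vs ka n (gatelen a M c n) in
  0 < v /\ `|v^-1 + ln v^-1 - ((c*M)%:R - c0 + (1-a%:R)/2
   + a%:R*(n%:R*gatesum ka n M (gatelen a M c n)))| <= C7/M%:R.
Proof.
move=> a1 ka0 pik Hc; have [C C1 HC] := refX_lin R; have [Ca Ca0 HCa] := refX_asymp R.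
have ar := a_gt0 R a1; have ar1 : 1 <= a%:R :> R by rewrite ler1n ltnW.
have aN0 : (0 < a)%N by apply: ltnW.
have sc0 := slowconst_gt0 ka0.
exists (2*slowconst ka*(C*a%:R)^+2 + 2*a%:R + 2) => M M20 G.
have M0 : (0 < M)%N by apply: leq_trans M20.
have Mr : 20 <= M%:R :> R by rewrite (ler_nat R 20).
have [K K0 HK] := gate_core a1 ka0 pik M20 G.
have la0 : 0 < ln a%:R :> R by apply: ln_gt0; rewrite ltr1n.
have [m1 m2 m3] := gatemain_cvg M c a1 Hc.
pose T n := X (a*n-c*M); pose E n := X (n+M).
pose W n := went ka n M.
have Wc : W n @[n --> \oo] --> X M by exact: went_cvg.
have lWc : ln (W n) @[n --> \oo] --> ln (X M).
 exact: (continuous_cvg _ (continuous_ln (refX_gt0 R M)) Wc).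
pose main n := gatemain a M c n - T n/E n*(W n - ln (W n)) + 1/2*(1 - T n/E n).
have mc : main n @[n --> \oo] --> (c*M)%:R + a%:R*M%:R + (a%:R-1)*c0
  - a%:R*(X M - ln (X M)) + 1/2*(1-a%:R).
 apply: cvgD; first apply: cvgB => //.
  by apply: cvgM => //; apply: cvgB.
 by apply: cvgM; [exact: cvg_cst|apply: cvgB; [exact: cvg_cst|]].
pose Ci := 1 + C + C*a%:R.
pose B1 := K + (Ca + C*(c*M)%:R + a%:R*Ca + 1 + ln a%:R + a%:R + (c*M)%:R) + 1.
pose B2 := ka^+2*(2*B1)^+3 + ka^+2*(2*C*M%:R)^+3 + ka^+2*(2*B1)^+2
  + ka^+2*(2*C*M%:R)^+2.
have e1 : 0 < 1/(4*M%:R) :> R by rewrite divr_gt0 // mulr_gt0 //; clear -Mr; lra.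
have m1' : 0 < 1/4/M%:R :> R by rewrite !divr_gt0 //; clear -Mr; lra.
have k8 : 0 < Num.min (3/8) (pi/4)/ka.
 rewrite divr_gt0 // lt_min divr_gt0 // divr_gt0 ?pi_gt0 //.
near=> n.
have n0 : (0 < n)%N by near: n; exact: nbhs_infty_gt.
have nbig : (c*M + M < n)%N by near: n; exact: nbhs_infty_gt.
have nr := natr_gt0 R n0.
have nr1 : 1 <= n%:R :> R by rewrite ler1n.
have l1 := ell_ge1 R n; have l0 := ell_gt0 R n.
have G1 : forall i, (M <= i)%N -> (n + i + c*M <= a*n)%N -> `|vs ka n i| <= M%:R^-1.
 by near: n.
have HKn : gate_est a ka M c K n by near: n.
have [v0 w0 wX] : [/\ vs ka n M < 0, 0 < went ka n M & `|went ka n M - X M| <= 1].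
 by near: n; exact: went_near.
have S1 : B1*ell R n^+1/n%:R <= Num.min (3/8) (pi/4)/ka.
 by near: n; exact: near_le_small.
have S2 : (C*a%:R*B2)*ell R n^+3/n%:R <= 1/4/M%:R.
 by near: n; exact: near_le_small.
have S3 : ((Ca + ln a%:R + a%:R + (c*M)%:R)*K)*ell R n^+2/n%:R <= 1/4/M%:R.
 by near: n; exact: near_le_small.
have mn : `|main n - ((c*M)%:R + a%:R*M%:R + (a%:R-1)*c0
  - a%:R*(X M - ln (X M)) + 1/2*(1-a%:R))| <= 1/4/M%:R.
 by near: n; exact: near_cvg_le.
set I := gatelen a M c n.
have twon : (n + n <= a*n)%N by rewrite addnn -mul2n leq_mul2r a1 orbT.
have IE : (n + I + c*M = a*n)%N by move: nbig twon; rewrite /I /gatelen; clia.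
have tE : (a*n - c*M = n + I)%N by rewrite -IE addnK.
have MI : (M <= I)%N by move: nbig twon; rewrite /I /gatelen; clia.
have IEle : (n + I + c*M <= a*n)%N by rewrite IE.
have [uI lI gI SI aI] := HKn I MI IEle.
have GI := G1 I MI IEle.
have T0 := refX_gt0 R (n+I); have E0 := refX_gt0 R (n+M); have Xn0 := refX_gt0 R n.
have nT : n%:R <= X (n+I).
 by apply: le_trans (ltW (refX_gtn R _)); rewrite ler_nat leq_addr.
have nE : n%:R <= X (n+M).
 by apply: le_trans (ltW (refX_gtn R _)); rewrite ler_nat leq_addr.
have TC : X (n+I) <= C*a%:R*n%:R.
 apply: le_trans (HC _ _) _; first by rewrite addn_gt0 n0.
 rewrite -mulrA -natrM ler_wpM2l ?ler_nat //; first by clear -C1; lra.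
 by rewrite -IE leq_addr.
have ET : X (n+M) <= X (n+I) by rewrite refX_le // leq_add2l.
have W1 : M%:R <= went ka n M.
 have := refX_ge R M; move: wX; rewrite ler_norml => /andP[h _] h2.
 by clear -h h2; lra.
have W2 : went ka n M <= 2*C*M%:R.
 have := HC M M0; move: wX; rewrite ler_norml => /andP[_ h] h2.
 by clear -h h2 Mr C1; nra.
have lt : ln (n+I)%:R <= ln n%:R + ln a%:R :> R.
 rewrite addrC -lnM ?posrE // -natrM ler_ln ?posrE ?ltr0n ?muln_gt0 ?aN0 ?addn_gt0 ?n0 //.
 by rewrite ler_nat -IE leq_addr.
have ln0n : 0 <= ln n%:R :> R by apply: ln_ge0.
have elln : ell R n = 1 + ln n%:R by [].
have t0 : (0 < n + I)%N by rewrite addn_gt0 n0.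
have Tt := HCa _ t0; have Xn := HCa _ n0.
have tan : (n+I)%:R + (c*M)%:R = a%:R*n%:R :> R by rewrite -natrD IE natrM.
have cM0 : 0 <= (c*M)%:R :> R by [].
have TaX : `|X (n+I) - a%:R*X n| <= (B1-K)*ell R n.
 have -> : X (n+I) - a%:R*X n = (X (n+I) - (n+I)%:R) - (c*M)%:R - a%:R*(X n - n%:R).
  by clear -tan; rewrite mulrBr -tan; ring.
 apply: le_trans (ler_normB _ _) _; rewrite [X in _ + X <= _]normrM normr_nat.
 have h1 := ler_normB (X (n+I) - (n+I)%:R) (c*M)%:R; rewrite normr_nat in h1.
 have h2 := ler_wpM2l (ltW ar) Xn.
 have q0 : 0 <= C*(c*M)%:R by rewrite mulr_ge0 //; clear -C1; lra.
 have q1 : 0 <= (Ca + C*(c*M)%:R + a%:R*Ca + ln a%:R + (c*M)%:R) * ln n%:R.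
  rewrite mulr_ge0 // !addr_ge0 ?mulr_ge0 ?(ltW ar) ?(ltW Ca0) ?(ltW la0) //.
  by clear -C1; lra.
 rewrite /B1 elln; move: (c*M)%:R cM0 h1 q0 q1 => m m0 h1 q0 q1.
 by clear -h1 h2 lt Tt q0 q1 ln0n ar1 m0; lra.
set u := us ka n I in uI lI SI aI *.
set th := pi/(2*ka) - angle ka u.
have thb : th <= B1*ell R n/n%:R.
 have aX : n%:R <= a%:R*X n.
  apply: le_trans (ltW (refX_gtn R n)) _; rewrite ler_peMl // ltW //.
 have := ln_diff_bound nr nT aX; rewrite lnM ?posrE // => h.
 have {}h : `|ln (X (n+I)) - (ln a%:R + ln (X n))| <= (B1-K)*ell R n/n%:R.
  by apply: le_trans h _; rewrite ler_pM2r ?invr_gt0.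
 have D : ln a%:R = pi/(2*ka) + pi/(2*ka) by rewrite -pik; field; posnz.
 have e : B1*ell R n/n%:R = (B1-K)*ell R n/n%:R + K*ell R n/n%:R by ring.
 move: h aI; rewrite !ler_norml => /andP[h1 _] /andP[h2 _].
 by rewrite e /th; clear -h1 h2 D; lra.
rewrite expr1 in S1.
have thm : th <= Num.min (3/8) (pi/4)/ka by exact: le_trans S1.
have u0 : 0 < u.
 rewrite ltNge; apply/negP => hu.
 have : angle ka u <= 0.
  rewrite /angle pmulr_lle0 ?invr_gt0 // -(@atan0 R) le_atan //.
  by rewrite pmulr_lle0 ?invr_gt0.
 have : Num.min (3/8) (pi/4)/ka <= pi/4/ka by rewrite ler_pM2r ?invr_gt0 // ge_min lexx orbT.
 have p0 : 0 < pi/4/ka by rewrite !divr_gt0 ?pi_gt0.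
 have e : pi/(2*ka) = pi/4/ka + pi/4/ka by field; posnz.
 by move: thm; rewrite /th e; clear -p0; lra.
set h := u^-1; have h0 : 0 < h by rewrite invr_gt0.
have thE : th = atan (ka*h)/ka by rewrite /th angle_compl.
have hth : h <= 2*th.
 have kh : 0 <= ka*h by rewrite mulr_ge0 // ltW.
 have : atan (ka*h) <= 3/8.
  move: thm; rewrite thE ler_pM2r ?invr_gt0 // => q; apply: le_trans q _.
  by rewrite ge_min lexx.
 move=> /(atan_small_inv kh) q; have at0 := atan_ge0 kh.
 have : ka*h <= ka*(2*th).
  have -> : ka*(2*th) = 2*atan (ka*h) by rewrite thE; field; posnz.
  by clear -q at0; lra.
 by rewrite ler_pM2l.
have hb : h <= 2*B1*ell R n/n%:R by clear -hth thb; lra.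
have r1 : `|th - h| <= ka^+2*h^+3 by rewrite thE; exact: (atan_div_bound ka0 (ltW h0)).
have uE := us_ent v0; set w := went ka n M in w0 wX W1 W2 uE.
set g := w/X (n+M); have g0 : 0 < g by rewrite divr_gt0.
have gb : g <= 2*C*M%:R/n%:R.
 have iX0 : 0 <= (X (n+M))^-1 by rewrite invr_ge0 ltW.
 by apply: ler_pM (ltW w0) iX0 W2 _; rewrite lef_pV2.
have gV : (X (n+M)/w)^-1 = g by rewrite invf_div.
have q0 : 0 < X (n+M)/w by rewrite divr_gt0.
have AME := angle_compl ka0 q0; rewrite gV in AME.
have r2 := atan_div_bound ka0 (ltW g0); rewrite -AME in r2.
set x := (vs ka n I)^-1.
have vI0 : 0 < vs ka n I by rewrite vsE mulr_gt0 // refz_gt0.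
have x0 : 0 < x by rewrite invr_gt0.
have xE : x = X (n+I)*h.
 by rewrite /x /h vsE refzE invfM invrK.
have uX : u = X (n+I)/x by rewrite /x invrK mulrC.
have lnu : ln u = ln (X (n+I)) - ln x by rewrite uX ln_div ?posrE.
have lt1 := logmod_ge_ln ka0 u0; have lt2 := logmod_le_ln ka u0.
have lM1 := logmod_ge_ln ka0 q0; have lM2 := logmod_le_ln ka q0.
have lnq : ln (X (n+M)/w) = ln (X (n+M)) - ln w by rewrite ln_div ?posrE.
rewrite lnu in lt1 lt2; rewrite lnq in lM1 lM2.
have uh : ka^+2/(2*u^+2) <= ka^+2*h^+2.
 rewrite /h; have -> : ka^+2/(2*u^+2) = 1/2*(ka^+2*u^-1^+2) by field; posnz.
 rewrite ler_piMl //; last by clra.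
 by rewrite mulr_ge0 ?sqr_ge0.
have qg : ka^+2/(2*(X (n+M)/w)^+2) <= ka^+2*g^+2.
 rewrite /g; have -> : ka^+2/(2*(X (n+M)/w)^+2) = 1/2*(ka^+2*(w/X (n+M))^+2).
  by field; posnz.
 rewrite ler_piMl //; last by clra.
 by rewrite mulr_ge0 ?sqr_ge0.
have {}lt2 : logmod ka u <= ln (X (n+I)) - ln x + ka^+2*h^+2 by clear -lt2 uh; lra.
have {}lM2 : logmod ka (X (n+M)/w) <= ln (X (n+M)) - ln w + ka^+2*g^+2.
 by clear -lM2 qg; lra.
have TE0 : 0 < X (n+I)/X (n+M) by rewrite divr_gt0.
have TEC : X (n+I)/X (n+M) <= C*a%:R.
 rewrite ler_pdivrMr //; apply: le_trans TC _; rewrite ler_pM2l //.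
 by rewrite mulr_gt0 //; clear -C1; lra.
set err := slow ka (z (n+I)) u - slow ka (z (n+M)) (us ka n M) + gatesum ka n M I in SI.
(* The slow-variable error that survives: at both ends [|u|] is at most [X/M], because the positions
   there are at distance at least [M]. *)
have Terr : X (n+I) * `|err| <= 2*slowconst ka*(C*a%:R)^+2/M%:R.
 have d1 : u - us ka n M <= 2*(X (n+I)/M%:R).
  have Mp := natr_gt0 R M0.
  have a1' : u <= X (n+I)/M%:R.
   rewrite /u /us mulrC ler_pM2l //.
   by move: GI; rewrite ler_norml => /andP[].
  have a2 : - us ka n M <= X (n+I)/M%:R.
   rewrite uE opprK; apply: ler_pM (ltW E0) _ ET _; first by rewrite invr_ge0 ltW.
   by rewrite lef_pV2 ?posrE.
  by clear -a1' a2; lra.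
 have d2 : z (n+M)^+2 <= n%:R^-1^+2.
  rewrite lerXn2r ?nnegrE ?invr_ge0 ?(ltW (refz_gt0 _ _)) //.
  apply: le_trans (refz_ltV R n0); by rewrite refz_le // leq_addr.
 have d0 : 0 <= u - us ka n M by rewrite subr_ge0 us_le.
 have d3 : `|err| <= slowconst ka*(n%:R^-1^+2*(2*(X (n+I)/M%:R))).
  apply: le_trans SI _; rewrite ler_pM2l //; apply: ler_pM => //; exact: sqr_ge0.
 have Mp := natr_gt0 R M0.
 apply: le_trans (ler_wpM2l (ltW T0) d3) _.
 have -> : X (n+I)*(slowconst ka*(n%:R^-1^+2*(2*(X (n+I)/M%:R)))) =
  2*slowconst ka*(X (n+I)/n%:R)^+2/M%:R by field; posnz.
 rewrite ler_pM2r ?invr_gt0 // ler_pM2l ?mulr_gt0 //.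
 rewrite lerXn2r ?nnegrE ?divr_ge0 ?(ltW T0) ?(ltW nr) //.
  by rewrite mulr_ge0 ?(ltW ar) //; clear -C1; lra.
 by rewrite ler_pdivrMr.
have lz (k : nat) : ln (z k) = - ln (X k) by rewrite refzE lnV ?posrE ?refX_gt0.
pose d1 := logmod ka (X (n+M)/w) - (ln (X (n+M)) - ln w).
pose d2 := logmod ka u - (ln (X (n+I)) - ln x).
(* The balance solved for [x]: [pi/ka] splits into the two half angles, and [d1], [d2] are the
   defects of [logmod u] from [ln |u|] at the two ends. *)
have key : x + ln x = main n + X (n+I)*gatesum ka n M I - X (n+I)*err -
  X (n+I)*(th-h) -
  X (n+I)*(pi/(2*ka) - angle ka (X (n+M)/w) - g) + d2 -
  X (n+I)/X (n+M)*d1.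
 rewrite /main /gatemain /T /E /W tE -/w /err /slow uE angleN logmodN !lz !refzE /Lam.
 rewrite xE /d1 /d2 /th /g xE -pik; field; posnz.
have Ca1 : 0 <= C*a%:R by rewrite mulr_ge0 ?(ltW ar) //; clear -C1; lra.
have nn (p q : R) : 0 <= p -> 0 <= q -> forall m, (0 < m)%N ->
  p <= q/n%:R -> p^+m.+1 <= q^+m.+1/n%:R/n%:R.
 move=> p0 q0' m m0 pq.
 have i1 : n%:R^-1 <= 1 :> R by rewrite invf_le1.
 have i0 : 0 <= n%:R^-1 :> R by rewrite invr_ge0 ltW.
 apply: (@le_trans _ _ ((q/n%:R)^+m.+1)).
  by rewrite lerXn2r ?nnegrE // divr_ge0 // ltW.
 rewrite exprMn -mulrA; apply: ler_wpM2l; first exact: exprn_ge0.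
 case: m m0 {pq} => // m _; rewrite 2!exprS mulrA ler_piMr ?mulr_ge0 //.
 exact: exprn_ile1.
have hB : 0 <= 2*B1*ell R n.
 have := le_trans (ltW h0) hb; rewrite pmulr_lge0 ?invr_gt0 //.
have gB : 0 <= 2*C*M%:R by apply: le_trans W2; exact: ltW.
have h3 := nn h _ (ltW h0) hB 2 isT hb; have h2 := nn h _ (ltW h0) hB 1 isT hb.
have g3 := nn g _ (ltW g0) gB 2 isT gb; have g2 := nn g _ (ltW g0) gB 1 isT gb.
have lp k : (k <= 3)%N -> ell R n^+k <= ell R n^+3.
 by move=> k3; rewrite ler_weXn2l.
have k2 := sqr_ge0 ka.
have l30 : 1 <= ell R n^+3 by rewrite exprn_ege1.
pose q1 := ka^+2*(2*B1)^+3; pose q2 := ka^+2*(2*C*M%:R)^+3.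
pose q3 := ka^+2*(2*B1)^+2; pose q4 := ka^+2*(2*C*M%:R)^+2.
have B1p : 0 <= 2*B1 by move: hB; rewrite pmulr_lge0.
have p1 : 0 <= q1 by rewrite /q1 mulr_ge0 // exprn_ge0.
have p2 : 0 <= q2 by rewrite /q2 mulr_ge0 // exprn_ge0.
have p3 : 0 <= q3 by rewrite /q3 mulr_ge0 // exprn_ge0.
have p4 : 0 <= q4 by rewrite /q4 mulr_ge0 // exprn_ge0.
have nn0 : 0 <= n%:R^-1 :> R by rewrite invr_ge0 ltW.
have n1' : n%:R^-1 <= 1 :> R by rewrite invf_le1.
have gen (y b q : R) : 0 <= b -> 0 <= q -> y <= q*ell R n^+3/n%:R/n%:R ->
  b <= C*a%:R*n%:R -> 0 <= y -> b*y <= C*a%:R*q*ell R n^+3/n%:R.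
 move=> b0 q0' yq bC y0.
 have -> : C*a%:R*q*ell R n^+3/n%:R = C*a%:R*n%:R*(q*ell R n^+3/n%:R/n%:R).
  by field; posnz.
 exact: ler_pM.
have s1 : X (n+I) * `|th - h| <= C*a%:R*q1*ell R n^+3/n%:R.
 apply: gen (ltW T0) p1 _ TC (normr_ge0 _); apply: le_trans r1 _.
 have -> : q1*ell R n^+3/n%:R/n%:R = ka^+2*((2*B1*ell R n)^+3/n%:R/n%:R).
  by rewrite /q1; ring.
 exact: ler_wpM2l.
have s2 : X (n+I) * `|pi/(2*ka) - angle ka (X (n+M)/w) - g| <= C*a%:R*q2*ell R n^+3/n%:R.
 apply: gen (ltW T0) p2 _ TC (normr_ge0 _); apply: le_trans r2 _.
 have -> : q2*ell R n^+3/n%:R/n%:R = ka^+2*((2*C*M%:R)^+3/n%:R/n%:R*ell R n^+3).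
  by rewrite /q2; ring.
 apply: ler_wpM2l => //; apply: le_trans g3 _.
 exact: (ler_peMr (mulr_ge0 (mulr_ge0 (exprn_ge0 _ gB) nn0) nn0) l30).
have s3 : 0 <= d2 <= C*a%:R*q3*ell R n^+3/n%:R.
 rewrite /d2 subr_ge0 lt1 /= lerBlDl.
 apply: le_trans lt2 _; rewrite lerD2l -[leLHS]mul1r.
 have y0 : 0 <= ka^+2*h^+2 by rewrite mulr_ge0 ?sqr_ge0.
 apply: gen ler01 p3 _ (le_trans nr1 (le_trans nT TC)) y0.
 have -> : q3*ell R n^+3/n%:R/n%:R =
   ka^+2*((2*B1)^+2/n%:R/n%:R*ell R n^+3) by rewrite /q3; ring.
 apply: ler_wpM2l => //; apply: le_trans h2 _.
 have -> : (2*B1*ell R n)^+2/n%:R/n%:R = (2*B1)^+2/n%:R/n%:R*ell R n^+2 by ring.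
 exact: ler_wpM2l (mulr_ge0 (mulr_ge0 (sqr_ge0 _) nn0) nn0) _ _ (lp 2%N isT).
have s4 : 0 <= X (n+I)/X (n+M)*d1 <= C*a%:R*q4*ell R n^+3/n%:R.
 have d10 : 0 <= d1 by rewrite /d1 subr_ge0.
 rewrite mulr_ge0 ?(ltW TE0) //=.
 apply: gen (ltW TE0) p4 _ _ d10.
  apply: (@le_trans _ _ (ka^+2*g^+2)); first by rewrite /d1 lerBlDl.
  have -> : q4*ell R n^+3/n%:R/n%:R =
    ka^+2*((2*C*M%:R)^+2/n%:R/n%:R*ell R n^+3) by rewrite /q4; ring.
  apply: ler_wpM2l => //; apply: le_trans g2 _.
  exact: (ler_peMr (mulr_ge0 (mulr_ge0 (exprn_ge0 _ gB) nn0) nn0) l30).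
 by apply: le_trans TEC _; rewrite ler_peMr.
have s5 : `|X (n+I)*gatesum ka n M I - a%:R*(n%:R*gatesum ka n M I)| <= 1/4/M%:R.
 apply: le_trans S3; rewrite mulrA -mulrBl normrM.
 have -> : (Ca + ln a%:R + a%:R + (c*M)%:R)*K*ell R n^+2/n%:R =
  (Ca + ln a%:R + a%:R + (c*M)%:R)*ell R n*(K*ell R n/n%:R) by ring.
 apply: ler_pM => //.
 have -> : X (n+I) - a%:R*n%:R = (X (n+I) - (n+I)%:R) - (c*M)%:R.
  by rewrite -tan; ring.
 apply: le_trans (ler_normB _ _) _; rewrite normr_nat.
 have : 0 <= (Ca + ln a%:R + (c*M)%:R) * ln n%:R.
  by rewrite mulr_ge0 // !addr_ge0 ?(ltW Ca0) ?(ltW la0).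
 move: (c*M)%:R => m; rewrite elln.
 by clear -Tt lt ln0n ar1; nra.
have psiM := Hc M M0; rewrite /psi in psiM.
have s6 : a%:R * `|X M - ln (X M) - M%:R - c0| <= 2*a%:R/M%:R.
 rewrite [2*_]mulrC -mulrA ler_pM2l //.
have S2' : C*a%:R*q1*ell R n^+3/n%:R + C*a%:R*q2*ell R n^+3/n%:R +
 C*a%:R*q3*ell R n^+3/n%:R + C*a%:R*q4*ell R n^+3/n%:R <= 1/4/M%:R.
 apply: le_trans S2; rewrite /B2 -/q1 -/q2 -/q3 -/q4.
 by rewrite le_eqVlt; apply/orP; left; apply/eqP; ring.
split=> //; rewrite key.
clear key.
have Mi : 0 < M%:R^-1 :> R by rewrite invr_gt0 ltr0n.
have -> : (2*slowconst ka*(C*a%:R)^+2 + 2*a%:R + 2)/M%:R =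
 2*slowconst ka*(C*a%:R)^+2/M%:R + 2*a%:R/M%:R + 2/M%:R by ring.
rewrite -[X in X * `|err|](gtr0_norm T0) -normrM in Terr.
rewrite -[X in X * `|th - h|](gtr0_norm T0) -normrM in s1.
rewrite -[X in X * `|_ - g|](gtr0_norm T0) -normrM in s2.
rewrite -[X in X * `|_ - c0|](gtr0_norm ar) -normrM in s6.
move: s3 s4 Terr s1 s2 s5 s6 mn S2' Mi.
move: (X (n+I)*err) (X (n+I)*(th-h)) (X (n+I)*(_-g)) => e1' e2' e3'.
rewrite (_ : a%:R*(X M - ln (X M) - M%:R - c0) = a%:R*(X M - ln (X M)) - a%:R*M%:R - a%:R*c0); last by ring.
rewrite (_ : (a%:R-1)*c0 = a%:R*c0 - c0); last by ring.
move: (X (n+I)*gatesum ka n M I) (a%:R*(n%:R*gatesum ka n M I)) => G2 G3.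
move: (X (n+I)/X (n+M)*d1) (a%:R*c0) (a%:R*(X M - ln (X M))) (a%:R*M%:R) => D1 AC AX AM.
move: (2*slowconst ka*_/_) (2*a%:R/_) (_*q1*_/_) (_*q2*_/_) (_*q3*_/_) (_*q4*_/_) => y1 y2 y3 y4 y5 y6.
move: (main n) (c*M)%:R d2 => mnn cM d2'.
clear; rewrite !ler_norml => /andP[? ?] /andP[? ?] /andP[? ?] /andP[? ?] /andP[? ?] /andP[? ?] /andP[? ?] /andP[? ?] ? ?.
by apply/andP; split; lra.
Unshelve. all: by end_near. Qed.
End ExitFormula.

(** * Finite-time shadowing by [quad] *)

Section Shadow.
Variable R : realType.
Local Notation C := R[i].

Definition quad {T : pzRingType} (x : T) : T := x + x^+2.

Lemma quadB {T : comPzRingType} (x y : T) : quad x - quad y = (x-y)*(1+x+y).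
Proof. by rewrite /quad; ring. Qed.
Lemma cn_quad (x : C) : cn (quad x) <= cn x + cn x^+2.
Proof. by rewrite /quad -cnX cnD. Qed.

(** Induction from the front: the first step is absorbed in the new base point [quad x0], whose
    bound is larger but explicit. *)
Lemma shadow L (B e : R) : 0 < e -> exists2 d, 0 < d & forall (x : nat -> C) (x0 : C),
 cn x0 <= B -> cn (x 0%N - x0) <= d ->
 (forall i, (i < L)%N -> cn (x i.+1 - quad (x i)) <= d) ->
 forall i, (i <= L)%N -> cn (x i - iter i quad x0) <= e.
Proof.
move=> e0; elim: L B => [|L IH] B.
 by exists e => // x x0 _ h _ i; rewrite leqn0 => /eqP ->.
have [d d0 Hd] := IH (`|B|+B^+2).
pose D := 4 + 2 * `|B|.
have D0 : 0 < D by rewrite /D; have := normr_ge0 B; lra.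
exists (Num.min e (Num.min 1 (d/D))).
 by rewrite !lt_min e0 ltr01 divr_gt0.
move=> x x0 hx0; rewrite !le_min => /and3P[h1 h2 h3] hx.
case=> [//|i] iL; rewrite iterSr.
have xB : cn x0 <= `|B| by apply: le_trans hx0 (ler_norm _).
have x0p := cn_ge0 x0.
apply: (Hd (fun j => x j.+1) (quad x0)) => //; last first.
- move=> j jL; have := hx j.+1 jL; rewrite !le_min => /and3P[_ _ q].
 apply: le_trans q _; rewrite ler_pdivrMr //; rewrite ler_peMr // ?(ltW d0) //.
 by rewrite /D; have := normr_ge0 B; lra.
- have := hx 0%N isT; rewrite !le_min => /and3P[_ _ q].
 have -> : x 1%N - quad x0 = (x 1%N - quad (x 0%N)) + (x 0%N - x0)*(1 + x 0%N + x0).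
  by rewrite -quadB; ring.
 apply: cnD_le; rewrite cnM.
 have b1 : cn (1 + x 0%N + x0) <= D - 1.
  have -> : 1 + x 0%N + x0 = 1 + (x 0%N - x0) + (x0+x0) by ring.
  have := cnD (1 + (x 0%N - x0)) (x0+x0); have := cnD 1 (x 0%N - x0).
  have := cnD x0 x0; rewrite cn1 /D; lra.
 have : cn (x 0%N - x0)*cn (1 + x 0%N + x0) <= d/D*(D-1).
  by apply: ler_pM => //; exact: cn_ge0.
 have -> : d/D*(D-1) = d - d/D by field; rewrite gt_eqF.
 by move: q; clra.
- apply: le_trans (cn_quad _) _; apply: lerD => //.
 rewrite -[B^+2]real_normK ?num_real //.
 by rewrite lerXn2r ?nnegrE ?normr_ge0 // x0p.
Qed.

Lemma iter_quad_real i (x : R) : (iter i quad x)%:C = iter i quad x%:C :> C.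
Proof.
by elim: i => //= i <-; rewrite /quad rmorphD rmorphXn.
Qed.

Lemma iter_quad_gt0 i (x : R) : 0 < x -> 0 < iter i quad x.
Proof. by move=> x0; elim: i => //= i h; rewrite /quad addr_gt0 ?exprn_gt0. Qed.

Lemma iter_quad_ge i (x : R) : 0 < x -> x <= iter i quad x.
Proof.
by move=> x0; elim: i => //= i h; rewrite /quad ler_wpDr // sqr_ge0.
Qed.

Lemma iter_quad_le i (x y : R) : 0 < x -> x <= y -> iter i quad x <= iter i quad y.
Proof.
move=> x0 xy; elim: i => //= i h; rewrite /quad; apply: lerD => //.
have := iter_quad_gt0 i x0; move: h; rewrite -/quad.
move: (iter i quad x) (iter i quad y) => p q pq p0.
by rewrite lerXn2r ?nnegrE ?(ltW p0) // (le_trans (ltW p0)).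
Qed.

(* In the coordinate [1/x] the map becomes [V - 1 + 1/(V+1)]. *)
Lemma iter_quad_inv i (x y : R) : 0 < x -> 0 < y ->
 `|(iter i quad x)^-1 - (iter i quad y)^-1| <= `|x^-1 - y^-1|.
Proof.
move=> x0 y0; elim: i => //= i; apply: le_trans.
have := iter_quad_gt0 i x0; have := iter_quad_gt0 i y0.
move: (iter i quad x) (iter i quad y) => p q q0 p0.
have -> : (quad p)^-1 - (quad q)^-1 = (p^-1-q^-1)*(1 - p/(1+p)*(q/(1+q))).
 rewrite /quad; field.
 by do ?[apply/andP; split]; rewrite gt_eqF //; clear -p0 q0; nra.
rewrite normrM ler_piMr //.
have b (t : R) : 0 < t -> 0 <= t/(1+t) <= 1.
 by move=> t0; rewrite divr_ge0 ?addr_ge0 ?(ltW t0) //= ler_pdivrMr ?mul1r; lra.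
have /andP[b1 b2] := b p p0; have /andP[b3 b4] := b q q0.
have b5 := mulr_ge0 b1 b3; have b6 : p/(1+p)*(q/(1+q)) <= 1 by exact: mulr_ile1.
by rewrite ger0_norm ?subr_ge0 // lerBlDr lerDl.
Qed.

End Shadow.

(** * The limiting exit orbit of the reference *)

Section RefExit.
Variable R : realType.
Implicit Types (a M c : nat) (ka : R).
Local Notation z := (refz R).

(** The shifted variable [w = v - z/2] follows [quad] up to [O(z^2)], uniformly in the starting
    index [I]. *)
Lemma ref_shadow ka L (B e : R) : 0 < e ->
 \forall n \near \oo, forall I, `|vs ka n I| <= B -> forall i, (i <= L)%N ->
  `|vs ka n (I+i) - iter i quad (vs ka n I)| <= e.
Proof.
move=> e0; have e2 : 0 < e/2 by rewrite divr_gt0.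
have [d d0 Hd] := shadow L B e2.
pose D := 1 + `|1/4 + ka^+2|.
have D1 : 1 <= D by rewrite /D lerDl.
have D0 : 0 < D by apply: lt_le_trans D1.
have m0 : 0 < Num.min (d/D) (Num.min e 1) by rewrite !lt_min divr_gt0 ?e0 ?ltr01.
have [N N0 HN] := refz_small_near m0.
exists N => // n /= Nn I hB i iL.
have zs j : 0 < z (n+I+j) /\ z (n+I+j) <= Num.min (d/D) (Num.min e 1).
 split; first exact: refz_gt0.
 by apply: le_trans (HN n Nn); rewrite refz_le // -addnA leq_addr.
have zs' j := let: conj p q := zs j in q.
have bd j : [/\ z (n+I+j) <= d/D, z (n+I+j) <= e & z (n+I+j) <= 1].
 by have := zs' j; rewrite !le_min => /and3P[].
have dD : d/D <= d by rewrite ler_pdivrMr // ler_peMr // ltW.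
pose x j : R[i] := (vs ka n (I+j) - z (n+I+j)/2)%:C.
have h := Hd x (vs ka n I)%:C _ _ _ i iL.
have {h} : cn (x i - iter i quad (vs ka n I)%:C) <= e/2.
 apply: h; first by rewrite cn_real.
  rewrite /x addn0 -rmorphB cn_real.
  have -> : vs ka n I - z (n+I+0)/2 - vs ka n I = - (z (n+I+0)/2) by ring.
  have [b1 _ _] := bd 0%N; have [z0 _] := zs 0%N.
  by rewrite normrN gtr0_norm ?divr_gt0 //; clear -b1 z0 dD; lra.
 move=> j _; rewrite /x /quad -rmorphXn -rmorphD -rmorphB cn_real addnS /= addnS /=.
 rewrite addnA.
 have [b1 b2 b3] := bd j; have [z0 _] := zs j.
 set zz := z (n+I+j) in b1 b2 b3 z0 *; set v := vs ka n (I+j).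
 have -> : v*(1-zz) + v^+2 + ka^+2*zz^+2 - (zz-zz^+2)/2 -
   (v - zz/2 + (v-zz/2)^+2) = (1/4+ka^+2)*zz^+2 by field.
 rewrite normrM [`|zz^+2|]ger0_norm ?sqr_ge0 //.
 have k0 := normr_ge0 (1/4+ka^+2); have kD : `|1/4 + ka^+2| <= D by rewrite /D lerDr.
 apply: (@le_trans _ _ (D*(d/D))); last by rewrite mulrC divfK // gt_eqF.
 apply: ler_pM => //; first exact: sqr_ge0.
 by apply: le_trans b1; rewrite expr2 ler_piMr // ltW.
rewrite /x -iter_quad_real -rmorphB cn_real => h.
have [_ b2 _] := bd i; have [z0 _] := zs i.
move: h; rewrite !ler_norml => /andP[h1 h2]; apply/andP; split; lra.
Qed.

(** [exit_formula] makes the point [c*M] steps before the end Cauchy only up to [O(1/M)]. Iterating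
    [quad] from there to a fixed index [j] does not increase distances in [1/x], so letting [M] grow
    gives convergence at [j]. *)
Lemma ref_exit a ka c : (1 < a)%N -> 0 < ka -> pi/ka = ln a%:R -> (0 < c)%N ->
 (\forall M \near \oo, in_gate a ka M c) ->
 exists r : nat -> R, [/\ forall j, 0 < r j, forall j, r j = quad (r j.+1) &
  forall j, vs ka (a^k) (gatelen a 1 j (a^k)) @[k --> \oo] --> r j].
Proof.
move=> a1 ka0 pik cp [M0 _ HM0].
have [c0 Hc] := psi_lim R.
have [C7 HC7] := exit_formula c a1 ka0 pik Hc.
pose C8 := 2 * `|C7| + 2.
have ak k : (k <= a^k)%N by apply: ltnW; apply: ltn_expl.
have ar := a_gt0 R a1.
have near_ak (Q : nat -> Prop) : (\forall n \near \oo, Q n) -> exists K, forall k, (K <= k)%N -> Q (a^k)%N.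
 by case=> K _ HK; exists K => k Kk; apply: HK; apply: leq_trans Kk (ak k).
have E1 M : (20 + M0 <= M)%N -> exists K, forall k, (K <= k)%N ->
  [/\ 0 < vs ka (a^k) (gatelen a M c (a^k)), vs ka (a^k) (gatelen a M c (a^k)) <= 1 &
  forall l, (K <= l)%N -> `|(vs ka (a^k) (gatelen a M c (a^k)))^-1 -
   (vs ka (a^l) (gatelen a M c (a^l)))^-1| <= C8/M%:R].
 move=> hM; have M20 : (20 <= M)%N := leqDl hM.
 have G : in_gate a ka M c by apply: HM0; rewrite /=; exact: leqDr hM.
 have Mr : 0 < M%:R :> R by rewrite ltr0n; apply: leq_trans M20.
 have [S HS] := gatesum_lim a1 ka0 pik M20 G.
 have eps0 : 0 < (a%:R*M%:R)^-1 :> R by rewrite invr_gt0 mulr_gt0.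
 have [K1 HK1] := HS _ eps0.
 have [K2 HK2] := near_ak _ (HC7 M M20 G); have [K3 HK3] := near_ak _ G.
 exists (K1 + K2 + K3 + (c*M+M).+1)%N => k hk.
 have hk1 : (K1 <= k)%N by move: hk; clia.
 have hk2 : (K2 <= k)%N by move: hk; clia.
 have hk3 : (K3 <= k)%N by move: hk; clia.
 have [vk hvk] := HK2 k hk2; split=> //.
  have hn : (c*M + M < a^k)%N by apply: leq_trans (ak k); move: hk; clia.
  have tw : (a^k + a^k <= a*a^k)%N by rewrite addnn -mul2n leq_mul2r a1 orbT.
  have h1 : (M <= gatelen a M c (a^k))%N by rewrite /gatelen; move: hn tw; clia.
  have h2 : (a^k + gatelen a M c (a^k) + c*M <= a*a^k)%N.
   by rewrite /gatelen; move: hn tw; clia.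
  have := HK3 k hk3 _ h1 h2; rewrite gtr0_norm // => /le_trans; apply.
  by rewrite invf_le1 // ler1n; apply: leq_trans M20.
 move=> l hl.
 have hl1 : (K1 <= l)%N by move: hl; clia.
 have hl2 : (K2 <= l)%N by move: hl; clia.
 have [vl hvl] := HK2 l hl2.
 set x := (vs ka (a^k) _)^-1 in hvk *; set y := (vs ka (a^l) _)^-1 in hvl *.
 have x0 : 0 < x by rewrite invr_gt0.
 have y0 : 0 < y by rewrite invr_gt0.
 (* Since [ln] is increasing, [x + ln x] does not contract distances, and it need not be
    inverted. *)
 have sep : `|x - y| <= `|x + ln x - (y + ln y)|.
  have [xy|yx] := leP x y.
   have q : ln x <= ln y by rewrite ler_ln.
   by rewrite !ler0_norm ?subr_le0 ?lerD //; clear -q; lra.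
  have q : ln y <= ln x by rewrite ler_ln // ltW.
  by rewrite !gtr0_norm ?subr_gt0 ?ltr_leD //; clear -q; lra.
 apply: le_trans sep _.
 have := HK1 k hk1; have := HK1 l hl1.
 move: hvk hvl; move: (_*gatesum _ _ _ _) (_*gatesum _ _ _ _) => g1 g2 h1 h2 h3 h4.
 have h5 : `|a%:R*(g1-S)| <= M%:R^-1.
  by rewrite normrM (gtr0_norm ar) -ler_pdivlMl // -invfM.
 have h6 : `|a%:R*(g2-S)| <= M%:R^-1.
  by rewrite normrM (gtr0_norm ar) -ler_pdivlMl // -invfM.
 have h7 : C7/M%:R <= `|C7| / M%:R by rewrite ler_pM2r ?invr_gt0 // ler_norm.
 have -> : C8/M%:R = 2*(`|C7| / M%:R) + 2*M%:R^-1 by rewrite /C8; ring.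
 move: (`|C7| / M%:R) (C7/M%:R) h7 h1 h2 h5 h6 => q q'; rewrite !mulrBr.
 move: (a%:R*g1) (a%:R*g2) (a%:R*S) (M%:R^-1) => G1 G2 G3 m.
 clear; rewrite !ler_norml => ? /andP[? ?] /andP[? ?] /andP[? ?] /andP[? ?].
 by apply/andP; split; lra.
pose x j k := vs ka (a^k) (gatelen a 1 j (a^k)).
have E2 M j (e : R) : (20 + M0 <= M)%N -> (j <= M)%N -> 0 < e -> exists K, forall k, (K <= k)%N ->
  `|x j k - iter (c*M-j) quad (vs ka (a^k) (gatelen a M c (a^k)))| <= e.
 move=> hM jM e0; have [K HK] := E1 M hM.
 have [K1 HK1] := near_ak _ (ref_shadow ka (c*M-j) 1 e0).
 exists (K+K1+c*M)%N => k hk.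
 have [h1 h2 _] := HK k (leq_trans (leq_trans (leq_addr _ _) (leq_addr _ _)) hk).
 have hk1 : (K1 <= k)%N by move: hk; clia.
 have := HK1 k hk1 (gatelen a M c (a^k)) _ (c*M-j)%N (leqnn _).
 rewrite gtr0_norm // => /(_ h2); congr (`| vs _ _ _ - _| <= _).
 have hn : (c*M <= a^k)%N by apply: leq_trans (ak k); move: hk; clia.
 have tw : (a^k + a^k <= a*a^k)%N by rewrite addnn -mul2n leq_mul2r a1 orbT.
 have jc : (j <= c*M)%N by apply: leq_trans jM _; rewrite leq_pmull.
 by rewrite /gatelen; move: hn tw jc; clia.
(* The lower bound keeps the limit away from 0. It comes from comparing every stage with the single
   stage [K], and [iter_quad_ge] carries it forward. *)
have E3 j : exists2 H, 0 < H & exists2 lo, 0 < lo & exists K, forall k, (K <= k)%N ->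
  lo <= x j k <= H.
 pose M := (20+M0+j)%N.
 have hM : (20 + M0 <= M)%N by rewrite leq_addr.
 have [K HK] := E1 M hM.
 have [vK0 vK1 _] := HK K (leqnn _); set vK := vs _ _ _ in vK0 vK1.
 have Mr : 0 < M%:R :> R by rewrite ltr0n.
 pose hi := vK^-1 + C8/M%:R.
 have C80 : 0 < C8 by rewrite /C8; have := normr_ge0 C7; clra.
 have hi0 : 0 < hi by rewrite addr_gt0 ?invr_gt0 // divr_gt0.
 have e0 : 0 < hi^-1/2 by rewrite divr_gt0 ?invr_gt0.
 have [K1 HK1] := E2 M j _ hM (leq_addl _ _) e0.
 pose H : R := iter (c*M-j) quad 1.
 have H0 : 0 < H by apply: iter_quad_gt0.
 exists (H+hi^-1/2); first by rewrite addr_gt0.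
 exists (hi^-1/2) => //; exists (K+K1)%N => k hk.
 have hK : (K <= k)%N := leqDl hk.
 have hK1 : (K1 <= k)%N := leqDr hk.
 have [v0 v1 v2] := HK k hK; have := v2 K (leqnn _).
 have := HK1 k hK1; move: v0 v1; set v := vs ka (a^k) _ => v0 v1 h1 h2.
 have h3 : iter (c*M-j) quad v <= H by apply: iter_quad_le.
 have h4 := iter_quad_ge (c*M-j) v0.
 have h5 : hi^-1 <= v.
  rewrite -[leRHS]invrK lef_pV2 ?posrE ?invr_gt0 // /hi.
  by move: h2; rewrite -/vK ler_norml => /andP[_]; clra.
 by move: h1; rewrite ler_norml => /andP[g1 g2]; clear -g1 g2 h3 h4 h5; apply/andP; split; lra.
have E4 j : exists l : R, forall e, 0 < e -> exists N, forall k, (N <= k)%N -> `|x j k - l| <= e.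
 apply: real_cauchy_lim => e e0.
 have [H H0 [lo lo0 [K HK]]] := E3 j.
 have e4 : 0 < Num.min 1 (e/4) by rewrite lt_min ltr01 divr_gt0.
 have C80 : 0 < C8 by rewrite /C8; have := normr_ge0 C7; clra.
 have [M1 M10 HM1] := inv_small ((H+1)^+2*C8) (ltac:(lra) : 0 < e/2).
 pose M := (20+M0+j+M1)%N.
 have hM : (20 + M0 <= M)%N by rewrite /M; clia.
 have jM : (j <= M)%N by rewrite /M; clia.
 have [K1 HK1] := E1 M hM; have [K2 HK2] := E2 M j _ hM jM e4.
 exists (K+K1+K2)%N => k l hk hl.
 have [v0 v1 v2] := HK1 k (leq_trans (leq_trans (leq_addl _ _) (leq_addr _ _)) hk).
 have hl1 := leq_trans (leq_trans (leq_addl _ _) (leq_addr _ _)) hl.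
 have {v2} := v2 l hl1; have [w0 w1 _] := HK1 l hl1.
 have hk2 := HK2 k (leqDr hk).
 have hl2 := HK2 l (leqDr hl).
 have /andP[_ bk] := HK k (leq_trans (leq_trans (leq_addr _ _) (leq_addr _ _)) hk).
 have /andP[_ bl] := HK l (leq_trans (leq_trans (leq_addr _ _) (leq_addr _ _)) hl).
 move: v0 w0 hk2 hl2; move: (vs ka (a^k) (gatelen a M _ _)) => v.
 move: (vs ka (a^l) (gatelen a M _ _)) => w v0 w0 hk2 hl2 vw.
 have := iter_quad_inv (c*M-j) v0 w0.
 have := iter_quad_gt0 (c*M-j) v0; have := iter_quad_gt0 (c*M-j) w0.
 move: hk2 hl2; rewrite !le_min => /andP[k1 k2] /andP[l1 l2].
 move: k1 k2 l1 l2; set p := iter _ _ v; set q := iter _ _ w => k1 k2 l1 l2 q0 p0 pq.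
 have pH : p <= H + 1 by move: k1 bk; rewrite ler_norml => /andP[+ _]; clra.
 have qH : q <= H + 1 by move: l1 bl; rewrite ler_norml => /andP[+ _]; clra.
 have : `|p - q| <= (H+1)^+2*C8/M%:R.
  have -> : p - q = (p*q)*(q^-1-p^-1) by field; rewrite !gt_eqF.
  rewrite normrM -mulrA; apply: ler_pM => //; last first.
   by rewrite distrC; apply: le_trans pq vw.
  by rewrite normrM !gtr0_norm // expr2; apply: ler_pM => //; exact: ltW.
 have hb := HM1 M (leq_addl _ _).
 move: hb k2 l2; clear; rewrite !ler_norml => ? /andP[? ?] /andP[? ?] /andP[? ?].
 by apply/andP; split; lra.
have E5 j : exists l : R, x j k @[k --> \oo] --> l.
 have [l Hl] := E4 j; exists l; apply: cvg_near_le => e e0.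
 by have [N HN] := Hl e e0; exists N.
have [r Hr] := boolp.choice E5.
exists r; split=> // j.
 have [H _ [lo lo0 [K HK]]] := E3 j; apply: lt_le_trans lo0 _.
 apply: (cvgr_to_ge (Hr j)).
 by exists K => // k /= /HK /andP[].
have h1 : (x j k - quad (x j.+1 k)) @[k --> \oo] --> r j - quad (r j.+1).
 apply: cvgB => //; apply: cvgD => //; rewrite expr2.
 rewrite [X in X @ _](_ : _ = fun k => x j.+1 k*x j.+1 k); last by apply/funext=> k; rewrite expr2.
 exact: cvgM.
have h2 : (x j k - quad (x j.+1 k)) @[k --> \oo] --> (0 : R).
 apply: cvg_near_le => e e0; have [H H0 [lo lo0 [K HK]]] := E3 j.+1.
 have [K1 HK1] := near_ak _ (ref_shadow ka 1 H e0).
 exists (K+K1+j.+1)%N => // k /= hk; rewrite subr0.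
 have := HK1 k (leq_trans (leq_trans (leq_addl _ _) (leq_addr _ _)) hk)
  (gatelen a 1 j.+1 (a^k)) _ 1%N (leqnn _).
 have /andP[b1 b2] := HK k (leq_trans (leq_trans (leq_addr _ _) (leq_addr _ _)) hk).
 rewrite gtr0_norm ?(lt_le_trans lo0) // => /(_ b2) /=; congr (`| vs _ _ _ - _| <= _).
 have hn : (j.+1 <= a^k)%N by apply: leq_trans (ak k); move: hk; clia.
 have tw : (a^k + a^k <= a*a^k)%N by rewrite addnn -mul2n leq_mul2r a1 orbT.
 by rewrite /gatelen; move: hn tw; clia.
by apply/eqP; rewrite -subr_eq0; apply/eqP; exact: (norm_cvg_unique h1 h2).
Qed.

End RefExit.

(** * Translation coordinate and phase *)

Section Translation.
Variable R : realType.
Local Notation C := R[i].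
Local Notation X := (refX R).
Implicit Types (A B : nat -> C) (w z : C).

(* Both [z -> z - z^2] in the coordinate [1/z] and [w -> w + w^2] in the
  coordinate [- 1/w] become the map [Z -> Z + 1 + 1/(Z-1)]. *)
Definition trans_orbit A := forall i, A i.+1 = A i + 1 + (A i - 1)^-1.

Lemma trans_quad w : w != 0 -> 1 + w != 0 ->
 - (quad w)^-1 = - w^-1 + 1 + (- w^-1-1)^-1.
Proof.
move=> w0 w1; rewrite /quad; field.
have e : -1 + -1*w = - (1+w) by ring.
have e2 : w + w^+2 = w*(1+w) by ring.
by rewrite e e2 oppr_eq0 w0 w1 mulf_neq0.
Qed.

Lemma trans_logistic z : z != 0 -> 1 - z != 0 ->
 (z-z^+2)^-1 = z^-1 + 1 + (z^-1-1)^-1.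
Proof.
move=> z0 z1; field.
have e : 1 + -1*z = 1 - z by ring.
have e2 : z - z^+2 = z*(1-z) by ring.
by rewrite e e2 z0 z1 mulf_neq0.
Qed.

Lemma transB (a b : C) : a - 1 != 0 -> b - 1 != 0 ->
 a + 1 + (a-1)^-1 - (b + 1 + (b-1)^-1) = (a-b)*(1 - ((a-1)*(b-1))^-1).
Proof. by move=> a1 b1; field; rewrite a1 b1. Qed.

(** The modulus is [|p-1|/|p|], and [Re p >= 1/2] describes the points closer to 1 than to 0. *)
Lemma cn_1subV (p : C) : 1/2 <= Re p -> cn (1-p^-1) <= 1.
Proof.
move=> hp; have p0 : p != 0.
 by apply/eqP => p0; move: hp; rewrite p0 /=; lra.
have cp : 0 < cn p by rewrite cn_gt0.
have -> : 1 - p^-1 = (p-1)/p by field.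
rewrite cn_div ler_pdivrMr // mul1r.
rewrite -(ler_pXn2r (n := 2)) ?nnegrE ?cn_ge0 // !cn_sqr cReB cImB /=.
by clear -hp; nra.
Qed.

Lemma Re_sub1 (x : C) : Re (x-1) = Re x - 1.
Proof. by rewrite cReB. Qed.
Lemma Im_sub1 (x : C) : Im (x-1) = Im x.
Proof. by rewrite cImB subr0. Qed.

Lemma Re_real (x : R) : Re x%:C = x. Proof. by []. Qed.
Lemma near_real (a : C) (x d : R) : cn (a-x%:C) <= d ->
 [/\ x - d <= Re a, Re a <= x + d & `|Im a| <= d].
Proof.
move=> h; have := le_trans (cn_ge_Re _) h; have := le_trans (cn_ge_Im _) h.
rewrite cReB cImB /= subr0 => h1; rewrite ler_norml => /andP[h2 h3].
by split=> //; lra.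
Qed.

Lemma refX_ge1 t : t%:R + 1 <= X t - 1.
Proof. by have := refX_ge R t; lra. Qed.

Lemma telescope_inv (t : nat) :
 (t%:R+1) ^- 2 <= 2*((t%:R+1)^-1 - (t%:R+2)^-1) :> R.
Proof.
have t0 : 0 <= t%:R :> R by [].
have -> : 2*((t%:R+1)^-1 - (t%:R+2)^-1) = 2*((t%:R+1)*(t%:R+2))^-1 :> R.
 by field; apply/andP; split; rewrite gt_eqF //; lra.
have -> : 2/((t%:R+1)*(t%:R+2)) = ((t%:R+1)*(t%:R+2)/2)^-1 :> R.
 by field; apply/andP; split; rewrite gt_eqF //; lra.
by rewrite lef_pV2 ?posrE; nra.
Qed.

Lemma near_ref_sub1 n (a : C) (D : R) : cn (a - (X n)%:C) <= D -> D <= (X n - 1)/2 ->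
 [/\ (X n - 1)/2 <= Re (a-1), a - 1 != 0 &
   cn ((a-1)*((X n)%:C - 1))^-1 <= 2*(n%:R+1) ^- 2].
Proof.
move=> h1 h2; have [h3 _ _] := near_real h1; have h4 := refX_ge1 n.
have n0 : 0 <= n%:R :> R by [].
have hr : (X n - 1)/2 <= Re (a-1) by rewrite Re_sub1; lra.
have p1 : 0 < Re (a-1) by lra.
have hc : (X n - 1)/2 <= cn (a-1) by apply: le_trans hr (le_trans (ler_norm _) (cn_ge_Re _)).
split=> //.
 by rewrite -cn_gt0; apply: lt_le_trans hc; lra.
rewrite cnV cnM -rmorphB cn_real gtr0_norm; last lra.
have -> : 2*(n%:R+1) ^- 2 = ((n%:R+1)/2*(n%:R+1))^-1 :> R.
 by field; rewrite gt_eqF //; lra.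
by rewrite lef_pV2 ?posrE; [apply: ler_pM|apply: mulr_gt0|apply: mulr_gt0]; clear -n0 h4 hc; lra.
Qed.

Lemma ref_trans_orbit n : trans_orbit (fun i => (X (n+i))%:C).
Proof.
move=> i; rewrite addnS refXS.
rewrite -[in RHS](rmorph1 (@real_complex R)) -rmorphB -fmorphV.
by rewrite -!rmorphD.
Qed.

(** By [transB] the difference from the reference is multiplied by [1 - 1/((A-1)(X-1))], of modulus
    at most 1 while [A] stays far to the right; it does stay there, because the deviation does not
    grow and [X] increases. *)
Lemma trans_dev n A : trans_orbit A -> cn (A 0%N - (X n)%:C) <= (X n - 1)/2 ->
 forall i, cn (A i - (X (n+i))%:C) <= cn (A 0%N - (X n)%:C).
Proof.
move=> HA h; elim=> [|i IH]; first by rewrite addn0.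
have X0 : X n <= X (n+i) by rewrite refX_le // leq_addr.
have [|h1 h2 _] := near_ref_sub1 (n := n + i) IH; first by move: h X0; clra.
have h4 := refX_ge1 (n+i); have n0 : 0 <= (n+i)%:R :> R by [].
rewrite HA (ref_trans_orbit n i) transB //; last first.
 by rewrite -cn_gt0 -rmorphB cn_real normr_gt0 gt_eqF //; lra.
rewrite cnM; apply: le_trans IH; apply: ler_piMr; first exact: cn_ge0.
apply: cn_1subV; rewrite cReM [Im (_%:C-1)]cImB [Re (_%:C-1)]cReB /= subr0 mulr0 subr0.
by move: h1; move: (Re _) => t; nra.
Qed.

(** The factors of [trans_dev] differ from 1 by [O(1/t^2)], so the deviation from the reference
    converges. Its limit is the phase [tau], a difference of Fatou coordinates. *)
Lemma trans_lim n A : trans_orbit A -> cn (A 0%N - (X n)%:C) <= (X n - 1)/2 ->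
 exists tau, forall i, cn (A i - (X (n+i))%:C - tau) <=
  4*cn (A 0%N - (X n)%:C)/(n+i).+1%:R.
Proof.
move=> HA h; set D0 := cn _.
pose D i := A i - (X (n+i))%:C.
have Dle i : cn (D i) <= D0 by exact: trans_dev.
have D00 : 0 <= D0 by exact: cn_ge0.
have inv t : (t%:R+1)^-1 = t.+1%:R^-1 :> R by rewrite -natr1.
have inv2 t : (t%:R+2)^-1 = t.+2%:R^-1 :> R by rewrite -[t.+2]addn2 natrD.
have step i : cn (D i.+1 - D i) <= 4*D0*((n+i).+1%:R^-1 - (n+i).+2%:R^-1).
 have [] := near_ref_sub1 (n := n + i) (Dle i).
  by apply: le_trans h _; have := refX_le R (leq_addr i n); lra.
 move=> h1 h2 h3; have h4 := refX_ge1 (n+i); have n0 : 0 <= (n+i)%:R :> R by [].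
 have -> : D i.+1 - D i = - (D i*((A i - 1)*((X (n+i))%:C - 1))^-1).
  rewrite /D HA (ref_trans_orbit n i) transB //; first by ring.
  by rewrite -cn_gt0 -rmorphB cn_real normr_gt0 gt_eqF //; lra.
 rewrite cnN cnM.
 have := telescope_inv (n+i); rewrite inv inv2 => h5.
 apply: le_trans (ler_pM (cn_ge0 _) (cn_ge0 _) (Dle i) h3) _.
 have -> : 4*D0*((n+i).+1%:R^-1 - (n+i).+2%:R^-1) =
  D0*(2*(2*((n+i).+1%:R^-1 - (n+i).+2%:R^-1))) by ring.
 by rewrite ler_wpM2l // ler_pM2l.
have tele i d : cn (D (i+d)%N - D i) <= 4*D0*((n+i).+1%:R^-1 - (n + (i+d)).+1%:R^-1).
 elim: d => [|d IH]; first by rewrite addn0 !subrr cn0 mulr0.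
 have -> : D (i+d.+1)%N - D i = (D (i+d).+1 - D (i+d)%N) + (D (i+d)%N - D i).
  by rewrite addnS; ring.
 apply: cnD_le; have := step (i+d)%N; rewrite !addnS in IH *.
 move: IH; set a := _^-1; set b := _^-1; set c := _^-1.
 by move=> ? ?; rewrite (_ : 4*D0*(a-c) = 4*D0*(b-c) + 4*D0*(a-b)); [lra|ring].
have tl i j : (i <= j)%N -> cn (D j - D i) <= 4*D0/(n+i).+1%:R.
 move=> ij; have := tele i (j-i)%N; rewrite subnKC // => /le_trans; apply.
 by apply: ler_wpM2l; [lra|rewrite lerBlDr lerDl].
have [|tau Ht] := @complex_cauchy_lim R D.
 move=> e e0; have [N N0 HN] := inv_small (4*D0) (ltac:(lra) : 0 < e/2).
 exists N => i j Ni Nj.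
 have hN k : (N <= k)%N -> cn (D k - D N) <= e/2.
  move=> Nk; apply: le_trans (tl _ _ Nk) _.
  by apply: HN; rewrite leqW // leq_addl.
 have -> : D i - D j = (D i - D N) - (D j - D N) by ring.
 by apply: cnB_le; have := hN i Ni; have := hN j Nj; lra.
exists tau => i; apply/ler_addgt0Pr => e e0.
have [N HN] := Ht e e0.
have -> : A i - (X (n+i))%:C - tau = (D (N+i)%N - tau) - (D (N+i)%N - D i) by rewrite /D; ring.
apply: cnB_le; rewrite addrC; apply: lerD.
 by apply: tl; rewrite leq_addl.
by apply: HN; rewrite leq_addr.
Qed.

(** The lower factor is kept explicit: its product over all times stays away from 0, so that
    positions can be recovered from phases. The [16/9] comes from [Re (A-1) >= (3/4)(X-1)]. *)
Lemma trans_sub n A B (D : R) : trans_orbit A -> trans_orbit B ->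
 cn (A 0%N - (X n)%:C) <= D -> cn (B 0%N - (X n)%:C) <= D -> D <= (X n - 1)/4 ->
 forall i, [/\ cn (A i.+1 - B i.+1) <= cn (A i - B i) &
  cn (A i - B i)*(1 - 16/9*(X (n+i) - 1) ^- 2) <= cn (A i.+1 - B i.+1)].
Proof.
move=> HA HB hA hB hD i.
have h4 := refX_ge1 (n+i); have n0 : 0 <= (n+i)%:R :> R by [].
have Xn := refX_le R (leq_addr i n).
have Xn2 := refX_ge2 R n.
have dA : cn (A i - (X (n+i))%:C) <= (X (n+i) - 1)/4.
 by apply: le_trans (trans_dev HA _ _) _; [|apply: le_trans hA _]; lra.
have dB : cn (B i - (X (n+i))%:C) <= (X (n+i) - 1)/4.
 by apply: le_trans (trans_dev HB _ _) _; [|apply: le_trans hB _]; lra.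
have [a1 _ a3] := near_real dA; have [b1 _ b3] := near_real dB.
have a4 : (X (n+i) - 1)*(3/4) <= Re (A i - 1) by rewrite Re_sub1; clear -a1; lra.
have b4 : (X (n+i) - 1)*(3/4) <= Re (B i - 1) by rewrite Re_sub1; clear -b1; lra.
have ca := le_trans a4 (le_trans (ler_norm _) (cn_ge_Re _)).
have cb := le_trans b4 (le_trans (ler_norm _) (cn_ge_Re _)).
have x1 : 1 <= X (n+i) - 1 by clear -Xn Xn2; lra.
have a0 : A i - 1 != 0 by rewrite -cn_gt0; clear -x1 ca; lra.
have b0 : B i - 1 != 0 by rewrite -cn_gt0; clear -x1 cb; lra.
rewrite HA HB transB // cnM; split.
 apply: ler_piMr; first exact: cn_ge0.
 apply: cn_1subV; rewrite cReM !Im_sub1.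
 move: a3 b3 a4 b4 x1; move: (Re _) (Re _) (Im _) (Im _) (X _ - 1).
 clear=> p q r s x; rewrite !ler_norml => /andP[? ?] /andP[? ?] ? ? ?.
 have e1 : r*s <= (x/4)^+2 by nra.
 have e2 : (x*(3/4))^+2 <= p*q by nra.
 by nra.
apply: ler_wpM2l; first exact: cn_ge0.
have -> : 16/9*(X (n+i) - 1) ^- 2 = ((X (n+i) - 1)*(3/4)*((X (n+i) - 1)*(3/4)))^-1.
 by field; rewrite gt_eqF //; clear -x1; lra.
apply: le_trans (cn_sub_ge _ _); rewrite cn1 lerD2l lerN2 cnV cnM.
by rewrite lef_pV2 ?posrE; [apply: ler_pM|apply: mulr_gt0|apply: mulr_gt0]; clear -x1 ca cb; lra.
Qed.

End Translation.

(** * The entry coordinate near the critical point *)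

Section Entry.
Variable R : realType.
Local Notation C := R[i].
Local Notation X := (refX R).
Implicit Types (w : C) (i : nat).

Lemma refX0 : X 0 = 2.
Proof. by rewrite -[X 0]invrK -refzE /= invf_div divr1. Qed.

Definition entry_orbit w i : C := - (iter i quad w)^-1.

Lemma cn_half : cn (1/2 : C) = 1/2.
Proof. by rewrite cn_div cn1 cn_nat. Qed.

Lemma entry_disc w (d : R) : cn (w+1/2) <= d -> 1/2 - d <= cn w <= 1/2 + d.
Proof.
move=> h; apply/andP; split.
 have := cnB (w+1/2) w; rewrite [w + 1/2]addrC addrK cn_half [1/2 + w]addrC; lra.
have := cnB (w+1/2) (1/2); rewrite addrK cn_half; lra.
Qed.

Lemma entry_start w : cn (w+1/2) <= 1/20 -> cn (entry_orbit w 0 - (X 0)%:C) <= 1/4.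
Proof.
move=> h; have /andP[h1 h2] := entry_disc h.
have w0 : w != 0 by rewrite -cn_gt0; lra.
rewrite refX0 /entry_orbit /=.
have -> : (2%:R : R)%:C = 2%:R :> C by rewrite rmorph_nat.
have -> : - w^-1 - 2 = - (2*(w+1/2)/w) by field; rewrite w0.
rewrite cnN cn_div cnM cn_nat ler_pdivrMr; lra.
Qed.

(** The two nonvanishing claims and the closeness of [-1/w] to [X] are proved in one induction:
    closeness excludes the value [-1], which would make the next point 0 and the coordinate
    meaningless. *)
Lemma entry_nz w i : cn (w+1/2) <= 1/20 -> iter i quad w != 0 /\ 1 + iter i quad w != 0.
Proof.
move=> h; have X02 := refX0.
suff H : (iter i quad w != 0) /\ cn (entry_orbit w i - (X i)%:C) <= 1/4.
 case: H => h1 h2; split=> //; apply/eqP => /eqP; rewrite addrC addr_eq0 => /eqP e.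
 move: h2; rewrite /entry_orbit e invrN invr1 opprK.
 have := refX_ge2 R i => h3; rewrite cnBC -[1](rmorph1 (@real_complex R)) -rmorphB cn_real.
 by rewrite ger0_norm; lra.
elim: i => [|i [h1 h2]].
 split; last exact: entry_start.
 by have /andP[? ?] := entry_disc h; rewrite -cn_gt0 /=; lra.
have n0 : 0 <= i%:R :> R by [].
have h3 := refX_ge1 R i.
have [|p1 p2 p3] := near_ref_sub1 (n := i) h2; first by lra.
have e1 : 1 + iter i quad w != 0.
 apply: contraNneq p2 => e; rewrite /entry_orbit.
 have -> : iter i quad w = -1 by apply/eqP; rewrite -addr_eq0 addrC e.
 by rewrite invrN invr1 opprK subrr.
have q0 : iter i.+1 quad w != 0.
 rewrite iterS /quad (_ : _ + _ = iter i quad w*(1 + iter i quad w)); last by ring.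
 by rewrite mulf_neq0.
split=> //; rewrite {1}/entry_orbit iterS trans_quad // -/(entry_orbit w i).
have r := ref_trans_orbit R 0 i; rewrite !add0n in r; rewrite r transB //; last first.
 by rewrite -cn_gt0 -rmorphB cn_real normr_gt0 gt_eqF //; lra.
rewrite cnM; apply: le_trans h2; apply: ler_piMr; first exact: cn_ge0.
apply: cn_1subV; rewrite cReM [Im (_%:C-1)]cImB [Re (_%:C-1)]cReB /= subr0 mulr0 subr0.
by move: p1; move: (Re _) => t; clear -h3 n0; nra.
Qed.

Lemma entry_trans w : cn (w+1/2) <= 1/20 -> trans_orbit (entry_orbit w).
Proof.
by move=> h i; have [h1 h2] := entry_nz i h; rewrite /entry_orbit iterS trans_quad.
Qed.

Lemma entry_ex : exists s : C -> C, forall w, cn (w+1/2) <= 1/20 ->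
 forall i, cn (entry_orbit w i - (X i)%:C - s w) <= i.+1%:R^-1.
Proof.
have X02 := refX0.
have H w : exists s, cn (w+1/2) <= 1/20 -> forall i, cn (entry_orbit w i - (X i)%:C - s) <= i.+1%:R^-1.
 have [h|h] := pselect (cn (w+1/2) <= 1/20); last by exists 0 => /h.
 have hs := entry_start h.
 have [|tau Ht] := trans_lim (n := 0) (entry_trans h).
  by move: hs; rewrite X02; lra.
 exists tau => _ i; apply: le_trans (Ht i) _; rewrite add0n.
 by rewrite ler_piMl ?invr_ge0 //; move: hs; lra.
by have [s Hs] := boolp.choice H; exists s.
Qed.

(** Attracting Fatou coordinate of [w + w^2], normalised to vanish at [-1/2]. It is specified on the
    disc of radius [1/20] only. *)
Definition entry : C -> C := projT1 (cid entry_ex).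

Lemma entryP w : cn (w+1/2) <= 1/20 ->
 forall i, cn (entry_orbit w i - (X i)%:C - entry w) <= i.+1%:R^-1.
Proof. exact: (projT2 (cid entry_ex)). Qed.

Lemma entry_sub w w' i : cn (w+1/2) <= 1/20 -> cn (w'+1/2) <= 1/20 ->
 cn (entry w - entry w') <= cn (entry_orbit w i - entry_orbit w' i) /\
 cn (entry_orbit w 1 - entry_orbit w' 1)/4 <= cn (entry w - entry w').
Proof.
move=> h h'; have X02 := refX0.
have H := trans_sub (entry_trans h) (entry_trans h') (entry_start h) (entry_start h').
have {}H : forall i, _ := H ltac:(lra); rewrite /= in H.
have app (e : R) : 0 < e -> exists N, forall i, (N <= i)%N ->
  cn (entry w - entry w') <= cn (entry_orbit w i - entry_orbit w' i) + e /\
  cn (entry_orbit w i - entry_orbit w' i) <= cn (entry w - entry w') + e.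
 move=> e0; have [N N0 HN] := inv_small 1 (ltac:(lra) : 0 < e/2).
 exists N => j Nj.
 have e1 : j.+1%:R^-1 <= e/2 by rewrite -[leLHS]mul1r; apply: HN; rewrite leqW.
 have a1 := entryP h j; have a2 := entryP h' j.
 set a := entry_orbit w j in a1 *; set b := entry_orbit w' j in a2 *.
 have d : cn ((a - (X j)%:C - entry w) - (b - (X j)%:C - entry w')) <= e.
  by apply: le_trans (cnB _ _) (le_trans (lerD a1 a2) _); rewrite [leRHS]splitr; exact: lerD.
 have e2 : entry w - entry w' = (a-b) - ((a - (X j)%:C - entry w) - (b - (X j)%:C - entry w')) by ring.
 have e3 : a - b = (entry w - entry w') + ((a - (X j)%:C - entry w) - (b - (X j)%:C - entry w')) by ring.
 split; first by rewrite {1}e2; apply: cnB_le; rewrite lerD2l.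
 by rewrite {1}e3; apply: cnD_le; rewrite lerD2l.
split.
 apply/ler_addgt0Pr => e e0; have [N HN] := app e e0.
 have [q _] := HN (N+i)%N (leq_addr _ _); apply: le_trans q _; rewrite lerD2r.
 elim: N {HN} => [|N IH]; first by rewrite add0n.
 by apply: le_trans IH; have [] := H (N+i)%N.
(* The factor starts below 1 and decreases towards [1/4]; the decrements of [16/9*(j+5/2)^-1] pay
   for the losses [16/9*(X-1)^-2] of the single steps. *)
have low j : cn (entry_orbit w 1 - entry_orbit w' 1)*(1/4 + 16/9*(j%:R+5/2)^-1) <=
  cn (entry_orbit w j.+1 - entry_orbit w' j.+1).
 elim: j => [|j IH].
  rewrite ler_piMr ?cn_ge0 //.
  have -> : (0%:R + 5/2 : R)^-1 = 2/5 by rewrite add0r invf_div. by lra.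
 have [_] := H j.+1; rewrite add0n; apply: le_trans.
 have j0 : 0 <= j%:R :> R by [].
 have X1 : j%:R + 3 <= X j.+1 - 1.
  elim: (j) => [|k IHk]; first by rewrite refXS X02; rewrite (_ : 2 - 1 = 1) ?invr1; lra.
  have k0 : 0 <= k%:R :> R by [].
  rewrite refXS -natr1; have : 0 <= (X k.+1 - 1)^-1 by rewrite invr_ge0; lra.
  by lra.
 have e2 : (X j.+1 - 1) ^- 2 <= (j%:R+5/2)^-1 - (j%:R+7/2)^-1.
  have -> : (j%:R+5/2)^-1 - (j%:R+7/2)^-1 = ((j%:R+5/2)*(j%:R+7/2))^-1 :> R.
   by field; apply/andP; split; rewrite gt_eqF //; clear -j0; lra.
  by rewrite lef_pV2 ?posrE; clear -j0 X1; nra.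
 have e3 : (j%:R+5/2)^-1 <= 2/5 :> R.
  by rewrite -[leRHS]invrK lef_pV2 ?posrE ?invr_gt0 ?invf_div; clear -j0; lra.
 have e4 : 0 <= (j.+1%:R+5/2)^-1 :> R by rewrite invr_ge0; have : 0 <= j.+1%:R :> R by []; lra.
 have e5 : j.+1%:R + 5/2 = j%:R + 7/2 :> R by rewrite -natr1; field.
 rewrite e5 in e4 *.
 apply: le_trans (ler_wpM2r _ IH); last first.
  have : 16/9*(X j.+1 - 1) ^- 2 <= 16/9*(2/5) by apply: ler_wpM2l; clear -e2 e3 e4; lra.
  by lra.
 rewrite -[leRHS]mulrA; apply: ler_wpM2l; first exact: cn_ge0.
 have i0 : 0 <= (X j.+1 - 1) ^- 2 by rewrite invr_ge0 sqr_ge0.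
 move: e2 e3 e4 i0; set p := _ ^- 2; set q := (_+5/2)^-1; set r := (_+7/2)^-1; clear.
 by nra.
apply/ler_addgt0Pr => e e0; have [N HN] := app e e0.
have [_ q] := HN N.+1 (leqnSn _); apply: le_trans q; apply: le_trans (low N).
apply: ler_wpM2l; first exact: cn_ge0.
have : 0 <= (N%:R+5/2)^-1 :> R by rewrite invr_ge0; have : 0 <= N%:R :> R by []; lra.
by lra.
Qed.

(** [quad w + 1/4] is [(w+1/2)^2], and dividing by [quad w*quad w'], which is close to [1/16], gives
    factors between 12 and 17. *)
Lemma entry_orbit1B w w' : cn (w+1/2) <= 1/20 -> cn (w'+1/2) <= 1/20 ->
 12*cn ((w+1/2)^+2 - (w'+1/2)^+2) <= cn (entry_orbit w 1 - entry_orbit w' 1)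
  <= 17*cn ((w+1/2)^+2 - (w'+1/2)^+2).
Proof.
have E (x : C) : quad x = (x+1/2)^+2 - 1/4 by rewrite /quad; field.
have q4 : cn (1/4 : C) = 1/4 by rewrite cn_div cn1 cn_nat.
have bd (x : C) : cn (x+1/2) <= 1/20 -> 99/400 <= cn (quad x) <= 101/400.
 move=> h; have h2 : cn ((x+1/2)^+2) <= 1/400.
  by rewrite cnX; have := cn_ge0 (x+1/2); clear -h; nra.
 have := cnB ((x+1/2)^+2) (1/4); rewrite -E q4.
 have := cnB ((x+1/2)^+2) (quad x); rewrite E opprB addrCA subrr addr0 -E q4.
 by move=> ? ?; apply/andP; split; lra.
move=> h h'; have /andP[a1 a2] := bd _ h; have /andP[b1 b2] := bd _ h'.
have n1 : quad w != 0 by rewrite -cn_gt0; clear -a1; lra.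
have n2 : quad w' != 0 by rewrite -cn_gt0; clear -b1; lra.
rewrite /entry_orbit /=.
have -> : - (quad w)^-1 - - (quad w')^-1 = (quad w - quad w')/(quad w*quad w').
 by field; rewrite n1 n2.
have -> : quad w - quad w' = (w+1/2)^+2 - (w'+1/2)^+2 by rewrite !E; ring.
rewrite cn_div cnM; have c0 := cn_ge0 ((w+1/2)^+2 - (w'+1/2)^+2).
have p0 : 0 < cn (quad w)*cn (quad w') by apply: mulr_gt0; clear -a1 b1; lra.
rewrite ler_pdivlMr // ler_pdivrMr //.
move: c0; move: (cn (_-_)) => c c0; move: (cn (quad w)) (cn (quad w')) a1 a2 b1 b2 c0; clear=> p q ? ? ? ? ?.
have h1 : p*q <= 1/12 by nra.
have h2 : 1/17 <= p*q by nra.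
by apply/andP; split; nra.
Qed.

(** Two-sided comparison with squares: [-1/2] is a simple critical point of [entry]. The upper bound
    makes the stage map superattracting there; the lower one is used on the circle
    [|w+1/2| = 1/40]. *)
Lemma entry_lip w w' : cn (w+1/2) <= 1/20 -> cn (w'+1/2) <= 1/20 ->
 3*cn ((w+1/2)^+2 - (w'+1/2)^+2) <= cn (entry w - entry w')
  <= 17*cn ((w+1/2)^+2 - (w'+1/2)^+2).
Proof.
move=> h h'; have [h1 h2] := entry_sub 1 h h'; have /andP[h3 h4] := entry_orbit1B h h'.
by apply/andP; split; lra.
Qed.

Lemma quad_refz i : iter i quad (- (1/2) : C) = - (refz R i)%:C.
Proof.
elim: i => [|i IH] /=; first by rewrite rmorphM fmorphV rmorph1 rmorph_nat.
by rewrite IH /quad sqrrN rmorphB rmorphXn opprB addrC.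
Qed.

Lemma entry_crit : entry (- (1/2)) = 0.
Proof.
apply/eqP; rewrite -cn_eq0 eq_le cn_ge0 andbT; apply/ler_addgt0Pr => e e0; rewrite add0r.
have [N N0 HN] := inv_small 1 e0.
have := @entryP (- (1/2)) _ N; rewrite addNr cn0 => /(_ ltac:(lra)).
rewrite /entry_orbit quad_refz invrN opprK refzE fmorphV invrK subrr sub0r cnN => /le_trans; apply.
by rewrite -[leLHS]mul1r; apply: HN; rewrite leqW.
Qed.

End Entry.

(** * Relative angle of a complex orbit and the reference *)

Section GateStep.
Variable R : realType.
Local Notation C := R[i].

Lemma cn_ge_sub (x y : C) (b d : R) : b <= cn y -> cn (x-y) <= d -> b - d <= cn x.
Proof. by move=> h1 h2; have := cn_sub_ge y x; rewrite cnBC; lra. Qed.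
Lemma cn_inv_le (x : C) (b : R) : 0 < b -> b <= cn x -> cn x^-1 <= b^-1.
Proof. by move=> b0 h; rewrite cnV lef_pV2 ?posrE // (lt_le_trans b0). Qed.

(* [k*s] is the tangent of the difference of the angles of [u] and [v]. *)
Definition rel_angle (k u v s : C) := u - v = s*(k^+2+u*v).

Lemma rel_angleE k u v s : rel_angle k u v s -> u*(1-s*v) = v + k^+2*s.
Proof.
move=> h; apply/eqP; rewrite -subr_eq0.
have -> : u*(1-s*v) - (v+k^+2*s) = (u-v) - s*(k^+2+u*v) by ring.
by rewrite h subrr.
Qed.

(** [k*gate_B/gate_A] is the tangent of the difference of two angle increments, that of [u] at rate
    [q] and that of [v] at rate [r]. Working with the fraction avoids complex arctangents. *)
Definition gate_A (k u v q r : C) := (1+q*u)*(1+r*v) + k^+2*q*r.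
Definition gate_B (u v q r : C) := (q-r) - q*r*(u-v).

(** Addition formula for tangents, read as a Moebius action on [s]. *)
Lemma rel_angle_step k u v s q r : rel_angle k u v s ->
 gate_A k u v q r - k^+2*s*gate_B u v q r != 0 ->
 rel_angle k (u + q*(u^+2+k^+2)) (v + r*(v^+2+k^+2))
  ((s*gate_A k u v q r + gate_B u v q r)/(gate_A k u v q r - k^+2*s*gate_B u v q r)).
Proof.
move=> h; set A := gate_A _ _ _ _ _; set B := gate_B _ _ _ _ => n0.
set u' := u + _; set v' := v + _; set Q := k^+2 + u*v in h.
have hQ : k^+2 + u'*v' = Q*(A-k^+2*s*B).
 have -> : Q*(A-k^+2*s*B) = Q*A - k^+2*(s*Q)*B by ring.
 by rewrite -h /Q /A /B /gate_A /gate_B /u' /v'; ring.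
have hD : u' - v' = Q*(s*A+B).
 have -> : Q*(s*A+B) = (s*Q)*A + Q*B by ring.
 by rewrite -h /Q /A /B /gate_A /gate_B /u' /v'; ring.
by rewrite /rel_angle hQ hD; field.
Qed.

Lemma gate_step (X Z v u s tau k : C) (m eta T sg : R) :
 0 < m -> m <= 1/100 -> 0 <= eta -> eta <= 1 -> 0 <= sg -> 0 <= T ->
 cn (Z-X-tau) <= eta -> cn tau <= T -> (T+4)*(T+1) <= m*cn X ->
 rel_angle k u v s -> cn s <= sg -> sg*cn v <= 1/4 -> cn v <= m*cn X ->
 cn k^+2*sg <= m -> cn k <= m*cn X -> sg <= 1 ->
 cn (u/Z) <= 2 * m /\
  exists2 s', rel_angle k (u + (Z-1)^-1*(u^+2+k^+2))
   (v + (X-1)^-1*(v^+2+k^+2)) s' &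
  cn (s'-s+tau/X^+2) <= (2*eta + (7+6*T) * m
    + 2*sg*(cn v^+2 + cn k^+2))/cn X^+2.
Proof.
move=> m0 m1 e0 e1 sg0 T0 hZ ht hX hr hs hsv hv hks hk sg1.
set x := cn X in hX hv hk *.
have x0 : 0 < x by clear -hX m0 T0; have := mulr_ge0 T0 T0; nra.
have hx : 4 <= m*x by clear -hX T0; nra.
have x400 : 400 <= x by clear -hx m1 x0 m0; nra.
have ZX : cn (Z-X) <= T + 1.
 rewrite -[Z - X](subrK tau); apply: cnD_le; clear -hZ ht e1; lra.
have T1 : T + 1 <= m*x by clear -hX T0; nra.
have mx1 : m*x <= 1/100*x by rewrite ler_pM2r.
have X1 : x*(99/100) <= cn (X-1).
 by have := cn_sub_ge X 1; rewrite cn1 -/x; clear -x400; lra.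
have Z1 : x*(98/100) <= cn (Z-1).
 have -> : Z - 1 = (X-1) - (X-Z) by ring.
 have := cn_sub_ge (X-1) (X-Z); rewrite [cn (X-Z)]cnBC.
 have : x - 1 <= cn (X-1) by have := cn_sub_ge X 1; rewrite cn1 -/x.
 by clear -ZX T1 mx1 x400; lra.
have Zx : x*(98/100) <= cn Z.
 by have := cn_sub_ge X (X-Z); rewrite subKr [cn (X-Z)]cnBC -/x; clear -ZX T1 mx1 x400; lra.
have Z0 : Z != 0 by rewrite -cn_gt0; clear -Zx x0; lra.
have Z10 : Z - 1 != 0 by rewrite -cn_gt0; clear -Z1 x0; lra.
have X10 : X - 1 != 0 by rewrite -cn_gt0; clear -X1 x0; lra.
have X0 : X != 0 by rewrite -cn_gt0.
set q := (Z-1)^-1; set r := (X-1)^-1.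
have qx : cn q <= 103/100/x.
 have -> : 103/100/x = (x*(100/103))^-1 by field; rewrite gt_eqF.
 by apply: cn_inv_le; clear -Z1 x0; lra.
have rx : cn r <= 102/100/x.
 have -> : 102/100/x = (x*(100/102))^-1 by field; rewrite gt_eqF.
 by apply: cn_inv_le; clear -X1 x0; lra.
have q0 := cn_ge0 q; have r0 := cn_ge0 r; have v0 := cn_ge0 v; have k0 := cn_ge0 k.
have s0 := cn_ge0 s; have u0 := cn_ge0 u.
have k20 : 0 <= cn k^+2 by exact: sqr_ge0.
have xi : 0 < x^-1 by rewrite invr_gt0.
have xix : x*x^-1 = 1 by rewrite mulfV // gt_eqF.
have sv : cn (s*v) <= 1/4.
 by rewrite cnM; apply: le_trans hsv; apply: ler_wpM2r.
have d1 : 3/4 <= cn (1-s*v).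
 by have := cn_sub_ge 1 (s*v); rewrite cn1; clear -sv; lra.
have d10 : 1 - s*v != 0 by rewrite -cn_gt0; clear -d1; lra.
have ks : cn (k^+2*s) <= m.
 by rewrite cnM cnX; apply: le_trans hks; apply: ler_wpM2l.
have hu : cn u <= 7/5*(m*x).
 have E := rel_angleE hr.
 have : cn u*cn (1-s*v) <= m*x + m.
  by rewrite -cnM E; apply: cnD_le; exact: lerD.
 by clear -d1 u0 x400 m0; nra.
have qu : cn (q*u) <= 3/2 * m.
 rewrite cnM; apply: le_trans (ler_pM q0 u0 qx hu) _.
 have -> : 103/100/x*(7/5*(m*x)) = 1442/1000*(m*(x*x^-1)) by field; rewrite gt_eqF.
 by rewrite xix; clear -m0; lra.
have rv : cn (r*v) <= 11/10 * m.
 rewrite cnM; apply: le_trans (ler_pM r0 v0 rx hv) _.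
 have -> : 102/100/x*(m*x) = 102/100*(m*(x*x^-1)) by field; rewrite gt_eqF.
 by rewrite xix; clear -m0; lra.
have qr : cn (q*r) <= 106/100*(x^-1*x^-1).
 rewrite cnM; apply: le_trans (ler_pM q0 r0 qx rx) _.
 have -> : 103/100/x*(102/100/x) = 10506/10000*(x^-1*x^-1) by field; rewrite gt_eqF.
 by rewrite ler_pM2r ?mulr_gt0 //; clra.
have kqr : cn (k^+2*q*r) <= 1/50 * m.
 rewrite -mulrA cnM cnX.
 have k2 : cn k^+2 <= (m*x)^+2 by rewrite lerXn2r ?nnegrE // (le_trans k0).
 apply: le_trans (ler_pM k20 (cn_ge0 _) k2 qr) _.
 have -> : (m*x)^+2*(106/100*(x^-1*x^-1)) = 106/100 * m*(m*(x*x^-1*(x*x^-1))).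
  by field; rewrite gt_eqF.
 by rewrite xix; clear -m0 m1; nra.
pose a := gate_A k u v q r - 1.
have ha : cn a <= 27/10 * m.
 have -> : a = q*u + r*v + (q*u)*(r*v) + k^+2*q*r by rewrite /a /gate_A; ring.
 have h4 : cn ((q*u)*(r*v)) <= 3/2 * m*(11/10 * m).
  by rewrite cnM; apply: ler_pM; rewrite ?cn_ge0.
 have := cnD (q*u + r*v + (q*u)*(r*v)) (k^+2*q*r).
 have := cnD (q*u+r*v) ((q*u)*(r*v)).
 have := cnD (q*u) (r*v).
 by clear -h4 qu rv kqr m0 m1; nra.
have AE : gate_A k u v q r = 1 + a by rewrite /a; ring.
pose E := (cn v^+2 + cn k^+2)*(x^-1*x^-1).
have E0 : 0 <= E by rewrite mulr_ge0 ?addr_ge0 ?sqr_ge0 // mulr_ge0 // ltW.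
have huv : u - v = s*(k^+2+v^+2)/(1-s*v).
 apply: (mulIf d10); rewrite mulfVK // mulrBl (rel_angleE hr); ring.
have hB2 : cn (q*r*(u-v)) <= 3/2*(sg*E).
 rewrite cnM huv cn_div cnM.
 have h1 : cn (k^+2+v^+2) <= cn v^+2 + cn k^+2.
  by rewrite addrC -!cnX; exact: cnD.
 have h2 : cn s*cn (k^+2+v^+2)/cn (1-s*v) <= sg*(cn v^+2 + cn k^+2)*(4/3).
  have -> : 4/3 = (3/4)^-1 :> R by rewrite invf_div.
  apply: ler_pM; [by rewrite mulr_ge0 ?cn_ge0|by rewrite invr_ge0 cn_ge0| |].
   by apply: ler_pM; rewrite ?cn_ge0.
  by rewrite lef_pV2 ?posrE //; clear -d1; lra.
 apply: le_trans (ler_pM (cn_ge0 _) _ qr h2) _.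
  by rewrite !mulr_ge0 ?invr_ge0 ?cn_ge0.
 have -> : 106/100*(x^-1*x^-1)*(sg*(cn v^+2 + cn k^+2)*(4/3)) =
   424/300*(sg*E) by rewrite /E; field; rewrite gt_eqF.
 by have := mulr_ge0 sg0 E0; clra.
have qrE : q - r = (X-Z)*(q*r) by rewrite /q /r; field; rewrite Z10 X10.
have y0 : 0 < x^-1*x^-1 by rewrite mulr_gt0.
have hqr : cn (q-r) <= (T+1)*(106/100*(x^-1*x^-1)).
 by rewrite qrE cnM; apply: ler_pM; rewrite ?cn_ge0 // cnBC.
have htq : cn (q-r+tau/X^+2) <= (106/100*eta + 109/100 * m)*(x^-1*x^-1).
 have -> : q - r + tau/X^+2 = - ((Z-X-tau)*(q*r)) +
   tau*(q*r*((Z-X)*(X-1) - 2*X + 1)/X^+2).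
  by rewrite /q /r; field; rewrite Z10 X10 X0.
 apply: cnD_le; rewrite cnN [leRHS]mulrDl; apply: lerD.
  have -> : 106/100*eta*(x^-1*x^-1) = eta*(106/100*(x^-1*x^-1)) by ring.
  by rewrite cnM; apply: ler_pM; rewrite ?cn_ge0.
 have h1 : cn ((Z-X)*(X-1) - 2*X + 1) <= (T+4)*(101/100*x).
  have h2 : cn ((Z-X)*(X-1)) <= (T+1)*(101/100*x).
   rewrite cnM; apply: ler_pM; rewrite ?cn_ge0 //.
   by apply: cnB_le; rewrite cn1 -/x; clear -x400; lra.
  apply: cnD_le; rewrite cn1.
  have := cnB ((Z-X)*(X-1)) (2*X); rewrite [cn (2*X)]cnM cn_nat -/x.
  by clear -h2 x400; lra.
 rewrite cnM cn_div cnX -/x cnM.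
 apply: (@le_trans _ _ (T*(106/100*(x^-1*x^-1)*((T+4)*(101/100*x))/x^+2))).
  apply: ler_pM; rewrite ?cn_ge0 // ?divr_ge0 ?mulr_ge0 ?cn_ge0 ?exprn_ge0 ?(ltW x0) //.
  apply: ler_wpM2r; first by rewrite invr_ge0 sqr_ge0.
  by apply: ler_pM; rewrite ?cn_ge0.
 have -> : T*(106/100*(x^-1*x^-1)*((T+4)*(101/100*x))/x^+2) =
   10706/10000*(T*(T+4))*x^-1*(x^-1*x^-1) by field; rewrite gt_eqF.
 rewrite ler_pM2r // ler_pdivrMr //.
 by clear -hX T0 m0 x0; nra.
set B := gate_B u v q r.
pose F := 106/100*(T+1)*(x^-1*x^-1) + 3/2*(sg*E).
have BF : cn B <= F.
 apply: cnB_le; rewrite /F; apply: lerD => //.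
 by apply: le_trans hqr _; rewrite le_eqVlt; apply/orP; left; apply/eqP; ring.
have F1 : F <= 1.
 have f1 : (T+1)*(x^-1*x^-1) <= 1/100.
  have : (T+1)*x^-1 <= m by rewrite ler_pdivrMr.
  have : x^-1 <= 1 by rewrite invf_le1 //; clear -x400; lra.
  by move=> a1 a2; rewrite mulrA; clear -m1 a1 a2 xi T0 m0; nra.
 have f2 : sg*E <= 2/100.
  have -> : sg*E = (sg*cn v)*(cn v*x^-1)*x^-1 + cn k^+2*sg*(x^-1*x^-1).
   by rewrite /E; ring.
  have a1 : cn v*x^-1 <= m by rewrite ler_pdivrMr.
  have a2 : x^-1 <= 1 by rewrite invf_le1 //; clear -x400; lra.
  have a3 : 0 <= cn v*x^-1 by rewrite mulr_ge0 // ltW.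
  have a4 : x^-1*x^-1 <= 1 by rewrite mulr_ile1 // ltW.
  have a5 : (sg*cn v)*(cn v*x^-1)*x^-1 <= 1/4 * m*1.
   have b1 : (sg*cn v)*(cn v*x^-1) <= 1/4 * m.
    exact: (ler_pM (mulr_ge0 sg0 v0) a3 hsv a1).
   exact: (ler_pM (mulr_ge0 (mulr_ge0 sg0 v0) a3) (ltW xi) b1 a2).
  have a6 : cn k^+2*sg*(x^-1*x^-1) <= m*1.
   by apply: ler_pM; rewrite ?mulr_ge0 // ltW.
  by clear -a5 a6 m1; lra.
 by rewrite /F; clear -f1 f2; lra.
have F0 : 0 <= F by apply: le_trans BF; exact: cn_ge0.
have ksB : cn (k^+2*s*B) <= m.
 rewrite cnM -[leRHS]mulr1; apply: ler_pM; rewrite ?cn_ge0 //.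
 exact: le_trans BF F1.
set D := gate_A k u v q r - k^+2*s*B.
have D1 : 95/100 <= cn D.
 rewrite /D AE.
 have -> : 1 + a - k^+2*s*B = 1 - (k^+2*s*B-a) by ring.
 have := cn_sub_ge 1 (k^+2*s*B-a); have := cnB (k^+2*s*B) a; rewrite cn1.
 by clear -ha ksB m1; lra.
have D0 : D != 0 by rewrite -cn_gt0; clear -D1; lra.
split.
 rewrite cn_div ler_pdivrMr ?cn_gt0 //; apply: le_trans hu _.
 by have := ler_wpM2l (ltW m0) Zx; have := mulr_gt0 m0 x0; clra.
exists ((s*gate_A k u v q r + B)/D); first exact: rel_angle_step.
(* Three parts: the drift estimated above, the second-order part of [gate_B], and the nonlinearity
   of the Moebius action, which carries a factor [B]. *)
have -> : (s*gate_A k u v q r + B)/D - s + tau/X^+2 =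
  (q-r+tau/X^+2) - q*r*(u-v) + B*(k^+2*s*s-a+k^+2*s*B)/D.
 have e : B = q - r - q*r*(u-v) by [].
 have -> : q - r + tau/X^+2 - q*r*(u-v) = B + tau/X^+2 by rewrite e; ring.
 rewrite [RHS]addrAC; congr (_+_); apply: (mulIf D0).
 by rewrite mulrBl (mulfVK D0) [RHS]mulrDl (mulfVK D0) /D AE; ring.
have hlast : cn (B*(k^+2*s*s-a+k^+2*s*B)/D) <= 5 * m*F.
 rewrite cn_div cnM.
 have h1 : cn (k^+2*s*s-a+k^+2*s*B) <= 47/10 * m.
  have h2 : cn (k^+2*s*s) <= m.
   by rewrite cnM -[leRHS]mulr1; apply: ler_pM; rewrite ?cn_ge0 // (le_trans hs).
  have := cnD (k^+2*s*s-a) (k^+2*s*B).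
  by have := cnB (k^+2*s*s) a; clear -h2 ha ksB; lra.
 rewrite ler_pdivrMr ?cn_gt0 //.
 apply: le_trans (ler_pM (cn_ge0 _) (cn_ge0 _) BF h1) _.
 by have := mulr_ge0 (ltW m0) F0; clear -D1; nra.
apply: cnD_le.
have h1 := cnB (q-r+tau/X^+2) (q*r*(u-v)).
have -> : (2*eta + (7+6*T) * m + 2*sg*(cn v^+2 + cn k^+2))/x^+2 =
  (2*eta + (7+6*T) * m)*(x^-1*x^-1) + 2*(sg*E).
 by rewrite /E; field; rewrite gt_eqF.
have h2 : 5 * m*F <= 53/10*(m*(T+1))*(x^-1*x^-1) + 75/1000*(sg*E).
 rewrite /F; have := mulr_ge0 sg0 E0; move: (sg*E) => g g0.
 by clear -m0 m1 g0 T0 y0; nra.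
have h3 : (106/100*eta + 109/100 * m)*(x^-1*x^-1) + 53/10*(m*(T+1))*(x^-1*x^-1)
  <= (2*eta + (7+6*T) * m)*(x^-1*x^-1).
 rewrite -mulrDl ler_pM2r //; have := mulr_ge0 (ltW m0) T0; clear -m0 e0; nra.
have := mulr_ge0 sg0 E0; clear -h1 h2 h3 hlast htq hB2; lra.
Qed.

End GateStep.

Section GateDiff.
Variable R : realType.
Local Notation C := R[i].
Local Notation X := (refX R).
Local Notation z := (refz R).
Implicit Types (a M c n : nat) (ka : R).

Lemma real_gate_step (x y k : R) : (y + (x-1)^-1*(y^+2+k^+2))%:C =
 y%:C + (x%:C-1)^-1*(y%:C^+2+k%:C^+2) :> C.
Proof.
have e : ((x-1)^-1)%:C = (x%:C-1)^-1 :> C by rewrite fmorphV rmorphB.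
by rewrite rmorphD rmorphM /= e rmorphD !rmorphXn.
Qed.

Lemma energyE ka n j : z (n+j)^+2*(us ka n j^+2 + ka^+2) =
 vs ka n j.+1 - vs ka n j + z (n+j)^+2*us ka n j.
Proof.
have z0 := refz_gt0 R (n+j); have /andP[_ z1] := refz_bound R (n+j).
rewrite !vsE us_step addnS /=.
have n0 : 1 - z (n+j) != 0 by rewrite gt_eqF //; lra.
by field.
Qed.

Lemma near_sqrt_small (K e : R) : 0 < e -> \forall n \near \oo, K/Num.sqrt n%:R <= e.
Proof.
move=> e0; near=> n.
have n0 : 0 < n%:R :> R by rewrite ltr0n; near: n; exact: nbhs_infty_gt.
rewrite ler_pdivrMr ?sqrtr_gt0 // -ler_pdivrMl //.
apply: le_trans (ler_norm _) _.
rewrite -sqrtr_sqr ler_sqrt ?ltW //.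
by near: n; exact: nbhs_infty_gtr.
Unshelve. all: by end_near. Qed.

(** By [energyE] each summand is an increment of [v] plus [z^2*u]: the increments telescope to at
    most [2/M] and the rest is [O(1/sqrt n)]. A merely bounded sum would leave in [gate_step] an
    error of the order [1/n] of [s] itself. *)
Lemma energy_sum a ka M c : (1 < a)%N -> 0 < ka -> pi/ka = ln a%:R ->
 (20 <= M)%N -> in_gate a ka M c ->
 \forall n \near \oo, forall i, (M <= i)%N -> (n + i + c*M <= a*n)%N ->
 \sum_(M <= j < i) z (n+j)^+2*(us ka n j^+2 + ka^+2) <= 3/M%:R.
Proof.
move=> a1 ka0 pik M20 G; have [K K0 HK] := gate_core a1 ka0 pik M20 G.
have Mr : 0 < M%:R :> R by rewrite ltr0n; apply: leq_trans M20.
near=> n => i Mi hi.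
have n0 : (0 < n)%N by near: n; exact: nbhs_infty_gt.
have Gn : forall i, (M <= i)%N -> (n + i + c*M <= a*n)%N -> `|vs ka n i| <= M%:R^-1.
 by near: n.
have HKn : forall i, (M <= i)%N -> (n + i + c*M <= a*n)%N -> `|us ka n i| <= K*n%:R.
 by near: n; apply: filterS HK => n h j hj1 hj2; have [] := h j hj1 hj2.
have hM : (n + M + c*M <= a*n)%N by apply: leq_trans hi; rewrite leq_add2r leq_add2l.
have sq : (1+K)/Num.sqrt n%:R <= 1/M%:R.
 by near: n; apply: near_sqrt_small; rewrite divr_gt0.
rewrite (eq_bigr (fun j => (vs ka n j.+1 - vs ka n j) + z (n+j)^+2*us ka n j)); last first.
 by move=> j _; exact: energyE.
rewrite big_split /= telescope_sumr //.
have h1 := le_trans (sum_abs_bound ka0 n0 Mi (HKn M (leqnn _) hM) (HKn i Mi hi)) sq.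
have h2 : \sum_(M <= j < i) z (n+j)^+2*us ka n j <= \sum_(M <= j < i) z (n+j)^+2 * `|us ka n j|.
 by apply: ler_sum => j _; rewrite ler_wpM2l ?sqr_ge0 ?ler_norm.
have := Gn i Mi hi; have := Gn M (leqnn _) hM.
have -> : 3/M%:R = 2*M%:R^-1 + 1/M%:R :> R by ring.
move: h1 h2; rewrite !ler_norml; clear=> h1 h2 /andP[? ?] /andP[? ?].
by lra.
Unshelve. all: by end_near. Qed.

Lemma sum_refz_sqr_nat n M i : (M <= i)%N ->
 \sum_(M <= j < i) z (n+j)^+2 = z (n+M) - z (n+i).
Proof.
move=> Mi; rewrite (eq_bigr (fun j => (- z (n+j.+1)) - (- z (n+j)))); last first.
 by move=> j _; rewrite addnS /=; ring.
by rewrite telescope_sumr // opprK addrC.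
Qed.

Lemma us_step_inv ka n j : us ka n j.+1 = us ka n j + (X (n+j) - 1)^-1*(us ka n j^+2 + ka^+2).
Proof.
rewrite us_step; congr (_+_*_); rewrite refzE.
have := refX_ge2 R (n+j) => h.
have h0 : X (n+j) != 0 by rewrite gt_eqF //; lra.
have h1 : X (n+j) - 1 != 0 by rewrite gt_eqF //; lra.
by field; rewrite h0 h1.
Qed.

(** The drifts [- tau*z^2] telescope to [- tau*(z (n+M) - z (n+i))]. All quantities have order
    [1/n], so errors must be a small multiple of [1/n]; the bound on [s] required at each step is
    recovered from the estimate being proved. *)
Lemma gate_diff a ka c (T S0 : R) : (1 < a)%N -> 0 < ka -> pi/ka = ln a%:R ->
 0 <= T -> 0 <= S0 ->
 exists2 C9, 1 <= C9 & exists M1, forall M, (M1 <= M)%N -> in_gate a ka M c ->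
 forall eta, 0 <= eta -> 2*C9*eta <= 1 ->
 \forall n \near \oo, forall (Z u : nat -> C) (tau s0 : C), cn tau <= T ->
  (forall j, (M <= j)%N -> (n + j + c*M <= a*n)%N -> cn (Z j - (X (n+j))%:C - tau) <= eta) ->
  (forall j, (M <= j)%N -> (n + j + c*M <= a*n)%N ->
   u j.+1 = u j + (Z j - 1)^-1*(u j^+2 + ka%:C^+2)) ->
  rel_angle ka%:C (u M) (us ka n M)%:C s0 -> cn s0 <= S0/n%:R ->
  forall i, (M <= i)%N -> (n + i + c*M <= a*n)%N -> cn (u i/Z i) <= 2/M%:R /\
   exists2 s, rel_angle ka%:C (u i) (us ka n i)%:C s &
    cn (s - s0 + tau*(z (n+M) - z (n+i))%:C) <= C9*(M%:R^-1+eta)/n%:R.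
Proof.
move=> a1 ka0 pik T0 S00; have [Cx Cx1 HCx] := refX_lin R.
(* Budget for [n*|s|]: the initial value, the total drift, and 1 for the accumulated error. *)
pose S := S0 + T + 1; pose C9 := 9 + 6*T + 6*S.
have Sp : 1 <= S by rewrite /S; lra.
have C91 : 9 <= C9 by rewrite /C9; lra.
have ar := a_gt0 R a1.
exists C9; first by lra.
have [N1 _ HN1] := inv_small (2*C9) (ltr01 : 0 < (1 : R)).
have [N2 _ HN2] := inv_small (S*Cx*a%:R) (ltac:(lra) : 0 < 1/4 :> R).
exists (100+N1+N2)%N => M hM G eta e0 eC.
have M100 : (100 <= M)%N by move: hM; clia.
have M20 : (20 <= M)%N by apply: leq_trans M100.
have Mr : 100 <= M%:R :> R by rewrite (ler_nat R 100).
have Mp : 0 < M%:R :> R by lra.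
have mp : 0 < M%:R^-1 :> R by rewrite invr_gt0.
have m1 : M%:R^-1 <= 1/100 :> R.
 by rewrite -[leRHS]invrK lef_pV2 ?posrE ?invr_gt0 ?invf_div; clear -Mp Mr; lra.
have C9m : 2*C9*M%:R^-1 <= 1 by apply: HN1; move: hM; clia.
have SCm : S*Cx*a%:R*M%:R^-1 <= 1/4 by apply: HN2; move: hM; clia.
have En := energy_sum a1 ka0 pik M20 G.
near=> n => Z u tau s0 ht hZ hu hs0 s0S.
have n0 : (0 < n)%N by near: n; exact: nbhs_infty_gt.
have nr := natr_gt0 R n0.
have nr1 : 1 <= n%:R :> R by rewrite ler1n.
have Gn : forall i, (M <= i)%N -> (n + i + c*M <= a*n)%N -> `|vs ka n i| <= M%:R^-1.
 by near: n.
have Enn : forall i, (M <= i)%N -> (n + i + c*M <= a*n)%N ->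
 \sum_(M <= j < i) z (n+j)^+2*(us ka n j^+2 + ka^+2) <= 3/M%:R by near: n.
have nT : (T+4)*(T+1)*M%:R <= n%:R by near: n; exact: nbhs_infty_ger.
have nk : ka*M%:R <= n%:R by near: n; exact: nbhs_infty_ger.
have nS : S <= n%:R by near: n; exact: nbhs_infty_ger.
have nkS : ka^+2*S*M%:R <= n%:R by near: n; exact: nbhs_infty_ger.
pose sg := S/n%:R.
have sg0 : 0 <= sg by rewrite divr_ge0 ?(ltW nr) //; clear -Sp; lra.
have e1 : eta <= 1 by clear -e0 eC C91; nra.
have zM : z (n+M) <= n%:R^-1.
 by apply: le_trans (refz_ltV R n0); rewrite refz_le // leq_addr.
have dz i : (M <= i)%N -> 0 <= z (n+M) - z (n+i) <= n%:R^-1.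
 move=> Mi; have := refz_gt0 R (n+i); have : z (n+i) <= z (n+M).
  by rewrite refz_le // leq_add2l.
 by have := zM; clear=> h1 h2 h3; apply/andP; split; lra.
pose err j := (2*eta + (7+6*T)*M%:R^-1)*z (n+j)^+2 +
  2*sg*(z (n+j)^+2*(us ka n j^+2 + ka^+2)).
have errS i : (M <= i)%N -> (n + i + c*M <= a*n)%N ->
  \sum_(M <= j < i) err j <= C9*(M%:R^-1+eta)/n%:R.
 move=> Mi hi; rewrite big_split /= -!mulr_sumr sum_refz_sqr_nat //.
 have /andP[d0 d1] := dz i Mi; have E3 := Enn i Mi hi.
 have h1 : (2*eta + (7+6*T)*M%:R^-1)*(z (n+M) - z (n+i)) <=
      (2*eta + (7+6*T)*M%:R^-1)*n%:R^-1.
  by apply: ler_wpM2l => //; rewrite addr_ge0 // mulr_ge0 //; clear -e0 T0; lra.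
 have h2 := ler_wpM2l (mulr_ge0 (ler0n R 2) sg0) E3.
 apply: le_trans (lerD h1 h2) _.
 have -> : 2*sg*(3/M%:R) = 6*S*M%:R^-1*n%:R^-1 by rewrite /sg; ring.
 rewrite -mulrDl ler_pM2r ?invr_gt0 // /C9.
 have := mulr_ge0 T0 e0; have : 0 <= S*eta by rewrite mulr_ge0 //; clear -Sp; lra.
 by clear -e0 mp; lra.
have St i' s : (M <= i')%N -> (n + i' + c*M <= a*n)%N ->
  rel_angle ka%:C (u i') (us ka n i')%:C s ->
  cn (s - s0 + tau*(z (n+M) - z (n+i'))%:C) <= \sum_(M <= j < i') err j ->
  cn (u i'/Z i') <= 2/M%:R /\ exists2 s', rel_angle ka%:C (u i'.+1) (us ka n i'.+1)%:C s' &
   cn (s' - s + tau*(z (n+i')^+2)%:C) <= err i'.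
 move=> Mi hi hs hb.
 have /andP[d0 d1] := dz i' Mi; have hE := errS i' Mi hi.
 have X0 := refX_gt0 R (n+i').
 have Xn : n%:R <= X (n+i').
  by apply: le_trans (ltW (refX_gtn R _)); rewrite ler_nat leq_addr.
 have ssg : cn s <= sg.
  have -> : s = (s - s0 + tau*(z (n+M) - z (n+i'))%:C) + s0 - tau*(z (n+M) - z (n+i'))%:C by ring.
  apply: cnB_le; have := cnD (s - s0 + tau*(z (n+M) - z (n+i'))%:C) s0.
  have : cn (tau*(z (n+M) - z (n+i'))%:C) <= T*n%:R^-1.
   by rewrite cnM cn_real ger0_norm //; apply: ler_pM; rewrite ?cn_ge0.
  have : C9*(M%:R^-1+eta)/n%:R <= 1*n%:R^-1.
   rewrite ler_pM2r ?invr_gt0 //; clear -C9m eC; lra.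
  have -> : sg = S0/n%:R + T*n%:R^-1 + 1*n%:R^-1 by rewrite /sg /S; ring.
  clear -hb hE s0S; lra.
 have vX : us ka n i' = X (n+i')*vs ka n i'.
  by rewrite /us mulrC.
 have usX : `|us ka n i'| <= M%:R^-1*X (n+i').
  by rewrite vX normrM gtr0_norm // mulrC ler_pM2r // Gn.
 have XC : X (n+i') <= Cx*a%:R*n%:R.
  apply: le_trans (HCx _ _) _; first by rewrite addn_gt0 n0.
  rewrite -mulrA -natrM ler_wpM2l ?ler_nat //; first by clear -Cx1; lra.
  exact: leqDl hi.
 have := @gate_step R (X (n+i'))%:C (Z i') (us ka n i')%:C (u i') s tau ka%:C
  M%:R^-1 eta T sg mp m1 e0 e1 sg0 T0 (hZ i' Mi hi) ht.
 rewrite !cn_real (gtr0_norm X0) (gtr0_norm ka0) real_normK ?num_real //.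
 have c1 : (T+4)*(T+1) <= M%:R^-1*X (n+i').
  by rewrite [leRHS]mulrC ler_pdivlMr //; exact: le_trans Xn.
 have c2 : sg * `|us ka n i'| <= 1/4.
  apply: le_trans (ler_wpM2l sg0 usX) _; apply: le_trans SCm.
  have -> : S*Cx*a%:R*M%:R^-1 = sg*(M%:R^-1*(Cx*a%:R*n%:R)).
   by rewrite /sg; field; rewrite !gt_eqF.
  by rewrite ler_wpM2l // ler_pM2l.
 have c3 : ka^+2*sg <= M%:R^-1.
  rewrite /sg mulrA ler_pdivrMr // -ler_pdivrMl // invrK mulrC //.
 have c4 : ka <= M%:R^-1*X (n+i').
  by rewrite mulrC ler_pdivlMr //; exact: le_trans Xn.
 have c5 : sg <= 1 by rewrite /sg ler_pdivrMr // mul1r.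
 move=> /(_ c1 hs ssg c2 usX c3 c4 c5) [b1 [s' hs' b2]]; split=> //.
 exists s'.
  rewrite hu // us_step_inv.
  by rewrite real_gate_step.
 have ez : (z (n+i')^+2)%:C = ((X (n+i'))%:C^+2)^-1 :> C.
  by rewrite refzE exprVn fmorphV rmorphXn.
 rewrite ez; apply: le_trans b2 _; rewrite /err.
 have -> : z (n+i')^+2 = (X (n+i')^+2)^-1 by rewrite refzE exprVn.
 by rewrite le_eqVlt; apply/orP; left; apply/eqP; ring.
have P i : (M <= i)%N -> (n + i + c*M <= a*n)%N ->
  exists2 s, rel_angle ka%:C (u i) (us ka n i)%:C s &
    cn (s - s0 + tau*(z (n+M) - z (n+i))%:C) <= \sum_(M <= j < i) err j.
 elim: i => [|i IH] Mi hi.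
  move: Mi; rewrite leqn0 => /eqP M0; rewrite -M0; exists s0 => //.
  by rewrite !subrr mulr0 addr0 cn0 big_geq.
 have [iM|iM] := ltnP i M.
  have -> : i.+1 = M by apply/eqP; rewrite eqn_leq iM Mi.
  by exists s0 => //; rewrite !subrr mulr0 addr0 cn0 big_geq.
 have hi' : (n + i + c*M <= a*n)%N by apply: leq_trans hi; rewrite leq_add2r leq_add2l.
 have [s hs hb] := IH iM hi'.
 have [_ [s' hs' hb']] := St i s iM hi' hs hb.
 exists s' => //; rewrite big_nat_recr //=.
 have -> : s' - s0 + tau*(z (n+M) - z (n+i.+1))%:C =
   (s - s0 + tau*(z (n+M) - z (n+i))%:C) + (s' - s + tau*(z (n+i)^+2)%:C).
  rewrite addnS /=.
  have -> : z (n+M) - (z (n+i) - z (n+i)^+2) = (z (n+M) - z (n+i)) + z (n+i)^+2 by ring.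
  by rewrite rmorphD; ring.
 by apply: cnD_le; exact: lerD.
move=> i Mi hi; have [s hs hb] := P i Mi hi.
split; last by exists s => //; apply: le_trans hb (errS i Mi hi).
by have [] := St i s Mi hi hs hb.
Unshelve. all: by end_near. Qed.

End GateDiff.

(** * Exit parametrisation of backward orbits *)

Section ExitMap.
Variables (R : realType) (r : nat -> R).
Hypothesis r0 : forall j, 0 < r j.
Hypothesis rS : forall j, r j = quad (r j.+1).
Local Notation C := R[i].
Let V j := (r j)^-1.

Lemma refV_gt0 j : 0 < V j.
Proof. by rewrite invr_gt0. Qed.

Lemma refV_step j : V j.+1 = V j + V j.+1/(V j.+1 + 1).
Proof.
have h := r0 j.+1; rewrite /V (rS j) /quad; field.
by do ?[apply/andP; split]; rewrite gt_eqF //; nra.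
Qed.

Lemma refV_growth : exists2 th : R, 0 < th & forall j, th*j.+1%:R <= V j.
Proof.
exists (V 0%N/(V 0%N + 1)); first by rewrite divr_gt0 ?addr_gt0 ?refV_gt0.
have V00 := refV_gt0 0%N.
have inc j : V 0%N <= V j.
 elim: j => // j IH; apply: le_trans IH _; rewrite refV_step lerDl.
 by rewrite divr_ge0 ?addr_ge0 // ltW ?refV_gt0.
elim=> [|j IH].
 by rewrite mulr1 ler_pdivrMr ?addr_gt0 // mulrDr mulr1 lerDr mulr_ge0 // ltW.
rewrite -[j.+2%:R]natr1 mulrDr mulr1 refV_step; apply: lerD => //.
have h := refV_gt0 j.+1; have i := inc j.+1.
rewrite ler_pdivlMr ?addr_gt0 // mulrAC ler_pdivrMr ?addr_gt0 //.
by nra.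
Qed.

Lemma quad_inv (x y : C) : x != 0 -> y != 0 -> 1 + x != 0 -> 1 + y != 0 ->
 (quad x)^-1 - (quad y)^-1 = (x^-1-y^-1)*(1 - ((x^-1+1)*(y^-1+1))^-1).
Proof.
move=> x0 y0 x1 y1; rewrite /quad; field; rewrite x0 y0.
have -> : x + x^+2 = x*(1+x) by ring.
have -> : y + y^+2 = y*(1+y) by ring.
by rewrite x1 y1 !mulf_neq0.
Qed.

Lemma quad_near (x : C) (v B : R) : 0 <= B -> 2*B <= v -> 0 < v -> cn (x^-1-v%:C) <= B ->
 [/\ x != 0, 1 + x != 0, quad x != 0, v + 1 - B <= Re (x^-1+1) & `|Im (x^-1+1)| <= B].
Proof.
move=> B0 Bv v0 h; have [h1 h2 h3] := near_real h.
have x0 : x != 0.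
 by apply/eqP => x0; move: h1; rewrite x0 invr0 /=; lra.
have x1 : 1 + x != 0.
 apply/eqP => /eqP; rewrite addrC addr_eq0 => /eqP e; move: h1; rewrite e invrN invr1 cReN /=; lra.
split=> //; last by rewrite cImD addr0.
 by rewrite /quad (_ : _ + _ = x*(1+x)) ?mulf_neq0 //; ring.
by rewrite cReD /=; lra.
Qed.

Lemma Re_mul_ge (a b : C) (p q : R) : 0 <= q -> q + 1 <= p ->
 p <= Re a -> p <= Re b -> `|Im a| <= q -> `|Im b| <= q ->
 1/2 <= Re (a*b).
Proof.
rewrite cReM; move: (Re a) (Re b) (Im a) (Im b) => s t u v.
rewrite !ler_norml => q0 qp ps pt /andP[? ?] /andP[? ?].
have h1 : p^+2 <= s*t by rewrite expr2; apply: ler_pM => //; lra.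
have h2 : u*v <= q^+2 by nra.
by nra.
Qed.

(** In the coordinate [1/x] a difference is multiplied by [1 - 1/((1/x+1)(1/y+1))] under [quad].
    With the reference as second orbit this bounds the deviation from [V], whose total change above
    level [j] is [O(1/j)]. *)
Lemma descent (B : R) : 0 <= B -> exists J, exists2 K, 0 < K & forall x y j d, (J <= j)%N ->
 cn (x^-1 - (V (j+d))%:C) <= B -> cn (y^-1 - (V (j+d))%:C) <= B ->
 [/\ iter d quad x != 0, cn ((iter d quad x)^-1 - (V j)%:C) <= B,
   cn ((iter d quad x)^-1 - (iter d quad y)^-1) <= cn (x^-1-y^-1) &
   cn ((iter d quad x)^-1 - (V j)%:C - (x^-1 - (V (j+d))%:C)) <= K/j.+1%:R].
Proof.
move=> B0; have [th th0 Hth] := refV_growth.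
have [J J0 HJ] := inv_small (2*B/th) (ltr01 : 0 < (1 : R)).
have big j : (J <= j)%N -> 2*B <= V j.
 move=> Jj; have := HJ j.+1 (leqW Jj).
 rewrite ler_pdivrMr // mul1r ler_pdivrMr // => h; apply: le_trans h _.
 by rewrite mulrC.
pose K := 1 + 2*B/th^+2.
have K0 : 0 < K by rewrite ltr_pwDl // divr_ge0 ?sqr_ge0 // mulr_ge0.
have one x y j : (J <= j)%N ->
 cn (x^-1 - (V j.+1)%:C) <= B -> cn (y^-1 - (V j.+1)%:C) <= B ->
 [/\ cn ((quad x)^-1 - (V j)%:C) <= B,
   cn ((quad x)^-1 - (quad y)^-1) <= cn (x^-1-y^-1) &
   cn ((quad x)^-1 - (V j)%:C - (x^-1 - (V j.+1)%:C)) <= K*(j.+1%:R^-1-j.+2%:R^-1)].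
 move=> Jj hx hy; have b := big j.+1 (leqW Jj); have v0 := refV_gt0 j.+1.
 have [x0 x1 _ x3 x4] := quad_near B0 b v0 hx.
 have [y0 y1 _ y3 y4] := quad_near B0 b v0 hy.
 have vV : (V j.+1)%:C = ((r j.+1)%:C)^-1 :> C by rewrite /V fmorphV.
 have hr : cn (((r j.+1)%:C)^-1 - (V j.+1)%:C) <= B by rewrite vV subrr cn0.
 have [r0' r1 _ r3 r4] := quad_near B0 b v0 hr.
 have ev : (V j)%:C = (quad (r j.+1)%:C)^-1 :> C.
  by rewrite /V rS fmorphV /quad rmorphD rmorphXn.
 have bv : B + 1 <= V j.+1 + 1 - B by move: b; clra.
 have e1 : (quad x)^-1 - (V j)%:C = (x^-1 - (V j.+1)%:C) *
   (1 - ((x^-1+1)*((r j.+1)%:C^-1 + 1))^-1).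
  by rewrite ev vV quad_inv.
 split.
 - rewrite e1 cnM; apply: le_trans hx; apply: ler_piMr; first exact: cn_ge0.
  by apply: cn_1subV; exact: (Re_mul_ge B0 bv).
 - rewrite quad_inv // cnM; apply: ler_piMr; first exact: cn_ge0.
  by apply: cn_1subV; exact: (Re_mul_ge B0 bv).
 rewrite e1 mulrBr mulr1 addrAC subrr add0r cnN cnM -vV.
 have tj := Hth j.+1.
 have c1 : V j.+1/2 <= cn (x^-1+1).
  apply: le_trans (le_trans (ler_norm _) (cn_ge_Re _)); apply: le_trans x3.
  by move: b; clra.
 have c2 : V j.+1 <= cn ((V j.+1)%:C + 1).
  rewrite -(rmorph1 (@real_complex R)) -rmorphD cn_real; apply: le_trans (ler_norm _).
  by rewrite lerDl.
 have jp : 0 < j.+1%:R :> R by rewrite ltr0n.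
 have jp2 : 0 < j.+2%:R :> R by rewrite ltr0n.
 have c3 : cn ((x^-1+1)*((V j.+1)%:C + 1))^-1 <= 2/th^+2*(j.+1%:R^-1-j.+2%:R^-1).
  have -> : 2/th^+2*(j.+1%:R^-1-j.+2%:R^-1) = (th^+2/2*(j.+1%:R*j.+2%:R))^-1.
   rewrite -[j.+2%:R]natr1; move: (j.+1%:R) jp => p pp; field.
   by rewrite !gt_eqF // addr_gt0.
  apply: cn_inv_le; first by rewrite !mulr_gt0 ?exprn_gt0 ?invr_gt0.
  rewrite cnM; apply: (@le_trans _ _ (V j.+1/2*V j.+1)).
   have t1 : th*j.+1%:R <= V j.+1.
    by apply: le_trans tj; rewrite ler_pM2l // ler_nat.
   have -> : th^+2/2*(j.+1%:R*j.+2%:R) = (th*j.+1%:R)/2*(th*j.+2%:R) by ring.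
   apply: ler_pM => //; first by rewrite divr_ge0 // mulr_ge0 // ltW.
    by rewrite mulr_ge0 // ltW.
   by rewrite ler_pM2r ?invr_gt0.
  apply: ler_pM => //; [by rewrite divr_ge0 // ltW|exact: ltW].
 apply: le_trans (ler_pM (cn_ge0 _) (cn_ge0 _) hx c3) _.
 rewrite mulrA; apply: ler_wpM2r.
  by rewrite subr_ge0 lef_pV2 ?posrE // ler_nat.
 by rewrite /K mulrA [B*2]mulrC lerDr.
exists J; exists K => // x y j d Jj.
have bJ i : (J <= j + i)%N by apply: leq_trans Jj (leq_addr _ _).
suff H : cn (x^-1 - (V (j+d))%:C) <= B -> cn (y^-1 - (V (j+d))%:C) <= B ->
  [/\ cn ((iter d quad x)^-1 - (V j)%:C) <= B, cn ((iter d quad y)^-1 - (V j)%:C) <= B,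
   cn ((iter d quad x)^-1 - (iter d quad y)^-1) <= cn (x^-1-y^-1) &
   cn ((iter d quad x)^-1 - (V j)%:C - (x^-1 - (V (j+d))%:C)) <= K*(j.+1%:R^-1 - (j+d).+1%:R^-1)].
 move=> hx hy; have [h1 h2 h3 h4] := H hx hy.
 have [x0 _ _ _ _] := quad_near B0 (big j Jj) (refV_gt0 j) h1.
 split=> //; apply: le_trans h4 _.
 by rewrite ler_pM2l // gerBl invr_ge0.
elim: d x y => [|d IH] x y hx hy.
 by split; rewrite ?addn0 ?subrr ?cn0 ?mulr0 // -[in V j](addn0 j).
rewrite addnS in hx hy.
have [p1 p2 p3] := one x y (j+d)%N (bJ d) hx hy.
have [p1' _ _] := one y x (j+d)%N (bJ d) hy hx.
have [q1 q2 q3 q4] := IH (quad x) (quad y) p1 p1'.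
rewrite !iterSr; split=> //; first exact: le_trans q3 p2.
rewrite !addnS; move: (iter d quad (quad x))^-1 q4 => A q4.
have -> : A - (V j)%:C - (x^-1 - (V (j+d).+1)%:C) =
  (A - (V j)%:C - ((quad x)^-1 - (V (j+d))%:C)) +
  ((quad x)^-1 - (V (j+d))%:C - (x^-1 - (V (j+d).+1)%:C)) by ring.
apply: cnD_le.
have -> : K*(j.+1%:R^-1 - (j+d).+2%:R^-1) = K*(j.+1%:R^-1 - (j+d).+1%:R^-1) +
  K*((j+d).+1%:R^-1 - (j+d).+2%:R^-1) by ring.
exact: lerD.
Qed.

Lemma iter_quad_cont d (l : C) (e : R) : 0 < e -> exists2 dl, 0 < dl &
 forall x, cn (x-l) <= dl -> cn (iter d quad x - iter d quad l) <= e.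
Proof.
move=> e0; have [dl dl0 H] := shadow d (cn l) e0; exists dl => // x hx.
by apply: (H (fun i => iter i quad x) l (lexx _) hx _ d) => // i _; rewrite iterS subrr cn0 ltW.
Qed.

(** Inverse of a repelling Fatou coordinate: start far up the reference backward orbit, displaced by
    [Y] in the coordinate [1/x], and come down to level [j]. *)
Definition exit_spec j (Y l : C) := forall e : R, 0 < e -> exists N, forall m, (N <= m)%N ->
 cn (iter (m-j) quad ((V m)%:C + Y)^-1 - l) <= e.

Lemma refV_unbounded (B : R) : exists J, forall j, (J <= j)%N -> B <= V j.
Proof.
have [th th0 Hth] := refV_growth.
have [J J0 HJ] := inv_small (B/th) (ltr01 : 0 < (1 : R)).
exists J => j Jj; have := HJ j.+1 (leqW Jj).
rewrite ler_pdivrMr // mul1r ler_pdivrMr // mulrC => h; exact: le_trans h (Hth j).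
Qed.

Lemma inv_diff (x y : C) (b : R) : 0 < b -> b <= cn x -> b <= cn y ->
 cn (x^-1-y^-1) <= cn (x-y)/b^+2.
Proof.
move=> b0 bx bz; have x0 : x != 0 by rewrite -cn_gt0 (lt_le_trans b0).
have y0 : y != 0 by rewrite -cn_gt0 (lt_le_trans b0).
have -> : x^-1 - y^-1 = (y-x)/(x*y) by field; rewrite x0 y0.
rewrite cn_div cnBC; apply: ler_wpM2l; first exact: cn_ge0.
have h : b^+2 <= cn (x*y) by rewrite cnM expr2; apply: ler_pM => //; exact: ltW.
by rewrite lef_pV2 ?posrE ?exprn_gt0 // cn_gt0 mulf_neq0.
Qed.

Lemma near_big (x : C) (v B : R) : cn (x-v%:C) <= B -> B + 1 <= v -> 1 <= cn x.
Proof.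
move=> /near_real[h _ _] hv; apply: le_trans (le_trans (ler_norm _) (cn_ge_Re _)); lra.
Qed.

(** [descent] works only above some level, so the limit is taken at a high level [j'] in the
    coordinate [1/x] and then brought down by continuity of finitely many steps. *)
Lemma exit_ex j (Y : C) : exists l, exit_spec j Y l.
Proof.
pose B := cn Y; have B0 : 0 <= B := cn_ge0 _.
have [J [K K0 H]] := descent (addr_ge0 B0 ler01).
have [J2 HJ2] := refV_unbounded (B+2).
pose j' := (J+J2+j)%N.
pose X m := (iter (m-j') quad ((V m)%:C + Y)^-1)^-1.
have st m : cn (((V m)%:C + Y)^-1^-1 - (V m)%:C) <= B by rewrite invrK addrC addKr.
have st1 m : cn (((V m)%:C + Y)^-1^-1 - (V m)%:C) <= B + 1 by apply: le_trans (st m) _; lra.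
have Jj' : (J <= j')%N by rewrite /j' -addnA leq_addr.
have Xb m : (j' <= m)%N -> cn (X m - (V j')%:C) <= B + 1.
 move=> jm; have [||_ + _ _] := H ((V m)%:C + Y)^-1 ((V m)%:C + Y)^-1 j' (m-j')%N Jj'.
 - by rewrite subnKC.
 - by rewrite subnKC.
 exact.
have V2 : B + 1 + 1 <= V j' by have := HJ2 j' ltac:(rewrite /j'; clia); lra.
have [l0 Hl0] : exists l, forall e : R, 0 < e -> exists N, forall m, (N <= m)%N -> cn (X m - l) <= e.
 apply: complex_cauchy_lim => e e0.
 have [N N0 HN] := inv_small K (ltac:(by rewrite divr_gt0) : 0 < e/2).
 have [N2 N20 HN2] := inv_small K (ltr01 : 0 < (1 : R)).
 exists (N+N2+j')%N.
 suff S m m' : (N + N2 + j' <= m)%N -> (m <= m')%N -> cn (X m' - X m) <= e/2.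
  move=> m m' hm hm'; have [mm|mm] := leqP m m'.
   by rewrite cnBC; apply: le_trans (S _ _ hm mm) _; lra.
  by apply: le_trans (S _ _ hm' (ltnW mm)) _; lra.
 move=> hm mm.
 have jm : (j' <= m)%N by move: hm; clia.
 have Jm : (J <= m)%N by apply: leq_trans Jj' jm.
 set y := iter (m'-m) quad ((V m')%:C + Y)^-1.
 have [||y1 y2 _ y4] := H ((V m')%:C + Y)^-1 ((V m')%:C + Y)^-1 m (m'-m)%N Jm.
 - by rewrite subnKC.
 - by rewrite subnKC.
 have -> : X m' = (iter (m-j') quad y)^-1.
  by rewrite /X /y -iterD; congr (iter _ _ _)^-1; move: mm jm; clia.
 have [||_ _ q _] := H y ((V m)%:C + Y)^-1 j' (m-j')%N Jj'.
 - by rewrite subnKC.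
 - by rewrite subnKC.
 apply: le_trans q _; rewrite invrK.
 have -> : y^-1 - ((V m)%:C + Y) = y^-1 - (V m)%:C - (((V m')%:C + Y)^-1^-1 - (V (m + (m'-m)))%:C).
  by rewrite invrK subnKC //; ring.
 apply: le_trans y4 _; apply: HN; move: hm; clia.
have l0b : cn (l0 - (V j')%:C) <= B + 1.
 apply/ler_addgt0Pr => e e0; have [N HN] := Hl0 e e0.
 have -> : l0 - (V j')%:C = (X (N+j')%N - (V j')%:C) - (X (N+j')%N - l0) by ring.
 apply: cnB_le; apply: lerD; first by apply: Xb; rewrite leq_addl.
 by apply: HN; rewrite leq_addr.
exists (iter (j'-j) quad l0^-1) => e e0.
have [dl dl0 Hdl] := iter_quad_cont (j'-j) l0^-1 e0.
have [N HN] := Hl0 dl dl0; exists (N+j')%N => m hm.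
have jm : (j' <= m)%N by move: hm; clia.
have -> : iter (m-j) quad ((V m)%:C + Y)^-1 = iter (j'-j) quad (X m)^-1.
 by rewrite /X invrK -iterD; congr (iter _ _ _); rewrite /j' in jm *; move: jm; clia.
apply: Hdl; apply: le_trans (inv_diff ltr01 (near_big (Xb m jm) V2) (near_big l0b V2)) _.
by rewrite expr1n divr1; apply: HN; move: hm; clia.
Qed.

Definition exit_map j (Y : C) : C := projT1 (cid (exit_ex j Y)).

Lemma exit_mapP j Y : exit_spec j Y (exit_map j Y).
Proof. exact: (projT2 (cid (exit_ex j Y))). Qed.

Lemma eq_small (x y : C) : (forall e : R, 0 < e -> cn (x-y) <= e) -> x = y.
Proof.
move=> h; apply/eqP; rewrite -subr_eq0 -cn_eq0 eq_le cn_ge0 andbT.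
by apply/ler_addgt0Pr => e e0; rewrite add0r; apply: h.
Qed.

Lemma exit_mapS j Y : quad (exit_map j.+1 Y) = exit_map j Y.
Proof.
apply: eq_small => e e0; have e2 : 0 < e/2 by rewrite divr_gt0.
have [dl dl0 H] := iter_quad_cont 1 (exit_map j.+1 Y) e2.
have [N1 H1] := @exit_mapP j.+1 Y _ dl0; have [N2 H2] := @exit_mapP j Y _ e2.
pose m := (N1+N2+j.+1)%N.
have h1 := H _ (H1 m ltac:(rewrite /m; clia)); have h2 := H2 m ltac:(rewrite /m; clia).
move: h1; rewrite /= -iterS.
have -> : (m-j.+1).+1 = (m-j)%N by rewrite /m; clia.
move=> h1; rewrite -[X in cn X](subrKA (iter (m-j) quad ((V m)%:C + Y)^-1)) addrC.
by apply: cnD_le; rewrite [cn (_ - iter _ _ _)]cnBC; lra.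
Qed.

Lemma exit_mapD j d Y : iter d quad (exit_map (j+d) Y) = exit_map j Y.
Proof. by elim: d j => [|d IH] j; rewrite ?addn0 // iterS addnS -addSn IH exit_mapS. Qed.

Lemma exit_tail (B : R) : 0 <= B -> exists J, exists2 K, 0 < K & forall j, (J <= j)%N ->
 B + 2 <= V j /\ forall Y, cn Y <= B ->
 [/\ exit_map j Y != 0, cn ((exit_map j Y)^-1 - (V j)%:C) <= B + 1,
  cn ((exit_map j Y)^-1 - (V j)%:C - Y) <= K/j.+1%:R &
  forall Y', cn Y' <= B -> cn ((exit_map j Y)^-1 - (exit_map j Y')^-1) <= cn (Y-Y')].
Proof.
move=> B0; have [J [K K0 H]] := descent B0.
have [J2 HJ2] := refV_unbounded (B+2).
exists (J+J2)%N; exists K => // j hj.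
have V2 : B + 2 <= V j by apply: HJ2; move: hj; clia.
have Jj : (J <= j)%N by move: hj; clia.
split=> //.
have st m Y : cn Y <= B -> cn (((V m)%:C + Y)^-1^-1 - (V m)%:C) <= B by rewrite invrK addrC addKr.
have app Y : cn Y <= B -> [/\ exit_map j Y != 0, cn ((exit_map j Y)^-1 - (V j)%:C) <= B &
  forall e, 0 < e -> exists N, forall m, (N <= m)%N ->
   cn ((iter (m-j) quad ((V m)%:C + Y)^-1)^-1 - (exit_map j Y)^-1) <= e].
 move=> hY; pose x m := iter (m-j) quad ((V m)%:C + Y)^-1.
 have xb m : (j <= m)%N -> x m != 0 /\ cn ((x m)^-1 - (V j)%:C) <= B.
  move=> jm; have [||h1 h2 _ _] := H ((V m)%:C + Y)^-1 ((V m)%:C + Y)^-1 j (m-j)%N Jj.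
  - by rewrite subnKC //; apply: st.
  - by rewrite subnKC //; apply: st.
  by [].
 have up m : (j <= m)%N -> cn (x m)^-1 <= V j + B.
  move=> jm; have [_ h] := xb m jm; rewrite -[(x m)^-1](subrK (V j)%:C).
  apply: cnD_le; rewrite cn_real gtr0_norm ?refV_gt0 // addrC lerD2l //.
 have VB : 0 < V j + B by rewrite ltr_pwDl ?refV_gt0.
 have lo m : (j <= m)%N -> (V j + B)^-1 <= cn (x m).
  move=> jm; have [x0 _] := xb m jm; have := up m jm.
  by rewrite cnV -[leRHS]invrK lef_pV2 ?posrE ?invr_gt0 ?cn_gt0.
 pose b := (V j + B)^-1/2.
 have b0 : 0 < b by rewrite divr_gt0 ?invr_gt0.
 have bV : b <= (V j + B)^-1 by rewrite /b ler_pdivrMr // ler_peMr ?invr_ge0 ?(ltW VB) //; lra.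
 have lim_lo : b <= cn (exit_map j Y).
  have [N HN] := @exit_mapP j Y b b0.
  have h1 := HN (N+j)%N (leq_addr _ _); have h2 := lo (N+j)%N (leq_addl _ _).
  have := cn_sub_ge (x (N+j)%N) (x (N+j)%N - exit_map j Y); rewrite subKr.
  by move: h1 h2; rewrite -/(x (N+j)%N) /b; lra.
 have l0 : exit_map j Y != 0 by rewrite -cn_gt0 (lt_le_trans b0).
 have cv e : 0 < e -> exists N, forall m, (N <= m)%N -> cn ((x m)^-1 - (exit_map j Y)^-1) <= e.
  move=> e0; have [|N HN] := @exit_mapP j Y (e*b^+2); first by rewrite mulr_gt0 ?exprn_gt0.
  exists (N+j)%N => m hm; have jm : (j <= m)%N := leqDr hm.
  have h1 := HN m (leqDl hm).
  apply: le_trans (inv_diff b0 (le_trans bV (lo m jm)) lim_lo) _.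
  by rewrite ler_pdivrMr ?exprn_gt0.
 split=> //; apply/ler_addgt0Pr => e e0; have [N HN] := cv e e0.
 have h1 := HN (N+j)%N (leq_addr _ _); have [_ h2] := xb (N+j)%N (leq_addl _ _).
 have -> : (exit_map j Y)^-1 - (V j)%:C = ((x (N+j)%N)^-1 - (V j)%:C) - ((x (N+j)%N)^-1 - (exit_map j Y)^-1) by ring.
 by apply: cnB_le; exact: lerD.
move=> Y hY; have [h1 h2 h3] := app Y hY; split=> //.
- by apply: le_trans h2 _; lra.
- apply/ler_addgt0Pr => e e0; have [N HN] := h3 e e0.
 pose m := (N+j)%N; have h4 := HN m (leq_addr _ _).
 have [||_ _ _ q] := H ((V m)%:C + Y)^-1 ((V m)%:C + Y)^-1 j (m-j)%N Jj.
 - by rewrite subnKC ?leq_addl //; apply: st.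
 - by rewrite subnKC ?leq_addl //; apply: st.
 move: q h4; rewrite invrK subnKC ?leq_addl // [_ + Y]addrC addrK; set x := _^-1 => q h4.
 have -> : (exit_map j Y)^-1 - (V j)%:C - Y = (x - (V j)%:C - Y) - (x - (exit_map j Y)^-1) by ring.
 by apply: cnB_le; apply: lerD => //; rewrite /x addrC.
move=> Y' hY'; have [_ _ h3'] := app Y' hY'.
apply/ler_addgt0Pr => e e0; have e2 : 0 < e/2 by rewrite divr_gt0.
have [N HN] := h3 _ e2; have [N' HN'] := h3' _ e2.
pose m := (N+N'+j)%N.
have h4 := HN m ltac:(rewrite /m; clia); have h4' := HN' m ltac:(rewrite /m; clia).
have [||_ _ q _] := H ((V m)%:C + Y)^-1 ((V m)%:C + Y')^-1 j (m-j)%N Jj.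
- by rewrite subnKC ?leq_addl //; apply: st.
- by rewrite subnKC ?leq_addl //; apply: st.
move: q h4 h4'; rewrite !invrK; set x := _^-1; set x' := (iter _ _ _)^-1 => q h4 h4'.
have -> : (exit_map j Y)^-1 - (exit_map j Y')^-1 =
 (x-x') - (x - (exit_map j Y)^-1) + (x' - (exit_map j Y')^-1) by ring.
apply: cnD_le; have := cnB (x-x') (x - (exit_map j Y)^-1).
have e1 : (V m)%:C + Y - ((V m)%:C + Y') = Y - Y' by ring.
by rewrite e1 in q; move: q h4 h4'; clra.
Qed.

Lemma quad_lip d (B : R) : exists2 L, 0 < L & forall x y : C, cn x <= B -> cn y <= B ->
 cn (iter d quad x - iter d quad y) <= L*cn (x-y).
Proof.
elim: d B => [|d IH] B; first by exists 1 => // x y _ _; rewrite mul1r.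
have [L L0 HL] := IH (`|B|+B^+2).
exists (L*(1 + 2 * `|B|)).
 by rewrite mulr_gt0 // ltr_pwDl // mulr_ge0.
move=> x y hx hy; rewrite !iterSr.
have qb t : cn t <= B -> cn (quad t) <= `|B| + B^+2.
 move=> ht; apply: le_trans (cn_quad _) _.
 have tB := le_trans ht (ler_norm _); apply: lerD => //.
 by rewrite -[B^+2]real_normK ?num_real // lerXn2r ?nnegrE ?cn_ge0 ?normr_ge0.
apply: le_trans (HL _ _ (qb _ hx) (qb _ hy)) _.
rewrite -mulrA ler_pM2l // quadB cnM mulrC; apply: ler_wpM2r; first exact: cn_ge0.
have := cnD (1+x) y; have := cnD 1 x; rewrite cn1.
have := le_trans hx (ler_norm _); have := le_trans hy (ler_norm _).
by lra.
Qed.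

Lemma near_big_inv (x : C) (v B : R) : cn (x^-1-v%:C) <= B -> B + 1 <= v -> cn x <= 1.
Proof.
move=> h hv; have := near_big h hv; rewrite cnV => q.
have x0 : 0 < cn x by rewrite -invr_gt0; apply: lt_le_trans q.
by rewrite -[leLHS]invrK invf_le1 // invr_gt0.
Qed.

Lemma exit_map_lip j (B : R) : 0 <= B -> exists2 L, 0 < L & forall Y Y', cn Y <= B -> cn Y' <= B ->
 cn (exit_map j Y - exit_map j Y') <= L*cn (Y-Y').
Proof.
move=> B0; have [J [K K0 H]] := exit_tail B0.
have [L L0 HL] := quad_lip J 1.
exists L => // Y Y' hY hY'.
have [V2 HJ] := H (j+J)%N (leq_addl _ _).
have [h1 h2 h3 h4] := HJ Y hY; have [h1' h2' _ _] := HJ Y' hY'.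
rewrite -(exit_mapD j J Y) -(exit_mapD j J Y').
have b1 : cn (exit_map (j+J) Y) <= 1 by apply: near_big_inv h2 _; lra.
have b2 : cn (exit_map (j+J) Y') <= 1 by apply: near_big_inv h2' _; lra.
apply: le_trans (HL _ _ b1 b2) _; rewrite ler_pM2l //.
apply: le_trans (h4 Y' hY').
have c1 := near_big h2 ltac:(lra); have c2 := near_big h2' ltac:(lra).
have := inv_diff ltr01 c1 c2; rewrite !invrK expr1n divr1; exact.
Qed.

(** An actual orbit reaches level [m] with an offset [D] that is only close to [Y]; the tolerance
    has to be the same for all large [m] and all bounded [Y]. *)
Lemma exit_map_unif j (B e : R) : 0 <= B -> 0 < e -> exists d, 0 < d /\ exists M0, forall m, (M0 <= m)%N ->
 forall Y D, cn Y <= B -> cn (D-Y) <= d ->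
 cn (iter (m-j) quad ((V m)%:C + D)^-1 - exit_map j Y) <= e.
Proof.
move=> B0 e0; have [J [K K0 H]] := exit_tail B0.
have [J1 [K1 K10 H1]] := descent (addr_ge0 B0 ler01).
have [J2 HJ2] := refV_unbounded (B+2).
pose j' := (j+J+J1+J2)%N.
have [L L0 HL] := quad_lip (j'-j) 1.
pose d := Num.min 1 (e/(2*L)).
have d0 : 0 < d by rewrite lt_min ltr01 divr_gt0 // mulr_gt0.
have [N1 _ HN1] := inv_small K d0; have [N2 _ HN2] := inv_small K (ltr01 : 0 < (1 : R)).
exists d; split=> //; exists (j'+N1+N2)%N => m hm Y D hY hD.
have jm : (j' <= m)%N by move: hm; clia.
have [V2 Hm] := H m ltac:(move: hm; rewrite /j'; clia).
have [g1 g2 g3 _] := Hm Y hY.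
have k1 : K/m.+1%:R <= d by apply: HN1; move: hm; clia.
have d1 : d <= 1 by rewrite ge_min lexx.
have dL : L*(2*d) <= e.
 have : d <= e/(2*L) by rewrite ge_min lexx orbT.
 by rewrite ler_pdivlMr ?mulr_gt0 //; clra.
have a1 : cn (((V m)%:C + D)^-1^-1 - (V m)%:C) <= B + 1.
 rewrite invrK addrC addKr -[D](subrK Y); apply: cnD_le; move: hY hD d1; clra.
have Jj' : (J1 <= j')%N by rewrite /j'; clia.
have [||h1 h2 h3 _] := H1 ((V m)%:C + D)^-1 (exit_map m Y) j' (m-j')%N Jj'.
- by rewrite subnKC.
- by rewrite subnKC.
have [||_ h2' _ _] := H1 (exit_map m Y) (exit_map m Y) j' (m-j')%N Jj'.
- by rewrite subnKC.
- by rewrite subnKC.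
have e1 : exit_map j' Y = iter (m-j') quad (exit_map m Y).
 by rewrite -(exit_mapD j' (m-j')%N Y) subnKC.
have e2 : exit_map j Y = iter (j'-j) quad (iter (m-j') quad (exit_map m Y)).
 by rewrite -e1 -(exit_mapD j (j'-j)%N Y) subnKC // /j'; clia.
have e3 : iter (m-j) quad ((V m)%:C + D)^-1 =
  iter (j'-j) quad (iter (m-j') quad ((V m)%:C + D)^-1).
 by rewrite -iterD; congr (iter _ _ _); move: jm; rewrite /j'; clia.
have V3 : B + 1 + 1 <= V j' by have := HJ2 j' ltac:(rewrite /j'; clia); clra.
rewrite e2 e3; apply: le_trans (HL _ _ (near_big_inv h2 V3) (near_big_inv h2' V3)) _.
apply: le_trans dL; rewrite ler_pM2l //.
have := inv_diff ltr01 (near_big h2 V3) (near_big h2' V3).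
rewrite !invrK expr1n divr1 => q; apply: le_trans q (le_trans h3 _).
rewrite invrK.
have -> : (V m)%:C + D - (exit_map m Y)^-1 = (D-Y) - ((exit_map m Y)^-1 - (V m)%:C - Y) by ring.
by apply: cnB_le; have := le_trans g3 k1; move: hD; clra.
Qed.

(** The asymptotic offset determines a backward orbit, because the descent from a high level
    tolerates small errors in the offset. *)
Lemma exit_map_backward (y : nat -> C) (Y : C) :
 (forall j, y j = quad (y j.+1)) ->
 (forall e : R, 0 < e -> exists N, forall j, (N <= j)%N -> y j != 0 /\ cn ((y j)^-1 - (V j)%:C - Y) <= e) ->
 forall j, exit_map j Y = y j.
Proof.
move=> yS yV j; apply: eq_small => e e0.
have [d [d0 [M0 HM]]] := @exit_map_unif j (cn Y) e (cn_ge0 _) e0.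
have [N HN] := yV d d0.
pose m := (M0+N+j)%N.
have [y0 hm] := HN m ltac:(rewrite /m; clia).
have := HM m ltac:(rewrite /m; clia) Y ((y m)^-1 - (V m)%:C) (lexx _) hm.
rewrite [(V m)%:C + _]addrC subrK invrK cnBC.
suff -> : iter (m-j) quad (y m) = y j by [].
have : (j <= m)%N by rewrite /m; clia.
move: (m) => k jk; rewrite -[in y k](subnK jk); elim: (k-j)%N => // i IH.
by rewrite iterSr addSn -yS IH.
Qed.

End ExitMap.

(** * One complete stage for complex orbits *)

Section Stage.
Variable R : realType.
Local Notation C := R[i].
Local Notation X := (refX R).
Local Notation z := (refz R).
Implicit Types (a M c n : nat) (ka : R).

Definition skew_orbit ka (zs ws : nat -> C) := forall i,
 zs i.+1 = zs i - zs i^+2 /\ ws i.+1 = ws i + ws i^+2 + (1/4+ka^+2)%:C*zs i^+2.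

Definition slope (zs ws : nat -> C) i := (ws i + zs i/2)/zs i.

Lemma slope_step ka zs ws i : skew_orbit ka zs ws -> (forall i, zs i != 0) ->
 slope zs ws i.+1 = slope zs ws i + ((zs i)^-1 - 1)^-1*(slope zs ws i^+2 + ka%:C^+2).
Proof.
move=> O z0; have [Oz Ow] := O i.
have h0 := z0 i; have h1 := z0 i.+1.
have h2 : 1 - zs i != 0.
 have e2 : zs i - zs i^+2 = zs i*(1 - zs i) by ring.
 by apply: contraNneq h1 => e; rewrite Oz e2 e mulr0.
have e14 : (1/4+ka^+2)%:C = 1/4 + ka%:C^+2 :> C.
 by rewrite rmorphD rmorphXn rmorphM fmorphV rmorph1 rmorph_nat.
rewrite /slope Ow Oz e14; move: (zs i) (ws i) (ka%:C) h0 h2 => x y k x0 x1.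
field; rewrite x0 /=.
have -> : 1 + -1*x = 1 - x by ring.
have -> : x - x^+2 = x*(1-x) by ring.
by rewrite x1 mulf_neq0.
Qed.

Lemma ratio_near M (e : R) : 0 < e -> \forall n \near \oo, `|n%:R*z (n+M) - 1| <= e.
Proof.
move=> e0; apply: near_cvg_le => //.
have r1 : X (n+M)/(n+M)%:R @[n --> \oo] --> (1 : R).
 apply: (@cvg_shift _ (fun n => n + M)%N (fun n => X n/n%:R) 1 0).
  by move=> n; rewrite addn0 leq_addr.
 exact: refX_ratio_cvg.
have r2 : (1*n+0)%:R/(n+M)%:R @[n --> \oo] --> (1%:R : R) by exact: ratio_cvg.
have r3 : (X (n+M)/(n+M)%:R)^-1 @[n --> \oo] --> (1^-1 : R).
 by apply: cvgV => //; exact: oner_neq0.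
have r4 : ((1*n+0)%:R/(n+M)%:R)*(X (n+M)/(n+M)%:R)^-1 @[n --> \oo] --> (1%:R*1^-1 : R).
 exact: cvgM.
rewrite invr1 mulr1 in r4; apply: cvg_near_eq r4.
exists 1%N => // n /= n0; rewrite mul1n addn0 refzE invf_div mulrA divfK //.
by rewrite pnatr_eq0 -lt0n addn_gt0 n0.
Qed.

Lemma ratio_exit_near a M c (e : R) : (1 < a)%N -> 0 < e -> \forall n \near \oo,
 `|n%:R*z (n + gatelen a M c n) - a%:R^-1| <= e /\
 `|X (n + gatelen a M c n)/n%:R - a%:R| <= e.
Proof.
move=> a1 e0; have [c0 Hc] := psi_lim R; have ar := a_gt0 R a1.
have [_ _ m3] := gatemain_cvg M c a1 Hc.
have m4 : (X (a*n-c*M)/(a*n)%:R)^-1 @[n --> \oo] --> (1^-1 : R).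
 by apply: cvgV => //; exact: oner_neq0.
have m5 : X (a*n-c*M)/(a*n)%:R*a%:R @[n --> \oo] --> (1*a%:R : R).
 by apply: cvgM => //; exact: cvg_cst.
have m6 : (X (a*n-c*M)/(a*n)%:R)^-1*a%:R^-1 @[n --> \oo] --> (1^-1*a%:R^-1 : R).
 by apply: cvgM => //; exact: cvg_cst.
rewrite mul1r in m5; rewrite invr1 mul1r in m6.
near=> n.
have h1 : `|X (a*n-c*M)/(a*n)%:R*a%:R - a%:R| <= e by near: n; exact: near_cvg_le.
have h2 : `|(X (a*n-c*M)/(a*n)%:R)^-1*a%:R^-1 - a%:R^-1| <= e by near: n; exact: near_cvg_le.
have nbig : (c*M < n)%N by near: n; exact: nbhs_infty_gt.
have nr : 0 < n%:R :> R by rewrite ltr0n (leq_ltn_trans _ nbig).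
have tw : (n + n <= a*n)%N by rewrite addnn -mul2n leq_mul2r a1 orbT.
have tE : (a*n - c*M = n + gatelen a M c n)%N by rewrite /gatelen; move: nbig tw; clia.
rewrite tE natrM in h1 h2; have X0 := refX_gt0 R (n + gatelen a M c n).
split.
 move: h2; congr (`|_ - _| <= _); rewrite refzE; field.
 by rewrite !gt_eqF.
by move: h1; congr (`|_ - _| <= _); field; rewrite !gt_eqF.
Unshelve. all: by end_near. Qed.

Lemma realc_div (p q : R) : (p/q)%:C = p%:C/q%:C :> C.
Proof. by rewrite rmorphM fmorphV. Qed.

Lemma cn_div_near (x y : C) (e : R) : e <= 1/2 -> cn (y-1) <= e ->
 cn (x/y-x) <= 2*cn x*e.
Proof.
move=> e2 hy; have e0 : 0 <= e by apply: le_trans hy; exact: cn_ge0.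
have y1 : 1/2 <= cn y.
 by have := cn_sub_ge 1 (1-y); rewrite subKr cn1 cnBC; lra.
have y0 : y != 0 by rewrite -cn_gt0; lra.
have -> : x/y - x = x*(1-y)/y by field.
have x0 := cn_ge0 x.
rewrite cn_div cnM ler_pdivrMr ?cn_gt0 // cnBC.
have := cn_ge0 (y-1); have h := ler_wpM2l x0 hy; have := mulr_ge0 x0 e0.
by nra.
Qed.

(** After [M] steps the slopes are [- Z/W] and [- X/Wo], with [W] close to [X M + entry] and [Wo]
    close to [X M]. Up to a factor near 1 their relative angle is the difference of inverse slopes,
    about [(W - Wo)/n], hence [entry/n]. *)
Lemma entry_stage ka M (B : R) : (0 < M)%N -> 0 < ka -> 0 <= B -> \forall n \near \oo,
 forall zs ws tau, skew_orbit ka zs ws -> (forall i, zs i != 0) ->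
 (forall i, cn ((zs i)^-1 - (X (n+i))%:C - tau) <= 1) -> cn tau <= B ->
 cn (ws 0%N + 1/2) <= 1/20 ->
 exists2 s0, rel_angle ka%:C (slope zs ws M) (us ka n M)%:C s0 &
  cn (n%:R*s0 - entry (ws 0%N)) <= 4/M%:R.
Proof.
move=> M0 ka0 B0; have Mr : 0 < M%:R :> R by rewrite ltr0n.
have XM := refX_gt0 R M; have XM2 := refX_ge2 R M.
pose W := X M + 2.
pose b := (X M + 1)^-1/2.
have b0 : 0 < b by rewrite divr_gt0 // invr_gt0; lra.
pose t := Num.min b (b^+2/M%:R).
have t0 : 0 < t by rewrite lt_min b0 divr_gt0 ?exprn_gt0.
have t2 : 0 < t/2 by rewrite divr_gt0.
have [dl dl0 Hdl] := shadow M 1 t2.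
(* [1/D] is the relative precision asked of [n/X] and of [X/Z]; since positions are bounded by
   [2*W], the factor [W*M] turns it into an error below [1/M]. *)
pose D := 40*W*M%:R + 2.
have W0 : 4 <= W by rewrite /W; lra.
have D0 : 0 < D by rewrite /D ltr_wpDl // !mulr_ge0 //; lra.
have q0 : 0 < D^-1 by rewrite invr_gt0.
have M1 : 0 < M%:R^-1 :> R by rewrite invr_gt0.
near=> n => zs ws tau O z0 hZ ht hw.
have n0 : (0 < n)%N by near: n; exact: nbhs_infty_gt.
have nr := natr_gt0 R n0.
have [v0 w0 wX] : [/\ vs ka n M < 0, 0 < went ka n M & `|went ka n M - X M| <= M%:R^-1].
 by near: n; exact: went_near.
have rn : `|n%:R*z (n+M) - 1| <= D^-1/4 by near: n; apply: ratio_near; rewrite divr_gt0.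
have nB : B + 1 + t^-1 + dl^-1*(1+ka^+2) + 10*(1+B)*D + 4*ka^+2*W^+2*D + 2 <= n%:R.
 by near: n; exact: nbhs_infty_ger.
have p1 : 0 <= t^-1 by rewrite invr_ge0 ltW.
have k2 := sqr_ge0 ka.
have p2 : 0 <= dl^-1*(1+ka^+2) by rewrite mulr_ge0 ?invr_ge0 ?addr_ge0 // ltW.
have B1 : 0 <= 1 + B by clear -B0; lra.
have p3 : 0 <= 10*(1+B)*D := mulr_ge0 (mulr_ge0 (ler0n _ 10) B1) (ltW D0).
have p4 : 0 <= 4*ka^+2*W^+2*D by exact: (mulr_ge0 (mulr_ge0 (mulr_ge0 (ler0n _ 4) k2) (sqr_ge0 W)) (ltW D0)).
have D2 : 2 <= D by rewrite /D lerDr !mulr_ge0 //; clear -W0; lra.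
have p3' : 10*(1+B)*2 <= 10*(1+B)*D by apply: ler_wpM2l D2; apply: mulr_ge0.
have f1 : t^-1 <= n%:R - B by clear -nB p2 p3 p4; lra.
have f2 : dl^-1*(1+ka^+2) <= n%:R - B by clear -nB p1 p3 p4; lra.
have f3 : 2 <= n%:R - B by clear -nB p1 p2 p3 p4; lra.
have f4 : 4*(1+B)*D <= n%:R - B by clear -nB p1 p2 p3 p4; lra.
have f5 : 4*ka^+2*W^+2*D <= n%:R by clear -nB p1 p2 p3 B0; lra.
have f6 : n%:R/2 <= n%:R - B by clear -nB p1 p2 p3 p3' p4 B0; lra.
clear nB p1 p2 p3 p3'.
have ZX i : cn ((zs i)^-1 - (X (n+i))%:C) <= B + 1.
 rewrite -[_ - _](subrK tau); apply: cnD_le; move: (hZ i) ht; clra.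
have Xn i : n%:R + 2 <= X (n+i).
 by apply: le_trans (refX_ge R _); rewrite lerD2r ler_nat leq_addr.
have Zn i : n%:R - B <= cn (zs i)^-1.
 have [h _ _] := near_real (ZX i); apply: le_trans (le_trans (ler_norm _) (cn_ge_Re _)).
 by move: h (Xn i); clra.
have zn i : cn (zs i) <= (n%:R-B)^-1.
 by rewrite -[zs i]invrK; apply: cn_inv_le => //; clear -f3; lra.
have zt i : cn (zs i) <= t.
 apply: le_trans (zn i) _; rewrite -[leRHS]invrK lef_pV2 ?posrE ?invr_gt0 //; clear -f3; lra.
have zd i : cn ((1/4+ka^+2)%:C*zs i^+2) <= dl.
 have k14 : 0 <= 1/4 + ka^+2 by rewrite addr_ge0 ?sqr_ge0 // divr_ge0.
 rewrite cnM cn_real cnX ger0_norm //.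
 have z1 : cn (zs i) <= 1.
  by apply: le_trans (zn i) _; rewrite invf_le1; clear -f3; lra.
 have z2 : cn (zs i) <= (dl^-1*(1+ka^+2))^-1.
  by apply: le_trans (zn i) _; rewrite lef_pV2 ?posrE ?mulr_gt0 ?invr_gt0 //; clear -f3 k2; lra.
 apply: (@le_trans _ _ ((1+ka^+2)*(dl^-1*(1+ka^+2))^-1)); last first.
  by rewrite invfM invrK mulrCA mulfV ?mulr1 // gt_eqF //; clear -k2; lra.
 apply: ler_pM k14 (exprn_ge0 _ (cn_ge0 _)) _ _; first by clra.
 by apply: le_trans z2; rewrite expr2 ler_piMl // cn_ge0.
have /andP[w1 w2] := entry_disc hw.
set f := iter M quad (ws 0%N).
have hf : cn (ws M - f) <= t/2.
 apply: (Hdl ws (ws 0%N)) => //; first by clear -w2; lra.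
  by rewrite subrr cn0 ltW.
 by move=> i _; have [_ ->] := O i; rewrite /quad addrAC subrr add0r.
set v := ws M + zs M/2.
have hv : cn (v-f) <= t.
 have -> : v - f = (ws M - f) + zs M/2 by rewrite /v; ring.
 apply: cnD_le; rewrite cn_div cn_nat; move: (zt M) hf; clra.
have e1 := entryP hw M.
have [f0 _] := entry_nz M hw; rewrite -/f in f0.
have dM : cn (entry_orbit (ws 0%N) M - (X M)%:C) <= 1/4.
 have st := entry_start hw; have X02 := refX0 R.
 have := @trans_dev R 0 _ (entry_trans hw) _ M; rewrite add0n => /(_ _)/le_trans; apply => //.
 by rewrite X02 in st *; clear -st; lra.
have fb : 2*b <= cn f.
 have h : cn f^-1 <= X M + 1.
  have -> : f^-1 = - ((entry_orbit (ws 0%N) M - (X M)%:C) + (X M)%:C) by rewrite /entry_orbit subrK opprK.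
  by rewrite cnN; apply: cnD_le; rewrite cn_real gtr0_norm //; clear -dM; lra.
 have -> : 2*b = (X M + 1)^-1 by rewrite /b; field; rewrite gt_eqF //; clear -XM; lra.
 by rewrite -[f]invrK; rewrite cnV lef_pV2 ?posrE ?cn_gt0 ?invr_eq0 //; clear -XM; lra.
have tb : t <= b by rewrite ge_min lexx.
have vb : b <= cn v by move: (cn_ge_sub fb hv) tb; clra.
have vn0 : v != 0 by rewrite -cn_gt0 (lt_le_trans b0).
set Wc := - v^-1.
have hW : cn (Wc - (X M)%:C - entry (ws 0%N)) <= 2/M%:R.
 have -> : Wc - (X M)%:C - entry (ws 0%N) =
  (entry_orbit (ws 0%N) M - (X M)%:C - entry (ws 0%N)) - (v^-1-f^-1).
  by rewrite /Wc /entry_orbit; ring.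
 apply: cnB_le.
 have h1 : M.+1%:R^-1 <= M%:R^-1 :> R by rewrite lef_pV2 ?posrE ?ltr0n // ler_nat.
 have h2 : cn (v^-1-f^-1) <= M%:R^-1.
  apply: le_trans (inv_diff b0 vb _) _; first by clear -fb b0; lra.
  rewrite ler_pdivrMr ?exprn_gt0 //; apply: le_trans hv _.
  by rewrite mulrC ge_min lexx orbT.
 have -> : 2/M%:R = M%:R^-1 + M%:R^-1 :> R by ring.
 apply: lerD => //; exact: le_trans h1.
set Wo := went ka n M in w0 wX *.
have uE : slope zs ws M = - (zs M)^-1/Wc.
 by rewrite /slope -/v /Wc invrN invrK; field.
have usE : us ka n M = - (X (n+M)/Wo) by rewrite us_ent.
set Z := (zs M)^-1 in uE; set x := X (n+M) in usE *.
have hWd : cn (Wc - Wo%:C - entry (ws 0%N)) <= 3/M%:R.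
 have -> : Wc - Wo%:C - entry (ws 0%N) = (Wc - (X M)%:C - entry (ws 0%N)) - (Wo - X M)%:C.
  by rewrite rmorphB; ring.
 apply: cnB_le; rewrite cn_real.
 have -> : 3/M%:R = 2/M%:R + M%:R^-1 :> R by ring.
 exact: lerD.
have Wob : Wo <= W.
 have h : M%:R^-1 <= 1 :> R by rewrite invf_le1 // ler1n.
 by move: wX; rewrite ler_norml /W => /andP[_]; clear -h; lra.
have Wcb : cn Wc <= 2*W.
 rewrite /Wc cnN cnV; apply: (@le_trans _ _ b^-1).
  by rewrite lef_pV2 ?posrE ?cn_gt0.
 by rewrite /b invfM !invrK /W; clear -XM; lra.
have x0 : 0 < x by exact: refX_gt0.
have Z0 : Z != 0 by rewrite invr_eq0.
have Wo0 : Wo%:C != 0 :> C by rewrite -cn_gt0 cn_real gtr0_norm.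
have Wc0 : Wc != 0 by rewrite oppr_eq0 invr_eq0.
have x0c : x%:C != 0 :> C by rewrite -cn_gt0 cn_real gtr0_norm.
have zx : z (n+M) = x^-1 by rewrite refzE.
have Dle1 : D^-1 <= 1/2 by rewrite -[leRHS]invrK lef_pV2 ?posrE ?invr_gt0 ?invf_div //; by clear -D2; lra.
have hq : cn (n%:R/x%:C-1) <= D^-1/4.
 by have := rn; rewrite zx -cn_real rmorphB rmorphM fmorphV rmorph_nat rmorph1.
have hxZ : cn (x%:C/Z-1) <= D^-1/4.
 have -> : x%:C/Z - 1 = - ((Z-x%:C)/Z) by field.
 rewrite cnN cn_div; have h1 := Zn M; rewrite -/Z in h1.
 rewrite ler_pdivrMr ?cn_gt0 //; apply: le_trans (ZX M) _; clear -h1 f4 q0 D0.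
 have : D^-1/4*(4*(1+B)*D) <= D^-1/4*cn Z.
  by apply: ler_wpM2l; [rewrite divr_ge0 // ltW|exact: le_trans h1].
 have -> : D^-1/4*(4*(1+B)*D) = 1 + B by field; rewrite gt_eqF.
 by rewrite addrC.
pose s0 := (Wc/Z-Wo%:C/x%:C)/(1 + ka%:C^+2*Wc*Wo%:C/(Z*x%:C)).
set den := 1 + _ in s0.
have hden : cn (den-1) <= D^-1/4.
 rewrite /den addrAC subrr add0r cn_div (cnM Z) (cnM (_*Wc)) (cnM (_^+2)) cnX.
 rewrite !cn_real !gtr0_norm //.
 have h1 := Zn M; rewrite -/Z in h1; have h2 := Xn M; rewrite -/x in h2.
 have nZ : n%:R/2 <= cn Z by exact: le_trans h1.
 have c1 : ka^+2*cn Wc*Wo <= ka^+2*(2*W)*W.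
  exact: ler_pM (mulr_ge0 k2 (cn_ge0 _)) (ltW w0) (ler_wpM2l k2 Wcb) Wob.
 have c2 : (4*ka^+2*W^+2*D)*2 <= cn Z*x.
  rewrite mulrC; apply: ler_pM => //.
  - by apply: le_trans h1.
  - by apply: le_trans f5 _; clear -h2; lra.
 have c3 : 0 < cn Z*x by rewrite mulr_gt0 ?cn_gt0.
 rewrite ler_pdivrMr //; apply: le_trans c1 _.
 have : D^-1/4*(4*ka^+2*W^+2*D*2) <= D^-1/4*(cn Z*x).
  by apply: ler_wpM2l => //; rewrite divr_ge0 // ltW.
 by apply: le_trans; rewrite le_eqVlt; apply/orP; left; apply/eqP; field; rewrite gt_eqF.
have den0 : den != 0.
 rewrite -cn_gt0; have := cn_sub_ge 1 (1-den); rewrite subKr cn1 cnBC; clear -hden Dle1 q0; lra.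
exists s0.
 have usC : (us ka n M)%:C = - (x%:C/Wo%:C) by rewrite usE -realc_div rmorphN.
 rewrite /rel_angle uE usC /s0.
 have -> : ka%:C^+2 + - Z/Wc * - (x%:C/Wo%:C) = den*(Z*x%:C)/(Wc*Wo%:C).
  by rewrite /den; field; rewrite Z0 Wc0 Wo0 x0c.
 by rewrite !mulrA divfK //; field; rewrite Z0 Wc0 Wo0 x0c.
have -> : n%:R*s0 - entry (ws 0%N) = (n%:R*(Wc/Z-Wo%:C/x%:C)/den -
  n%:R*(Wc/Z-Wo%:C/x%:C)) + (n%:R*(Wc/Z-Wo%:C/x%:C) - (Wc-Wo%:C)) +
  (Wc - Wo%:C - entry (ws 0%N)) by rewrite /s0; ring.
set y := n%:R*(_-_/x%:C).
have yE : y = Wc*((n%:R/x%:C)*(x%:C/Z)) - Wo%:C*(n%:R/x%:C).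
 by rewrite /y; field; rewrite Z0 x0c.
have hqb : cn (n%:R/x%:C) <= 2.
 rewrite -[_/_](subrK 1); apply: cnD_le; rewrite cn1.
 by clear -hq Dle1 q0; lra.
have h1 : cn (y - (Wc-Wo%:C)) <= 3*W*D^-1.
 have -> : y - (Wc-Wo%:C) = Wc*((n%:R/x%:C)*(x%:C/Z-1)) +
   (Wc-Wo%:C)*(n%:R/x%:C-1) by rewrite yE; ring.
 apply: cnD_le; rewrite (cnM Wc) (cnM (n%:R/x%:C)) (cnM (Wc-Wo%:C)).
 have h2 : cn (Wc-Wo%:C) <= 3*W.
  by apply: cnB_le; rewrite cn_real gtr0_norm //; clear -Wcb Wob; lra.
 have h3 : cn Wc*(cn (n%:R/x%:C)*cn (x%:C/Z-1)) <= 2*W*(2*(D^-1/4)).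
  by apply: ler_pM; rewrite ?mulr_ge0 ?cn_ge0 //; apply: ler_pM; rewrite ?cn_ge0.
 have h4 : cn (Wc-Wo%:C)*cn (n%:R/x%:C-1) <= 3*W*(D^-1/4).
  by apply: ler_pM; rewrite ?cn_ge0.
 have WD : 0 <= W*D^-1 by rewrite mulr_ge0 ?(ltW q0) //; clear -W0; lra.
 by clear -h3 h4 WD; lra.
have yb : cn y <= 5*W.
 rewrite -[y](subrK (Wc-Wo%:C)); apply: cnD_le.
 have : cn (Wc-Wo%:C) <= 3*W.
  by apply: cnB_le; rewrite cn_real gtr0_norm //; clear -Wcb Wob; lra.
 have : 3*W*D^-1 <= 3*W*(1/2) by apply: ler_wpM2l => //; clear -W0; lra.
 by clear -h1 W0; lra.
have h5 := @cn_div_near y den (D^-1/4) ltac:(clear -Dle1; lra) hden.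
have h6 : 2*cn y*(D^-1/4) <= 3*W*D^-1.
 have : cn y*D^-1 <= 5*W*D^-1 by rewrite ler_pM2r.
 have WD : 0 <= W*D^-1 by rewrite mulr_ge0 ?(ltW q0) //; clear -W0; lra.
 by clear -WD; lra.
have h7 : 6*W*D^-1 <= M%:R^-1.
 rewrite ler_pdivrMr // -ler_pdivrMl ?invr_gt0 // invrK /D.
 have WM : 0 <= W*M%:R by rewrite mulr_ge0 //; clear -W0; lra.
 by clear -WM; lra.
apply: cnD_le.
have := cnD (y/den-y) (y - (Wc-Wo%:C)).
have -> : 4/M%:R = M%:R^-1 + 3/M%:R :> R by ring.
by move: h1 h5 h6 h7 hWd; clra.
Unshelve. all: by end_near. Qed.

(** At the exit the reference slope is [X/Vo]. The relation for [s], solved for [Z/u], gives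
    [Vo - X*s] up to factors tending to 1. *)
Lemma exit_stage a ka M c (B Sb H d : R) : (1 < a)%N -> 0 < d -> 0 <= B -> 0 < Sb -> 0 < H ->
 \forall n \near \oo, forall (Z u s : C) (Vo : R),
  cn (Z - (X (n + gatelen a M c n))%:C) <= B -> cn s <= Sb/n%:R -> 0 < Vo -> Vo <= H ->
  rel_angle ka%:C u (X (n + gatelen a M c n)/Vo)%:C s ->
  u != 0 /\ cn (Z/u - (Vo%:C - (X (n + gatelen a M c n))%:C*s)) <= d.
Proof.
move=> a1 d0 B0 Sb0 H0; have ar := a_gt0 R a1.
pose P := H + (a%:R+1)*Sb.
have P0 : 0 < P by rewrite addr_gt0 // mulr_gt0 // addr_gt0.
pose e := Num.min (1/2) (d/(6*P)).
have e0 : 0 < e by rewrite lt_min !divr_gt0 // mulr_gt0.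
have e12 : e <= 1/2 by rewrite ge_min lexx.
have eP : 6*P*e <= d.
 have : e <= d/(6*P) by rewrite ge_min lexx orbT.
 by rewrite ler_pdivlMr ?mulr_gt0 // mulrC.
near=> n => Z u s Vo hZ hs V0 VH hr.
have n0 : (0 < n)%N by near: n; exact: nbhs_infty_gt.
have nr := natr_gt0 R n0.
have nr1 : 1 <= n%:R :> R by rewrite ler1n.
have [_ r1] : `|n%:R*z (n + gatelen a M c n) - a%:R^-1| <= 1 /\
 `|X (n + gatelen a M c n)/n%:R - a%:R| <= 1 by near: n; apply: ratio_exit_near.
have nK : ka^+2*Sb*H/e <= n%:R by near: n; exact: nbhs_infty_ger.
have nB : B/e <= n%:R by near: n; exact: nbhs_infty_ger.
set T := X _ in hZ hr r1 *.
have T0 : 0 < T by exact: refX_gt0.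
have nT : n%:R <= T.
 by apply: le_trans (ltW (refX_gtn R _)); rewrite ler_nat leq_addr.
have Tn : T <= (a%:R+1)*n%:R.
 by rewrite -ler_pdivrMr //; move: r1; rewrite ler_norml => /andP[_]; clra.
have T0c : T%:C != 0 :> C by rewrite -cn_gt0 cn_real gtr0_norm.
have V0c : Vo%:C != 0 :> C by rewrite -cn_gt0 cn_real gtr0_norm.
set p := Vo%:C - T%:C*s.
have pP : cn p <= P.
 apply: cnB_le; rewrite cnM !cn_real !gtr0_norm //; apply: lerD => //.
 have -> : (a%:R+1)*Sb = (a%:R+1)*n%:R*(Sb/n%:R) by field; rewrite gt_eqF.
 by apply: ler_pM; rewrite ?cn_ge0 // ltW.
pose y := 1 + ka%:C^+2*s*(Vo%:C/T%:C).
have hy : cn (y-1) <= e.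
 rewrite /y addrAC subrr add0r cnM (cnM (_^+2)) cnX cn_div !cn_real (gtr0_norm V0) (gtr0_norm T0).
 rewrite real_normK ?num_real //.
 have h1 : Vo/T <= H.
  by rewrite ler_pdivrMr //; apply: le_trans VH _; rewrite ler_peMr ?(ltW H0) // (le_trans nr1).
 apply: (@le_trans _ _ (ka^+2*(Sb/n%:R)*H)).
  apply: ler_pM => //; [by rewrite mulr_ge0 ?sqr_ge0 ?cn_ge0|by rewrite divr_ge0 // ltW|].
  by apply: ler_wpM2l => //; exact: sqr_ge0.
 have -> : ka^+2*(Sb/n%:R)*H = ka^+2*Sb*H/n%:R by ring.
 by rewrite ler_pdivrMr // [e*_]mulrC -ler_pdivrMr.
have y0 : y != 0.
 rewrite -cn_gt0; have := cn_sub_ge 1 (1-y); rewrite subKr cn1 cnBC; clear -hy e12; lra.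
have E := rel_angleE hr.
have up : u * p = T%:C*y.
 have -> : u * p = u*(1 - s*(T/Vo)%:C)*Vo%:C.
  by rewrite /p realc_div; field.
 by rewrite E realc_div /y; field; rewrite T0c V0c.
have up0 : u * p != 0 by rewrite up mulf_neq0.
have u0 : u != 0 by apply: contraNneq up0 => ->; rewrite mul0r.
have p0 : p != 0 by apply: contraNneq up0 => ->; rewrite mulr0.
split=> //.
have -> : Z/u - p = (p/y-p) + (Z-T%:C)/T%:C*(p/y).
 have -> : u = T%:C*y/p by rewrite -up mulfK.
 by field; rewrite T0c p0 y0.
apply: cnD_le.
have h1 := cn_div_near p e12 hy.
have h2 : cn p*e <= P*e by rewrite ler_pM2r.
have h3 : cn (p/y) <= 2*P.
 rewrite -[p/y](subrK p); apply: cnD_le.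
 have : P*e <= P*(1/2) by rewrite ler_pM2l.
 by clear -h1 h2 pP; lra.
rewrite (cnM ((Z-T%:C)/T%:C)) cn_div cn_real (gtr0_norm T0).
have h4 : cn (Z-T%:C)/T <= e.
 rewrite ler_pdivrMr //; apply: le_trans hZ _; rewrite mulrC -ler_pdivrMr //; exact: le_trans nT.
have h5 : cn (Z-T%:C)/T*cn (p/y) <= e*(2*P).
 by apply: ler_pM; rewrite ?cn_ge0 // divr_ge0 ?cn_ge0 // ltW.
have Pe : 0 <= P*e by rewrite mulr_ge0 // ltW.
by clear -h1 h2 h5 eP Pe; lra.
Unshelve. all: by end_near. Qed.

Lemma ratio_real (x : R) n m : (x/n%:R-m%:R)%:C = x%:C/n%:R - m%:R :> C.
Proof. by rewrite rmorphB rmorphM fmorphV !rmorph_nat. Qed.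

Lemma ratio2_real (x y : R) n m : (n%:R*x - 1 - (n%:R*y-m%:R^-1))%:C =
 n%:R*x%:C - 1 - (n%:R*y%:C-m%:R^-1) :> C.
Proof. by rewrite !rmorphB !rmorphM fmorphV !rmorph_nat rmorph1. Qed.

Lemma entry_bound (w : C) : cn (w+1/2) <= 1/20 -> cn (entry w) <= 5/4.
Proof.
move=> h; have := entryP h 0; have := entry_start h; rewrite invr1.
set p := _ - (X 0)%:C => h1 h2.
by rewrite -[entry w](subKr p); apply: cnB_le; clear -h1 h2; lra.
Qed.

Lemma z_small (B e : R) : 0 <= B -> 0 < e -> \forall n \near \oo, forall (zs : nat -> C) tau,
 (forall i, cn ((zs i)^-1 - (X (n+i))%:C - tau) <= 1) -> cn tau <= B -> forall i, cn (zs i) <= e.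
Proof.
move=> B0 e0; near=> n => zs tau hZ ht i.
have nB : B + 1 + e^-1 <= n%:R by near: n; exact: nbhs_infty_ger.
have ei : 0 < e^-1 by rewrite invr_gt0.
have Xn : n%:R + 2 <= X (n+i).
 by apply: le_trans (refX_ge R _); rewrite lerD2r ler_nat leq_addr.
have hb : cn ((zs i)^-1 - (X (n+i))%:C) <= B + 1.
 rewrite -[_ - _](subrK tau); apply: cnD_le; move: (hZ i) ht; clra.
have [h _ _] := near_real hb.
have {}h : e^-1 <= cn (zs i)^-1.
 apply: le_trans (le_trans (ler_norm _) (cn_ge_Re _)); clear -h Xn nB; lra.
by rewrite -[zs i]invrK -[e]invrK; apply: cn_inv_le.
Unshelve. all: by end_near. Qed.

Lemma near_pow a (Q : nat -> Prop) : (1 < a)%N -> (\forall n \near \oo, Q n) ->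
 \forall k \near \oo, Q (a^k)%N.
Proof.
move=> a1 [K _ HK]; exists K => // k /= Kk; apply: HK => /=.
by apply: leq_trans Kk _; apply: ltnW; apply: ltn_expl.
Qed.

Lemma skew_shadow ka L (B e : R) : 0 < e -> exists2 d, 0 < d & forall zs ws (x0 : C) I,
 skew_orbit ka zs ws -> cn x0 <= B -> cn (ws I - x0) <= d -> (forall i, cn (zs i) <= d) ->
 forall i, (i <= L)%N -> cn (ws (I+i)%N - iter i quad x0) <= e.
Proof.
move=> e0; have [d d0 Hd] := shadow L B e0.
have k1 : 1 <= 1 + ka^+2 by rewrite lerDl sqr_ge0.
have k0 : 0 < 1 + ka^+2 by apply: lt_le_trans k1.
pose d' := Num.min (Num.min 1 d) (d/(1+ka^+2)).
exists d'; first by rewrite !lt_min d0 ltr01 divr_gt0.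
move=> zs ws x0 I O hx h0 hz i iL.
have [d1 d2 d3] : [/\ d' <= 1, d' <= d & d'*(1+ka^+2) <= d].
 split; [by rewrite !ge_min lexx|by rewrite !ge_min lexx orbT|].
 by rewrite -ler_pdivlMr // !ge_min lexx !orbT.
apply: (Hd (fun i => ws (I+i)%N) x0) => //; first by rewrite addn0; apply: le_trans d2.
move=> k _; have [_ Ow] := O (I+k)%N; rewrite addnS Ow /quad addrAC subrr add0r.
rewrite cnM cn_real cnX ger0_norm; last by have := sqr_ge0 ka; lra.
apply: le_trans d3; rewrite mulrC.
have z0 := cn_ge0 (zs (I+k)%N); have hzk := hz (I+k)%N.
apply: ler_pM; [exact: exprn_ge0|have := sqr_ge0 ka; lra| |lra].
by apply: (le_trans _ hzk); rewrite expr2 ler_piMl // (le_trans hzk).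
Qed.

(** [n*s] starts at [entry w], loses [tau*(n*z (n+M) - n*z (n+I))], which tends to [tau*(1 - 1/a)],
    and is multiplied by [X/n], which tends to [a]. The exit offset is therefore
    [(a-1)*tau - a*entry w]; [exit_map_unif] and [skew_shadow] bring it down to level [j]. *)
Lemma stage a ka c (r : nat -> R) (r0 : forall j, 0 < r j) (rS : forall j, r j = quad (r j.+1)) :
 (1 < a)%N -> 0 < ka -> pi/ka = ln a%:R -> (0 < c)%N ->
 (\forall M \near \oo, in_gate a ka M c) ->
 (forall j, vs ka (a^k) (gatelen a 1 j (a^k)) @[k --> \oo] --> r j) ->
 forall (B e : R) j, 0 <= B -> 0 < e -> exists2 eta, 0 < eta & exists A, \forall k \near \oo,
 forall zs ws tau, skew_orbit ka zs ws -> (forall i, zs i != 0) ->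
 (forall i, cn ((zs i)^-1 - (X (a^k+i))%:C - tau) <= eta) -> cn tau <= B ->
 cn (ws 0%N + 1/2) <= 1/20 ->
 [/\ cn (ws (a*a^k-a^k-j)%N -
     exit_map r0 rS j ((a%:R-1)*tau - a%:R*entry (ws 0%N))) <= e,
   forall i, (A <= i)%N -> (a^k + i + A <= a*a^k)%N -> cn (ws i) <= e &
   forall i, (i <= j)%N -> cn (ws i - iter i quad (ws 0%N)) <= e /\ cn (zs i) <= e].
Proof.
move=> a1 ka0 pik cp [Mg _ HMg] Hr B e j B0 e0.
have ar := a_gt0 R a1; have ar1 : 1 <= a%:R :> R by rewrite ler1n ltnW.
pose B' := a%:R*B + 2*a%:R.
have B'0 : 0 <= B' by rewrite /B' addr_ge0 ?mulr_ge0 // ltW.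
have e2 : 0 < e/2 by rewrite divr_gt0.
have [d [d0 [M0' HM0]]] := exit_map_unif r0 rS j B'0 e2.
have [C9 C91 [M1 HM1]] := gate_diff c a1 ka0 pik B0 (ler0n R 2).
have C90 : 0 < C9 by clear -C91; lra.
have d8 : 0 < d/8 by rewrite divr_gt0.
have [N1 _ HN1] := inv_small (a%:R*(4+C9)) d8.
have [N2 _ HN2] := inv_small 2 e2.
have [N3 _ HN3] := inv_small (2*C9) (ltr01 : 0 < (1 : R)).
have [N4 _ HN4] := inv_small 2 (ltr01 : 0 < (1 : R)).
pose M := (M1+M0'+Mg+j+20+N1+N2+N3+N4)%N.
have hM1 : (M1 <= M)%N by rewrite /M; clia.
have hM0 : (M0' <= c*M)%N.
 by apply: (@leq_trans M); [rewrite /M; clia|rewrite leq_pmull].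
have hMg : (Mg <= M)%N by rewrite /M; clia.
have hMj : (j <= c*M)%N.
 by apply: (@leq_trans M); [rewrite /M; clia|rewrite leq_pmull].
have hM20 : (20 <= M)%N by rewrite /M; clia.
have q1 : a%:R*(4+C9)/M%:R <= d/8 by apply: HN1; rewrite /M; clia.
have q2 : 2/M%:R <= e/2 by apply: HN2; rewrite /M; clia.
have q3 : 2*C9/M%:R <= 1 by apply: HN3; rewrite /M; clia.
have q4 : 2/M%:R <= 1 :> R by apply: HN4; rewrite /M; clia.
move: M hM1 hM0 hMg hMj hM20 q1 q2 q3 q4 => M hM1 hM0 hMg hMj hM20 q1 q2 q3 q4.
have M0 : (0 < M)%N by apply: leq_trans hM20.
have Mr := natr_gt0 R M0.
have Mi : 0 < M%:R^-1 :> R by rewrite invr_gt0.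
have G := HMg M hMg.
pose eta := Num.min (Num.min 1 (2*C9)^-1) (d/(16*a%:R*C9)).
have eta0 : 0 < eta by rewrite !lt_min ltr01 invr_gt0 divr_gt0 ?mulr_gt0.
have [et1 et2 et3] : [/\ eta <= 1, 2*C9*eta <= 1 & a%:R*C9*eta <= d/16].
 split; first by rewrite !ge_min lexx.
  rewrite mulrC -ler_pdivlMr ?mulr_gt0 // mul1r !ge_min lexx orbT //.
 have -> : d/16 = a%:R*C9*(d/(16*a%:R*C9)) by field; rewrite !gt_eqF.
 by rewrite ler_pM2l ?mulr_gt0 // !ge_min lexx !orbT.
exists eta => //; exists (c*M+M)%N.
pose Sb := 3 + B; have Sb0 : 0 < Sb by rewrite /Sb; clear -B0; lra.
pose V := (r (c*M)%N)^-1; have V0 : 0 < V by rewrite invr_gt0.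
pose H := V + 1; have H0 : 0 < H by rewrite addr_gt0.
have [d1 d10 Hd1] := skew_shadow ka (c*M) 1 e2.
have [d2 d20 Hd2] := skew_shadow ka j 1 e0.
pose ep := Num.min 1 (Num.min (d/(32*a%:R*(B+1))) (d/(16*Sb))).
have ep0 : 0 < ep by rewrite !lt_min ltr01 !divr_gt0 ?mulr_gt0 // ltr_wpDl.
have [ep1 ep2] : a%:R*(2*B*ep) <= d/16 /\ ep*Sb <= d/16.
 split; last first.
  have -> : d/16 = d/(16*Sb)*Sb by field; rewrite gt_eqF.
  by rewrite ler_pM2r // !ge_min lexx !orbT.
 have B1 : 0 < B + 1 by clear -B0; lra.
 have : ep <= d/(32*a%:R*(B+1)) by rewrite !ge_min lexx !orbT.
 move=> h; apply: (@le_trans _ _ (a%:R*(2*(B+1)*(d/(32*a%:R*(B+1)))))); last first.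
  by rewrite le_eqVlt; apply/orP; left; apply/eqP; field; rewrite !gt_eqF.
 rewrite ler_pM2l //; apply: ler_pM => //; [by rewrite mulr_ge0|exact: ltW|].
 by clra.
have d4 : 0 < Num.min (Num.min 1 (V/2)) (d/4) by rewrite !lt_min ltr01 !divr_gt0.
have hVo : (vs ka (a^k) (gatelen a 1 (c*M) (a^k)))^-1 @[k --> \oo] --> V.
 by apply: cvgV => //; rewrite gt_eqF.
(* Only the closeness of the reference exit to its limit needs [n] to be a power of [a]; everything
   else holds for all large [n]. *)
suff main : \forall n \near \oo,
 `|(vs ka n (gatelen a 1 (c*M) n))^-1 - V| <= Num.min (Num.min 1 (V/2)) (d/4) ->
 forall zs ws tau, skew_orbit ka zs ws -> (forall i, zs i != 0) ->
 (forall i, cn ((zs i)^-1 - (X (n+i))%:C - tau) <= eta) -> cn tau <= B ->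
 cn (ws 0%N + 1/2) <= 1/20 ->
 [/\ cn (ws (a*n-n-j)%N -
     exit_map r0 rS j ((a%:R-1)*tau - a%:R*entry (ws 0%N))) <= e,
   forall i, (c*M + M <= i)%N -> (n + i + (c*M+M) <= a*n)%N -> cn (ws i) <= e &
   forall i, (i <= j)%N -> cn (ws i - iter i quad (ws 0%N)) <= e /\ cn (zs i) <= e].
 apply: filterS2 (near_pow a1 main) (near_cvg_le d4 hVo) => k h1 h2.
 exact: h1 h2.
clear hVo; near=> n => hV zs ws tau O z0 hZ ht hw.
have hZ1 i : cn ((zs i)^-1 - (X (n+i))%:C - tau) <= 1 by apply: le_trans (hZ i) et1.
have Hent : forall zs ws tau, skew_orbit ka zs ws -> (forall i, zs i != 0) ->
   (forall i, cn ((zs i)^-1 - (X (n+i))%:C - tau) <= 1) -> cn tau <= B ->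
   cn (ws 0%N + 1/2) <= 1/20 ->
   exists2 s0, rel_angle ka%:C (slope zs ws M) (us ka n M)%:C s0 &
   cn (n%:R*s0 - entry (ws 0%N)) <= 4/M%:R.
 by near: n; exact: entry_stage.
have Hgate : forall (Z u : nat -> C) (tau s0 : C), cn tau <= B ->
  (forall j, (M <= j)%N -> (n + j + c*M <= a*n)%N -> cn (Z j - (X (n+j))%:C - tau) <= eta) ->
  (forall j, (M <= j)%N -> (n + j + c*M <= a*n)%N ->
   u j.+1 = u j + (Z j - 1)^-1*(u j^+2 + ka%:C^+2)) ->
  rel_angle ka%:C (u M) (us ka n M)%:C s0 -> cn s0 <= 2/n%:R ->
  forall i, (M <= i)%N -> (n + i + c*M <= a*n)%N -> cn (u i/Z i) <= 2/M%:R /\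
   exists2 s, rel_angle ka%:C (u i) (us ka n i)%:C s &
    cn (s - s0 + tau*(z (n+M) - z (n+i))%:C) <= C9*(M%:R^-1+eta)/n%:R.
 by near: n; apply: HM1 => //; exact: ltW.
have Hexit : forall (Z u s : C) (Vo : R),
  cn (Z - (X (n + gatelen a M c n))%:C) <= B + 1 -> cn s <= Sb/n%:R -> 0 < Vo -> Vo <= H ->
  rel_angle ka%:C u (X (n + gatelen a M c n)/Vo)%:C s ->
  u != 0 /\ cn (Z/u - (Vo%:C - (X (n + gatelen a M c n))%:C*s)) <= d/4.
 near: n; apply: exit_stage => //; first by rewrite divr_gt0.
 by rewrite addr_ge0.
have Hz : forall (zs : nat -> C) tau,
   (forall i, cn ((zs i)^-1 - (X (n+i))%:C - tau) <= 1) -> cn tau <= B ->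
    forall i, cn (zs i) <= Num.min (Num.min d1 d2) e.
 by near: n; apply: z_small => //; rewrite !lt_min d10 d20 e0.
have rM : `|n%:R*z (n+M) - 1| <= ep by near: n; exact: ratio_near.
have [rI rT] : `|n%:R*z (n + gatelen a M c n) - a%:R^-1| <= ep /\
   `|X (n + gatelen a M c n)/n%:R - a%:R| <= ep by near: n; exact: ratio_exit_near.
have nbig : (c*M + M < n)%N by near: n; exact: nbhs_infty_gt.
have n0 : (0 < n)%N by apply: leq_ltn_trans nbig.
have nr := natr_gt0 R n0.
have hz i : [/\ cn (zs i) <= d1, cn (zs i) <= d2 & cn (zs i) <= e].
 by have := Hz zs tau hZ1 ht i; rewrite !le_min => /andP[/andP[? ?] ?].
have eb := entry_bound hw.
have [s0 hs0 hs0e] := Hent zs ws tau O z0 hZ1 ht hw.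
have q4' : 4/M%:R = 2*(2/M%:R) :> R by ring.
have s0b : cn s0 <= 2/n%:R.
 rewrite ler_pdivlMr // mulrC -(cn_nat R n) -cnM.
 rewrite -[_*s0](subrK (entry (ws 0%N))); apply: cnD_le.
 have q5 : 4/M%:R <= 1/2 :> R.
  by rewrite ler_pdivrMr //; have : 20 <= M%:R :> R by [rewrite (ler_nat R 20)|]; clra.
 by move: hs0e eb q5; clra.
set I := gatelen a M c n in Hexit rI rT.
have tw : (n + n <= a*n)%N by rewrite addnn -mul2n leq_mul2r a1 orbT.
have MI : (M <= I)%N by rewrite /I /gatelen; move: nbig tw; clia.
have Ian : (n + I + c*M <= a*n)%N by rewrite /I /gatelen; move: nbig tw; clia.
have IE : I = gatelen a 1 (c*M) n by rewrite /I /gatelen muln1.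
have Gt i Mi hi := Hgate (fun i => (zs i)^-1) (slope zs ws) tau s0 ht (fun j _ _ => hZ j)
 (fun j _ _ => slope_step j O z0) hs0 s0b i Mi hi.
have sv i : slope zs ws i/(zs i)^-1 = ws i + zs i/2.
 by rewrite /slope invrK; field.
have wb i : (M <= i)%N -> (n + i + c*M <= a*n)%N -> cn (ws i) <= e.
 move=> iM hi; have [h _] := Gt i iM hi; rewrite sv in h.
 have -> : ws i = (ws i + zs i/2) - zs i/2 by ring.
 apply: cnB_le; rewrite (cn_div (zs i)) cn_nat.
 by have [_ _ h3] := hz i; move: h q2 h3; clra.
split; last 2 first.
- move=> i hi1 hi2; apply: wb; first exact: leqDr hi1.
 by apply: leq_trans hi2; rewrite leq_add2l leq_addr.
- move=> i ij; have [_ h2 h3] := hz i; split=> //.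
 have /andP[w1 w2] := entry_disc hw.
 have := Hd2 zs ws (ws 0%N) 0%N O _ _ _ i ij; rewrite add0n; apply.
 + by move: w2; clra.
 + by rewrite subrr cn0 ltW.
 + by move=> l; have [] := hz l.
have [vIb [s hs hse]] := Gt I MI Ian; rewrite sv in vIb.
rewrite -IE in hV; set T := X (n+I) in Hexit rT.
have T0 : 0 < T by exact: refX_gt0.
set Vo := (vs ka n I)^-1 in hV.
have [hV1 hV2 hV3] : [/\ `|Vo - V| <= 1, `|Vo - V| <= V/2 & `|Vo - V| <= d/4].
 by move: hV; rewrite !le_min => /andP[/andP[? ?] ?].
have Vo0 : 0 < Vo by move: hV2 V0; rewrite ler_norml => /andP[+ _]; clra.
have VoH : Vo <= H by move: hV1; rewrite ler_norml /H => /andP[_]; clra.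
have ZT : cn ((zs I)^-1 - T%:C) <= B + 1.
 rewrite -[_ - _](subrK tau); apply: cnD_le.
 by move: (hZ1 I) ht; clear; rewrite -/T; lra.
set dz := z (n+M) - z (n+I) in hse.
have dz1 : 0 <= dz <= n%:R^-1.
 have h1 := refz_gt0 R (n+I); have h2 : z (n+I) <= z (n+M) by rewrite refz_le // leq_add2l.
 have h3 : z (n+M) <= n%:R^-1.
  by apply: le_trans (refz_ltV R n0); rewrite refz_le // leq_addr.
 by rewrite /dz; move: h1 h2 h3; clear=> ? ? ?; apply/andP; split; lra.
have /andP[dz0 dzn] := dz1.
pose rho := s - s0 + tau*dz%:C.
have sE : s = rho + s0 - tau*dz%:C by rewrite /rho; ring.
have sb : cn s <= Sb/n%:R.
 rewrite sE; apply: cnB_le; rewrite (cnM tau) cn_real (ger0_norm dz0).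
 have h1 : cn tau*dz <= B*n%:R^-1 by apply: ler_pM; rewrite ?cn_ge0.
 have h2 : C9*(M%:R^-1+eta)/n%:R <= 1*n%:R^-1.
  by rewrite ler_pM2r ?invr_gt0 // mulrDr; move: q3 (et2); clra.
 have -> : Sb/n%:R = 1*n%:R^-1 + 2/n%:R + B*n%:R^-1 by rewrite /Sb; ring.
 by apply: le_trans (lerD (cnD _ _) h1) _; move: h2 hse s0b; rewrite -/rho; clra.
have usE : us ka n I = T/Vo by rewrite /us /Vo invrK mulrC.
have [u0 hex] := Hexit (zs I)^-1 (slope zs ws I) s Vo ZT sb Vo0 VoH ltac:(by rewrite -usE).
set vI := ws I + zs I/2 in vIb.
have vE : (zs I)^-1/slope zs ws I = vI^-1.
 by rewrite /vI -sv [RHS]invf_div.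
have vI0 : vI != 0 by rewrite /vI -sv mulf_neq0 // invr_eq0 invr_eq0.
set Y := _*tau - _.
have nc0 : n%:R != 0 :> C by rewrite -cn_gt0 cn_nat.
(* The budget is [d/16] for [X/n], [d/16] for the two values of [n*z], and [d/8 + d/16] for the
   errors of entrance and gate together. *)
have hTs : cn (T%:C*s+Y) <= 5/16*d.
 pose ns := n%:R*s.
 have nsb : cn ns <= Sb by rewrite /ns cnM cn_nat mulrC -ler_pdivlMr.
 have acE : (a%:R : R)%:C = a%:R :> C by rewrite rmorph_nat.
 have ac0 : a%:R != 0 :> C by rewrite -cn_gt0 cn_nat.
 have e1 : cn ((T/n%:R-a%:R)%:C*ns) <= ep*Sb.
  by rewrite cnM cn_real; apply: ler_pM; rewrite ?cn_ge0.
 have e2' : cn (a%:R*(n%:R*s0 - entry (ws 0%N))) <= a%:R*(4/M%:R).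
  by rewrite cnM cn_nat ler_pM2l.
 have e3 : cn (a%:R*(tau*(n%:R*z (n+M) - 1 - (n%:R*z (n+I) - a%:R^-1))%:C)) <=
   a%:R*(2*B*ep).
  rewrite cnM cn_nat ler_pM2l // cnM cn_real.
  have -> : 2*B*ep = B*(ep+ep) by ring.
  apply: ler_pM; rewrite ?cn_ge0 //.
  by apply: le_trans (ler_normB _ _) _; exact: lerD.
 have e4 : cn (a%:R*(n%:R*rho)) <= a%:R*(C9*(M%:R^-1+eta)).
  by rewrite cnM cn_nat ler_pM2l // cnM cn_nat mulrC -ler_pdivlMr.
 have -> : T%:C*s + Y = (T/n%:R-a%:R)%:C*ns +
  a%:R*(n%:R*s0 - entry (ws 0%N)) -
  a%:R*(tau*(n%:R*z (n+M) - 1 - (n%:R*z (n+I) - a%:R^-1))%:C) + a%:R*(n%:R*rho).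
  rewrite /Y /rho /dz /ns ratio_real ratio2_real rmorphB.
  by field; rewrite nc0 ac0.
 apply: cnD_le; apply: le_trans (lerD (cnB _ _) (lexx _)) _.
 apply: le_trans (lerD (lerD (cnD _ _) (lexx _)) (lexx _)) _.
 have q1' : a%:R*(4/M%:R) + a%:R*(C9*(M%:R^-1+eta)) =
   a%:R*(4+C9)/M%:R + a%:R*C9*eta by ring.
 move: e1 e2' e3 e4 q1' q1 et3 ep1 ep2.
 move: (a%:R*(4/_)) (a%:R*(C9*_)) (a%:R*(4+C9)/_) (a%:R*C9*eta) => y1 y2 y3 y4.
 by clra.
have hD : cn ((vI^-1-V%:C) - Y) <= d.
 have -> : vI^-1 - V%:C - Y = (vI^-1 - (Vo%:C-T%:C*s)) + (Vo-V)%:C -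
   (T%:C*s+Y) by rewrite rmorphB; ring.
 apply: cnB_le; apply: le_trans (lerD (cnD _ _) (lexx _)) _.
 by rewrite cn_real; rewrite vE in hex; move: hex hV3 hTs (d0); clra.
have YB : cn Y <= B'.
 rewrite /Y; apply: cnB_le; rewrite !cnM cn_nat.
 have a1c : cn (a%:R - 1 : C) <= a%:R.
  rewrite -(rmorph_nat (@real_complex R) a) -(rmorph1 (@real_complex R)) -rmorphB cn_real.
  by rewrite ger0_norm ?subr_ge0 // gerBl.
 apply: lerD; first by apply: ler_pM; rewrite ?cn_ge0.
 by rewrite [2*_]mulrC ler_pM2l //; move: eb; clra.
have := HM0 (c*M)%N hM0 Y _ YB hD; rewrite -/V [V%:C + _]addrC subrK invrK => hfin.
have vI1 : cn vI <= 1 by exact: le_trans q4.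
have h0 : cn (ws I - vI) <= d1.
 have -> : ws I - vI = - (zs I/2) by rewrite /vI; ring.
 rewrite cnN (cn_div (zs I)) cn_nat; have [h _ _] := hz I.
 by move: h (cn_ge0 (zs I)); clra.
have := Hd1 zs ws vI I O vI1 h0 _ (c*M-j)%N (leq_subr _ _).
have -> : (I + (c*M-j) = a*n - n - j)%N.
 by rewrite /I /gatelen; move: nbig tw hMj; clia.
move=> /(_ (fun i => let: And3 h _ _ := hz i in h)) hsh.
set y := iter (c*M-j) quad vI in hfin hsh.
rewrite -[ws _ - _](subrKA y); apply: cnD_le.
by rewrite [e]splitr; apply: lerD.
Unshelve. all: by end_near. Qed.

End Stage.

(** * Backward orbits of [quad] with prescribed branches *)

Section Chains.
Variable R : realType.
Local Notation C := R[i].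
Implicit Types (y x : nat -> C) (p q : C).

Lemma same_quadrant p q : 0 <= Re p*Re q -> 0 <= Im p*Im q ->
 cn p^+2 + cn q^+2 <= cn (p+q)^+2.
Proof.
rewrite !cn_sqr cReD cImD; move: (Re p) (Re q) (Im p) (Im q).
by clear=> *; lra.
Qed.

Lemma quad_sqr p q : p = quad q -> (q+1/2)^+2 = p + 1/4.
Proof. by move=> ->; rewrite /quad; field. Qed.

Lemma Re_half (p : C) : Re (p+1/2) = Re p + 1/2.
Proof.
rewrite cReD; congr (_+_).
by have := realc_div (1 : R) 2; rewrite rmorph1 rmorph_nat => <-.
Qed.

Lemma Im_half (p : C) : Im (p+1/2) = Im p.
Proof.
rewrite cImD -[RHS]addr0; congr (_+_).
by have := realc_div (1 : R) 2; rewrite rmorph1 rmorph_nat => <-.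
Qed.

Lemma Im_quad p q : p = quad q -> Im p = 2*(Re q + 1/2)*Im q.
Proof. by move=> ->; rewrite /quad expr2 cImD cImM; field. Qed.

(** Here [p - p' = (q-q')(q+q'+1)]. If [q+1/2] and [q'+1/2] lie in one closed quadrant, the squared
    modulus of their sum is at least the sum of the squared moduli, which is
    [|p+1/4| + |p'+1/4|]. *)
Lemma contract (p q p' q' : C) (b k : R) : p = quad q -> p' = quad q' -> 0 <= k -> 1 <= k^+2*b ->
 b <= cn (p+1/4) + cn (p'+1/4) ->
 0 <= (Re q + 1/2)*(Re q' + 1/2) -> 0 <= Im q*Im q' ->
 cn (q-q') <= k*cn (p-p').
Proof.
move=> e e' k0 kb hb hr hi.
have h := same_quadrant (p := q + 1/2) (q := q' + 1/2).
rewrite !Re_half !Im_half in h; have {}h := h hr hi.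
rewrite -!cnX (quad_sqr e) (quad_sqr e') cnX in h.
have -> : p - p' = (q-q')*(q + 1/2 + (q'+1/2)).
 by rewrite e e' quadB; field.
rewrite cnM mulrCA ler_peMr ?cn_ge0 //.
rewrite -(ler_pXn2r (n := 2)) ?nnegrE ?mulr_ge0 ?cn_ge0 // expr1n exprMn.
apply: le_trans kb _; apply: ler_wpM2l; first exact: sqr_ge0.
exact: le_trans hb h.
Qed.

(** On the left branch both imaginary parts change sign at each step, so they keep a common sign and
    [contract] applies. Once [|y+1/4| >= 7/10] the factor is [17/20], as [(17/20)^2*(14/10) >= 1];
    the weaker first step, with factor [11/10], is paid by [13/10]. *)
Lemma minus_run m y x : (forall j, (j < m)%N -> y j = quad (y j.+1) /\ Re (y j.+1) < - (1/2)) ->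
 (forall j, (j < m)%N -> x j = quad (x j.+1) /\ Re (x j.+1) < - (1/2)) ->
 0 < Im (y 0%N)*Im (x 0%N) ->
 44/100 <= cn (y 0%N + 1/4) -> 44/100 <= cn (x 0%N + 1/4) ->
 forall j, (j <= m)%N -> [/\ 0 < Im (y j)*Im (x j),
  (0 < j)%N -> 7/10 <= cn (y j + 1/4) /\ 7/10 <= cn (x j + 1/4) &
  cn (y j - x j) <= 13/10*(17/20)^+j*cn (y 0%N - x 0%N)].
Proof.
move=> Hy Hx i0 cy cx.
have grow (p q : C) : p = quad q -> Re q < - (1/2) -> 44/100 <= cn (p+1/4) ->
  7/10 <= cn (q+1/4).
 move=> e hr hc; have h := congr1 (@cn R) (quad_sqr e); rewrite cnX in h.
 have q4 : Re (1/4 : C) = 1/4 /\ Im (1/4 : C) = 0.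
  by have := realc_div (1 : R) 4; rewrite rmorph1 rmorph_nat => <-.
 rewrite -(ler_pXn2r (n := 2)) ?nnegrE ?cn_ge0 //.
 rewrite cn_sqr Re_half Im_half in h; move: h hc; rewrite cn_sqr cReD cImD; case: q4 => -> ->.
 move: hr; move: (Re q) (Im q) (cn _); clear=> s t u hs hu hc; nra.
have imp (p q p' q' : C) : p = quad q -> p' = quad q' -> Re q < - (1/2) -> Re q' < - (1/2) ->
  0 < Im p*Im p' -> 0 < Im q*Im q'.
 move=> e e' hr hr'; rewrite (Im_quad e) (Im_quad e').
 move: hr hr'; move: (Re q) (Im q) (Re q') (Im q'); clear=> a b c d ha hc.
 have -> : 2*(a+1/2)*b*(2*(c+1/2)*d) = 4*((a+1/2)*(c+1/2))*(b*d) by ring.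
 have h : 0 < 4*((a+1/2)*(c+1/2)) by nra.
 by rewrite pmulr_rgt0.
elim=> [|j IH] jm.
 by split=> //; rewrite expr0 ler_peMl ?cn_ge0 //; clra.
have [h1 h2 h3] := IH (ltnW jm).
have [ey ry] := Hy j jm; have [ex rx] := Hx j jm.
have im := imp _ _ _ _ ey ex ry rx h1.
have [c1 c2] : 44/100 <= cn (y j + 1/4) /\ 44/100 <= cn (x j + 1/4).
 by case: (j) h2 => [//|i] /(_ isT)[]; clear; split; lra.
split=> //; first by split; [exact: grow ey ry c1|exact: grow ex rx c2].
have re : 0 <= (Re (y j.+1) + 1/2)*(Re (x j.+1) + 1/2).
 by move: ry rx; clear; nra.
case: j h2 h3 {IH jm h1} ey ry ex rx im c1 c2 re => [|j] h2 h3 ey ry ex rx im c1 c2 re.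
 have := @contract _ _ _ _ (88/100) (11/10) ey ex ltac:(clra) ltac:(clra) ltac:(move: c1 c2; clra) re (ltW im).
 by rewrite expr1; have := cn_ge0 (y 0%N - x 0%N); clra.
have [d1 d2] := h2 isT.
have := @contract _ _ _ _ (14/10) (17/20) ey ex ltac:(clra) ltac:(clra) ltac:(move: d1 d2; clra) re (ltW im).
move=> h; apply: le_trans h _; rewrite exprS.
have -> : 13/10*(17/20*(17/20)^+j.+1)*cn (y 0%N - x 0%N) =
 17/20*(13/10*(17/20)^+j.+1*cn (y 0%N - x 0%N)) by ring.
by apply: ler_wpM2l => //; lra.
Qed.

(* [V_k = 1/y_k] along a backward orbit taking the branch [Re y > -1/2]. *)
Definition plus_orbit (V : nat -> C) := forall k,
 [/\ V k = V k.+1 - 1 + (V k.+1 + 1)^-1 & 1 < cn (V k.+1 + 1)].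

Lemma plus_mono V k : plus_orbit V -> Re (V k) <= Re (V k.+1).
Proof.
move=> /(_ k)[-> h]; rewrite !cReD cReN /=.
have : Re (V k.+1 + 1)^-1 <= 1.
 apply: le_trans (le_trans (ler_norm _) (cn_ge_Re _)) _.
 by rewrite cnV invf_le1 ?ltW // (lt_trans ltr01).
by clra.
Qed.

Lemma plus_step V k : plus_orbit V -> 0 <= Re (V k.+1) ->
 Re (V k) + 1 <= Re (V k.+1) + (Re (V k.+1) + 1)^-1.
Proof.
move=> /(_ k)[-> h] h0; rewrite !cReD cReN /=.
have : Re (V k.+1 + 1)^-1 <= (Re (V k.+1) + 1)^-1.
 apply: le_trans (le_trans (ler_norm _) (cn_ge_Re _)) _.
 apply: cn_inv_le; first by clear -h0; lra.
 by have := le_trans (ler_norm _) (cn_ge_Re (V k.+1 + 1)); rewrite cReD.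
by clra.
Qed.

Lemma plus_grow V : plus_orbit V -> 2 <= Re (V 0%N) -> forall k,
 2 + k%:R/2 <= Re (V k) /\
 (Re (V k.+1) + 1) ^- 2 <= (Re (V k))^-1 - (Re (V k.+1))^-1.
Proof.
move=> P h0; have ge2 k : 2 <= Re (V k).
 by elim: k => // k IH; apply: le_trans IH (plus_mono k P).
move=> k; split.
 elim: k => [|k IH]; first by rewrite mul0r addr0.
 have h := ge2 k.+1; have := @plus_step V k P ltac:(lra).
 have : (Re (V k.+1) + 1)^-1 <= 1/3.
  by rewrite -[leRHS]invrK lef_pV2 ?posrE ?invf_div ?divr1; lra.
 by rewrite -[k.+1%:R]natr1; move: IH; clra.
have a := ge2 k; have b := ge2 k.+1; have := @plus_step V k P ltac:(lra).
move: a b; move: (Re (V k)) (Re (V k.+1)); clear=> s t s2 t2 h.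
have t1 : 0 < t + 1 by lra.
have h' : (s+1-t)*(t+1) <= 1.
 by rewrite -ler_pdivlMr // -[leRHS]mul1r mul1r; lra.
have -> : s^-1 - t^-1 = (t-s)/(s*t) by field; rewrite !gt_eqF //; lra.
rewrite ler_pdivlMr; last by apply: mulr_gt0; lra.
rewrite mulrC ler_pdivrMr ?exprn_gt0 //.
have : t/(t+1) <= t - s by rewrite ler_pdivrMr //; nra.
have st : s <= t + 1 by nra.
move=> q; apply: (@le_trans _ _ (t/(t+1)*(t+1)^+2)); last by rewrite ler_pM2r ?exprn_gt0.
have -> : t/(t+1)*(t+1)^+2 = t*(t+1) by field; rewrite gt_eqF.
by nra.
Qed.

Lemma plus_diff V W : plus_orbit V -> plus_orbit W -> forall k,
 V k.+1 != -1 /\ W k.+1 != -1 /\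
 V k - W k = (V k.+1 - W k.+1)*(1 - ((V k.+1 + 1)*(W k.+1 + 1))^-1).
Proof.
move=> P Q k; have [eV hV] := P k; have [eW hW] := Q k.
have v0 : V k.+1 + 1 != 0 by rewrite -cn_gt0 (lt_trans ltr01).
have w0 : W k.+1 + 1 != 0 by rewrite -cn_gt0 (lt_trans ltr01).
split; first by rewrite -addr_eq0.
split; first by rewrite -addr_eq0.
by rewrite eV eW; field; rewrite v0 w0.
Qed.

Lemma plus_diff_le V W k (b : R) : plus_orbit V -> plus_orbit W -> 0 < b ->
 b <= (Re (V k.+1) + 1)*(Re (W k.+1) + 1) ->
 0 <= Re (V k.+1) -> 0 <= Re (W k.+1) ->
 cn (V k.+1 - W k.+1)*(1-b^-1) <= cn (V k - W k) /\
 cn (V k.+1 - W k.+1 - (V k - W k)) <= cn (V k.+1 - W k.+1)*b^-1.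
Proof.
move=> P Q b0 hb hv hw; have [_ [_ ->]] := plus_diff P Q k.
have ge (x : C) : 0 <= Re x -> Re x + 1 <= cn (x+1).
 by move=> _; have := le_trans (ler_norm _) (cn_ge_Re (x+1)); rewrite cReD.
have h : cn ((V k.+1 + 1)*(W k.+1 + 1))^-1 <= b^-1.
 apply: cn_inv_le => //; apply: le_trans hb _; rewrite cnM.
 by apply: ler_pM; try exact: ge; lra.
split.
 rewrite cnM; apply: ler_wpM2l; first exact: cn_ge0.
 apply: le_trans (cn_sub_ge _ _); rewrite cn1 lerD2l lerN2 //.
rewrite mulrBr mulr1 subKr cnM; apply: ler_wpM2l => //; exact: cn_ge0.
Qed.

(** Distortion bound: the factors [1 - 1/((V+1)(W+1))] differ from 1 by less than increments of
    [1/Re V] and [1/Re W], which telescope. So the difference at most doubles and settles at rate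
    [1/k]. *)
Lemma plus_run V W : plus_orbit V -> plus_orbit W ->
 2 <= Re (V 0%N) -> 2 <= Re (W 0%N) ->
 (forall k, cn (V k - W k) <= 2*cn (V 0%N - W 0%N)) /\
 (forall k d, cn (V (k+d)%N - W (k+d)%N - (V k - W k)) <= 8*cn (V 0%N - W 0%N)/k.+1%:R).
Proof.
move=> P Q hV hW; have gV := plus_grow P hV; have gW := plus_grow Q hW.
pose a k := (Re (V k))^-1; pose b k := (Re (W k))^-1.
have kk k : 0 <= k%:R/2 :> R by rewrite divr_ge0.
have a2 k : 0 < a k /\ a k <= 1/2.
 have [h _] := gV k; have := kk k => q.
 split; first by rewrite invr_gt0; lra.
 by rewrite -[leRHS]invrK lef_pV2 ?posrE ?invf_div ?divr1; lra.
have b2 k : 0 < b k /\ b k <= 1/2.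
 have [h _] := gW k; have := kk k => q.
 split; first by rewrite invr_gt0; lra.
 by rewrite -[leRHS]invrK lef_pV2 ?posrE ?invf_div ?divr1; lra.
pose e k := ((Re (V k.+1) + 1)*(Re (W k.+1) + 1))^-1.
have step k : [/\ 0 < e k, e k <= 1/2*(a k - a k.+1 + (b k - b k.+1)),
 cn (V k.+1 - W k.+1)*(1 - e k) <= cn (V k - W k) &
 cn (V k.+1 - W k.+1 - (V k - W k)) <= cn (V k.+1 - W k.+1)*e k].
 have [h1 _] := gV k.+1; have [h2 _] := gW k.+1; have := kk k.+1 => q.
 have v0 : 0 < Re (V k.+1) + 1 by clear -h1 q; lra.
 have w0 : 0 < Re (W k.+1) + 1 by clear -h2 q; lra.
 have [_ e1] := gV k; have [_ e2] := gW k.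
 have [||r1 r2] := @plus_diff_le V W k _ P Q (mulr_gt0 v0 w0) (lexx _).
 - by clear -h1 q; lra.
 - by clear -h2 q; lra.
 split=> //; first by rewrite invr_gt0 mulr_gt0.
 apply: le_trans (_ : 1/2*((Re (V k.+1) + 1) ^- 2 + (Re (W k.+1) + 1) ^- 2) <= _); last first.
  by rewrite ler_pM2l ?divr_gt0 //; apply: lerD.
 have am (s t : R) : s*t <= 1/2*(s^+2+t^+2).
  by have := sqr_ge0 (s-t); clra.
 by rewrite /e invfM -!exprVn; exact: am.
have main k : cn (V k - W k)*(1/2 + 1/2*(a k + b k)) <= cn (V 0%N - W 0%N).
 elim: k => [|k IH].
  have [_ ha] := a2 0%N; have [_ hb] := b2 0%N.
  by rewrite ler_piMr ?cn_ge0 //; clear -ha hb; lra.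
 apply: le_trans IH; have [e0 e1 e2 _] := step k.
 have [a0 ha] := a2 k; have [b0 hb] := b2 k.
 have [a0' _] := a2 k.+1; have [b0' _] := b2 k.+1.
 have c0 : 0 <= 1/2 + 1/2*(a k + b k) by clear -a0 b0; lra.
 apply: le_trans (ler_wpM2r c0 e2); rewrite -[leRHS]mulrA; apply: ler_wpM2l; first exact: cn_ge0.
 clear -e0 e1 ha hb a0 b0 a0' b0'; nra.
have bd k : cn (V k - W k) <= 2*cn (V 0%N - W 0%N).
 have := main k; have [a0 _] := a2 k; have [b0 _] := b2 k; have := cn_ge0 (V k - W k).
 by clear -a0 b0; nra.
split=> // k d.
have tele : cn (V (k+d)%N - W (k+d)%N - (V k - W k)) <=
  cn (V 0%N - W 0%N)*(a k - a (k+d)%N + (b k - b (k+d)%N)).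
 elim: d => [|d IH]; first by rewrite addn0 !subrr addr0 mulr0 cn0.
 have [e0 e1 _ e3] := step (k+d)%N.
 have -> : V (k+d.+1)%N - W (k+d.+1)%N - (V k - W k) =
  (V (k+d).+1 - W (k+d).+1 - (V (k+d)%N - W (k+d)%N)) + (V (k+d)%N - W (k+d)%N - (V k - W k)).
  by rewrite addnS; ring.
 apply: cnD_le; rewrite addnS.
 have h1 : cn (V (k+d).+1 - W (k+d).+1)*e (k+d)%N <= 2*cn (V 0%N - W 0%N)*e (k+d)%N.
  by rewrite ler_pM2r.
 have h2 : 2*cn (V 0%N - W 0%N)*e (k+d)%N <=
   cn (V 0%N - W 0%N)*(a (k+d)%N - a (k+d).+1 + (b (k+d)%N - b (k+d).+1)).
  have := ler_wpM2l (cn_ge0 (V 0%N - W 0%N)) e1; clra.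
 by move: e3 h1 h2 IH; clra.
apply: le_trans tele _; rewrite [8*_]mulrC -mulrA; apply: ler_wpM2l; first exact: cn_ge0.
have [a0 _] := a2 (k+d)%N; have [b0 _] := b2 (k+d)%N.
have k1 : 0 < k.+1%:R :> R by rewrite ltr0n.
have h1 : a k <= 4/k.+1%:R.
 have [h _] := gV k; have -> : 4/k.+1%:R = (k.+1%:R/4)^-1 :> R by rewrite invf_div.
 by rewrite lef_pV2 ?posrE ?divr_gt0 // -?[k.+1%:R]natr1; move: h (kk k); clra.
have h2 : b k <= 4/k.+1%:R.
 have [h _] := gW k; have -> : 4/k.+1%:R = (k.+1%:R/4)^-1 :> R by rewrite invf_div.
 by rewrite lef_pV2 ?posrE ?divr_gt0 // -?[k.+1%:R]natr1; move: h (kk k); clra.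
have -> : 8/k.+1%:R = 4/k.+1%:R + 4/k.+1%:R :> R by ring.
by move: h1 h2 a0 b0; move: (a k) (b k) (a _) (b _) (4/_); clear=> *; lra.
Qed.

(* The backward orbits of points near [-1/2] which turn up, then make [m] steps
  in the branch [Re < -1/2] and take the branch [Re > -1/2] forever. *)
Definition chain m y := [/\ forall j, y j = quad (y j.+1), cn (y 0%N + 1/2) <= 1/20,
 0 < Im (y 1%N), forall j, (2 <= j <= m.+1)%N -> Re (y j) < - (1/2) &
 forall j, (m.+1 < j)%N -> - (1/2) < Re (y j)].

Lemma geom_small (K e : R) : 0 < e -> exists m0, forall m, (m0 <= m)%N -> K*(17/20)^+m <= e.
Proof.
move=> e0; have h : (17/20 : R)^+n @[n --> \oo] --> (0 : R).
 by apply: cvg_expr; rewrite ger0_norm; lra.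
have h2 : K*(17/20 : R)^+n @[n --> \oo] --> K*0 by apply: cvgM => //; exact: cvg_cst.
rewrite mulr0 in h2; have [N _ HN] := near_cvg_le e0 h2.
exists N => m Nm; have := HN m Nm; rewrite /= subr0; apply: le_trans; exact: ler_norm.
Qed.

Lemma chain_first p q : p = quad q -> cn (p+1/2) <= 1/20 -> 0 < Im q ->
 [/\ 44/100 <= Im q, 44/100 <= cn (q+1/4) & cn (q - (-1 +i* 1)%C) <= 1].
Proof.
move=> e hp hi; have [] := near_real (a := p + 1/2) (x := 0) (d := 1/20) _.
 by rewrite rmorph0 subr0.
rewrite Re_half Im_half => h1 h2 h3.
have h := quad_sqr e.
have q4 : Re (1/4 : C) = 1/4 /\ Im (1/4 : C) = 0.
 by have := realc_div (1 : R) 4; rewrite rmorph1 rmorph_nat => <-.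
have hR := congr1 (@complex.Re R) h; have hI := congr1 (@complex.Im R) h.
rewrite expr2 cReM Re_half Im_half cReD (proj1 q4) in hR.
rewrite expr2 cImM Re_half Im_half cImD (proj2 q4) in hI.
have tb : 44/100 <= Im q.
 move: hi hR h2; move: (Re q) (Im q) (Re p); clear=> s t u t0 e1 e2.
 have t2 : 1/5 <= t*t by have := sqr_ge0 (s+1/2); move: e1 e2; clra.
 by move: t0 t2; clear; nra.
split=> //; first by apply: le_trans tb (le_trans (ler_norm _) _); have := cn_ge_Im (q+1/4); rewrite cImD (proj2 q4) addr0.
rewrite -(ler_pXn2r (n := 2)) ?nnegrE ?cn_ge0 // cn_sqr cReB cImB /= expr1n.
move: h1 h2 h3 hR hI hi tb; move: (Re q) (Im q) (Re p) (Im p).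
clear=> s t u v; rewrite ler_norml => h1 h2 /andP[h3 h4] h5 h6 h7 h8.
have s1 : s + 1/2 <= 6/100 by nra.
have s2 : - (6/100) <= s + 1/2 by nra.
have t1 : t <= 6/10 by nra.
nra.
Qed.

Lemma cn_im0 (t : R) : cn (t +i* 0)%C = `|t|.
Proof. exact: cn_real. Qed.

(** The points [-1 + i] and [-1 - i] form a cycle of [quad] that attracts the inverse branch with
    [Re < -1/2]; a long left run ends near it. *)
Definition cycle2 j : C := (-1 +i* (-1)^+j)%C.

Lemma sign_sqr j : ((-1)^+j)^+2 = 1 :> R.
Proof. by rewrite -exprM mulnC exprM sqrrN expr1n expr1n. Qed.

Lemma cycle2S j : cycle2 j = quad (cycle2 j.+1).
Proof.
have h := sign_sqr j; rewrite /quad /cycle2 expr2; apply: complex_ext => /=.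
 rewrite exprS; move: h; move: ((-1)^+j) => t; rewrite expr2; clra.
by rewrite exprS; clra.
Qed.

Lemma chain_neq0 m y : chain m y -> forall j, y j != 0.
Proof.
move=> [yS y0 _ _ _] j; apply/eqP => e.
have : y 0%N = 0.
 by elim: j e => // j IH e; apply: IH; rewrite yS e /quad expr0n addr0.
by move=> e0; move: y0; rewrite e0 add0r cn_half; clra.
Qed.

Lemma chain_turn m y : chain m y ->
 [/\ 0 < Im (y m.+1)*(-1)^+m, cn (y m.+1 - cycle2 m) <= 13/10*(17/20)^+m &
   (0 < m)%N -> 7/10 <= cn (y m.+1 + 1/4)].
Proof.
move=> [yS y0 y1 ym yp]; have [h1 h2 h3] := chain_first (yS 0%N) y0 y1.
have := @minus_run m (fun j => y j.+1) cycle2 _ _ _ _ _ m (leqnn m); case.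
- by move=> j jm; split; [exact: yS|apply: ym; rewrite ltnS].
- by move=> j jm; split; [exact: cycle2S|rewrite /cycle2 /=; clra].
- by rewrite /cycle2 /= expr0 mulr1.
- exact: h2.
- have := cn_ge_Im (cycle2 0 + 1/4); have := realc_div (1 : R) 4.
 by rewrite rmorph1 rmorph_nat cImD => <- /=; rewrite expr0 addr0 normr1; clra.
rewrite /= => a1 a2 a3; split=> //; last by move=> /a2[].
apply: le_trans a3 _; rewrite /cycle2 expr0 -[leRHS]mulr1; exact: ler_wpM2l.
Qed.

Lemma inv_plus p q : p = quad q -> p != 0 -> q != 0 -> - (1/2) < Re q ->
 p^-1 = q^-1 - 1 + (q^-1+1)^-1 /\ 1 < cn (q^-1+1).
Proof.
move=> e p0 q0 hq; have q1 : 1 + q != 0.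
 by apply: contraNneq p0 => q1; rewrite e /quad expr2 -[X in X + _]mulr1 -mulrDr q1 mulr0.
split.
 by rewrite e /quad; field; rewrite q0 q1 /=; have -> : q + q^+2 = q*(1+q) by [ring|]; rewrite mulf_neq0.
have -> : q^-1 + 1 = (1+q)/q by field.
rewrite cn_div ltr_pdivlMr ?cn_gt0 // mul1r.
rewrite -(ltr_pXn2r (n := 2)) ?nnegrE ?cn_ge0 // !cn_sqr cReD cImD /=.
by move: hq; clear; nra.
Qed.

(** At the end of a long left run the orbit is near [-1 + sg*i], hence its next right preimages are
    near the explicit points [sg*i] and [3/10 + (5/8)*sg*i]. These numbers place [1/y] where
    [plus_start] applies. *)
Lemma chain_turned : exists m1, forall m y, (m1 <= m)%N -> chain m y ->
 [/\ (0 < m)%N /\ 0 < Im (y m.+1)*(-1)^+m, 0 < Im (y m.+2)*(-1)^+m,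
  7/10 <= cn (y m.+1 + 1/4), 7/10 <= cn (y m.+2 + 1/4) &
  [/\ 29/100 <= cn (y m.+3), 0 < Im (y m.+3)*(-1)^+m &
  plus_orbit (fun k => (y (m.+3+k)%N)^-1) /\ 1/2 <= Re (y m.+3)^-1]].
Proof.
have [m1 Hm1] := geom_small (13/10) (ltac:(lra) : 0 < 1/200 :> R).
exists m1.+1 => m y hm Y; have [i1 c1 g1] := chain_turn Y.
have yn := chain_neq0 Y; case: Y => yS y0 y1 ym yp.
have {}c1 := le_trans c1 (Hm1 m (ltnW hm)).
have m0 : (0 < m)%N by apply: leq_trans hm.
have sg2 := sign_sqr m; set sg := (-1)^+m in i1 sg2 *.
have nextIm j : (m < j)%N -> 0 < Im (y j)*sg -> 0 < Im (y j.+1)*sg.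
 move=> mj; rewrite (Im_quad (yS j)) => h.
 have r := yp j.+1 mj; have r0 : 0 < 2*(Re (y j.+1) + 1/2) by move: r; clra.
 by rewrite -mulrA pmulr_rgt0 in h.
have i2 := nextIm m.+1 (ltnSn m) i1; have i3 := nextIm m.+2 (ltnW (ltnSn _)) i2.
pose q : C := (0 +i* sg)%C.
have qE : cycle2 m = quad q.
 apply: complex_ext; rewrite /quad expr2 /= -/sg; move: sg2; rewrite expr2; clra.
have c2 : cn (y m.+2 - q) <= 1/200.
 apply: le_trans c1; rewrite -[leRHS]mul1r.
 apply: (@contract _ _ _ _ 1 1 (yS m.+1) qE).
 - by clra.
 - by clra.
 - have := cn_ge_Im (cycle2 m + 1/4); have := realc_div (1 : R) 4.
  rewrite rmorph1 rmorph_nat cImD => <- /=; rewrite addr0 -/sg => h.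
  have s1 : `|sg| = 1 by apply/eqP; rewrite -sqrp_eq1 // -normrX sg2 normr1.
  by move: h; rewrite s1; have := cn_ge0 (y m.+1 + (1/4)%:C); clra.
 - by rewrite /=; have := yp m.+2 (ltnSn _); clra.
 - by rewrite /=; exact: ltW.
(* Rational approximation of the right preimage of [q], with residue [1/1600]. *)
pose p : C := (3/10 +i* (5/8*sg))%C.
have pE : quad p - q = (- (1/1600) +i* 0)%C.
 by apply: complex_ext; rewrite /quad expr2 /=; move: sg2; rewrite expr2; clra.
have c3 : cn (y m.+3 - p) <= 1/100.
 have e : (y m.+3 - p)*(1 + y m.+3 + p) = (y m.+2 - q) - (quad p - q).
  by rewrite -quadB (yS m.+2); ring.
 have h1 : cn ((y m.+3 - p)*(1 + y m.+3 + p)) <= 1/200 + 1/1600.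
  rewrite e; apply: cnB_le; apply: lerD => //.
  by rewrite pE cn_im0 ler_norml; apply/andP; split; clra.
 have h2 : 8/10 <= cn (1 + y m.+3 + p).
  apply: le_trans (le_trans (ler_norm _) (cn_ge_Re _)); rewrite !cReD /=.
  by have := yp m.+3 (ltnW (ltnSn _)); clra.
 by move: h1; rewrite cnM; have := cn_ge0 (y m.+3 - p); clear -h2; nra.
have h1 := le_trans (cn_ge_Re _) c3; have h2 := le_trans (cn_ge_Im _) c3.
rewrite cReB /= in h1; rewrite cImB /= in h2.
have r3 : 29/100 <= Re (y m.+3) by move: h1; rewrite ler_norml => /andP[h _]; move: h; clra.
have g2 : 7/10 <= cn (y m.+2 + 1/4).
 have := le_trans (cn_ge_Im _) c2; rewrite cImB /= => h.
 have := cn_ge_Im (y m.+2 + 1/4); have := realc_div (1 : R) 4.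
 rewrite rmorph1 rmorph_nat cImD => <- /=; rewrite addr0 => h'.
 apply: le_trans h'; have : `|sg| <= `|Im (y m.+2) - sg| + `|Im (y m.+2)|.
  by rewrite distrC -[X in `|X| <= _](subrK (Im (y m.+2))) ler_normD.
 have -> : `|sg| = 1 by apply/eqP; rewrite -sqrp_eq1 // -normrX sg2 normr1.
 by move: h; clra.
split=> //; first exact: g1.
split=> //; first by apply: le_trans r3 (le_trans (ler_norm _) (cn_ge_Re _)).
split.
 move=> k; rewrite addnS; have [] := inv_plus (yS (m.+3+k)%N) (yn _) (yn _) (yp _ _) => //.
 by clia.
rewrite cReV cn_sqr ler_pdivlMr; last first.
 by rewrite ltr_wpDr ?sqr_ge0 // exprn_gt0 //; clear -r3; lra.
move: h1 h2 r3 sg2; move: (Re _) (Im _) sg {i1 i2 i3 nextIm q qE c2 p pE c3 g2}; clear=> a b t.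
rewrite !ler_norml => /andP[h1 h2] /andP[h3 h4] h5 h6.
have b2 : b^+2 <= (635/1000)^+2.
 by move/eqP: h6; rewrite sqrf_eq1 => /orP[]/eqP e; rewrite e in h3 h4; move: h3 h4; clear; nra.
by move: h1 h2 h5 b2; clear; nra.
Qed.

Lemma chain_first_diff p q p' q' : p = quad q -> p' = quad q' -> 44/100 <= Im q ->
 44/100 <= Im q' -> cn (q-q') <= 12/10*cn (p-p').
Proof.
move=> e e' h h'; have -> : p - p' = (q-q')*(1+q+q') by rewrite e e' quadB.
rewrite cnM; have : 88/100 <= cn (1+q+q').
 apply: le_trans (le_trans (ler_norm _) (cn_ge_Im _)); rewrite !cImD /= add0r.
 by move: h h'; clra.
by have := cn_ge0 (q-q'); clear; nra.
Qed.

Lemma plus_orbit_shift V d : plus_orbit V -> plus_orbit (fun k => V (d+k)%N).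
Proof. by move=> P k; rewrite addnS; exact: P. Qed.

(** A step turns [x] into some [t] with [x + 1 <= t + 1/(t+1)], and the right side increases for
    [t >= 0]; the bounds [1/2], [1], [8/5], [2] follow one from another. *)
Lemma plus_start V : plus_orbit V -> 1/2 <= Re (V 0%N) ->
 [/\ 1 <= Re (V 1%N), 8/5 <= Re (V 2%N) & 2 <= Re (V 3%N)].
Proof.
move=> P h0; have up (k : nat) (x : R) : 0 <= x -> x <= Re (V k) -> 
  (x+1) <= Re (V k.+1) + (Re (V k.+1) + 1)^-1.
 move=> x0 hx; have h := le_trans hx (plus_mono k P).
 by apply: le_trans (plus_step P _); [rewrite lerD2r|exact: le_trans h].
have low (t b c : R) : 0 <= t -> 0 <= b -> b + (b+1)^-1 <= c -> c <= t + (t+1)^-1 -> b <= t.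
 move=> t0 b0 h1 h2; rewrite leNgt; apply/negP => tb.
 have : b + (b+1)^-1 - (t + (t+1)^-1) = (b-t)*(1 - ((b+1)*(t+1))^-1).
  by field; rewrite !gt_eqF //; lra.
 have : ((b+1)*(t+1))^-1 < 1 by rewrite invf_lt1; nra.
 by nra.
have n0 k : 0 <= Re (V k).
 apply: (@le_trans _ _ (Re (V 0%N))); first by lra.
 by elim: k => // k IH; apply: le_trans IH (plus_mono k P).
have h1 : 1 <= Re (V 1%N).
 have e2 : (1 + 1 : R)^-1 = 1/2 by field.
 have u := up 0%N (1/2) ltac:(lra) h0.
 by apply: (low _ _ _ (n0 1%N) ler01 _ u); rewrite e2; lra.
have h2 : 8/5 <= Re (V 2%N).
 apply: (low _ _ _ (n0 2%N) _ _ (up 1%N 1 ler01 h1)); first by lra.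
 have -> : (8/5 + 1 : R)^-1 = 5/13 by field.
 by lra.
split=> //; apply: (low _ _ _ (n0 3%N) _ _ (up 2%N (8/5) _ h2)); try lra.
have -> : (2 + 1 : R)^-1 = 1/3 by field.
by lra.
Qed.

Definition exit_lim (r : nat -> R) y (Y : C) := forall e : R, 0 < e -> exists N, forall j, (N <= j)%N ->
 y j != 0 /\ cn ((y j)^-1 - ((r j)^-1)%:C - Y) <= e.

Lemma ref_plus_orbit (r : nat -> R) : (forall j, 0 < r j) -> (forall j, r j = quad (r j.+1)) ->
 plus_orbit (fun k => ((r k)^-1)%:C).
Proof.
move=> r0 rS k; have h0 := r0 k; have h1 := r0 k.+1.
have re : - (1/2) < Re (r k.+1)%:C :> R by rewrite /=; move: h1; clra.
have e : (r k)%:C = quad (r k.+1)%:C :> C by rewrite {1}rS /quad rmorphD rmorphXn.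
have n0 j : (r j)%:C != 0 :> C by rewrite -cn_gt0 cn_real normr_gt0 gt_eqF.
by have := inv_plus e (n0 k) (n0 k.+1) re; rewrite !fmorphV => -[].
Qed.

Lemma chain_lim (r : nat -> R) : (forall j, 0 < r j) -> (forall j, r j = quad (r j.+1)) ->
 exists m1, forall m y, (m1 <= m)%N -> chain m y -> exists Y, exit_lim r y Y.
Proof.
move=> r0 rS.
have [m1 Hm1] := chain_turned; exists m1 => m y hm Y.
have [_ _ _ _ [_ _ [P hP]]] := Hm1 m y hm Y.
have yn := chain_neq0 Y.
have [J HJ] := refV_unbounded r0 rS 2.
pose J' := (3+J)%N.
pose V k := (y (m.+3 + (J'+k))%N)^-1; pose W k := ((r (m.+3 + (J'+k))%N)^-1)%:C.
have PV : plus_orbit V by exact: (plus_orbit_shift J' P).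
have PW : plus_orbit W by exact: (plus_orbit_shift J' (plus_orbit_shift m.+3 (ref_plus_orbit r0 rS))).
have [] := plus_start P; first by rewrite addn0.
move=> _ _ h3.
have V2 : 2 <= Re (V 0%N).
 apply: le_trans h3 _; rewrite /V /J' addn0; elim: (J) => [|i IH]; first by rewrite addn0.
 by apply: le_trans IH _; have := plus_mono (3+i)%N P; rewrite !addnS.
have W2 : 2 <= Re (W 0%N) by apply: HJ; rewrite /J'; clia.
have [_ H] := plus_run PV PW V2 W2.
set K := 8*_ in H.
have [l Hl] : exists l, forall e : R, 0 < e -> exists N, forall k, (N <= k)%N -> cn (V k - W k - l) <= e.
 apply: (@complex_cauchy_lim R (fun k => V k - W k)) => e e0.
 have [N N0 HN] := inv_small K (ltac:(by rewrite divr_gt0) : 0 < e/2).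
 have S k : (N <= k)%N -> cn (V k - W k - (V N - W N)) <= e/2.
  move=> Nk; have := H N (k-N)%N; rewrite subnKC // => /le_trans; apply.
  by apply: HN; rewrite leqnSn.
 exists N => i k Ni Nk.
 have -> : V i - W i - (V k - W k) = (V i - W i - (V N - W N)) - (V k - W k - (V N - W N)) by ring.
 by apply: cnB_le; rewrite [e]splitr; apply: lerD; exact: S.
exists l => e e0; have [N HN] := Hl e e0; exists (N + (m.+3+J'))%N => j hj; split=> //.
have := HN (j - (m.+3+J'))%N; rewrite /V /W.
have -> : (m.+3 + (J' + (j - (m.+3+J'))) = j)%N by move: hj; clia.
by apply; move: hj; clia.
Qed.

(** The left run contracts by [(17/20)^m], while the turn and the right run have bounded distortion.
    In the other direction, the first point of a chain depends on its offset in a strongly expanding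
    way. *)
Lemma chain_sep (r : nat -> R) : exists m1, forall m y y' Y Y', (m1 <= m)%N -> chain m y -> chain m y' ->
 exit_lim r y Y -> exit_lim r y' Y' -> cn (Y-Y') <= 100*(17/20)^+m*cn (y 0%N - y' 0%N).
Proof.
have [m1 Hm1] := chain_turned; exists m1 => m y y' Y Y' hm D D' L L'.
have [[m0 i1] i2 g1 g2 [g3 i3 [P hP]]] := Hm1 m y hm D.
have [[_ i1'] i2' g1' g2' [g3' i3' [P' hP']]] := Hm1 m y' hm D'.
have yn := chain_neq0 D; have yn' := chain_neq0 D'.
have sg2 := sign_sqr m; set sg := (-1)^+m in i1 i2 i3 i1' i2' i3' sg2.
have imp (a b : R) : 0 < a*sg -> 0 < b*sg -> 0 <= a*b.
 move=> h1 h2; have := mulr_gt0 h1 h2.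
 have -> : a*sg*(b*sg) = a*b*sg^+2 by ring.
 by rewrite sg2 mulr1 => /ltW.
case: D => yS y0 y1 ym yp; case: D' => yS' y0' y1' ym' yp'.
have [a1 a2 _] := chain_first (yS 0%N) y0 y1; have [a1' a2' _] := chain_first (yS' 0%N) y0' y1'.
have s1 := chain_first_diff (yS 0%N) (yS' 0%N) a1 a1'.
have := @minus_run m (fun j => y j.+1) (fun j => y' j.+1) _ _ _ _ _ m (leqnn m); case.
- by move=> j jm; split; [exact: yS|apply: ym; rewrite ltnS].
- by move=> j jm; split; [exact: yS'|apply: ym'; rewrite ltnS].
- by move: a1 a1'; clear; nra.
- exact: a2.
- exact: a2'.
rewrite /= => _ _ s2.
have ge j : (m.+1 < j)%N -> 0 <= (Re (y j) + 1/2)*(Re (y' j) + 1/2).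
 by move=> mj; have := yp j mj; have := yp' j mj; clear; nra.
have s3 : cn (y m.+2 - y' m.+2) <= cn (y m.+1 - y' m.+1).
 rewrite -[leRHS]mul1r; apply: (@contract _ _ _ _ 1 1 (yS _) (yS' _) _ _ _ (ge _ (ltnSn _)) (imp _ _ i2 i2')).
 - by clra.
 - by clra.
 - by move: g1 g1'; clra.
have s4 : cn (y m.+3 - y' m.+3) <= cn (y m.+2 - y' m.+2).
 rewrite -[leRHS]mul1r; apply: (@contract _ _ _ _ 1 1 (yS _) (yS' _) _ _ _ (ge _ (ltnW (ltnSn _))) (imp _ _ i3 i3')).
 - by clra.
 - by clra.
 - by move: g2 g2'; clra.
pose V k := (y (m.+3+k)%N)^-1; pose W k := (y' (m.+3+k)%N)^-1.
have s5 : cn (V 0%N - W 0%N) <= 12*cn (y m.+3 - y' m.+3).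
 rewrite /V /W addn0; apply: le_trans (inv_diff _ g3 g3') _; first by clra.
 rewrite mulrC; apply: ler_wpM2r; first exact: cn_ge0.
 by rewrite -[leRHS]invrK lef_pV2 ?posrE ?invr_gt0 ?exprn_gt0 //; clra.
have [|v1 v2 v3] := plus_start P; first by rewrite addn0.
have [|w1 w2 w3] := plus_start P'; first by rewrite addn0.
have st k : 1 <= Re (V k.+1) -> 1 <= Re (W k.+1) ->
  cn (V k.+1 - W k.+1) <= 4/3*cn (V k - W k).
 move=> hv hw; have [||||q _] := @plus_diff_le V W k 4 P P'.
 - by clra.
 - by move: hv hw; clear; nra.
 - by move: hv; clra.
 - by move: hw; clra.
 have -> : 4/3*cn (V k - W k) = cn (V k - W k)/(1-4^-1) by field.
 rewrite ler_pdivlMr //; clra.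
have t1 := st 0%N v1 w1.
have t2 := st 1%N ltac:(move: v2; rewrite /V; clra) ltac:(move: w2; rewrite /W; clra).
have t3 := st 2%N ltac:(move: v3; rewrite /V; clra) ltac:(move: w3; rewrite /W; clra).
have [bd _] := @plus_run (fun k => V (3+k)%N) (fun k => W (3+k)%N)
 (plus_orbit_shift 3 P) (plus_orbit_shift 3 P') v3 w3.
rewrite /= in bd.
have fin : cn (Y-Y') <= 2*cn (V 3%N - W 3%N).
 apply/ler_addgt0Pr => e e0; have e2 : 0 < e/2 by rewrite divr_gt0.
 have [N HN] := L _ e2; have [N' HN'] := L' _ e2.
 pose k := (N+N')%N; have := bd k.
 have [_ q] := HN (m.+3 + (3+k))%N ltac:(rewrite /k; clia).
 have [_ q'] := HN' (m.+3 + (3+k))%N ltac:(rewrite /k; clia).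
 rewrite /V /W; move: q q'; set p := _^-1; set p' := (y' _)^-1; set ref := _%:C => q q' h.
 have -> : Y - Y' = (p-p') - (p-ref-Y) + (p'-ref-Y') by ring.
 apply: cnD_le; apply: le_trans (lerD (cnB _ _) (lexx _)) _.
 by move: q q' h; clra.
have pw : 0 <= (17/20)^+m :> R by apply: exprn_ge0; clra.
have s6 : 13/10*(17/20)^+m*cn (y 1%N - y' 1%N) <=
  13/10*(17/20)^+m*(12/10*cn (y 0%N - y' 0%N)).
 by apply: ler_wpM2l s1; move: pw; clra.
(* The constants multiply to [(156/100)*12*(4/3)^3*2], which is below 100. *)
have := mulr_ge0 pw (cn_ge0 (y 0%N - y' 0%N)).
move: s6; rewrite mulrA; move: s2 s3 s4 s5 t1 t2 t3 fin; clear.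
set a := _^+m; set b := cn (y 0%N - _).
have -> : 13/10*a*(12/10)*b = 156/100*(a*b) by field.
have -> : 100*a*b = 100*(a*b) by ring.
by lra.
Qed.

(** A chain issued from the critical point itself: [quad (-1/2 + i/2) = -1/2], and afterwards the
    sign of [csqrt] selects the branch. Imaginary parts never vanish from index 1 on, so the branch
    inequalities are strict. *)
Fixpoint ideal_chain m j : C :=
 match j with
 | 0 => - (1/2)
 | 1 => (- (1/2) +i* (1/2))%C
 | k.+1 => - (1/2) + (if (k < m.+1)%N then - csqrt (ideal_chain m k + 1/4)
             else csqrt (ideal_chain m k + 1/4))
 end.

Lemma ideal_chainP m : chain m (ideal_chain m).
Proof.
have E (p s : C) : s^+2 = p + 1/4 -> p = quad (- (1/2) + s).
 by move=> h; apply: (addIr (1/4)); rewrite -h /quad; field.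
have hf : (- (1/2) : C) = (- (1/2) : R)%:C.
 by have := realc_div (1 : R) 2; rewrite rmorph1 rmorph_nat => <-; rewrite rmorphN.
have step j : ideal_chain m j.+2 = - (1/2) + (if (j.+1 < m.+1)%N then - csqrt (ideal_chain m j.+1 + 1/4)
   else csqrt (ideal_chain m j.+1 + 1/4)) by [].
have yS j : ideal_chain m j = quad (ideal_chain m j.+1).
 case: j => [|j].
  by rewrite [ideal_chain m 0]/= hf; apply: complex_ext; rewrite /quad expr2 /=; clra.
 rewrite step; apply: E; case: ifP => _; rewrite ?sqrrN; exact: csqrt_sqr.
have im j : Im (ideal_chain m j.+1) != 0.
 elim: j => [|j IH]; first by rewrite /= gt_eqF //; clra.
 have := Im_quad (yS j.+1); apply: contra_eq_neq => e; rewrite e mulr0; exact: IH.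
have re j : Re (csqrt (ideal_chain m j.+1 + 1/4)) > 0.
 rewrite lt_neqAle csqrt_ge0 andbT eq_sym; apply/eqP => e.
 have := csqrt_sqr (ideal_chain m j.+1 + 1/4) => /(congr1 (@complex.Im R)).
 rewrite expr2 cImM e mul0r mulr0 addr0 cImD.
 have := realc_div (1 : R) 4; rewrite rmorph1 rmorph_nat => <- /=; rewrite addr0 => /esym/eqP.
 by rewrite (negbTE (im j)).
split=> //.
- by rewrite /= addNr cn0; clra.
- by rewrite /=; clra.
- case=> [|[|j]] // /andP[_ jm]; rewrite step jm hf cReD /= cReN.
 by have := re j; clra.
case=> [|[|j]] jm; [by []|by []|].
rewrite step ifF; last by rewrite ltnNge -ltnS jm.
by rewrite hf cReD Re_real; have := re j; clra.
Qed.

End Chains.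

(** * Cauchy estimates for polynomials *)

Section PolyBounds.
Variable R : realType.
Local Notation C := R[i].
Implicit Types (p : {poly C}).

(** Iterated square roots of [-1] are primitive roots of unity of order [2^(k+1)]; they allow
    averaging over a circle without integrals. *)
Fixpoint root2 k : C := if k is k'.+1 then csqrt (root2 k') else -1.

Lemma root2_exp k : root2 k^+(2^k) = -1.
Proof.
elim: k => [|k IH]; first by rewrite expn0 expr1.
by rewrite expnS exprM /= csqrt_sqr.
Qed.

Lemma root2_prim k : (2^k.+1).-primitive_root (root2 k).
Proof.
have h1 : root2 k^+(2^k.+1) = 1 by rewrite expnSr exprM root2_exp sqrrN expr1n.
have [n pn nd] := prim_order_exists (expn_gt0 2 k.+1 : (0 < 2^k.+1)%N) h1.
have /(dvdn_pfactor _ _ (isT : prime 2)) [e ek ne] := nd.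
suff -> : k.+1 = e by rewrite -ne.
apply/eqP; rewrite eqn_leq ek andbT ltnNge; apply/negP => ek'.
have : root2 k^+(2^k) == 1.
 by rewrite -(prim_order_dvd pn) ne dvdn_exp2l.
rewrite root2_exp => /eqP e1.
have : cn (1 - (-1) : C) = 0 by rewrite e1 subrr cn0.
by rewrite opprK -(natrD _ 1 1) cn_nat => /eqP; rewrite pnatr_eq0.
Qed.

(** Averaging [p(rho*om^l)*om^(-i*l)] over the powers of a root of unity [om], of order larger than
    the degree and than [i], isolates the coefficient of index [i]. *)
Lemma coef_bound p (rho M : R) i : 0 < rho -> (forall s, cn s = rho -> cn p.[s] <= M) ->
 cn p`_i*rho^+i <= M.
Proof.
move=> rho0 HM.
pose k := (size p + i)%N; pose N := (2^k.+1)%N; pose om := root2 k.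
have pr : N.-primitive_root om := root2_prim k.
have kN : (k < N)%N by apply: leq_trans (ltn_expl k (isT : (1 < 2)%N)) _; rewrite leq_exp2l.
have sN : (size p <= N)%N by apply: leq_trans (ltnW kN); rewrite leq_addr.
have iN : (i < N)%N by apply: leq_ltn_trans kN; rewrite leq_addl.
have N0 : (0 < N)%N by apply: leq_ltn_trans kN.
have om1 : cn om = 1.
 have h : cn om^+N = 1 by rewrite -cnX (prim_expr_order pr) cn1.
 by apply/eqP; rewrite -(eqrXn2 N0) ?cn_ge0 ?ler01 // h expr1n.
have om0 : om != 0 by rewrite -cn_gt0 om1 ltr01.
pose rc := rho%:C : C.
have crc : cn rc = rho by rewrite cn_real gtr0_norm.
have key : \sum_(l < N) p.[rc * om^+l] * om ^- (i * l) = N%:R*(p`_i*rc^+i).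
 transitivity (\sum_(l < N) \sum_(j < N) p`_j*rc^+j*(om^+j/om^+i)^+l).
  apply: eq_bigr => l _; rewrite (horner_coef_wide _ sN) mulr_suml; apply: eq_bigr => j _.
  rewrite exprMn -!mulrA; congr (_*(_*_)).
  by rewrite expr_div_n -!exprM [(l*j)%N]mulnC.
 rewrite exchange_big /= (bigD1 (Ordinal iN)) //= [X in _ + X]big1 ?addr0.
  rewrite (eq_bigr (fun=> p`_i*rc^+i)); last first.
   by move=> l _; rewrite divff ?expf_neq0 // expr1n mulr1.
  by rewrite sumr_const card_ord mulr_natl.
 move=> j ji; rewrite -mulr_sumr; set th := _/_.
 have th1 : th != 1.
  apply: contraNneq ji => e; apply/eqP/val_inj => /=.
  have : om^+j == om^+i by rewrite -(divfK (expf_neq0 i om0) (om^+j)) -/th e mul1r.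
  by rewrite (eq_prim_root_expr pr) !modn_small // => /eqP.
 have thN : th^+N = 1.
  by rewrite /th expr_div_n -!exprM ![(_*N)%N]mulnC !exprM (prim_expr_order pr) !expr1n divr1.
 have := subrX1 th N; rewrite thN subrr => /esym/eqP; rewrite mulf_eq0 subr_eq0 (negbTE th1) /=.
 by move=> /eqP ->; rewrite mulr0.
have Nr := natr_gt0 R N0.
have : cn (N%:R*(p`_i*rc^+i)) <= N%:R*M.
 rewrite -key; have -> : N%:R*M = \sum_(l < N) M by rewrite sumr_const card_ord mulr_natl.
 apply: (big_ind2 (fun (x : C) (y : R) => cn x <= y)) => [|x y x' y' h h'|l _].
 - by rewrite cn0.
 - by apply: cnD_le; exact: lerD.
 rewrite cnM cnV cnX om1 expr1n invr1 mulr1; apply: HM.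
 by rewrite cnM cnX om1 expr1n mulr1.
by rewrite cnM cn_nat ler_pM2l // cnM cnX crc.
Qed.

Lemma coef_bound_disc p (rho M : R) i : 0 < rho -> (forall s, cn s <= rho -> cn p.[s] <= M) ->
 cn p`_i <= M*rho^-1^+i.
Proof.
move=> r0 H; rewrite exprVn ler_pdivlMr ?exprn_gt0 //.
by apply: coef_bound => // s hs; apply: H; rewrite hs.
Qed.

Lemma half_sum n : \sum_(i < n) 2^-1^+i <= 2 :> R.
Proof.
suff -> : \sum_(i < n) 2^-1^+i = 2 - 2*2^-1^+n :> R.
 by rewrite gerBl mulr_ge0 // exprn_ge0 // invr_ge0.
elim: n => [|n IH]; first by rewrite big_ord0 expr0 mulr1 subrr.
by rewrite big_ord_recr /= IH exprS; field.
Qed.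

Lemma half_sum1 n : \sum_(i < n) i%:R*2^-1^+i <= 2 :> R.
Proof.
suff -> : \sum_(i < n) i%:R*2^-1^+i = 2 - 2*(n%:R+1)*2^-1^+n :> R.
 by rewrite gerBl mulr_ge0 ?mulr_ge0 ?addr_ge0 // exprn_ge0 // invr_ge0.
elim: n => [|n IH]; first by rewrite big_ord0 expr0; ring.
by rewrite big_ord_recr /= IH exprS -[n.+1%:R]natr1; field.
Qed.

Lemma cn_sum n (f : 'I_n -> C) (g : 'I_n -> R) : (forall i, cn (f i) <= g i) ->
 cn (\sum_(i < n) f i) <= \sum_(i < n) g i.
Proof.
move=> h; apply: (big_ind2 (fun (x : C) (y : R) => cn x <= y)) => [|x y x' y' h1 h2|l _] //.
 by rewrite cn0.
by apply: cnD_le; exact: lerD.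
Qed.

(** A weak two constants theorem, uniform in the degree: the bound on radius 2 makes the tail of the
    coefficients small on the unit disc, and the bound on radius [dl] handles the first [m] of
    them. *)
Lemma two_constants (B e dl : R) : 0 <= B -> 0 < e -> 0 < dl -> exists2 d, 0 < d &
 forall p, (forall s, cn s <= 2 -> cn p.[s] <= B) -> (forall s, cn s <= dl -> cn p.[s] <= d) ->
 forall s, cn s <= 1 -> cn p.[s] <= e.
Proof.
move=> B0 e0 dl0.
have h : (2^-1 : R)^+n @[n --> \oo] --> (0 : R).
 by apply: cvg_expr; rewrite ger0_norm ?invr_ge0 // invf_lt1 // ltr1n.
have h2 : (2*B)*(2^-1 : R)^+n @[n --> \oo] --> (2*B)*0 by apply: cvgM => //; exact: cvg_cst.
rewrite mulr0 in h2; have [m _ Hm] := near_cvg_le (ltac:(by rewrite divr_gt0) : 0 < e/2) h2.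
have {h h2 Hm} hm : 2*B*2^-1^+m <= e/2.
 have := Hm m (leqnn m); rewrite /= subr0; apply: le_trans; exact: ler_norm.
pose S := 1 + \sum_(i < m) dl^-1^+i.
have S0 : 0 < S by rewrite ltr_pwDl // sumr_ge0 // => i _; rewrite exprn_ge0 // invr_ge0 ltW.
exists (e/(2*S)); first by rewrite divr_gt0 // mulr_gt0.
move=> p hB hd s s1.
have sz : (size p <= m + size p)%N by rewrite leq_addl.
rewrite (horner_coef_wide _ sz) big_split_ord /=; apply: cnD_le.
rewrite [e]splitr; apply: lerD.
 apply: (@le_trans _ _ (\sum_(i < m) e/(2*S)*dl^-1^+i)).
  apply: cn_sum => i; rewrite cnM cnX -[leRHS]mulr1; apply: ler_pM; rewrite ?exprn_ge0 ?cn_ge0 //.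
   exact: coef_bound_disc.
  by rewrite exprn_ile1 ?cn_ge0.
 rewrite -mulr_sumr; have -> : e/2 = e/(2*S)*S by field; rewrite gt_eqF.
 by rewrite ler_pM2l ?divr_gt0 ?mulr_gt0 // /S lerDr.
apply: (@le_trans _ _ (\sum_(i < size p) B*2^-1^+m*2^-1^+i)).
 apply: cn_sum => i; rewrite cnM cnX -[leRHS]mulr1; apply: ler_pM; rewrite ?exprn_ge0 ?cn_ge0 //.
  by rewrite -mulrA -exprD; exact: coef_bound_disc.
 by rewrite exprn_ile1 ?cn_ge0.
rewrite -mulr_sumr; apply: le_trans hm; rewrite [2*B]mulrC -!mulrA; apply: ler_wpM2l => //.
rewrite [2*_]mulrC; apply: ler_wpM2l; last exact: half_sum.
by rewrite exprn_ge0 // invr_ge0.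
Qed.

Lemma powB_le (s t : C) (b : R) i : cn s <= b -> cn t <= b ->
 cn (s^+i-t^+i) <= i%:R*b^+i.-1*cn (s-t).
Proof.
move=> hs ht; rewrite subrXX cnM mulrC; apply: ler_wpM2r; first exact: cn_ge0.
apply: (@le_trans _ _ (\sum_(j < i) b^+i.-1)); last by rewrite sumr_const card_ord mulr_natl.
apply: cn_sum => j; rewrite cnM !cnX.
have ji : (j <= i.-1)%N by have := ltn_ord j; clia.
rewrite -[in leRHS](subnK ji) exprD; have b0 : 0 <= b by apply: le_trans hs; exact: cn_ge0.
by apply: ler_pM; rewrite ?exprn_ge0 ?cn_ge0 // lerXn2r ?nnegrE ?cn_ge0.
Qed.

Lemma poly_lip p (rho M : R) : 0 < rho -> (forall s, cn s <= rho -> cn p.[s] <= M) ->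
 forall s t, cn s <= rho/2 -> cn t <= rho/2 -> cn (p.[s]-p.[t]) <= 4*M/rho*cn (s-t).
Proof.
move=> r0 H s t hs ht; rewrite !horner_coef -sumrB.
have M0 : 0 <= M by apply: le_trans (H 0 _); rewrite ?cn_ge0 ?cn0 // ltW.
apply: (@le_trans _ _ (\sum_(i < size p) 2*M/rho*cn (s-t)*(i%:R*2^-1^+i))).
 apply: cn_sum => i; rewrite -mulrBr cnM.
 have c := coef_bound_disc i r0 H; have d := powB_le i hs ht.
 apply: le_trans (ler_pM (cn_ge0 _) (cn_ge0 _) c d) _.
 case: (i : nat) => [|j]; first by rewrite !mul0r mulr0 mulr0.
 rewrite /= exprMn le_eqVlt; apply/orP; left; apply/eqP.
 rewrite ![_^+j.+1]exprS exprVn.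
 by field; rewrite !expf_neq0 ?gt_eqF.
rewrite -mulr_sumr.
have -> : 4*M/rho*cn (s-t) = 2*M/rho*cn (s-t)*2 by ring.
apply: ler_wpM2l; last exact: half_sum1.
by rewrite !mulr_ge0 ?cn_ge0 // invr_ge0 ltW.
Qed.

Lemma poly_taylor p (rho M : R) : 0 < rho -> (forall s, cn s <= rho -> cn p.[s] <= M) ->
 forall s, cn s <= rho/2 -> cn (p.[s]-p.[0]-p`_1*s) <= 2*M/rho^+2*cn s^+2.
Proof.
move=> r0 H s hs.
have M0 : 0 <= M by apply: le_trans (H 0 _); rewrite ?cn_ge0 ?cn0 // ltW.
have sz : (size p <= (size p).+2)%N by rewrite leqW.
rewrite horner_coef0 (horner_coef_wide _ sz) 2!big_ord_recl /= expr0 mulr1 expr1.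
set S := \sum_(i < _) _.
have -> : p`_0 + (p`_1*s+S) - p`_0 - p`_1*s = S by ring.
apply: (@le_trans _ _ (\sum_(i < size p) M/rho^+2*cn s^+2*2^-1^+i)).
 apply: cn_sum => i; rewrite /bump /= !add1n cnM cnX.
 have c := coef_bound_disc i.+2 r0 H.
 have d : cn s^+i <= (rho/2)^+i by rewrite lerXn2r ?nnegrE ?cn_ge0 // divr_ge0 // ltW.
 have d' : cn s^+i.+2 <= cn s^+2*(rho/2)^+i.
  by rewrite -addn2 exprD mulrC; apply: ler_wpM2l => //; exact: sqr_ge0.
 apply: le_trans (ler_pM (cn_ge0 _) (exprn_ge0 _ (cn_ge0 _)) c d') _.
 rewrite le_eqVlt; apply/orP; left; apply/eqP.
 rewrite exprMn -addn2 exprD !exprVn.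
 by field; rewrite !expf_neq0 ?gt_eqF.
rewrite -mulr_sumr.
have -> : 2*M/rho^+2*cn s^+2 = M/rho^+2*cn s^+2*2 by ring.
apply: ler_wpM2l; last exact: half_sum.
exact: (mulr_ge0 (divr_ge0 M0 (sqr_ge0 _)) (sqr_ge0 _)).
Qed.

End PolyBounds.

(** * Polydiscs, connectedness and Fatou components *)

Section Box.
Variable R : realType.
Local Notation C := R[i].
Local Notation K := (R[i] : numFieldType).
Local Notation T := 'rV[K]_2.

Definition box (p : T) (d : R) : set T :=
 [set q | forall j : 'I_2, cn (q 0 j - p 0 j) <= d].

Lemma boxxx p d : 0 <= d -> box p d p.
Proof. by move=> d0 j; rewrite subrr cn0. Qed.
Lemma box_sym p q d : box p d q -> box q d p.
Proof. by move=> h j; rewrite cnBC. Qed.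

Lemma box_trans p q r d e : box p d q -> box q e r -> box p (d+e) r.
Proof.
move=> h k j; have := cnD (r 0 j - q 0 j) (q 0 j - p 0 j).
by rewrite addrA subrK => /le_trans; apply; rewrite addrC lerD.
Qed.

Lemma box_le p d e : d <= e -> box p d `<=` box p e.
Proof. by move=> de q h j; apply: le_trans (h j) de. Qed.
Lemma ballCE (x y : K) (e : R) : ball x e%:C y <-> cn (x-y) < e.
Proof. by rewrite -ball_normE /ball_ /= cnE ltcR. Qed.

Lemma ball_rowE (x y : T) (e : R) : 0 < e ->
 ball x e%:C y <-> forall j, cn (y 0 j - x 0 j) < e.
Proof.
move=> e0; split=> [[_ h] j|h].
 by have /ballCE := h 0 j; rewrite cnBC.
by split=> [|i j]; rewrite ?ltcR // ord1 ballCE cnBC.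
Qed.

Lemma pos_realC (e : C) : 0 < e -> exists2 r : R, 0 < r & e = r%:C.
Proof.
move=> e0; exists (Re e).
 by move: e0; case: e => a b; rewrite ltcE /= => /andP[].
by move: e0; case: e => a b; rewrite ltcE /= => /andP[/eqP -> _].
Qed.

Lemma nbhs_box (p : T) (V : set T) :
 nbhs p V <-> exists2 d : R, 0 < d & box p d `<=` V.
Proof.
split.
 move=> /nbhs_ballP[e /= /pos_realC[d d0 ->] h]; exists (d/2); first by rewrite divr_gt0.
 move=> q hq; apply: h; apply/ball_rowE => // j.
 by apply: le_lt_trans (hq j) _; lra.
move=> [d d0 h]; apply/nbhs_ballP; exists d%:C; first by rewrite /= ltcR.
by move=> q /ball_rowE hq; apply: h => j; apply/ltW/hq.
Qed.

Lemma open_box (U : set T) p : open U -> U p -> exists2 d : R, 0 < d & box p d `<=` U.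
Proof. by move=> oU Up; apply/nbhs_box; apply: open_nbhs_nbhs. Qed.

Lemma box_open (U : set T) :
 (forall p, U p -> exists2 d : R, 0 < d & box p d `<=` U) -> open U.
Proof. by move=> h; rewrite openE => p /h /nbhs_box. Qed.

Lemma luc_box (U : set T) f h : locally_uniform_cvg U f h ->
 forall x, U x -> exists2 d : R, 0 < d & forall e, 0 < e ->
  \forall n \near \oo, forall q, box x d q -> box (h q) e (f n q).
Proof.
move=> hf x /hf[V /nbhs_box[d d0 dV] hV]; exists d => // e e0.
have : nbhs (h : {uniform` V -> T}) [set g | forall y, V y -> box (h y) e (g y)].
 apply/uniform_nbhs; exists [set xy | ball xy.1 e%:C xy.2]; split.
  by rewrite -entourage_ballE; exists e%:C; rewrite //= ltcR.
 by move=> g /= hg y /hg /ball_rowE b j; apply/ltW/b.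
move=> /hV h1; have [N _ hN] : \forall n \near \oo, forall y, V y -> box (h y) e (f n y) := h1.
by exists N => // n /hN hn q /dV; apply: hn.
Qed.

Lemma box_luc (U : set T) f h :
 (forall x, U x -> exists2 d : R, 0 < d & forall e, 0 < e ->
  \forall n \near \oo, forall q, box x d q -> box (h q) e (f n q)) ->
 locally_uniform_cvg U f h.
Proof.
move=> hf x /hf[d d0 hd]; exists (box x d); first by apply/nbhs_box; exists d.
move=> Q /uniform_nbhs[E [entE subE]].
move: entE; rewrite -entourage_ballE => -[e /= /pos_realC[r r0 ->] rE].
have r20 : 0 < r/2 by rewrite divr_gt0.
have [N _ hN] := hd (r/2) r20.
exists N => // n /hN h1; apply: subE => y /h1 h2; apply: rE; apply/ball_rowE => // j.
by apply: le_lt_trans (h2 j) _; lra.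
Qed.

Lemma complex_square_compact (B : R) :
 compact [set z : K | (- B <= Re z <= B) /\ (- B <= Im z <= B)].
Proof.
pose g := fun x : R*R => (x.1 +i* x.2)%C : K.
have -> : [set z : K | (- B <= Re z <= B) /\ (- B <= Im z <= B)] =
  g @` (`[- B, B] `*` `[- B, B]).
 apply/seteqP; split=> [[a b] /= [h1 h2]|z [[a b] /= []]].
  by exists (a, b) => //=; rewrite !in_itv.
 by rewrite !in_itv /= => h1 h2 <-.
apply: continuous_compact; last by apply: compact_setX; exact: segment_compact.
apply: continuous_subspaceT => -[a b] V /nbhs_ballP[e /= /pos_realC[d d0 ->] hV].
exists (ball a (d/2), ball b (d/2)) => /=.
 by split; apply: nbhsx_ballx; rewrite divr_gt0.
move=> [a' b'] /= [h1 h2]; apply: hV; rewrite ballCE.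
move: h1 h2; rewrite -!ball_normE /ball_ /= => h1 h2.
have -> : g (a, b) - g (a', b') = (a-a')%:C + 'i%C*(b-b')%:C.
 by rewrite /g; apply/eqP; rewrite eq_complex /= !(mul0r, mul1r, mulr0, mulr1, subr0, addr0, add0r, oppr0) !eqxx.
apply: le_lt_trans (cnD _ _) _; rewrite cnM !cn_real.
have -> : cn ('i%C : C) = 1 by rewrite /cn normc_def /= expr0n /= add0r expr1n sqrtr1.
by rewrite mul1r; lra.
Qed.

Lemma box_compact (B : R) : exists2 L : set T, compact L & box 0 B `<=` L.
Proof.
exists [set v : T | forall i : 'I_2,
  [set z : K | (- B <= Re z <= B) /\ (- B <= Im z <= B)] (v 0 i)].
 have h := @rV_compact K 2 (fun _ => _) (fun _ => @complex_square_compact B).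
 exact: h.
move=> q hq j /=; have := hq j; rewrite mxE subr0 => h.
have := cn_ge_Re (q 0 j); have := cn_ge_Im (q 0 j); rewrite !ler_norml.
by move=> /andP[h1 h2] /andP[h3 h4]; split; apply/andP; split; move: h h1 h2 h3 h4; clra.
Qed.

Lemma not_divergent (U : set T) f x (B : R) : U x ->
 (forall N, exists2 n, (N <= n)%N & box 0 B (f n x)) -> ~ compactly_divergent U f.
Proof.
move=> Ux hx /(_ ([set x] : set T)); have [L cL BL] := box_compact B.
move=> /(_ L) h; have [|//|N _ hN] := h (@compact_set1 T x); first by move=> _ ->.
have [n Nn /BL Ln] := hx N; have := hN n Nn => /eqP; apply/negP/set0P.
by exists (f n x); split=> //; exists x.
Qed.

(** Transfer between any two nearby points makes the set of points with the property relatively open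
    and relatively closed. *)
Lemma conn_ind (Om : set T) (Q : T -> Prop) : connected Om ->
 (forall x, Om x -> exists2 d : R, 0 < d &
  forall y y', Om y -> Om y' -> box x d y -> box x d y' -> Q y -> Q y') ->
 forall x0, Om x0 -> Q x0 -> forall x, Om x -> Q x.
Proof.
move=> cO loc x0 O0 Q0 x Ox.
have e : Om `&` [set y | Q y] = Om.
 apply: cO; first by exists x0.
 - exists (interior [set y : T | Om y -> Q y]); first exact: open_interior.
  apply/seteqP; split=> y [Oy Qy]; split=> //; last by have := interior_subset Qy; exact.
  have [d d0 hd] := loc y Oy; apply/nbhs_box; exists d => // y' hy' Oy'.
  by apply: (hd y) => //; exact/boxxx/ltW.
 exists (~` interior [set y : T | Om y -> ~ Q y]); first exact/open_closedC/open_interior.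
 apply/seteqP; split=> y [Oy Qy]; split=> //; first by move=> /interior_subset; exact.
 apply: contrapT => nQ; apply: Qy.
 have [d d0 hd] := loc y Oy; apply/nbhs_box; exists d => // y' hy' Oy' Qy'.
 by apply: nQ; apply: (hd y') => //; exact/boxxx/ltW.
by have [_ ] : (Om `&` [set y | Q y]) x by rewrite e.
Qed.

Lemma box_connected (p : T) (d : R) : connected (box p d).
Proof.
have [d0|d0] := ltP d 0.
 suff -> : box p d = set0 by exact: connected0.
 by apply/seteqP; split=> // q /(_ 0); rewrite leNgt (lt_le_trans d0) // cn_ge0.
pose seg q := [set p + t%:C *: (q-p) | t in `[0%R : R, 1]].
have -> : box p d = \bigcup_(q in box p d) seg q.
 apply/seteqP; split=> q.
  move=> hq; exists q => //; exists 1; first by rewrite /= in_itv /= ler01 lexx.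
  by rewrite scale1r addrC subrK.
 move=> [q' hq' [t]]; rewrite /= in_itv /= => /andP[t0 t1] <- j.
 rewrite !mxE (addrC (p 0 j)) addrK cnM cn_real ger0_norm //.
 by apply: le_trans (hq' j); rewrite ler_piMl // cn_ge0.
apply: bigcup_connected.
 exists p => q _; exists 0; first by rewrite /= in_itv /= ler01 lexx.
 by rewrite scale0r addr0.
move=> q _; apply: connected_continuous_connected; first exact: segment_connected.
apply: continuous_subspaceT => t V /nbhs_box[e e0 hV].
pose D := 1 + cn ((q-p) 0 0) + cn ((q-p) 0 1).
have D0 : 0 < D by rewrite /D; have := cn_ge0 ((q-p) 0 0); have := cn_ge0 ((q-p) 0 1); lra.
apply/nbhs_ballP; exists (e/D); first by rewrite /= divr_gt0.
move=> s; rewrite -ball_normE /ball_ /= distrC => hs; apply: hV => j.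
have -> : (p + s%:C *: (q-p)) 0 j - (p + t%:C *: (q-p)) 0 j = (s-t)%:C*(q 0 j - p 0 j).
 rewrite !mxE rmorphB; ring.
rewrite cnM cn_real.
have cD : cn (q 0 j - p 0 j) <= D.
 have := cn_ge0 ((q-p) 0 0); have := cn_ge0 ((q-p) 0 1).
 rewrite /D; have [->|->] : j = 0 \/ j = 1 by case: j => [[|[|//]] h]; [left|right]; exact: val_inj.
  by rewrite !mxE; move: (cn _) (cn _) => u v; lra.
 by rewrite !mxE; move: (cn _) (cn _) => u v; lra.
apply: le_trans (_ : e/D*D <= _); last by rewrite divfK ?gt_eqF.
by apply: ler_pM; rewrite ?cn_ge0 // ltW.
Qed.

Lemma component_open (U : set T) x : open U -> open (connected_component U x).
Proof.
move=> oU; apply: box_open => p Cp.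
have Up : U p by exact: connected_component_sub Cp.
have [d d0 hd] := open_box oU Up; exists d => // q hq.
apply: connected_component_trans Cp _.
by exists (box p d) => //; split=> //; [exact/boxxx/ltW|exact: box_connected].
Qed.

Lemma fatou_open (P : T -> T) : open (fatou_set P).
Proof. by apply: bigcup_open => U []. Qed.
Lemma fatou_component_sub P (Om : set T) : fatou_component P Om -> Om `<=` fatou_set P.
Proof. by move=> [x _ ->]; exact: connected_component_sub. Qed.
Lemma fatou_component_open P (Om : set T) : fatou_component P Om -> open Om.
Proof. by move=> [x _ ->]; apply: component_open; exact: fatou_open. Qed.
Lemma fatou_component_connected P (Om : set T) : fatou_component P Om -> connected Om.
Proof. by move=> [x _ ->]; exact: component_connected. Qed.

Lemma fatou_component_eq P (O1 O2 : set T) x :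
 fatou_component P O1 -> fatou_component P O2 -> O1 x -> O2 x -> O1 = O2.
Proof.
move=> [x1 _ ->] [x2 _ ->] h1 h2.
by rewrite (same_connected_component h1) (same_connected_component h2).
Qed.

(** Components are open and disjoint, so each is labelled by a point with rational coordinates. *)
Lemma countable_components P : countable [set Om : set T | fatou_component P Om].
Proof.
pose F := [set Om : set T | fatou_component P Om].
pose rp (a : rat*rat*(rat*rat)) : T :=
 \row_j (if j == 0 then (ratr a.1.1 +i* ratr a.1.2)%C else (ratr a.2.1 +i* ratr a.2.2)%C).
have rat_near (x d : R) : 0 < d -> exists q : rat, `|ratr q - x| <= d.
 move=> d0; have [|q h] := @rat_in_itvoo R x (x+d); first by rewrite ltrDl.
 exists q; move: h; rewrite in_itv /= => /andP[h1 h2].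
 by rewrite ger0_norm; move: h1 h2; clra.
have ex Om : F Om -> exists a, Om (rp a).
 move=> FO; have [x fx e] := FO.
 have Ox : Om x by rewrite e; exact: connected_component_refl.
 have [d d0 hd] := open_box (fatou_component_open FO) Ox.
 have d2 : 0 < d/2 by rewrite divr_gt0.
 have [a1 h1] := rat_near (Re (x 0 0)) _ d2.
 have [a2 h2] := rat_near (Im (x 0 0)) _ d2.
 have [b1 k1] := rat_near (Re (x 0 1)) _ d2.
 have [b2 k2] := rat_near (Im (x 0 1)) _ d2.
 exists ((a1, a2), (b1, b2)); apply: hd => j; rewrite mxE.
 have cnle (z z' : C) : `|Re z - Re z'| <= d/2 ->
  `|Im z - Im z'| <= d/2 -> cn (z-z') <= d.
  move=> e1 e2; apply: le_trans (cn_le_ReIm _) _.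
  by rewrite cReB cImB; move: e1 e2; clra.
 have [->|->] : j = 0 \/ j = 1 by case: j => [[|[|//]] h]; [left|right]; exact: val_inj.
  by apply: cnle.
 by apply: cnle.
pose g Om := xget ((0, 0), (0, 0)) [set a | Om (rp a)].
have gP Om : F Om -> Om (rp (g Om)).
 by move=> /ex[a ha]; exact: (@xgetPex _ _ [set a | Om (rp a)]) (ex_intro _ a ha).
apply/countable_injP; exists (choice.pickle \o g) => O1 O2 /set_mem F1 /set_mem F2 /= /(pcan_inj choice.pickleK) e12.
have h2 : O2 (rp (g O1)) by rewrite e12; exact: gP.
by apply: (fatou_component_eq F1 F2 (gP _ F1) h2).
Qed.
End Box.

Lemma ord2' (j : 'I_2) : j = 0 \/ j = 1.
Proof. by case: j => [[|[|//]] h]; [left|right]; exact: val_inj. Qed.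

Lemma mul_frac_le (R : realFieldType) (x e : R) : 0 <= x -> 0 <= e -> x*(e/(x+1)) <= e.
Proof.
move=> x0 e0; rewrite mulrA ler_pdivrMr ?ltr_wpDl // mulrC; apply: ler_wpM2l => //.
by rewrite lerDl.
Qed.

(** * Rank of differentials *)

Section Differential.
Variable R : realType.
Local Notation C := R[i].
Local Notation K := (R[i] : numFieldType).
Local Notation T := 'rV[K]_2.

Lemma norm_row_le (v : T) (M : R) : 0 <= M -> (forall j, cn (v 0 j) <= M) -> `|v| <= M%:C.
Proof.
move=> M0 h; have -> : `|v| = mx_norm v by [].
have [->|/mx_norm_neq0[[i j] /= ->]] := eqVneq (mx_norm v) 0; first by rewrite lecR.
by rewrite ord1 cnE lecR.
Qed.

Lemma coord_le_norm (v : T) (M : R) j : `|v| <= M%:C -> cn (v 0 j) <= M.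
Proof.
move=> h; apply/ler_addgt0Pr => e e0; have M0 : 0 <= M by rewrite -lecR; exact: le_trans h.
have : ball (0 : T) (M+e)%:C v.
 rewrite -ball_normE /ball_ /= sub0r normrN; apply: le_lt_trans h _.
 by rewrite ltcR ltrDl.
by move/ball_rowE => /(_ (ltr_wpDl M0 e0))/(_ j); rewrite mxE subr0 => /ltW.
Qed.

Lemma point_linear (v : T) : (point : {linear T -> T}) v = 0.
Proof. by []. Qed.

(** By convention the differential is 0 where [f] is not differentiable; the upper bound on ranks
    thus covers limit functions without a proof of their differentiability. *)
Lemma diff_default (f : T -> T) x : ~ differentiable f x -> forall v, 'd f x v = 0.
Proof.
move=> nd v; rewrite /diff xgetPN ?point_linear // => df [h1 h2]; apply: nd.
by apply/diffP; apply: (@getPex _ (fun (df : {linear T -> T}) => continuous df /\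
 forall y, f y = f (lim (nbhs x)) + df (y - lim (nbhs x)) +o_(y \near x) (y - lim (nbhs x)))); exists df.
Qed.

Lemma diff_box (f : T -> T) x (e : R) : differentiable f x -> 0 < e -> exists2 d : R, 0 < d &
 forall (v : T) M, 0 <= M -> (forall j, cn (v 0 j) <= M) -> M <= d ->
  forall j, cn ((f (v+x) - f x - 'd f x v) 0 j) <= e*M.
Proof.
move=> df e0.
have h : f \o shift x = cst (f x) + 'd f x +o_ 0 id.
 by rewrite funeqE => v /=; rewrite (diff_locallyx df).
move/eqaddoP: h => /(_ e%:C); rewrite ltcR => /(_ e0) /nbhs_box[d d0 hd].
exists d => // v M M0 hv Md j; apply: coord_le_norm.
have bv : box 0 d v by move=> i; rewrite mxE subr0; exact: le_trans (hv i) Md.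
have := hd v bv; rewrite /= opprD addrA => /le_trans; apply.
by rewrite rmorphM /=; apply: ler_wpM2l; [rewrite lecR ltW|exact: norm_row_le].
Qed.

Lemma jacobian_coord0 (f : T -> T) x (d : R) : 0 < d -> (forall q, box x d q -> f q 0 0 = 0) ->
 (\rank ('J f x) <= 1)%N.
Proof.
move=> d0 hf.
have z v : ('d f x v) 0 0 = 0.
 have [df|nd] := pselect (differentiable f x); last by rewrite diff_default // mxE.
 pose M := cn (v 0 0) + cn (v 0 1).
 have M0 : 0 <= M by rewrite addr_ge0 ?cn_ge0.
 have vM j : cn (v 0 j) <= M by rewrite /M; have [->|->] := ord2' j; rewrite ?lerDl ?lerDr cn_ge0.
 apply/eqP; rewrite -cn_eq0 eq_le cn_ge0 andbT; apply/ler_addgt0Pl => e e0; rewrite addr0.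
 have e1 : 0 < e/(M+1) by rewrite divr_gt0 // ltr_wpDl.
 have [d1 d10 h1] := diff_box df e1.
 pose t := Num.min d d1/(M+1).
 have t0 : 0 < t by rewrite divr_gt0 ?ltr_wpDl // lt_min d0.
 have tM : t*M <= Num.min d d1.
  rewrite /t mulrAC ler_pdivrMr ?ltr_wpDl //; apply: ler_wpM2l; last by rewrite lerDl.
  by rewrite le_min !ltW.
 have vtM j : cn ((t%:C *: v) 0 j) <= t*M.
  by rewrite mxE cnM cn_real gtr0_norm //; apply: ler_wpM2l => //; exact: ltW.
 have tM1 : t*M <= d1 by apply: le_trans tM _; rewrite ge_min lexx orbT.
 have := h1 _ _ (mulr_ge0 (ltW t0) M0) vtM tM1 0.
 have b1 : box x d (t%:C *: v + x).
  move=> j; rewrite !mxE addrK; have := vtM j; rewrite mxE => /le_trans; apply.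
  by apply: le_trans tM _; rewrite ge_min lexx.
 rewrite linearZ !mxE (hf _ b1) (hf x (boxxx x (ltW d0))) subr0 sub0r cnN cnM cn_real gtr0_norm //.
 rewrite mulrCA ler_pM2l // => /le_trans; apply.
 by rewrite mulrAC ler_pdivrMr ?ltr_wpDl // ler_wpM2l ?lerDl // ltW.
have -> : 'J f x = 'J f x *m delta_mx 1 1.
 apply/matrixP => i j; rewrite [RHS]mxE (bigD1 1) //= big1 ?addr0; last first.
  by move=> k k1; rewrite [delta_mx _ _ _ _]mxE (negbTE k1) mulr0.
 rewrite [delta_mx _ _ _ _]mxE eqxx /=; have [->|->] := ord2' j; rewrite /= ?mulr1 // mulr0.
 have -> : ('J f x) i 0 = (row i ('J f x)) 0 0 by rewrite [RHS]mxE.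
 by rewrite rowE mul_rV_lin1 z.
by apply: leq_trans (mxrankM_maxr _ _) _; rewrite mxrank_delta.
Qed.

(** Differentiability is not assumed: the quadratic error gives it, with differential
    [v |-> (0, b*v_0)]. *)
Lemma jacobian_shear (f : T -> T) x (b : C) (M d : R) : 0 < d -> b != 0 ->
 (forall v : T, (forall j, cn (v 0 j) <= d) -> (f (v+x) - f x) 0 0 = 0 /\
   cn ((f (v+x) - f x) 0 1 - b*v 0 0) <= M*cn (v 0 0)^+2) ->
 \rank ('J f x) = 1%N.
Proof.
move=> d0 b0 hf; pose A : 'M[K]_2 := b *: delta_mx 0 1.
have vA v j : (v *m A) 0 j = if j == 0 then 0 else b*v 0 0.
 rewrite /A -scalemxAr mxE mxE (bigD1 0) //= big1 ?addr0; last first.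
  by move=> i i0; rewrite mxE (negbTE i0) mulr0.
 by rewrite mxE /=; have [->|->] := ord2' j; rewrite /= ?mulr0 ?mulr1.
have dA : 'd f x = mulmxr A :> (T -> T).
 apply: diff_unique.
  move=> v V /nbhs_box[e e0 he]; apply/nbhs_box; exists (e/(cn b + 1)).
   by rewrite divr_gt0 // ltr_wpDl // cn_ge0.
  move=> u hu; apply: he => j; rewrite /= !vA; case: ifP => _; first by rewrite subrr cn0 ltW.
  rewrite -mulrBr cnM; apply: le_trans (_ : cn b*(e/(cn b + 1)) <= _).
   by apply: ler_wpM2l; [exact: cn_ge0|exact: hu].
  by apply: mul_frac_le; rewrite ?cn_ge0 ?ltW.
 apply/eqaddoP => _ /pos_realC[e e0 ->]; apply/nbhs_box.
 exists (Num.min d (e/(`|M|+1))); first by rewrite lt_min d0 divr_gt0 // ltr_wpDl.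
 move=> v hv; have vd j : cn (v 0 j) <= d by have := hv j; rewrite mxE subr0 le_min => /andP[].
 have [h0 h1] := hf v vd; have v0 : cn (v 0 0) <= e/(`|M|+1).
  by have := hv 0; rewrite mxE subr0 le_min => /andP[].
 have cv : (cn (v 0 0))%:C <= `|v|.
  have [r er] : exists r : R, `|v| = r%:C.
   by exists (Re `|v|); move: (normr_ge0 v); case: (`|v|) => p q; rewrite lecE /= => /andP[/eqP -> _].
  by rewrite er lecR; apply: coord_le_norm; rewrite er.
 apply: le_trans (_ : (e*cn (v 0 0))%:C <= _); last by rewrite rmorphM /= ler_wpM2l // lecR ltW.
 apply: norm_row_le; first by rewrite mulr_ge0 ?cn_ge0 ?ltW.
 move=> j; have -> : (f \o shift x - (cst (f x) + mulmxr A)) v 0 j = (f (v+x) - f x) 0 j - (v *m A) 0 j.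
  by rewrite /= !mxE opprD addrA.
 rewrite vA; have [->|->] := ord2' j; rewrite /=; first by rewrite h0 subr0 cn0 mulr_ge0 ?cn_ge0 ?ltW.
 apply: le_trans h1 _; rewrite expr2 mulrA; apply: ler_wpM2r; first exact: cn_ge0.
 apply: le_trans (ler_wpM2r (cn_ge0 _) (ler_norm M)) _.
 apply: le_trans (_ : `|M| * (e/(`|M|+1)) <= _); first by rewrite ler_wpM2l.
 by apply: mul_frac_le => //; exact: ltW.
have -> : 'J f x = A.
 by apply/row_matrixP => i; rewrite !rowE mul_rV_lin1 dA.
by rewrite /A mxrank_scale_nz // mxrank_delta.
Qed.
End Differential.

(** * Iterates of the skew map *)

Section SkewMap.
Variables (R : realType) (alpha : int).
Local Notation C := R[i].
Local Notation K := (R[i] : numFieldType).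
Local Notation T := 'rV[K]_2.
Local Notation P := (@skew_map R alpha).
Local Notation c := (1/4%:R + pi^+2/ln (alpha%:~R)^+2 : R).

Lemma ord2 (j : 'I_2) : j = 0 \/ j = 1.
Proof. by case: j => [[|[|//]] h]; [left|right]; exact: val_inj. Qed.
Lemma skew0 (q : T) : P q 0 0 = q 0 0 - q 0 0^+2.
Proof. by rewrite mxE. Qed.
Lemma skew1 (q : T) : P q 0 1 = q 0 1 + q 0 1^+2 + c%:C*q 0 0^+2.
Proof. by rewrite mxE. Qed.
Lemma skew_coef_ge0 : 0 <= c.
Proof. by rewrite addr_ge0 ?divr_ge0 ?sqr_ge0. Qed.

Lemma cn_sqr_sub (x y : C) (B : R) : cn x <= B -> cn y <= B -> cn (x^+2-y^+2) <= 2*B*cn (x-y).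
Proof.
move=> hx hy; rewrite subr_sqr cnM mulrC; apply: ler_wpM2r; first exact: cn_ge0.
by apply: cnD_le; move: hx hy; clra.
Qed.

Lemma skew_iter_lip n (p : T) (D : R) : 0 <= D -> exists2 L, 0 < L &
 forall q q', box p D q -> box p D q' -> forall d, box q d q' -> box (iter n P q) (L*d) (iter n P q').
Proof.
move=> D0; elim: n => [|n [L L0 IH]]; first by exists 1 => // q q' _ _ d h; rewrite mul1r.
pose B := cn (iter n P p 0 0) + cn (iter n P p 0 1) + L*D.
have B0 : 0 <= B by rewrite !addr_ge0 ?cn_ge0 // mulr_ge0 // ltW.
have bd q j : box p D q -> cn (iter n P q 0 j) <= B.
 move=> hq; have := IH p q (boxxx p D0) hq D hq j.
 have := cnD (iter n P q 0 j - iter n P p 0 j) (iter n P p 0 j); rewrite subrK.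
 have := cn_ge0 (iter n P p 0 0); have := cn_ge0 (iter n P p 0 1).
 by rewrite /B; have [->|->] := ord2 j; clra.
have c0 := skew_coef_ge0; set c1 := c in c0 *.
exists ((1 + 2*B + c1*(2*B))*L).
 by rewrite mulr_gt0 // ltr_wpDr ?mulr_ge0 // ltr_wpDr ?mulr_ge0.
move=> q q' hq hq' d hd j; rewrite -mulrA; have e := IH _ _ hq hq' _ hd.
move: (bd _ 0 hq) (bd _ 1 hq) (bd _ 0 hq') (bd _ 1 hq') (e 0) (e 1).
rewrite 2!iterS; move: (iter n P q) (iter n P q') (L*d) => u v l.
move=> b1 b2 b3 b4 e0 e1; have l0 : 0 <= l by apply: le_trans e0; exact: cn_ge0.
have s0 := cn_sqr_sub b3 b1; have s1 := cn_sqr_sub b4 b2.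
have s0' : cn (v 0 0^+2 - u 0 0^+2) <= 2*B * l.
 by apply: le_trans s0 _; apply: ler_wpM2l => //; rewrite mulr_ge0.
have s1' : cn (v 0 1^+2 - u 0 1^+2) <= 2*B * l.
 by apply: le_trans s1 _; apply: ler_wpM2l => //; rewrite mulr_ge0.
have [->|->] := ord2 j.
 rewrite !skew0; set x := (X in cn X <= _).
 have -> : x = (v 0 0 - u 0 0) - (v 0 0^+2 - u 0 0^+2) by rewrite /x; ring.
 apply: cnB_le; have : 0 <= c1*(2*B) * l by rewrite !mulr_ge0.
 by move: e0 s0'; clra.
rewrite !skew1 -/c1; set x := (X in cn X <= _).
have -> : x = (v 0 1 - u 0 1) + (v 0 1^+2 - u 0 1^+2) + c1%:C*(v 0 0^+2 - u 0 0^+2).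
 by rewrite /x; ring.
apply: cnD_le; have := cnD (v 0 1 - u 0 1) (v 0 1^+2 - u 0 1^+2).
rewrite cnM cn_real ger0_norm //.
have : c1*cn (v 0 0^+2 - u 0 0^+2) <= c1*(2*B * l) by apply: ler_wpM2l.
by move: e1 s1'; clra.
Qed.

Lemma skew_iter_cont n (p : T) (e : R) : 0 < e -> exists2 d, 0 < d <= 1 &
 forall q, box p d q -> box (iter n P p) e (iter n P q).
Proof.
move=> e0; have [L L0 hL] := @skew_iter_lip n p 1 ler01.
exists (Num.min 1 (e/L)); first by rewrite lt_min ltr01 divr_gt0 //= ge_min lexx.
move=> q hq; apply: box_le (_ : L*(e/L) <= e) _ _; first by rewrite mulrC divfK ?gt_eqF.
apply: hL; [exact: boxxx|by apply: box_le hq; rewrite ge_min lexx|].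
by apply: box_le hq; rewrite ge_min lexx orbT.
Qed.

Lemma skew_iter_bounded n (p : T) (D : R) : 0 <= D -> exists B : R,
 forall q, box p D q -> box 0 B (iter n P q).
Proof.
move=> D0; have [L L0 hL] := skew_iter_lip n p D0.
exists (cn (iter n P p 0 0) + cn (iter n P p 0 1) + L*D) => q hq j; rewrite mxE subr0.
have := hL p q (boxxx p D0) hq D hq j.
have := cnD (iter n P q 0 j - iter n P p 0 j) (iter n P p 0 j); rewrite subrK.
have := cn_ge0 (iter n P p 0 0); have := cn_ge0 (iter n P p 0 1).
by have [->|->] := ord2 j; clra.
Qed.

Lemma skew_iter_poly n (p v : T) : exists f : 'I_2 -> {poly C},
 forall s : C, forall j, iter n P (p + s *: v) 0 j = (f j).[s].
Proof.
elim: n => [|n [f IH]].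
 exists (fun j => (p 0 j)%:P + (v 0 j) *: 'X) => s j.
 by rewrite /= !mxE hornerD hornerC hornerZ hornerX mulrC.
exists (fun j => if j == 0 then f 0 - f 0^+2 else f 1 + f 1^+2 + c%:C *: f 0^+2) => s j.
rewrite iterS; have [->|->] := ord2 j.
 by rewrite skew0 IH /= !hornerE.
by rewrite skew1 !IH /= !hornerE.
Qed.

Lemma skew_iter_fiber n (p q : T) : p 0 0 = q 0 0 -> iter n P p 0 0 = iter n P q 0 0.
Proof. by move=> h; elim: n => //= n IH; rewrite !skew0 IH. Qed.

(** Above [3 + c*b^2] the square of [w] dominates both [w] and the forcing [c*z^2], so [|w|] cannot
    decrease. *)
Lemma skew_escape n (p : T) (b : R) : (forall i, (i <= n)%N -> cn (iter i P p 0 0) <= b) ->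
 3 + c*b^+2 <= cn (p 0 1) -> cn (p 0 1) <= cn (iter n P p 0 1).
Proof.
move=> hb h; have c0 := skew_coef_ge0; elim: n hb => // n IH hb.
have {IH} hw := IH (fun i hi => hb i (leqW hi)); apply: le_trans (hw) _.
set w := iter n P p 0 1 in hw *.
have zb := hb n (leqnSn n).
rewrite iterS skew1 -/w; set z := iter n P p 0 0 in zb *.
have zc : cn (c%:C*z^+2) <= c*b^+2.
 rewrite cnM cn_real ger0_norm // cnX; apply: ler_wpM2l => //.
 by rewrite ler_sqr ?nnegrE ?cn_ge0 // (le_trans (cn_ge0 z)).
have w3 : 3 + c*b^+2 <= cn w by apply: le_trans h hw.
have b2 : 0 <= c*b^+2 by rewrite mulr_ge0 ?sqr_ge0.
have h1 := cn_sub_ge (w^+2) (- (w+c%:C*z^+2)).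
rewrite opprK cnN cnX addrA in h1; rewrite (addrC w).
have h2 := cnD w (c%:C*z^+2).
move: zc w3 b2 h1 h2; set x := cn w; set y := c*b^+2; set u := cn (c%:C*_).
set v := cn (w+_); set v' := cn (w^+2+_+_); clearbody x y u v v'; clear; nra.
Qed.

(** A polynomial constant on a disc is constant on the whole vertical line. A start whose [|w|]
    exceeds both the escape bound and the supposed constant then contradicts [skew_escape]. *)
Lemma fiber_nonconst n (p : T) (d : R) : 0 < d ->
 ~ (forall s : C, cn s <= d -> iter n P (p + s *: delta_mx 0 1) 0 1 = iter n P p 0 1).
Proof.
move=> d0 h; have [f hf] := skew_iter_poly n p (delta_mx 0 1).
pose g := f 1 - (iter n P p 0 1)%:P.
have gb s : cn s <= d -> cn g.[s] <= 0.
 by move=> hs; rewrite /g hornerD hornerN hornerC -hf h // subrr cn0.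
have g0 : g = 0.
 apply/polyP => i; rewrite coef0; apply/eqP; rewrite -cn_eq0.
 by rewrite eq_le cn_ge0 andbT; apply: le_trans (coef_bound_disc i d0 gb) _; rewrite mul0r.
have [b hb] : exists b, forall i, (i <= n)%N -> cn (iter i P p 0 0) <= b.
 exists (\sum_(i < n.+1) cn (iter i P p 0 0)) => i hi.
 rewrite (bigD1 (Ordinal (hi : (i < n.+1)%N))) //= lerDl; apply: sumr_ge0 => j _; exact: cn_ge0.
pose B := 3 + c*b^+2 + cn (iter n P p 0 1).
have c0 := skew_coef_ge0.
have B0 : 0 <= B by rewrite /B !addr_ge0 ?cn_ge0 // mulr_ge0 ?sqr_ge0.
pose s : C := (B+1)%:C - p 0 1.
pose q := p + s *: delta_mx 0 1 : T.
have q0 : q 0 0 = p 0 0 by rewrite !mxE /= mulr0 addr0.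
have q1 : q 0 1 = (B+1)%:C by rewrite !mxE /= mulr1 addrC subrK.
have hq : iter n P q 0 1 = iter n P p 0 1.
 by rewrite hf; have := congr1 (fun u => u.[s]) g0; rewrite /g horner0 hornerD hornerN hornerC => /eqP; rewrite subr_eq0 => /eqP.
have e1 : cn (q 0 1) = B + 1 by rewrite q1 cn_real ger0_norm // addr_ge0.
have := @skew_escape n q b; rewrite hq e1 => /(_ _ _)/Wrap[].
- by move=> i hi; rewrite (skew_iter_fiber i q0); exact: hb.
- by rewrite /B; have := cn_ge0 (iter n P p 0 1); lra.
have : 0 <= c*b^+2 by rewrite mulr_ge0 ?sqr_ge0.
by rewrite /B; have := cn_ge0 (iter n P p 0 1); lra.
Qed.

Lemma skew_map_orbit (p : T) : 0 < alpha ->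
 skew_orbit (pi/ln (`|alpha|%N)%:R) (fun i => iter i P p 0 0) (fun i => iter i P p 0 1).
Proof.
move=> a0 i; rewrite /= skew0 skew1; split=> //.
have -> : (`|alpha|%N)%:R = alpha%:~R :> R by rewrite natr_absz gtr0_norm.
by rewrite exprMn exprVn.
Qed.
End SkewMap.

(** * Phases of orbits of the first coordinate *)

Section Tracking.
Variable R : realType.
Local Notation C := R[i].
Local Notation X := (refX R).

(** In the coordinate [-1/w] an orbit from the disc stays within [1/4] of [X i], which is at least 3
    for positive [i], whereas points of the disc have modulus at most [100/45] there. *)
Lemma no_return (w : C) i : cn (w+1/2) <= 1/20 -> (0 < i)%N ->
 1/20 < cn (iter i quad w + 1/2).
Proof.
move=> hw i0; rewrite ltNge; apply/negP => hi.
have /entry_disc/andP[lo _] := hi; have st := entry_start hw.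
have [|h1 _ _] := near_real (le_trans (trans_dev (n := 0) (entry_trans hw) _ i) st).
 by rewrite refX0; move: st; rewrite refX0; clra.
have := cn_ge_Re (entry_orbit w i); rewrite ler_norml => /andP[_ h2].
have : cn (entry_orbit w i) <= 100/45.
 rewrite /entry_orbit cnN cnV -[leRHS]invrK lef_pV2 ?posrE ?invr_gt0 ?divr_gt0 ?invf_div //.
  by move: lo; clra.
 by apply: lt_le_trans lo; clra.
have X3 : 3 <= X (0+i).
 apply: le_trans (refX_ge R _); rewrite add0n.
 have : 1 <= i%:R :> R by rewrite ler1n.
 by move: (i%:R) => x; clra.
by move: h1 h2 X3; clra.
Qed.

Definition tracked n (zs : nat -> C) tau := (forall i, zs i != 0) /\
 exists D : R, forall i, cn ((zs i)^-1 - (X (n+i))%:C - tau) <= D/i.+1%:R.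

(** The orbit is first built in the coordinate [1/z], where its modulus stays above 1; identifying
    [zs] with its inverse then excludes zeros of [zs]. *)
Lemma track_start n zs : (forall i, zs i.+1 = zs i - zs i^+2) ->
 cn ((zs 0%N)^-1 - (X n)%:C) <= (X n - 1)/2 ->
 (forall i, zs i != 0) /\ exists tau, forall i,
  cn ((zs i)^-1 - (X (n+i))%:C - tau) <= 4*cn ((zs 0%N)^-1 - (X n)%:C)/(n+i).+1%:R.
Proof.
move=> hz h0.
pose A i := iter i (fun x : C => x + 1 + (x-1)^-1) (zs 0%N)^-1.
have tA : trans_orbit A by [].
have dev := trans_dev tA h0.
have X1 i : (X n - 1)/2 + 1 < X (n+i).
 have := refX_ge1 R n; have : X n <= X (n+i) by apply: refX_le; rewrite leq_addr.
 have := ler0n R n; move: (n%:R) => x; clra.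
have Abig i : 1 < cn (A i).
 have [h1 _ _] := near_real (le_trans (dev i) h0).
 have := cn_ge_Re (A i); rewrite ler_norml => /andP[_].
 by move: (X1 i) h1; clra.
have An0 i : A i != 0 by rewrite -cn_gt0 (lt_trans ltr01).
have An1 i : A i != 1 by apply/eqP => e; have := Abig i; rewrite e cn1 ltxx.
have zA i : zs i = (A i)^-1.
 elim: i => [|i IH]; first by rewrite /A /= invrK.
 rewrite hz IH; apply: invr_inj; rewrite invrK trans_logistic ?invr_eq0 //; first by rewrite invrK.
 by rewrite subr_eq0 eq_sym -invr1 (inj_eq invr_inj).
split=> [i|]; first by rewrite zA invr_eq0.
have [tau ht] := trans_lim tA h0.
by exists tau => i; rewrite zA invrK; exact: ht.
Qed.

Lemma tracked_shift n t zs tau (D : R) : (forall i, zs i != 0) ->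
 (forall i, cn ((zs (t+i)%N)^-1 - (X (n+t+i))%:C - tau) <= D/i.+1%:R) -> tracked n zs tau.
Proof.
move=> z0 h; split=> //.
have D0 : 0 <= D by have := le_trans (cn_ge0 _) (h 0%N); rewrite divr1.
pose e i := cn ((zs i)^-1 - (X (n+i))%:C - tau).
exists (D*t.+1%:R + \sum_(i < t) e i * i.+1%:R) => i; rewrite -/(e i).
have s0 : 0 <= \sum_(i < t) e i * i.+1%:R by apply: sumr_ge0 => j _; rewrite mulr_ge0 ?cn_ge0.
rewrite ler_pdivlMr ?ltr0n //; have [it|ti] := ltnP i t.
 rewrite (bigD1 (Ordinal it)) //= addrCA lerDl addr_ge0 ?mulr_ge0 //.
 by apply: sumr_ge0 => j _; rewrite mulr_ge0 ?cn_ge0.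
have := h (i-t)%N; rewrite -addnA subnKC // -/(e i) ler_pdivlMr ?ltr0n // => hi.
have h2 : e i * i.+1%:R <= e i*(i-t).+1%:R*t.+1%:R.
 rewrite -mulrA; apply: ler_wpM2l; first exact: cn_ge0.
 by rewrite -natrM ler_nat; move: ti; clear; nia.
have h3 : e i*(i-t).+1%:R*t.+1%:R <= D*t.+1%:R by apply: ler_wpM2r.
by move: s0 h2 h3; clra.
Qed.

(** Once they are large, [1/z] and [X] both advance by nearly 1, so their difference grows by at
    most [2/19] per step, more slowly than the allowance [(X-1)/2]. *)
Lemma track_eventually n zs : (forall i, zs i.+1 = zs i - zs i^+2) -> (forall i, zs i != 0) ->
 (forall e : R, 0 < e -> exists N, forall t, (N <= t)%N -> cn (zs t) <= e) ->
 exists T, cn ((zs T)^-1 - (X (n+T))%:C) <= (X (n+T) - 1)/2.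
Proof.
move=> hz z0 zl; have [|N hN] := zl (1/20); first by rewrite divr_gt0.
have [M hM] : exists M, (N + 20 <= M)%N by exists (N+20)%N.
pose D i := (zs (M+i)%N)^-1 - (X (n + (M+i)))%:C.
have small (x : C) : 20 <= cn x -> x - 1 != 0 /\ cn ((x-1)^-1) <= 1/19.
 move=> hx; have := cn_sub_ge x 1; rewrite cn1 => h.
 have h19 : 19 <= cn (x-1) by move: hx h; clra.
 split; first by rewrite -cn_gt0; apply: lt_le_trans h19.
 by rewrite cnV div1r lef_pV2 // posrE //; apply: lt_le_trans h19.
have DS i : cn (D i) <= cn (D 0%N) + 2/19 * i%:R.
 elim: i => [|i IH]; first by rewrite mulr0 addr0.
 have zb : 20 <= cn (zs (M+i)%N)^-1.
  rewrite cnV -[20]invrK lef_pV2 ?posrE ?invr_gt0 ?cn_gt0 //.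
  by rewrite -div1r; apply: hN; move: hM; clia.
 have [a1 a2] := small _ zb.
 have Xb : 20 <= cn (X (n + (M+i)))%:C.
  rewrite cn_real; apply: le_trans (ler_norm _); apply: le_trans (refX_ge R _).
  by rewrite -natrD ler_nat; move: hM; clia.
 have [b1 b2] := small _ Xb.
 have -> : D i.+1 = D i + (((zs (M+i)%N)^-1 - 1)^-1 - ((X (n + (M+i)))%:C - 1)^-1).
  rewrite /D !addnS hz trans_logistic //; last first.
   by apply: contra a1 => /eqP e; rewrite subr_eq0 (_ : zs (M+i)%N = 1) ?invr1 //; move/eqP: e; rewrite subr_eq0 => /eqP.
  have -> : (X (n + (M+i)).+1)%:C = (X (n + (M+i)))%:C + 1 + ((X (n + (M+i)))%:C - 1)^-1 :> C.
   by rewrite refXS; move: (X _) => x; apply/eqP; rewrite !rmorphD fmorphV rmorphB rmorph1.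
  ring.
 have -> : i.+1%:R = i%:R + 1 :> R by rewrite natr1.
 have := cnD (D i) (((zs (M+i)%N)^-1 - 1)^-1 - ((X (n + (M+i)))%:C - 1)^-1).
 have := cnB ((zs (M+i)%N)^-1 - 1)^-1 ((X (n + (M+i)))%:C - 1)^-1.
 by move: IH a2 b2; clra.
have [i hi] : exists i, 8*cn (D 0%N) <= i%:R :> R.
 exists (Num.bound (8*cn (D 0%N))); apply/ltW/archi_boundP; by rewrite mulr_ge0 ?cn_ge0.
exists (M+i)%N; apply: le_trans (DS i) _.
have := refX_ge1 R (n + (M+i)); rewrite !natrD.
have := ler0n R n; have := ler0n R M; have := ler0n R i.
by move: hi; move: (cn (D 0%N)) (X _) => y3 y4; clra.
Qed.

Lemma track_exists n zs : (forall i, zs i.+1 = zs i - zs i^+2) -> (forall i, zs i != 0) ->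
 (forall e : R, 0 < e -> exists N, forall t, (N <= t)%N -> cn (zs t) <= e) ->
 exists tau, tracked n zs tau.
Proof.
move=> hz z0 zl; have [T hT] := track_eventually n hz z0 zl.
have hz' i : zs (T+i.+1)%N = zs (T+i)%N - zs (T+i)%N^+2 by rewrite addnS.
have [|_ [tau ht]] := @track_start (n+T) (fun i => zs (T+i)%N) hz'; first by rewrite /= addn0.
exists tau; apply: (@tracked_shift _ T _ _ (4*cn ((zs (T+0))^-1 - (X (n+T))%:C))) => // i.
apply: le_trans (ht i) _; apply: ler_wpM2l; first by rewrite mulr_ge0 ?cn_ge0.
by rewrite lef_pV2 ?posrE ?ltr0n // ler_nat; clia.
Qed.

Lemma inv_cont (x : C) (e : R) : x != 0 -> 0 < e -> exists2 d, 0 < d &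
 forall y, cn (y-x) <= d -> y != 0 /\ cn (y^-1-x^-1) <= e.
Proof.
move=> x0 e0; have cx : 0 < cn x by rewrite cn_gt0.
exists (Num.min (cn x/2) (e*cn x^+2/2)).
 by rewrite lt_min !divr_gt0 // mulr_gt0 // exprn_gt0.
move=> y; rewrite le_min => /andP[h1 h2].
have hy : cn x/2 <= cn y by have := cn_sub_ge x (x-y); rewrite subKr cnBC; move: h1; clra.
have y0 : y != 0 by rewrite -cn_gt0; apply: lt_le_trans hy; rewrite divr_gt0.
split=> //; have -> : y^-1 - x^-1 = (x-y)/(y*x).
 by rewrite invfM mulrBl; field; rewrite x0 y0.
rewrite cn_div cnM cnBC ler_pdivrMr ?mulr_gt0 ?cn_gt0 //; apply: le_trans h2 _.
rewrite -!mulrA ler_pM2l //; move: hy cx; clear; nra.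
Qed.
End Tracking.

(** * Stability of chains and phases under perturbation *)

Section ChainOpen.
Variables (R : realType) (r : nat -> R).
Hypothesis r0 : forall j, 0 < r j.
Hypothesis rS : forall j, r j = quad (r j.+1).
Local Notation C := R[i].
Local Notation E := (exit_map r0 rS).

Lemma exit_map_finite_near (Y0 : C) J (g : nat -> R) : (forall j, 0 < g j) ->
 exists2 d, 0 < d <= 1 & forall Y, cn (Y-Y0) <= d -> forall j, (j < J)%N ->
  cn (E j Y - E j Y0) <= g j.
Proof.
move=> g0; elim: J => [|J [d /andP[d0 d1] IH]]; first by exists 1; rewrite ?ltr01 ?lexx.
have B0 : 0 <= cn Y0 + 1 by rewrite addr_ge0 ?cn_ge0.
have [L L0 hL] := exit_map_lip r0 rS J B0.
exists (Num.min d (g J/L)); first by rewrite lt_min d0 divr_gt0 //= ge_min d1.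
move=> Y; rewrite le_min => /andP[h1 h2] j; rewrite ltnS leq_eqVlt => /orP[/eqP ->|]; last exact: IH.
apply: le_trans (hL _ _ _ _) _; last by rewrite mulrC -ler_pdivlMr.
 have := cnD (Y-Y0) Y0; rewrite subrK; move: h1 d1; clra.
by rewrite lerDl ler01.
Qed.

Lemma exit_lim_exit_map Y : exit_lim r (fun j => E j Y) Y.
Proof.
have [J [Kk K0 h]] := exit_tail r0 rS (cn_ge0 Y).
move=> e e0; exists (J + Num.bound (Kk/e))%N => j hj.
have [|_ /(_ Y (lexx _)) [n0 _ h1 _]] := h j; first exact: leqDl hj.
split=> //; apply: le_trans h1 _; rewrite ler_pdivrMr ?ltr0n // mulrC -ler_pdivrMr //.
have := archi_boundP (ltW (divr_gt0 K0 e0)); move/ltW/le_trans; apply; rewrite ler_nat.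
by apply: leq_trans (leqnSn _); exact: leqDr hj.
Qed.

(** Of the infinitely many strict inequalities those of high index are automatic, because [1/y]
    stays near the large reference value; continuity handles the finitely many others. *)
Lemma chain_open m (Y0 : C) : chain m (fun j => E j Y0) -> exists2 d, 0 < d & forall Y,
 cn (Y-Y0) <= d -> cn (E 0%N Y + 1/2) <= 1/20 -> chain m (fun j => E j Y).
Proof.
move=> [_ _ c1 c2 c3].
have B0 : 0 <= cn Y0 + 1 by rewrite addr_ge0 ?cn_ge0.
have [J [Kk K0 hJ]] := exit_tail r0 rS B0.
pose g j : R := if j == 0%N then 1 else if j == 1%N then Im (E 1%N Y0)/2
 else `|Re (E j Y0) + 1/2| / 2.
have g0 j : 0 < g j.
 rewrite /g; case: j => [|[|j]] //=; first by rewrite divr_gt0.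
 rewrite divr_gt0 // normr_gt0; have [h|h] := leqP j.+2 m.+1.
  by have := c2 j.+2; rewrite h => /(_ isT) h'; rewrite lt_eqF //; move: h'; clra.
 by have h' := c3 j.+2 h; rewrite gt_eqF //; move: h'; clra.
have [d /andP[d0 d1] hd] := exit_map_finite_near Y0 (J+m+2) g0.
exists d => // Y hY e0; split=> //.
- by move=> j; rewrite exit_mapS.
- have h := hd Y hY 1%N; rewrite addn2 in h; have {}h := h isT.
 have := le_trans (cn_ge_Im _) h; rewrite cImB ler_norml /g /= => /andP[h1 _].
 by move: h1 c1; clra.
- move=> j /andP[j2 jm]; have c2' := c2 j; rewrite j2 jm in c2'; have {}c2' := c2' isT.
 have jJ : (j < J + m + 2)%N by move: jm; clia.
 have := le_trans (cn_ge_Re _) (hd Y hY j jJ); rewrite cReB ler_norml => /andP[_ h1].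
 move: h1; rewrite /g; case: (j) j2 c2' => [|[|i]] // _ c2' /=.
 rewrite ler0_norm; last by move: c2'; clra.
 by move: c2'; clra.
move=> j mj; have c3' := c3 j mj.
have [jJ|Jj] := ltnP j (J+m+2).
 have := le_trans (cn_ge_Re _) (hd Y hY j jJ); rewrite cReB ler_norml => /andP[h1 _].
 move: h1; rewrite /g; case: (j) mj c3' => [|[|i]] // mj c3' /=.
 rewrite ger0_norm; last by move: c3'; clra.
 by move: c3'; clra.
have [|v2 hv] := hJ j; first by apply: leq_trans Jj; rewrite -addnA leq_addr.
have [|n0 h1 _ _] := hv Y.
 have := cnD (Y-Y0) Y0; rewrite subrK; move: hY d1; clra.
have [h2 _ _] := near_real h1.
have h3 : 0 < Re (E j Y)^-1 by apply: lt_le_trans h2; move: v2; clra.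
have : 0 < Re (E j Y); last by clra.
by move: h3; rewrite cReV pmulr_lgt0 // invr_gt0 exprn_gt0 // cn_gt0.
Qed.
End ChainOpen.

Section Orbits.
Variables (R : realType) (alpha : int).
Local Notation C := R[i].
Local Notation K := (R[i] : numFieldType).
Local Notation T := 'rV[K]_2.
Local Notation P := (@skew_map R alpha).
Local Notation zz := (fun x i => iter i P x 0 0).
Local Notation ww := (fun x i => iter i P x 0 1).
Local Notation X := (refX R).

Lemma zz_step (x : T) i : zz x i.+1 = zz x i - zz x i^+2.
Proof. by rewrite /= skew0. Qed.

Lemma zz_zero (x : T) i t : (i <= t)%N -> zz x i = 0 -> zz x t = 0.
Proof.
move=> it h; rewrite -(subnK it); elim: (t-i)%N => [//|k IH].
by rewrite addSn zz_step IH expr0n subrr.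
Qed.

(** The phase can be read at a late time [t] with error [O(1/t)], and the point at that time depends
    continuously on the start. *)
Lemma tracked_near n (x : T) tau (e : R) : tracked n (zz x) tau -> 0 < e -> exists2 d, 0 < d &
 forall q, box x d q -> exists2 tau', tracked n (zz q) tau' & cn (tau'-tau) <= e.
Proof.
move=> [z0 [D hD]] e0.
have D0 : 0 <= D by have := le_trans (cn_ge0 _) (hD 0%N); rewrite divr1.
pose B := cn tau + D + 1.
have B0 : 0 < B by rewrite /B ltr_wpDl // addr_ge0 // cn_ge0.
have [t ht] : exists t : nat, 8*B + 8*B/e + 8 <= t.+1%:R.
 exists (Num.bound (8*B+8*B/e+8)).
 have h : 0 <= 8*B + 8*B/e + 8 by rewrite !addr_ge0 ?divr_ge0 ?mulr_ge0 // ltW.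
 by have := archi_boundP h; move/ltW/le_trans; apply; rewrite ler_nat.
have t0 : 0 < t.+1%:R :> R by rewrite ltr0n.
have Be : 0 <= 8*B/e by rewrite divr_ge0 ?mulr_ge0 // ltW.
have small : 8*B/t.+1%:R <= e.
 have h : 8*B/e <= t.+1%:R by apply: le_trans ht; move: B0 Be; clra.
 by rewrite ler_pdivrMr // [e*_]mulrC -ler_pdivrMr.
have e4 : 0 < Num.min 1 (e/4) by rewrite lt_min ltr01 divr_gt0.
have [d1 d10 hd1] := inv_cont (z0 t) e4.
have [d /andP[d0 _] hd] := skew_iter_cont alpha t x d10.
exists d => // q /hd /(_ 0) /hd1[zq0].
rewrite le_min => /andP[zq1 zqe].
have near : cn ((zz x t)^-1 - (X (n+t))%:C) <= cn tau + D.
 have := cnD ((zz x t)^-1 - (X (n+t))%:C - tau) tau; rewrite subrK.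
 have h1 := hD t; have h2 : D/t.+1%:R <= D by rewrite ler_pdivrMr // ler_peMr // ler1n.
 by move: h1 h2; move: (t.+1%:R^-1) => u; clra.
have nearq : cn ((zz q t)^-1 - (X (n+t))%:C) <= B.
 have := cnD ((zz x t)^-1 - (X (n+t))%:C) ((zz q t)^-1 - (zz x t)^-1); rewrite addrC addrA subrK.
 by move: near zq1; rewrite /B; clra.
have hz' i : zz q (t+i.+1)%N = zz q (t+i)%N - zz q (t+i)%N^+2 by rewrite addnS zz_step.
have [|zq [tau' ht']] := @track_start R (n+t) (fun i => zz q (t+i)%N) hz'.
 rewrite addn0; apply: le_trans nearq _; have := refX_ge1 R (n+t); rewrite natrD.
 move: ht; rewrite -natr1; have := ler0n R n; move: B0 Be; clra.
have zqn i : zz q i != 0.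
 have [it|ti] := leqP i t; last by have := zq (i-t)%N; rewrite subnKC // ltnW.
 by apply/eqP => /(zz_zero it) h; have := zq 0%N; rewrite addn0 h eqxx.
have trq : tracked n (zz q) tau'.
 apply: (@tracked_shift _ _ t _ _ (4*B)) => // i; apply: le_trans (ht' i) _.
 rewrite addn0; apply: ler_pM; rewrite ?mulr_ge0 ?cn_ge0 ?invr_ge0 //; first by apply: ler_wpM2l.
 by rewrite lef_pV2 ?posrE ?ltr0n // ler_nat ltnS leq_addl.
exists tau' => //.
have h1 := hD t; have h2 := ht' 0%N; rewrite !addn0 in h2.
have h3 : D/t.+1%:R <= e/4.
 apply: le_trans (_ : B/t.+1%:R <= _); last by move: small e0; move: (t.+1%:R^-1) => u; clra.
 apply: ler_wpM2r; first by rewrite invr_ge0 ltW.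
 by have := cn_ge0 tau; rewrite /B; clra.
have h4 : 4*cn ((zz q t)^-1 - (X (n+t))%:C)/(n+t).+1%:R <= e/2.
 apply: le_trans (_ : 4*B/t.+1%:R <= _); last by move: small e0; move: (t.+1%:R^-1) => u; clra.
 apply: ler_pM; rewrite ?mulr_ge0 ?cn_ge0 ?invr_ge0 //; first by apply: ler_wpM2l.
 by rewrite lef_pV2 ?posrE ?ltr0n // ler_nat ltnS leq_addl.
have -> : tau' - tau = ((zz x t)^-1 - (X (n+t))%:C - tau) - ((zz q t)^-1 - (X (n+t))%:C - tau') +
  ((zz q t)^-1 - (zz x t)^-1) by ring.
apply: cnD_le.
have := cnB ((zz x t)^-1 - (X (n+t))%:C - tau) ((zz q t)^-1 - (X (n+t))%:C - tau').
by move: (le_trans h1 h3) (le_trans h2 h4) zqe; clra.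
Qed.

Lemma tracked_small n (B D e : R) : 0 < e -> exists N, forall zs tau, (forall i, zs i != 0) ->
 (forall i, cn ((zs i)^-1 - (X (n+i))%:C - tau) <= D) -> cn tau <= B ->
 forall t, (N <= t)%N -> cn (zs t) <= e.
Proof.
move=> e0; pose N := Num.bound (`|B| + `|D|+e^-1); exists N => zs tau z0 h hB t ht.
have hN : `|B| + `|D| + e^-1 <= t%:R.
 apply: le_trans (_ : N%:R <= _); last by rewrite ler_nat.
 by apply/ltW/archi_boundP; rewrite !addr_ge0 // invr_ge0 ltW.
have h1 : cn ((zs t)^-1 - (X (n+t))%:C) <= `|B| + `|D|.
 have := cnD ((zs t)^-1 - (X (n+t))%:C - tau) tau; rewrite subrK.
 have := h t; have := ler_norm B; have := ler_norm D; move: hB; clra.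
have [h2 _ _] := near_real h1; have := cn_ge_Re (zs t)^-1; rewrite ler_norml => /andP[_ h3].
have := refX_ge R (n+t); rewrite natrD; have := ler0n R n => n0 h4.
have : e^-1 <= cn (zs t)^-1 by move: hN h2 h3 n0 h4; clra.
by rewrite cnV lef_pV2 // posrE // cn_gt0.
Qed.
End Orbits.

(** * Packaged stage law and subsequences of times *)

Section ExitData.
Variables (R : realType) (alpha : int).
Local Notation C := R[i].
Local Notation K := (R[i] : numFieldType).
Local Notation T := 'rV[K]_2.
Local Notation P := (@skew_map R alpha).
Local Notation zz := (fun x i => iter i P x 0 0).
Local Notation ww := (fun x i => iter i P x 0 1).
Local Notation X := (refX R).
Local Notation a := (`|alpha|%N).

(** All that the global argument needs from the gate, stated for iterates of the map itself; the
    parameters [ka], [M] and [c] of the analysis no longer appear. *)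
Record exit_data := ExitData {
 exit_ref : nat -> R;
 exit_ref_gt0 : forall j, 0 < exit_ref j;
 exit_refS : forall j, exit_ref j = quad (exit_ref j.+1);
 exit_stage_law : forall (B e : R) j, 0 <= B -> 0 < e -> exists2 eta, 0 < eta & exists A k0,
  forall k, (k0 <= k)%N -> forall (p : T) tau, (forall i, zz p i != 0) ->
  (forall i, cn ((zz p i)^-1 - (X (a^k+i))%:C - tau) <= eta) -> cn tau <= B ->
  cn (p 0 1 + 1/2) <= 1/20 ->
  [/\ cn (ww p (a*a^k-a^k-j)%N - exit_map exit_ref_gt0 exit_refS j
     ((a%:R-1)*tau - a%:R*entry (p 0 1))) <= e,
   forall i, (A <= i)%N -> (a^k + i + A <= a*a^k)%N -> cn (ww p i) <= e &
   forall i, (i <= j)%N -> cn (ww p i - iter i quad (p 0 1)) <= e]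
}.

Lemma exit_data_exists : 1 < alpha -> inhabited exit_data.
Proof.
move=> a1; have a1' : (1 < a)%N by move: a1; clia.
have la : 0 < ln a%:R :> R by rewrite ln_gt0 // ltr1n.
have p0 : 0 < pi :> R := pi_gt0 R.
have ka0 : 0 < pi/ln a%:R :> R by rewrite divr_gt0.
have e : pi/(pi/ln a%:R) = ln a%:R :> R by rewrite invf_div mulrCA divff ?mulr1 ?gt_eqF.
have [M0 [c2 [M00 hg]]] := gate_bound a1' ka0 e.
(* The stage lemmas want a positive constant; the successor of [c2] only restricts the range of
   indices. *)
have hin : \forall M \near \oo, in_gate a (pi/ln a%:R : R) M c2.+1.
 exists M0 => // M /= hM; apply: filterS (hg M hM) => n hn i Mi hi; apply: hn => //.
 by move: hi; clear; nia.
have [r [r0 rS rl]] := ref_exit a1' ka0 e (ltn0Sn c2) hin.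
split; apply: (@ExitData r r0 rS) => B ep j B0 e0.
have [eta eta0 [A [k0 _ h]]] := stage r0 rS a1' ka0 e (ltn0Sn c2) hin rl j B0 e0.
exists eta => //; exists A, k0 => k hk p tau h1 h2 h3 h4.
have a0 : 0 < alpha by move: a1; clia.
have [g1 g2 g3] := h k hk _ _ tau (skew_map_orbit p a0) h1 h2 h3 h4.
by split=> // i /g3[].
Qed.
End ExitData.

Lemma contraction_bound (R : realFieldType) (b l t x y U : R) : 0 < l -> 0 < b -> 0 <= y ->
 x <= 17*(y*U) -> U <= 2*t -> 68*b * l*t <= 1 -> l*(b*x) <= 1/2*y.
Proof.
move=> l0 b0 y0 h hU h2.
have h1 : x <= 17*(y*(2*t)) by apply: le_trans h _; rewrite !ler_wpM2l.
apply: le_trans (_ : l*(b*(17*(y*(2*t)))) <= _); first by rewrite ler_pM2l // ler_pM2l.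
have : 68*b * l*t*y <= 1*y by apply: ler_wpM2r.
clra.
Qed.

Lemma extract (Q : nat -> Prop) : (forall N, exists2 n, (N <= n)%N & Q n) ->
 exists2 phi, strictly_increasing phi & forall n, Q (phi n).
Proof.
move=> h; pose f N := projT1 (cid2 (h N)).
have f1 N : (N <= f N)%N by rewrite /f; case: cid2.
have f2 N : Q (f N) by rewrite /f; case: cid2.
pose phi n := iter n (fun x => f x.+1) (f 0%N).
exists phi; last by case=> [|n] /=.
by apply: homo_ltn => [|n]; [exact: ltn_trans|exact: f1].
Qed.

(** Relative to the stage times, some subsequence of the given times is constant, or lies at a fixed
    delay after some [tm k], or at a fixed advance before it; otherwise the times move away from all
    [tm k], where [W] is small. Each case yields its own uniform estimate. *)
Lemma subseq_cauchy (R : realType) (U : Type) (W : U -> nat -> R[i]) (tm : nat -> nat) :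
 (forall k l, (k <= l)%N -> (tm k <= tm l)%N) -> (forall N, exists k, (N <= tm k)%N) ->
 (forall s (e : R), 0 < e -> exists N, forall q k l, (N <= k)%N -> (N <= l)%N ->
   cn (W q (tm k + s)%N - W q (tm l + s)%N) <= e) ->
 (forall s (e : R), 0 < e -> exists N, forall q k l, (N <= k)%N -> (N <= l)%N ->
   cn (W q (tm k - s)%N - W q (tm l - s)%N) <= e) ->
 (forall e : R, 0 < e -> exists A N, forall q k t, (N <= k)%N -> (tm k + A <= t)%N ->
   (t + A <= tm k.+1)%N -> cn (W q t) <= e) ->
 forall u : nat -> nat, exists2 phi, strictly_increasing phi &
  (exists v, forall n, u (phi n) = v) \/
  ((forall M, exists N, forall n, (N <= n)%N -> (M <= u (phi n))%N) /\
   forall e : R, 0 < e -> exists N, forall q n l, (N <= n)%N -> (N <= l)%N ->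
    cn (W q (u (phi n)) - W q (u (phi l))) <= e).
Proof.
move=> mono unb H1 H2 H3 u.
have io (Q : nat -> Prop) : ~ (forall N, exists2 n, (N <= n)%N & Q n) ->
  exists N, forall n, (N <= n)%N -> ~ Q n.
 move=> /existsNP[N hN]; exists N => n Nn Qn; apply: hN; by exists n.
have [[v hv]|nc] := pselect (exists v, forall N, exists2 n, (N <= n)%N & u n = v).
 by have [phi p1 p2] := extract hv; exists phi => //; left; exists v.
have uinf M : exists N, forall n, (N <= n)%N -> (M <= u n)%N.
 elim: M => [|M [N hN]]; first by exists 0%N.
 have /io[N' hN'] : ~ (forall N, exists2 n, (N <= n)%N & u n = M) by move=> h; apply: nc; exists M.
 exists (N+N')%N => n hn; rewrite ltn_neqAle hN ?andbT; last by move: hn; clia.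
 by apply/eqP => e; apply: (hN' n); [move: hn; clia|].
have sub phi M : strictly_increasing phi -> exists N, forall n, (N <= n)%N -> (M <= u (phi n))%N.
 move=> p1; have [N hN] := uinf M; exists N => n hn; apply: hN; apply: leq_trans hn _.
 by elim: n => // n IH; apply: leq_ltn_trans IH _; exact: p1.
have main (g : nat -> nat) : (forall N, exists2 n, (N <= n)%N & exists k, u n = g k) ->
 (forall k l, (k <= l)%N -> (g k <= g l)%N) ->
 (forall e : R, 0 < e -> exists N, forall q k l, (N <= k)%N -> (N <= l)%N ->
   cn (W q (g k) - W q (g l)) <= e) ->
 exists2 phi, strictly_increasing phi &
  (exists v, forall n, u (phi n) = v) \/
  ((forall M, exists N, forall n, (N <= n)%N -> (M <= u (phi n))%N) /\
   forall e : R, 0 < e -> exists N, forall q n l, (N <= n)%N -> (N <= l)%N ->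
    cn (W q (u (phi n)) - W q (u (phi l))) <= e).
 move=> /extract[phi p1 p2] gm gc; exists phi => //; right; split; first by move=> M; exact: sub.
 move=> e /gc[N hN]; have [N' hN'] := sub phi (g N).+1 p1; exists N' => q n l /hN' hn /hN' hl.
 have [k hk] := p2 n; have [k' hk'] := p2 l; rewrite hk hk' in hn hl *.
 apply: hN; rewrite leqNgt; apply/negP => /ltnW /gm.
  by move: hn; clia.
 by move: hl; clia.
have [[s hs]|n1] := pselect (exists s, forall N, exists2 n, (N <= n)%N & exists k, u n = (tm k + s)%N).
 by apply: main hs _ (H1 s) => k l /mono h; rewrite leq_add2r.
have [[s hs]|n2] := pselect (exists s, forall N, exists2 n, (N <= n)%N & exists k, u n = (tm k - s)%N).
 by apply: main hs _ (H2 s) => k l /mono h; rewrite leq_sub2r.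
exists id => //; right; split=> // e e0.
have e2 : 0 < e/2 by rewrite divr_gt0.
have [A [N hN]] := H3 _ e2.
have [N1 hN1] : exists N1, forall n, (N1 <= n)%N -> forall s, (s < A.+1)%N -> forall k, u n <> (tm k + s)%N /\ u n <> (tm k - s)%N.
 elim: A.+1 => [|B [N1 h1]]; first by exists 0%N.
 have /io[Na ha] : ~ (forall N, exists2 n, (N <= n)%N & exists k, u n = (tm k + B)%N) by move=> h; apply: n1; exists B.
 have /io[Nb hb] : ~ (forall N, exists2 n, (N <= n)%N & exists k, u n = (tm k - B)%N) by move=> h; apply: n2; exists B.
 exists (N1+Na+Nb)%N => n hn s; rewrite ltnS leq_eqVlt => /orP[/eqP -> k|sB]; last by apply: h1 => //; move: hn; clia.
 split=> hu; [apply: (ha n)|apply: (hb n)]; try by exists k.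
  by move: hn; clia.
 by move: hn; clia.
have [N2 hN2] := uinf (tm N).
suff h q n : (N1 + N2 <= n)%N -> cn (W q (u n)) <= e/2.
 exists (N1+N2)%N => q n l /(h q) h1 /(h q) h2; apply: cnB_le; move: h1 h2; clra.
move=> hn; have n1' : (N1 <= n)%N by move: hn; clia.
have n2' : (tm N <= u n)%N by apply: hN2; move: hn; clia.
have [k [Nk k1 k2]] : exists k, [/\ (N <= k)%N, (tm k <= u n)%N & (u n < tm k.+1)%N].
 have [b hb] := unb (u n).+1.
 have bN : (N < b)%N.
  by rewrite ltnNge; apply/negP => /mono; move: hb n2'; clia.
 have [d eb] : exists d, b = (N+d)%N by exists (b-N)%N; rewrite subnKC // ltnW.
 rewrite {}eb in hb; clear bN b; elim: d hb => [|d IH] hb; first by move: hb n2'; rewrite addn0; clia.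
 have [h|h] := leqP (u n).+1 (tm (N+d)%N); first exact: IH.
 by exists (N+d)%N; rewrite leq_addr -addnS; split.
apply: (hN q k) => //.
 rewrite leqNgt; apply/negP => h; have [|g _] := hN1 n n1' (u n - tm k)%N _ k.
  by move: h; clia.
 by apply: g; rewrite subnKC.
rewrite leqNgt; apply/negP => h; have [|_ g] := hN1 n n1' (tm k.+1 - u n)%N _ k.+1.
 by move: h; clia.
by apply: g; rewrite subKn // ltnW.
Qed.

Section TauLower.
Variable R : realType.
Local Notation C := R[i].
Local Notation X := (refX R).

Lemma inv_trans_orbit (zs : nat -> C) : (forall i, zs i.+1 = zs i - zs i^+2) -> (forall i, zs i != 0) ->
 trans_orbit (fun i => (zs i)^-1).
Proof.
move=> hz z0 i; rewrite hz trans_logistic //; apply/eqP => h1; have := z0 i.+1.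
have e1 : zs i = 1 by apply/esym/eqP; rewrite -subr_eq0 h1.
by rewrite hz e1 expr1n subrr eqxx.
Qed.

(** The weights [1 + 4/(n+i)] decrease at least as fast as the lower factors of [trans_sub], tend to
    1, and start at most at 2 because [n >= 4]; so the total contraction is at most by 2. *)
Lemma tracked_separation n (zs zs' : nat -> C) tau tau' : (4 <= n)%N ->
 (forall i, zs i.+1 = zs i - zs i^+2) -> (forall i, zs' i.+1 = zs' i - zs' i^+2) ->
 cn ((zs 0%N)^-1 - (X n)%:C) <= (X n - 1)/4 -> cn ((zs' 0%N)^-1 - (X n)%:C) <= (X n - 1)/4 ->
 tracked n zs tau -> tracked n zs' tau' -> cn ((zs 0%N)^-1 - (zs' 0%N)^-1) <= 2*cn (tau-tau').
Proof.
move=> n4 hz hz' h0 h0' [z0 [D hD]] [z0' [D' hD']].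
pose d i := cn ((zs i)^-1 - (zs' i)^-1).
pose b i : R := 1 + 4/(n+i)%:R.
have n4' : 4 <= n%:R :> R by rewrite ler_nat.
have b1 i : 1 <= b i by rewrite /b lerDl divr_ge0.
have grow i : d 0%N*b i <= d i*b 0%N.
 elim: i => [//|i IH].
 have [_ s] := trans_sub (inv_trans_orbit hz z0) (inv_trans_orbit hz' z0') h0 h0' (lexx _) i.
 have X1 : (n+i)%:R + 1 <= X (n+i) - 1 := refX_ge1 R (n+i).
 have x4 : 4 <= (n+i)%:R :> R by rewrite natrD; have := ler0n R i; move: n4'; clra.
 have step : b i.+1 <= b i*(1 - 16/9*(X (n+i) - 1) ^- 2).
  have b0 : 0 <= b i by apply: le_trans (b1 i).
  apply: le_trans (_ : b i*(1 - 16/9*((n+i)%:R + 1) ^- 2) <= _).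
   rewrite /b (_ : (n+i.+1)%:R = (n+i)%:R + 1); last by rewrite addnS natr1.
   move: x4; move: ((n+i)%:R : R) => x x4.
   rewrite -subr_ge0.
   have -> : (1+4/x)*(1 - 16/9*(x+1) ^- 2) - (1 + 4/(x+1)) = (20*x-28)/(9*x*(x+1)^+2).
    field; apply/andP; split; apply/eqP; move: x4; clra.
   by rewrite divr_ge0 ?mulr_ge0 ?exprn_ge0 //; move: x4; clra.
  apply: ler_wpM2l => //; rewrite lerD2l lerN2; apply: ler_wpM2l; first by rewrite divr_ge0.
  rewrite lef_pV2 ?posrE ?exprn_gt0 //; try by move: X1 x4; clra.
  by rewrite ler_sqr ?nnegrE //; move: X1 x4; clra.
 apply: le_trans (_ : d 0%N*(b i*(1 - 16/9*(X (n+i) - 1) ^- 2)) <= _).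
  by apply: ler_wpM2l => //; exact: cn_ge0.
 have f0 : 0 <= 1 - 16/9*(X (n+i) - 1) ^- 2.
  by rewrite -(pmulr_rge0 _ (lt_le_trans ltr01 (b1 i))); apply: le_trans step; apply: le_trans (b1 _).
 rewrite mulrA; apply: le_trans (ler_wpM2r f0 IH) _.
 rewrite mulrAC; apply: ler_wpM2r; first by apply: le_trans (b1 0%N).
 exact: s.
have half i : d 0%N <= 2*d i.
 have h1 : d 0%N <= d 0%N*b i by rewrite ler_peMr ?cn_ge0.
 have h2 : b 0%N <= 2.
  rewrite /b addn0; have : 4/n%:R <= 1 :> R by rewrite ler_pdivrMr ?mul1r // (lt_le_trans _ n4').
  by clra.
 apply: le_trans h1 (le_trans (grow i) _); rewrite mulrC; apply: ler_wpM2r => //; exact: cn_ge0.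
apply/ler_addgt0Pl => e e0.
have D0 : 0 <= `|D| + `|D'| by rewrite addr_ge0.
have [i hi] : exists i : nat, 2*(`|D| + `|D'|)/e < i%:R.
 by exists (Num.bound (2*(`|D| + `|D'|)/e)); apply: archi_boundP; rewrite divr_ge0 ?mulr_ge0 // ltW.
have i0 : 0 < i.+1%:R :> R by [].
have hi' : 2*(`|D| + `|D'|)/i.+1%:R <= e.
 rewrite ler_pdivrMr // [e*_]mulrC -ler_pdivrMr //; apply: le_trans (ltW hi) _; rewrite ler_nat //.
have g1 : cn ((zs i)^-1 - (X (n+i))%:C - tau) <= `|D| / i.+1%:R.
 by apply: le_trans (hD i) _; apply: ler_wpM2r (ler_norm _); rewrite invr_ge0.
have g2 : cn ((zs' i)^-1 - (X (n+i))%:C - tau') <= `|D'| / i.+1%:R.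
 by apply: le_trans (hD' i) _; apply: ler_wpM2r (ler_norm _); rewrite invr_ge0.
apply: le_trans (half i) _; rewrite /d.
have -> : (zs i)^-1 - (zs' i)^-1 = ((zs i)^-1 - (X (n+i))%:C - tau) - ((zs' i)^-1 - (X (n+i))%:C - tau') + (tau-tau') by ring.
have g3 := cnD (((zs i)^-1 - (X (n+i))%:C - tau) - ((zs' i)^-1 - (X (n+i))%:C - tau')) (tau-tau').
have g4 := cnB ((zs i)^-1 - (X (n+i))%:C - tau) ((zs' i)^-1 - (X (n+i))%:C - tau').
rewrite mulrDr mulrDl in hi'.
move: g1 g2 g3 g4 hi'; rewrite -!mulrA; move: (`|D| / _) (`|D'| / _) => u v; clra.
Qed.
End TauLower.

(** * Stable centres of the stage map *)

Section Setting.
Variables (R : realType) (alpha : int) (S : exit_data R alpha).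
Hypothesis alpha1 : 1 < alpha.
Local Notation C := R[i].
Local Notation K := (R[i] : numFieldType).
Local Notation T := 'rV[K]_2.
Local Notation P := (@skew_map R alpha).
Local Notation zz := (fun x i => iter i P x 0 0).
Local Notation ww := (fun x i => iter i P x 0 1).
Local Notation X := (refX R).
Local Notation a := (`|alpha|%N).
Local Notation E := (exit_map (exit_ref_gt0 S) (exit_refS S)).
(** A point is thought to start at the reference time [a^k0], so its stage [k] begins after this
    number of iterations. *)
Local Notation tm k0 k := (a^k-a^k0)%N.
Local Notation c := (1/4%:R + pi^+2/ln (alpha%:~R)^+2 : R).
Local Notation wt q k0 k := (ww q (tm k0 k)).
Local Notation exitY tau w := ((a%:R-1)*tau - a%:R*entry w : C).

Lemma abs_gt1 : (1 < a)%N.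
Proof. by move: alpha1; clia. Qed.
Lemma pow_le k l : (k <= l)%N -> (a^k <= a^l)%N.
Proof. by move=> h; rewrite leq_pexp2l // ltnW // abs_gt1. Qed.
Lemma pow_ge k : (k < a^k)%N.
Proof. exact: ltn_expl abs_gt1. Qed.

Lemma tmS k0 k : (k0 <= k)%N -> tm k0 k.+1 = (tm k0 k + (a*a^k-a^k))%N.
Proof.
move=> /pow_le h; rewrite expnS; have := abs_gt1; move: h.
by move: (a^k)%N (a^k0)%N (a) => x y b; clear; nia.
Qed.

Lemma tm_le k0 k l : (k <= l)%N -> (tm k0 k <= tm k0 l)%N.
Proof. by move=> h; apply: leq_sub2r; exact: pow_le. Qed.

Lemma tm_ge k0 N : exists k1, forall k, (k1 <= k)%N -> (N <= tm k0 k)%N.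
Proof.
exists (a^k0+N)%N => k hk; rewrite leq_subRL; last by apply: pow_le; apply: leq_trans hk; have := pow_ge k0; lia.
by apply: leq_trans hk _; apply/ltnW/pow_ge.
Qed.

Lemma gap_ge N : exists k1, forall k, (k1 <= k)%N -> (N <= a*a^k - a^k)%N.
Proof.
exists N => k hk; have := abs_gt1; have := pow_ge k; move: hk.
by move: (a^k)%N (a) => x b; clear; nia.
Qed.

Lemma shifted_stage k0 (B D e : R) j : 0 <= B -> 0 < e -> exists A k1, forall k, (k1 <= k)%N ->
 forall (q : T) tau, (forall i, zz q i != 0) ->
 (forall i, cn ((zz q i)^-1 - (X (a^k0+i))%:C - tau) <= D/i.+1%:R) -> cn tau <= B ->
 cn (wt q k0 k + 1/2) <= 1/20 ->
 [/\ cn (ww q (tm k0 k.+1 - j)%N - E j (exitY tau (wt q k0 k))) <= e,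
   forall t, (tm k0 k + A <= t)%N -> (t + A <= tm k0 k.+1)%N -> cn (ww q t) <= e &
   forall i, (i <= j)%N -> cn (ww q (tm k0 k + i)%N - iter i quad (wt q k0 k)) <= e].
Proof.
move=> B0 e0; have [eta eta0 [A [k1 h]]] := exit_stage_law S j B0 e0.
have [k2 hk2] := tm_ge k0 (Num.bound (`|D| / eta)).
have [k3 hk3] := gap_ge j.
exists A, (k0+k1+k2+k3)%N => k hk q tau z0 hz tB w1.
have k0k : (k0 <= k)%N by move: hk; clia.
have k1k : (k1 <= k)%N by move: hk; clia.
have k2k : (k2 <= k)%N by move: hk; clia.
have k3k : (k3 <= k)%N by move: hk; clia.
have sh i : iter i P (iter (tm k0 k) P q) = iter (tm k0 k + i) P q by rewrite addnC iterD.
have e1 i : (a^k+i)%N = (a^k0 + (tm k0 k + i))%N.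
 by have := pow_le k0k; clia.
have z0' i : zz (iter (tm k0 k) P q) i != 0 by rewrite sh.
have [|g1 g2 g3] := h k k1k (iter (tm k0 k) P q) tau z0' _ tB w1.
 move=> i; rewrite sh e1; apply: le_trans (hz _) _.
 apply: le_trans (_ : `|D| / (tm k0 k).+1%:R <= _).
  apply: le_trans (ler_wpM2r _ (ler_norm D)) _ => //.
  by apply: ler_wpM2l => //; rewrite lef_pV2 ?posrE ?ltr0n // ler_nat ltnS leq_addr.
 rewrite ler_pdivrMr ?ltr0n // [eta*_]mulrC -ler_pdivrMr //.
 have := archi_boundP (divr_ge0 (normr_ge0 D) (ltW eta0)) => /ltW/le_trans; apply.
 by rewrite ler_nat; apply: leq_trans (hk2 k k2k) _.
have e2 : (tm k0 k + (a*a^k-a^k-j))%N = (tm k0 k.+1 - j)%N.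
 by rewrite tmS // addnBA // hk3.
split; first by move: g1; rewrite sh e2.
 move=> t t1 t2; have := g2 (t - tm k0 k)%N; rewrite sh subnKC; last by move: t1; clia.
 apply; first by move: t1; clia.
 have aa : (a^k <= a*a^k)%N by rewrite leq_pmull // ltnW // abs_gt1.
 move: t1 t2 aa; rewrite tmS //; have := pow_le k0k.
 move: (a*a^k)%N (a^k)%N (a^k0)%N => x y z; clia.
by move=> i /g3; rewrite sh.
Qed.

Lemma center_constants (tau0 : C) m : chain m (fun j => E j ((a%:R-1)*tau0)) ->
 E 0 ((a%:R-1)*tau0) = - (1/2) ->
 exists rho ep, [/\ 0 < rho <= 1/40, 0 < ep <= 1 & forall tau w, cn (tau-tau0) <= ep -> cn (w+1/2) <= rho ->
  [/\ (cn (E 0 (exitY tau w) + 1/2) <= 1/20 -> chain m (fun j => E j (exitY tau w))),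
    cn (E 0 (exitY tau w) + 1/2) <= rho/2 &
    forall w', cn (w'+1/2) <= rho ->
     cn (E 0 (exitY tau w) - E 0 (exitY tau w')) <= 1/2*cn (w-w')]].
Proof.
move=> ch e0; set Y0 := (_*tau0) in ch e0 *.
have [dc dc0 hdc] := chain_open ch.
have B0 : 0 <= cn Y0 + 1 by rewrite addr_ge0 ?cn_ge0.
have [L L0 hL] := exit_map_lip (exit_ref_gt0 S) (exit_refS S) 0 B0.
have a0 : 1 <= a%:R :> R by rewrite ler1n ltnW // abs_gt1.
have a0' : 0 < a%:R :> R by apply: lt_le_trans a0.
have aC : cn (a%:R : C) = a%:R by rewrite cn_nat.
have aC1 : cn (a%:R - 1 : C) <= a%:R.
 have -> : a%:R - 1 = (a.-1)%:R :> C by rewrite -subn1 natrB // ltnW // abs_gt1.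
 by rewrite cn_nat ler_nat leq_pred.
(* [1/(68*a*L)] brings the Lipschitz constant [L*a*17*2*rho] below [1/2]; [2*L*dc] fits the
   tolerance of [chain_open], and [2*L] keeps the offset within 1 of [Y0]. *)
pose rho := Num.min (Num.min (1/40) (1/(68*a%:R*L))) (Num.min (2*L*dc) (2*L)).
have rho0 : 0 < rho by rewrite !lt_min !divr_gt0 ?mulr_gt0.
have : rho <= rho by [].
rewrite {2}/rho !le_min => /andP[/andP[r1 r2] /andP[r3 r4]].
have r2' : 68*a%:R*L*rho <= 1.
 by move: r2; rewrite ler_pdivlMr ?mulr_gt0 // mulrC.
exists rho, (Num.min 1 (rho/(4*a%:R*L))); split.
- by rewrite rho0.
- by rewrite lt_min ltr01 divr_gt0 ?mulr_gt0 //= ge_min lexx.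
move=> tau w; rewrite le_min => /andP[t1 t2] hw.
have hw20 v : cn (v+1/2) <= rho -> cn (v+1/2) <= 1/20.
 by move=> hv; apply: le_trans hv _; move: r1; clra.
have ent v v' : cn (v+1/2) <= rho -> cn (v'+1/2) <= rho ->
  L*cn (exitY tau v - exitY tau v') <= 1/2*cn (v-v').
 move=> hv hv'; have -> : exitY tau v - exitY tau v' = a%:R*(entry v' - entry v) by ring.
 rewrite cnM aC cnBC; have /andP[_ h] := entry_lip (hw20 _ hv) (hw20 _ hv').
 rewrite subr_sqr cnM (_ : v + 1/2 - (v'+1/2) = v - v') in h; last by ring.
 have := cnD (v+1/2) (v'+1/2); have := cn_ge0 (v-v').
 move=> v0 vs.
 apply: contraction_bound h _ r2' => //.
 by move: vs hv hv'; clra.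
have half0 : cn (- (1/2) + 1/2 : C) <= rho by rewrite addNr cn0 ltW.
have YY v : cn (v+1/2) <= rho -> L*cn (exitY tau v - Y0) <= rho/2.
 move=> hv; have -> : exitY tau v - Y0 = (a%:R-1)*(tau-tau0) - a%:R*entry v by rewrite /Y0; ring.
 have half0' : cn (- (1/2) + 1/2 : C) <= 1/20 by exact: hw20 half0.
 have /andP[_] := entry_lip (hw20 _ hv) half0'; rewrite entry_crit addNr expr0n !subr0 cnX => h.
 have h1 := cnB ((a%:R-1)*(tau-tau0)) (a%:R*entry v); rewrite !cnM aC in h1.
 have h2 : cn (a%:R - 1 : C)*cn (tau-tau0) <= a%:R*(rho/(4*a%:R*L)).
  by apply: ler_pM; rewrite ?cn_ge0.
 have h3 : L*(a%:R*(rho/(4*a%:R*L))) = rho/4 by field; rewrite !gt_eqF.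
 have h4 : L*cn (a%:R - 1 : C)*cn (tau-tau0) <= rho/4 by rewrite -mulrA -h3 ler_wpM2l // ltW.
 have h5 : L*(a%:R*cn (entry v)) <= rho/4.
  have : cn (v+1/2)^+2 <= rho^+2 by rewrite ler_sqr ?nnegrE ?cn_ge0 // ltW.
  move=> hh; have hh' : cn (entry v) <= 17*(rho/2*(2*rho)).
   apply: le_trans h _; rewrite ler_wpM2l //; suff -> : rho/2*(2*rho) = rho^+2 by []; by field.
  have rho2 : 0 <= rho/2 by rewrite divr_ge0 // ltW.
  by have := contraction_bound L0 a0' rho2 hh' (lexx _) r2'; clra.
 apply: le_trans (ler_wpM2l (ltW L0) h1) _.
 by rewrite mulrDr [L*(_*_)]mulrA; move: h4 h5; clra.
have cY v : cn (v+1/2) <= rho -> cn (exitY tau v) <= cn Y0 + 1.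
 move=> hv; have := YY v hv; have := cnD (exitY tau v - Y0) Y0; rewrite subrK.
 have h : L*cn (exitY tau v - Y0) <= rho/2 -> cn (exitY tau v - Y0) <= 1.
  move=> h; rewrite -(ler_pM2l L0) mulr1; apply: le_trans h _; move: r4; clra.
 by move=> h1 /h h2; move: h1 h2; clra.
split.
- apply: hdc; rewrite -(ler_pM2l L0); apply: le_trans (YY w hw) _; move: r3; clra.
- have := hL (exitY tau w) Y0 (cY w hw); rewrite lerDl ler01 e0 opprK => /(_ isT) h.
 exact: le_trans h (YY w hw).
move=> w' hw'; apply: le_trans (hL _ _ (cY w hw) (cY w' hw')) _; exact: ent.
Qed.

Lemma cn_a1 : cn (a%:R - 1 : C) <= a%:R.
Proof.
have -> : a%:R - 1 = (a.-1)%:R :> C by rewrite -subn1 natrB // ltnW // abs_gt1.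
by rewrite cn_nat ler_nat leq_pred.
Qed.

Lemma exitY_bound (B : R) tau w : cn tau <= B -> cn (w+1/2) <= 1/20 ->
 cn (exitY tau w) <= a%:R*(B+2).
Proof.
move=> hB hw; have h := entry_bound hw; apply: cnB_le; rewrite !cnM cn_nat.
rewrite mulrDr; apply: lerD; first by apply: ler_pM; rewrite ?cn_ge0 ?cn_a1.
by apply: ler_wpM2l => //; apply: le_trans h _; rewrite ler_pdivrMr //; lra.
Qed.

Lemma exitY_lip tau tau' w w' : cn (w+1/2) <= 1/20 -> cn (w'+1/2) <= 1/20 ->
 cn (exitY tau w - exitY tau' w') <= 2*a%:R*(cn (tau-tau') + cn (w-w')).
Proof.
move=> hw hw'; have -> : exitY tau w - exitY tau' w' = (a%:R-1)*(tau-tau') - a%:R*(entry w - entry w') by ring.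
have /andP[_ h] := entry_lip hw hw'.
rewrite subr_sqr (_ : w + 1/2 - (w'+1/2) = w - w') in h; last by ring.
have h1 : cn ((w-w')*(w + 1/2 + (w'+1/2))) <= cn (w-w')*(1/10).
 rewrite cnM; apply: ler_wpM2l; first exact: cn_ge0.
 by apply: cnD_le; move: hw hw'; clra.
apply: cnB_le; rewrite !cnM cn_nat -mulrA mulrDr mulrDr.
have h2 : cn (a%:R - 1 : C)*cn (tau-tau') <= a%:R*cn (tau-tau') by rewrite ler_wpM2r ?cn_ge0 ?cn_a1.
have h3 : a%:R*cn (entry w - entry w') <= a%:R*(2*cn (w-w')).
 rewrite ler_wpM2l //; have := cn_ge0 (w-w'); move: h h1; clra.
have h4 : 0 <= a%:R*cn (tau-tau') by rewrite mulr_ge0 ?cn_ge0.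
by move: h2 h3 h4; clra.
Qed.

Lemma stage_map_lip j (B : R) : 0 <= B -> exists2 L, 0 < L & forall tau tau' w w',
 cn tau <= B -> cn tau' <= B -> cn (w+1/2) <= 1/20 -> cn (w'+1/2) <= 1/20 ->
 cn (E j (exitY tau w) - E j (exitY tau' w')) <= L*(cn (tau-tau') + cn (w-w')).
Proof.
move=> B0; have a0 : 0 < a%:R :> R by rewrite ltr0n ltnW // abs_gt1.
have B0' : 0 <= a%:R*(B+2) by rewrite mulr_ge0 // addr_ge0.
have [L L0 hL] := exit_map_lip (exit_ref_gt0 S) (exit_refS S) j B0'.
exists (L*(2*a%:R)); first by rewrite !mulr_gt0.
move=> tau tau' w w' h1 h2 h3 h4; apply: le_trans (hL _ _ (exitY_bound h1 h3) (exitY_bound h2 h4)) _.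
by rewrite -mulrA; apply: ler_wpM2l; [exact: ltW|exact: exitY_lip].
Qed.

Lemma limit_exit k0 (q : T) tau y0 : tracked (a^k0) (zz q) tau ->
 (forall e : R, 0 < e -> exists N, forall k, (N <= k)%N -> cn (wt q k0 k - y0) <= e) ->
 cn (y0+1/2) < 1/20 ->
 forall j (e : R), 0 < e -> exists N, forall k, (N <= k)%N ->
  cn (ww q (tm k0 k - j)%N - E j (exitY tau y0)) <= e.
Proof.
move=> [z0 [D hD]] hy y20 j e e0.
have [L L0 hL] := stage_map_lip j (cn_ge0 tau).
have e2 : 0 < e/2 by rewrite divr_gt0.
have [A [k1 h1]] := shifted_stage k0 D j (cn_ge0 tau) e2.
have d0 : 0 < Num.min (1/20 - cn (y0+1/2)) (e/(2*L)).
 by rewrite lt_min subr_gt0 y20 divr_gt0 ?mulr_gt0.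
have [N hN] := hy _ d0; exists (N+k1).+1 => -[//|k]; rewrite ltnS => hk.
have := hN k; rewrite le_min => /(_ _)/andP[|w1 w2]; first by move: hk; clia.
have w20 : cn (wt q k0 k + 1/2) <= 1/20.
 have := cn_tri (wt q k0 k) y0 (1/2).
 by move: w1; clra.
have [|g _ _] := h1 k _ q tau z0 hD (lexx _) w20; first by move: hk; clia.
have := hL tau tau (wt q k0 k) y0 (lexx _) (lexx _) w20 (ltW y20).
rewrite subrr cn0 add0r => g2.
have g3 : L*cn (wt q k0 k - y0) <= e/2.
 by move: w2; rewrite ler_pdivlMr ?mulr_gt0 //; clra.
have := cn_tri (ww q (tm k0 k.+1 - j)%N) (E j (exitY tau (wt q k0 k))) (- E j (exitY tau y0)).
by move: g g2 g3; clra.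
Qed.

(** The constants are parameters, not existentially bound, since later convergence must be uniform
    over all such points. *)
Definition centered k0 tau0 (rho ep D B : R) (q : T) tau :=
 [/\ forall i, zz q i != 0,
   forall i, cn ((zz q i)^-1 - (X (a^k0+i))%:C - tau) <= D/i.+1%:R,
   cn tau <= B, cn (tau-tau0) <= ep &
   forall k, (k0 <= k)%N -> cn (wt q k0 k + 1/2) <= rho].

Definition stable_at m tau0 (rho ep : R) := forall tau w, cn (tau-tau0) <= ep -> cn (w+1/2) <= rho ->
  [/\ (cn (E 0 (exitY tau w) + 1/2) <= 1/20 -> chain m (fun j => E j (exitY tau w))),
    cn (E 0 (exitY tau w) + 1/2) <= rho/2 &
    forall w', cn (w'+1/2) <= rho ->
     cn (E 0 (exitY tau w) - E 0 (exitY tau w')) <= 1/2*cn (w-w')].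

(** The centre is [(1/(X n + tau0), -1/2)] with [n = a^k0] so large that nearby phases lie within
    [ep] of [tau0]. Induction on the stage keeps the orbit in the disc: the stage map lands in the
    half disc, with an error at most [rho/2]. *)
Lemma center_box m tau0 rho ep : 0 < rho <= 1/40 -> 0 < ep <= 1 -> stable_at m tau0 rho ep ->
 exists k0 q0 d D B, [/\ 0 < d, 0 <= B, 0 <= D, (4 <= a^k0)%N & forall q, box q0 d q ->
  cn ((q 0 0)^-1 - (X (a^k0))%:C) <= (X (a^k0) - 1)/4 /\ exists tau, centered k0 tau0 rho ep D B q tau].
Proof.
move=> /andP[rho0 rho1] /andP[ep0 ep1] st.
have B0 : 0 <= cn tau0 + 1 by rewrite addr_ge0 ?cn_ge0.
have r2 : 0 < rho/2 by rewrite divr_gt0.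
have [eta eta0 [A [k1 h1]]] := exit_stage_law S 0 B0 r2.
pose D := 4*(cn tau0 + 1).
have D0 : 0 <= D by rewrite mulr_ge0.
pose mu := Num.min (ep/2) eta; have mu0 : 0 < mu by rewrite lt_min eta0 divr_gt0.
have [k2 hk2] : exists k2 : nat, 2*D + D/mu <= k2%:R.
 exists (Num.bound (2*D+D/mu)); apply/ltW/archi_boundP.
 by rewrite addr_ge0 ?mulr_ge0 ?invr_ge0 // ltW.
have Dmu : 0 <= D/mu by rewrite divr_ge0 // ltW.
pose k0 := (k1+k2+4)%N; pose n := (a^k0)%N.
have nk : 2*D + D/mu <= n%:R.
 apply: le_trans hk2 _; rewrite ler_nat /n; apply: leq_trans (ltnW (pow_ge _)); rewrite /k0; clia.
have Xn := refX_ge1 R n.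
pose c0 := (X n)%:C + tau0.
have c00 : c0 != 0.
 rewrite -cn_gt0; have := cn_sub_ge (X n)%:C (- tau0); rewrite opprK cnN cn_real.
 have := ler_norm (X n); rewrite /c0; move: Xn nk D0 Dmu; rewrite /D; have := cn_ge0 tau0; clra.
have c0i : c0^-1 != 0 by rewrite invr_eq0.
have ep2 : 0 < ep/2 by rewrite divr_gt0.
have [d d0 hd] := inv_cont c0i ep2.
pose q0 : T := \row_(j < 2) if j == 0 then c0^-1 else - (1/2).
exists k0, q0, (Num.min d rho), D, (cn tau0 + 1); split=> //; first by rewrite lt_min d0.
 by apply: leq_trans (ltnW (pow_ge _)); rewrite /k0 leq_addl.
move=> q hq; have := hq 0; rewrite le_min !mxE /= => /andP[/hd[zq0 zq1] _].
have := hq 1; rewrite le_min !mxE /= opprK => /andP[_ wq].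
rewrite invrK in zq1.
have s1 : cn ((zz q 0%N)^-1 - (X n)%:C) <= cn tau0 + ep/2.
 have := cnD ((zz q 0%N)^-1 - c0) tau0; rewrite /c0 opprD addrA subrK => h.
 by apply: le_trans h _; rewrite [leRHS]addrC lerD2r /=; move: zq1; rewrite /c0 opprD addrA.
have s2 : 4*cn ((zz q 0%N)^-1 - (X n)%:C) <= D by rewrite /D; move: s1 ep1; clra.
have [|zn [tau ht]] := track_start (zz_step alpha q) (n := n) _.
 by move: s2 nk D0 Xn Dmu; clra.
have ht' i : cn ((zz q i)^-1 - (X (n+i))%:C - tau) <= D/(n+i).+1%:R.
 by apply: le_trans (ht i) _; apply: ler_wpM2r.
have Dn : D/n.+1%:R <= mu.
 rewrite ler_pdivrMr ?ltr0n // mulrC -ler_pdivrMr //.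
 by have : n%:R <= n.+1%:R :> R; [rewrite ler_nat|move: nk D0 Dmu; clra].
have mu' : mu <= ep/2 /\ mu <= eta by rewrite /mu; split; rewrite ge_min lexx ?orbT.
have ttau : cn (tau-tau0) <= ep.
 have h := ht' 0%N; rewrite !addn0 in h.
 have -> : tau - tau0 = ((zz q 0%N)^-1 - c0) - ((zz q 0%N)^-1 - (X n)%:C - tau) by rewrite /c0; ring.
 apply: cnB_le; move: zq1 (le_trans h (le_trans Dn mu'.1)); clra.
have tB : cn tau <= cn tau0 + 1.
 by have := cnD (tau-tau0) tau0; rewrite subrK; move: ttau ep1; clra.
split; first by move: s2 nk D0 Xn Dmu; rewrite -/n; plra.
exists tau; split=> //.
 by move=> i; apply: le_trans (ht' i) _; rewrite ler_wpM2l // lef_pV2 ?posrE ?ltr0n // ler_nat ltnS leq_addl.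
move=> k hk; have [i ->] : exists i, k = (k0+i)%N by exists (k-k0)%N; rewrite subnKC.
elim: i {k hk} => [|i IH]; first by rewrite addn0 subnn.
set k := (k0+i)%N in IH; have k0k : (k0 <= k)%N by rewrite leq_addr.
have sh l : iter l P (iter (tm k0 k) P q) = iter (tm k0 k + l) P q by rewrite addnC iterD.
have z0' l : zz (iter (tm k0 k) P q) l != 0 by rewrite sh.
have tr' l : cn ((zz (iter (tm k0 k) P q) l)^-1 - (X (a^k+l))%:C - tau) <= eta.
 rewrite sh; have -> : (a^k+l)%N = (n + (tm k0 k + l))%N.
  by have := pow_le k0k; rewrite /n; clia.
 apply: le_trans (ht' _) _; apply: le_trans (_ : D/n.+1%:R <= _); last exact: le_trans Dn mu'.2.
 by rewrite ler_wpM2l // lef_pV2 ?posrE ?ltr0n // ler_nat ltnS leq_addr.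
have w20 : cn (wt q k0 k + 1/2) <= 1/20 by apply: le_trans IH _; move: rho1; plra.
have [|g _ _] := h1 k _ _ tau z0' tr' tB w20; first by rewrite /k /k0 -!addnA leq_addr.
rewrite sh subn0 -tmS // -addnS in g.
have [_ g2 _] := st tau _ ttau IH.
rewrite addnS -/k.
have := cn_tri (wt q k0 k.+1) (E 0 (exitY tau (wt q k0 k))) (1/2).
move => h; apply: le_trans h _.
by rewrite addnS -/k in g; move: g g2; clra.
Qed.

Lemma geom_approach (x : nat -> nat -> R) (B e : R) N : 0 <= B -> 0 < e ->
 (forall k l, (N <= k)%N -> (N <= l)%N -> x k l <= B) ->
 (forall k l, (N <= k)%N -> (N <= l)%N -> x k.+1 l.+1 <= 1/2*x k l + e/4) ->
 exists N', forall k l, (N' <= k)%N -> (N' <= l)%N -> x k l <= e.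
Proof.
move=> B0 e0 xb xs; have e2 : 0 < e/2 by rewrite divr_gt0.
have [m0 hm] := geom_small B e2.
suff h n : forall k l, (N + n <= k)%N -> (N + n <= l)%N -> x k l <= B*(17/20)^+n + e/2.
 exists (N+m0)%N => k l hk hl; apply: le_trans (h _ k l hk hl) _.
 by have := hm m0 (leqnn _); plra.
elim: n => [|n IH] k l.
 by rewrite addn0 expr0 mulr1 => hk hl; apply: le_trans (xb k l hk hl) _; rewrite lerDl ltW.
case: k => [|k]; first by rewrite addnS.
case: l => [|l]; first by rewrite addnS.
rewrite addnS !ltnS => hk hl.
have := xs k l (leqDl hk) (leqDl hl); have := IH k l hk hl.
have : 0 <= B*(17/20)^+n by rewrite mulr_ge0 // exprn_ge0 // divr_ge0.
have -> : B*(17/20)^+n.+1 = B*(17/20)^+n*(17/20) by rewrite exprS; ring.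
by plra.
Qed.

(** * Uniform convergence near the centre *)

Section Centered.
Variables (m k0 : nat) (tau0 : C) (rho ep D B : R).
Hypothesis rho1 : 0 < rho <= 1/40.
Hypothesis st : stable_at m tau0 rho ep.
Hypothesis B0 : 0 <= B.
Hypothesis D0 : 0 <= D.
Notation centd := (centered k0 tau0 rho ep D B).

Lemma centered_w20 q tau k : centd q tau -> (k0 <= k)%N -> cn (wt q k0 k + 1/2) <= 1/20.
Proof.
move=> [_ _ _ _ h] /h h1; apply: le_trans h1 _; case/andP: rho1 => _ /le_trans; apply.
by rewrite !div1r lef_pV2 ?posrE ?ler_nat.
Qed.

Lemma centered_stage j (e : R) : 0 < e -> exists A N, forall q tau, centd q tau -> forall k, (N <= k)%N ->
 [/\ cn (wt q k0 k + 1/2) <= 1/20, cn (ww q (tm k0 k.+1 - j)%N - E j (exitY tau (wt q k0 k))) <= e,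
   forall t, (tm k0 k + A <= t)%N -> (t + A <= tm k0 k.+1)%N -> cn (ww q t) <= e &
   forall i, (i <= j)%N -> cn (ww q (tm k0 k + i)%N - iter i quad (wt q k0 k)) <= e].
Proof.
move=> e0; have [A [k1 h1]] := shifted_stage k0 D j B0 e0.
exists A, (k0+k1)%N => q tau cq k hk; have [z0 hz tB _ hw] := cq.
have w20 := centered_w20 cq (leqDl hk).
by have [] := h1 k (leqDr hk) q tau z0 hz tB w20.
Qed.

(** The stage map contracts by [1/2] and actual stages follow it within [e/8], so raising both
    indices by one halves the difference of two stages up to [e/4]. *)
Lemma centered_cauchy (e : R) : 0 < e -> exists N, forall q tau, centd q tau -> forall k l,
 (N <= k)%N -> (N <= l)%N -> cn (wt q k0 k - wt q k0 l) <= e.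
Proof.
move=> e0; have e8 : 0 < e/8 by rewrite divr_gt0.
have [A [N hN]] := centered_stage 0 e8.
pose F (k l : nat) : set R := [set x | exists q tau, centd q tau /\ x = cn (wt q k0 k - wt q k0 l)].
pose M := (k0+N)%N.
have r0 : 0 <= 2*rho by rewrite mulr_ge0 // ltW //; case/andP: rho1.
have step q tau k l : centd q tau -> (M <= k)%N -> (M <= l)%N ->
 cn (wt q k0 k.+1 - wt q k0 l.+1) <= 1/2*cn (wt q k0 k - wt q k0 l) + e/4.
 move=> cq hk hl; have [z0 hz tB te hw] := cq.
 have [_ g1 _ _] := hN q tau cq k (leqDr hk).
 have [_ g2 _ _] := hN q tau cq l (leqDr hl).
 have wk := hw k (leqDl hk); have wl := hw l (leqDl hl).
 have [_ _ /(_ _ wl) g3] := st te wk.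
 rewrite !subn0 in g1 g2.
 apply: le_trans (cn_via _ _ (E 0 (exitY tau (wt q k0 k))) (E 0 (exitY tau (wt q k0 l)))) _.
 by move: g1 g2 g3; plra.
(* The supremum over centred points makes the recursion uniform; 0 is adjoined so that the set is
   never empty. *)
pose x k l := sup (0 |` F k l).
have Fb q tau k l : centd q tau -> (M <= k)%N -> (M <= l)%N -> cn (wt q k0 k - wt q k0 l) <= 2*rho.
 move=> [_ _ _ _ hw] hk hl.
 have wk := hw k (leqDl hk); have wl := hw l (leqDl hl).
 have := cnB (wt q k0 k + 1/2) (wt q k0 l + 1/2).
 by rewrite opprD addrACA subrr addr0; move: wk wl; plra.
have xub q tau k l : centd q tau -> (M <= k)%N -> (M <= l)%N -> cn (wt q k0 k - wt q k0 l) <= x k l.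
 move=> cq hk hl; apply: ub_le_sup; last by right; exists q, tau.
 by exists (2*rho) => _ [->//|[q' [tau' [cq' ->]]]]; exact: Fb cq' hk hl.
have xle k l (b : R) : 0 <= b -> (forall q tau, centd q tau -> cn (wt q k0 k - wt q k0 l) <= b) -> x k l <= b.
 move=> b0 hb; apply: ge_sup; first by exists 0; left.
 by move=> _ [->//|[q [tau [cq ->]]]]; exact: hb cq.
have x0 k l : (M <= k)%N -> (M <= l)%N -> 0 <= x k l.
 move=> hk hl; apply: ub_le_sup; last by left.
 by exists (2*rho) => _ [->//|[q' [tau' [cq' ->]]]]; exact: Fb cq' hk hl.
have [N' hN'] : exists N', forall k l, (N' <= k)%N -> (N' <= l)%N -> x k l <= e.
 apply: (@geom_approach x (2*rho) e M) => // k l hk hl; first by apply: xle => // q tau cq; exact: Fb cq hk hl.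
 have x0' := x0 k l hk hl; apply: xle => [|q tau cq]; first by move: x0' e0; plra.
 apply: le_trans (step q tau k l cq hk hl) _; have := xub q tau k l cq hk hl.
 by plra.
exists (M+N')%N => q tau cq k l hk hl.
apply: le_trans (xub q tau k l cq _ _) _; rewrite ?(leqDl hk) ?(leqDl hl) //.
by apply: hN'; [exact: leqDr hk|exact: leqDr hl].
Qed.

Lemma centered_cauchy_back j (e : R) : 0 < e -> exists N, forall q tau, centd q tau -> forall k l,
 (N <= k)%N -> (N <= l)%N -> cn (ww q (tm k0 k - j)%N - ww q (tm k0 l - j)%N) <= e.
Proof.
move=> e0; have e3 : 0 < e/3 by rewrite divr_gt0.
have [L L0 hL] := stage_map_lip j B0.
have [A [N hN]] := centered_stage j e3.
have eL : 0 < e/3/L by rewrite divr_gt0.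
have [N' hN'] := centered_cauchy eL.
exists (N+N').+1 => q tau cq [//|k] [//|l]; rewrite !ltnS => hk hl; have [_ _ tB _ _] := cq.
have [w1 g1 _ _] := hN q tau cq k (leqDl hk).
have [w2 g2 _ _] := hN q tau cq l (leqDl hl).
have g3 := hN' q tau cq k l (leqDr hk) (leqDr hl).
have := hL tau tau _ _ tB tB w1 w2; rewrite subrr cn0 add0r => g4.
have g5 : L*cn (wt q k0 k - wt q k0 l) <= e/3 by rewrite mulrC -ler_pdivlMr.
apply: le_trans (cn_via _ _ (E j (exitY tau (wt q k0 k))) (E j (exitY tau (wt q k0 l)))) _.
by move: g1 g2 (le_trans g4 g5); plra.
Qed.

Lemma centered_cauchy_fwd j (e : R) : 0 < e -> exists N, forall q tau, centd q tau -> forall k l,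
 (N <= k)%N -> (N <= l)%N -> cn (ww q (tm k0 k + j)%N - ww q (tm k0 l + j)%N) <= e.
Proof.
move=> e0; have e3 : 0 < e/3 by rewrite divr_gt0.
have [L L0 hL] := quad_lip j (1 : R).
have [A [N hN]] := centered_stage j e3.
have eL : 0 < e/3/L by rewrite divr_gt0.
have [N' hN'] := centered_cauchy eL.
exists (N+N')%N => q tau cq k l hk hl; have [_ _ tB _ _] := cq.
have [w1 _ _ /(_ j (leqnn _)) g1] := hN q tau cq k (leqDl hk).
have [w2 _ _ /(_ j (leqnn _)) g2] := hN q tau cq l (leqDl hl).
have g3 := hN' q tau cq k l (leqDr hk) (leqDr hl).
have b1 (w : C) : cn (w+1/2) <= 1/20 -> cn w <= 1 by move=> /entry_disc/andP[_]; plra.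
have g4 := hL _ _ (b1 _ w1) (b1 _ w2).
have g5 : L*cn (wt q k0 k - wt q k0 l) <= e/3 by rewrite mulrC -ler_pdivlMr.
apply: le_trans (cn_via _ _ (iter j quad (wt q k0 k)) (iter j quad (wt q k0 l))) _.
by move: g1 g2 (le_trans g4 g5); plra.
Qed.

Lemma centered_z_small (e : R) : 0 < e -> exists N, forall q tau, centd q tau ->
 forall t, (N <= t)%N -> cn (zz q t) <= e.
Proof.
move=> e0; have [N hN] := tracked_small (a^k0) B D e0.
exists N => q tau [z0 hz tB _ _] t Nt; apply: (hN (zz q) tau) => // i.
by apply: le_trans (hz i) _; rewrite ler_pdivrMr ?ltr0n // ler_peMr // ler1n.
Qed.

Lemma centered_luc (u : nat -> nat) : exists2 phi, strictly_increasing phi & exists h : T -> T,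
 forall e : R, 0 < e -> exists N, forall n, (N <= n)%N -> forall q tau, centd q tau ->
  box (h q) e (iter (u (phi n)) P q).
Proof.
pose U := {q : T | exists tau, centd q tau}.
pose W (x : U) t := ww (proj1_sig x) t.
have [||||| phi p1 p2] := @subseq_cauchy R U W (fun k => tm k0 k) _ _ _ _ _ u.
- by move=> k l; exact: tm_le.
- by move=> N; have [k hk] := tm_ge k0 N; exists k; exact: hk.
- move=> s e e0; have [N hN] := centered_cauchy_fwd s e0.
 by exists N => -[q [tau cq]] k l; exact: hN cq k l.
- move=> s e e0; have [N hN] := centered_cauchy_back s e0.
 by exists N => -[q [tau cq]] k l; exact: hN cq k l.
- move=> e e0; have [A [N hN]] := centered_stage 0 e0.
 by exists A, N => -[q [tau cq]] k t hk; have [_ _ h _] := hN q tau cq k hk; exact: h.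
exists phi => //; case: p2 => [[v hv]|[uinf uc]].
 (* For a constant subsequence of times the limit is that iterate itself, not a map into the line
    [z = 0]. *)
 by exists (iter v P) => e e0; exists 0%N => n _ q _ _; rewrite hv; exact/boxxx/ltW.
have lim q : exists l : C, (exists tau, centd q tau) -> forall e : R, 0 < e -> exists N, forall n, (N <= n)%N ->
  cn (ww q (u (phi n)) - l) <= e.
 have [hq|nq] := pselect (exists tau, centd q tau); last by exists 0.
 have [l hl] := complex_cauchy_lim (x := fun n => ww q (u (phi n))) (fun e e0 =>
  let: ex_intro N hN := uc e e0 in ex_intro _ N (fun n l => hN (exist _ q hq) n l)).
 by exists l.
pose h (q : T) : T := \row_(j < 2) if j == 0 then 0 else projT1 (cid (lim q)).
exists h => e e0; have [N1 h1] := centered_z_small e0; have [N2 h2] := uinf N1.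
have e2 : 0 < e/2 by rewrite divr_gt0.
have [N3 h3] := uc _ e2; exists (N2+N3)%N => n hn q tau cq j; have [->|->] := ord2 j; rewrite mxE /=.
 by rewrite subr0; apply: h1 cq _ _; apply: h2; apply: leq_trans hn; exact: leq_addr.
case: cid => l /= hl; have cqe : exists tau, centd q tau by exists tau.
have [N4 h4] := hl cqe _ e2.
have := h3 (exist _ q cqe) n (N3+N4)%N; rewrite leq_addr (leqDr hn) => /(_ isT isT).
rewrite /W /= => g1; have g2 := h4 (N3+N4)%N (leq_addl _ _).
have := cn_tri (ww q (u (phi n))) (ww q (u (phi (N3+N4)%N))) (- l).
by move: g1 g2; plra.
Qed.

Lemma center_fatou q0 d : 0 < d -> (forall q, box q0 d q -> exists tau, centd q tau) -> fatou_set P q0.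
Proof.
move=> d0 hq; exists (interior (box q0 d : set T)); last by apply/nbhs_box; exists d.
split; first exact: open_interior.
move=> u; have [phi p1 [h hh]] := centered_luc u; exists phi => //; left; exists h.
apply: box_luc => x /nbhs_box[e e0 he]; exists e => // ee ee0.
have [N hN] := hh _ ee0; exists N => // n Nn q /he /hq[tau ctau]; exact: hN ctau.
Qed.

(** A value of [w] beyond the escape bound could never decrease again, yet the orbit returns to the
    disc at every stage. *)
Lemma centered_bounded q tau : centd q tau -> exists B1 : R, forall n, box 0 B1 (iter n P q).
Proof.
move=> cq; have [N hN] := centered_z_small (@ltr01 R).
pose b := 1 + \sum_(i < N) cn (zz q i).
have s0 : 0 <= \sum_(i < N) cn (zz q i) by apply: sumr_ge0 => i _; exact: cn_ge0.
have zb i : cn (zz q i) <= b.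
 have [iN|Ni] := ltnP i N; last by apply: le_trans (hN _ _ cq _ Ni) _; rewrite /b lerDl.
 rewrite /b (bigD1 (Ordinal iN)) //= addrCA lerDl addr_ge0 //.
 by apply: sumr_ge0 => j _; exact: cn_ge0.
have c0 := skew_coef_ge0 R alpha.
have cb : 0 <= c*b^+2 by rewrite mulr_ge0 // sqr_ge0.
exists (b + (3+c*b^+2)) => n j; rewrite mxE subr0; have [->|->] := ord2 j.
 by apply: le_trans (zb n) _; rewrite lerDl addr_ge0.
have b0 : 0 <= b by apply: le_trans (zb 0%N); exact: cn_ge0.
apply: le_trans (_ : 3 + c*b^+2 <= _); last by rewrite lerDr.
rewrite leNgt; apply/negP => hb.
have [k1 hk1] := tm_ge k0 n.
have hk := hk1 (k0+k1)%N (leq_addl _ _).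
have := @skew_escape R alpha (tm k0 (k0+k1) - n) (iter n P q) b.
rewrite -iterD subnK // => h.
have [_ _ _ _ hw] := cq.
have /entry_disc/andP[_ h2] := centered_w20 cq (leq_addr k1 k0).
have : cn (ww q n) <= cn (wt q k0 (k0+k1)).
 by apply: h (ltW hb) => i _; rewrite -iterD; exact: zb.
by move: hb h2 cb; plra.
Qed.
End Centered.

(** * Propagation over a Fatou component *)

Definition locally_bounded (x : T) := exists d B : R, 0 < d /\ forall n q, box x d q -> box 0 B (iter n P q).

(** Otherwise some times and points tending to [y] give unbounded values. Along these times
    normality offers a subsequence that converges uniformly near [y], hence is bounded through one
    of its members, or one that diverges, which the bounded orbit of [y0] forbids. *)
Lemma normal_bounded (U : set T) y0 (B : R) : open U -> normal_on U (fun n => iter n P) -> U y0 ->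
 (forall n, box 0 B (iter n P y0)) -> forall y, U y -> locally_bounded y.
Proof.
move=> oU nU Uy0 hB y Uy; apply: contrapT => nb.
have bad n : exists t q, box y n.+1%:R^-1 q /\ ~ box 0 n%:R (iter t P q).
 apply: contrapT => h; apply: nb; exists n.+1%:R^-1, n%:R; split; first by rewrite invr_gt0.
 move=> t q hq; apply: contrapT => hn; apply: h; by exists t, q.
pose u n := projT1 (cid (bad n)).
have hu n : exists q, box y n.+1%:R^-1 q /\ ~ box 0 n%:R (iter (u n) P q) by rewrite /u; case: cid.
have [phi p1 [[h lh]|dv]] := nU u; last first.
 by apply: (not_divergent Uy0 _ dv) => N; exists N => //; exact: hB.
have [d d0 hd] := luc_box lh Uy.
have [N _ hN] := hd 1 ltr01.
have [B1 hB1] := skew_iter_bounded alpha (u (phi N)) y (ltW d0).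
have phi_ge n : (n <= phi n)%N by elim: n => // n IH; apply: leq_ltn_trans IH _; exact: p1.
pose n := (N + Num.bound (`|B1|+2) + Num.bound d^-1)%N.
have [q [hq nq]] := hu (phi n); apply: nq.
have dq : box y d q.
 apply: box_le hq; rewrite -[leRHS]invrK lef_pV2 ?posrE ?invr_gt0 //.
 have := archi_boundP (ltW (_ : 0 < d^-1)); rewrite invr_gt0 => /(_ d0)/ltW/le_trans; apply.
 by rewrite ler_nat; apply: leq_trans (leqnSn _); apply: leq_trans (phi_ge n); rewrite leq_addl.
have g1 := hN N (leqnn N) q dq.
have Nn : (N <= n)%N by rewrite /n -addnA leq_addr.
have g2 := hN n Nn q dq.
have g3 := box_trans (box_trans (hB1 q dq) (box_sym g1)) g2.
apply: box_le g3; have : `|B1| + 2 <= (phi n)%:R.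
 apply: le_trans (_ : (Num.bound (`|B1|+2))%:R <= _); first by apply/ltW/archi_boundP; rewrite addr_ge0.
 by rewrite ler_nat; apply: leq_trans (phi_ge n); rewrite /n addnAC leq_addl.
by have := ler_norm B1; plra.
Qed.

Lemma component_bounded (Om : set T) q0 (B : R) : fatou_component P Om -> Om q0 ->
 (forall n, box 0 B (iter n P q0)) -> forall x, Om x -> locally_bounded x.
Proof.
move=> fO Oq0 hB.
have start : locally_bounded q0.
 by have [U [oU nU] Uq0] := fatou_component_sub fO Oq0; exact: (normal_bounded oU nU Uq0 hB Uq0).
apply: (conn_ind (fatou_component_connected fO) _ Oq0 start) => x Ox.
have [U [oU nU] Ux] := fatou_component_sub fO Ox.
have [d d0 hd] := open_box oU Ux; exists d => // y y' _ _ /hd Uy /hd Uy' [e [b [e0 hb]]].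
apply: (normal_bounded oU nU Uy _ Uy') => n; apply: hb; exact/boxxx/ltW.
Qed.

(** A Cauchy condition, so that no limit function has to be carried through the propagation. *)
Definition converges_near k0 (x : T) := exists2 d : R, 0 < d & forall (e : R) j, 0 < e -> exists N, forall q, box x d q ->
 (forall t, (N <= t)%N -> cn (zz q t) <= e) /\
 forall k l, (N <= k)%N -> (N <= l)%N -> cn (ww q (tm k0 k - j)%N - ww q (tm k0 l - j)%N) <= e.

(** On the complex line through [y] and [q] differences of iterates are polynomials, bounded because
    orbits are, and small near [y]; [two_constants] carries the smallness to [q]. *)
Lemma converges_propagate k0 x : locally_bounded x -> exists2 d : R, 0 < d & forall y y',
 box x d y -> box x d y' -> converges_near k0 y -> converges_near k0 y'.
Proof.
move=> [d [B [d0 hB]]]; exists (d/8); first by rewrite divr_gt0.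
have d8 : 0 < d/8 by rewrite divr_gt0.
have B0 : 0 <= B by have := hB 0%N x (boxxx x (ltW d0)) 0; rewrite !mxE subr0; apply: le_trans; exact: cn_ge0.
move=> y y' hy hy' [dy dy0 hc]; exists (d/8) => // e j e0.
have dl0 : 0 < dy/d by rewrite divr_gt0.
have B20 : 0 <= 2*B by rewrite mulr_ge0.
have [dd dd0 tc] := two_constants B20 e0 dl0.
have [N hN] := hc dd j dd0; exists N => q hq.
(* Its entries are at most [3*d/8], so [y + s*v] stays in the box of size [d] about [x] for
   [|s| <= 2]. *)
pose v := q - y.
have qy : box q (d/8+d/8+d/8) y by apply: box_trans (box_trans (box_sym hq) (box_sym hy')) hy.
have l1 s : cn s <= 2 -> box x d (y + s *: v).
 move=> hs i; rewrite !mxE.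
 rewrite -[y 0 i + _ - _]addrAC; apply: cnD_le; rewrite cnM.
 have := hy i; have : cn s*cn (q 0 i - y 0 i) <= 2*(d*(3/8)).
  apply: ler_pM; rewrite ?cn_ge0 //; have := qy i; rewrite cnBC; plra.
 by move: d0; plra.
have l2 s : cn s <= dy/d -> box y dy (y + s *: v).
 move=> hs i; rewrite !mxE [y 0 i + _]addrC addrK cnM.
 rewrite -[leRHS](@divfK _ d) ?gt_eqF //; apply: ler_pM; rewrite ?cn_ge0 //.
 by have := qy i; rewrite cnBC; move: d0; plra.
have e1 : y + 1 *: v = q by rewrite scale1r /v addrC subrK.
have c1 : cn (1 : C) <= 1 by rewrite cn1.
split=> [t Nt|k l hk hl].
 have [f hf] := skew_iter_poly alpha t y v.
 rewrite -e1 hf; apply: tc c1 => s hs; rewrite -hf.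
  have := hB t _ (l1 s hs) 0; rewrite mxE subr0 => /le_trans; apply.
  by move: B0; plra.
 by have [h _] := hN _ (l2 s hs); exact: h.
have [f hf] := skew_iter_poly alpha (tm k0 k - j) y v.
have [g hg] := skew_iter_poly alpha (tm k0 l - j) y v.
rewrite -e1 hf hg -hornerN -hornerD; apply: tc c1 => s hs; rewrite hornerD hornerN -hf -hg.
 have := hB (tm k0 k - j)%N _ (l1 s hs) 1; have := hB (tm k0 l - j)%N _ (l1 s hs) 1; rewrite mxE !subr0.
 by have := cnB (ww (y + s *: v) (tm k0 k - j)%N) (ww (y + s *: v) (tm k0 l - j)%N); plra.
by have [_ h] := hN _ (l2 s hs); exact: h.
Qed.

Lemma component_converges k0 (Om : set T) q0 (B : R) : fatou_component P Om -> Om q0 ->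
 (forall n, box 0 B (iter n P q0)) -> converges_near k0 q0 -> forall x, Om x -> converges_near k0 x.
Proof.
move=> fO Oq0 hB cq; apply: (conn_ind (fatou_component_connected fO) _ Oq0 cq) => x Ox.
have [d d0 h] := converges_propagate k0 (component_bounded fO Oq0 hB Ox).
by exists d => // y y' _ _; exact: h.
Qed.

Definition limits k0 (x : T) (y : nat -> C) := forall j (e : R), 0 < e -> exists N, forall k, (N <= k)%N ->
 cn (ww x (tm k0 k - j)%N - y j) <= e.

Lemma limits_exist k0 x : converges_near k0 x -> exists y, limits k0 x y.
Proof.
move=> [d d0 h].
have lim j : exists l : C, forall e : R, 0 < e -> exists N, forall k, (N <= k)%N -> cn (ww x (tm k0 k - j)%N - l) <= e.
 apply: complex_cauchy_lim => e e0; have [N hN] := h e j e0; exists N => k l.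
 by have [_ hh] := hN x (boxxx x (ltW d0)); exact: hh.
by exists (fun j => projT1 (cid (lim j))) => j; case: cid.
Qed.

Lemma limits_unique k0 x y y' : limits k0 x y -> limits k0 x y' -> y =1 y'.
Proof.
move=> h h' j; apply/eqP; rewrite -subr_eq0 -cn_eq0 eq_le cn_ge0 andbT; apply/ler_addgt0Pl => e e0.
have e2 : 0 < e/2 by rewrite divr_gt0.
have [N hN] := h j _ e2; have [N' hN'] := h' j _ e2.
have g1 := hN (N+N')%N (leq_addr _ _); have g2 := hN' (N+N')%N (leq_addl _ _).
set v := ww x _ in g1 g2; have -> : y j - y' j = (v - y' j) - (v - y j) by ring.
by apply: cnB_le; move: g1 g2; plra.
Qed.

Lemma limits_quad k0 x y : converges_near k0 x -> limits k0 x y -> forall j, y j = quad (y j.+1).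
Proof.
move=> [d d0 hc] h j; apply/eqP; rewrite -subr_eq0 -cn_eq0 eq_le cn_ge0 andbT; apply/ler_addgt0Pl => e e0.
have e4 : 0 < e/4 by rewrite divr_gt0.
have [dl dl0 hq] := iter_quad_cont 1 (y j.+1) e4.
have [N1 h1] := h j _ e4; have [N2 h2] := h j.+1 _ dl0.
have c0 := skew_coef_ge0 R alpha.
pose mu := Num.min 1 (e/4/(c+1)).
have mu0 : 0 < mu by rewrite lt_min ltr01 divr_gt0 // ltr_wpDl.
have [N3 h3] := hc mu 0%N mu0; have [hz _] := h3 x (boxxx x (ltW d0)).
have [k1 hk1] := tm_ge k0 (j.+1+N3).
pose k := (N1+N2+k1)%N.
have t1 : (j.+1 + N3 <= tm k0 k)%N by apply: hk1; rewrite leq_addl.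
have g1 : cn (ww x (tm k0 k - j)%N - y j) <= e/4 by apply: h1; rewrite /k -addnA leq_addr.
have g2 : cn (ww x (tm k0 k - j.+1)%N - y j.+1) <= dl by apply: h2; rewrite /k addnAC leq_addl.
have g3 : cn (zz x (tm k0 k - j.+1)%N) <= mu by apply: hz; move: t1; plia.
have g4 := hq _ g2; rewrite /= in g4.
have es : (tm k0 k - j)%N = (tm k0 k - j.+1).+1 by move: t1; plia.
rewrite es iterS skew1 in g1.
set w := ww x (tm k0 k - j.+1)%N in g1 g2 g4; set z := zz x _ in g3 g1.
have g5 : cn (c%:C*z^+2) <= e/4.
 rewrite cnM cn_real ger0_norm // cnX expr2.
 move: g3; rewrite le_min => /andP[z1 z2].
 have zz2 : cn z*cn z <= cn z by rewrite ler_piMr // cn_ge0.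
 apply: le_trans (_ : c*(e/4/(c+1)) <= _); first by apply: ler_wpM2l => //; exact: le_trans zz2 z2.
 rewrite mulrA ler_pdivrMr ?ltr_wpDl // mulrC; apply: ler_wpM2l; first exact: ltW.
 by rewrite lerDl.
have -> : y j - quad (y j.+1) = (quad w - quad (y j.+1)) + c%:C*z^+2 - (w + w^+2 + c%:C*z^+2 - y j).
 by rewrite /quad; ring.
apply: cnB_le; have := cnD (quad w - quad (y j.+1)) (c%:C*z^+2).
by move: g1 g4 g5 e0; plra.
Qed.

Lemma limits_near k0 x y j (e : R) : converges_near k0 x -> limits k0 x y -> 0 < e -> exists2 d : R, 0 < d &
 forall q y', box x d q -> limits k0 q y' -> cn (y' j - y j) <= e.
Proof.
move=> [d d0 hc] h e0; have e5 : 0 < e/5 by rewrite divr_gt0.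
have [N1 h1] := hc (e/5) j e5; have [N2 h2] := h j _ e5.
pose k := (N1+N2)%N; pose t := (tm k0 k - j)%N.
have [d' /andP[d'0 _] hd'] := skew_iter_cont alpha t x e5.
exists (Num.min d d'); first by rewrite lt_min d0.
move=> q y' hq hy'; have hq1 : box x d q by apply: box_le hq; rewrite ge_min lexx.
have g1 : cn (ww q t - ww x t) <= e/5 by apply: hd'; apply: box_le hq; rewrite ge_min lexx orbT.
have g2 := h2 k (leq_addl _ _); have [_ cq] := h1 q hq1.
have [N3 h3] := hy' j _ e5; have g3 := h3 (N1+N3)%N (leq_addl _ _).
have g4 := cq k (N1+N3)%N (leq_addr _ _) (leq_addr _ _).
rewrite -/t in g2 g4.
set v := ww q (tm k0 (N1+N3) - j)%N in g3 g4.
have -> : y' j - y j = (ww q t - ww x t) + (ww x t - y j) - (ww q t - v) - (v - y' j) by ring.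
have k1 := cnB (ww q t - ww x t + (ww x t - y j) - (ww q t - v)) (v - y' j).
have k2 := cnB (ww q t - ww x t + (ww x t - y j)) (ww q t - v).
have k3 := cnD (ww q t - ww x t) (ww x t - y j).
by move: g1 g2 g3 g4 k1 k2 k3 e0; plra.
Qed.

(* If the first coordinate vanished from some time on, the second coordinate would follow [quad], whose orbits
  do not return to the disc; so the entrance and exit analysis applies to every point with [y 0] near [-1/2]. *)
Lemma limits_exit k0 x y : converges_near k0 x -> limits k0 x y -> cn (y 0%N + 1/2) < 1/20 ->
 (exists tau, tracked (a^k0) (zz x) tau) /\
 forall tau, tracked (a^k0) (zz x) tau -> forall j, y j = E j (exitY tau (y 0%N)).
Proof.
move=> cx h y20; have [d d0 hc] := cx.
have z0 t : zz x t != 0.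
 apply/eqP => zt; have g0 : 0 < (1/20 - cn (y 0%N + 1/2)) by rewrite subr_gt0.
 have [N hN] := h 0%N _ g0; have [k1 hk1] := tm_ge k0 t.
 have [k2 hk2] := gap_ge 1; pose k := (k0+N+k1+k2)%N.
 have w20 l : (k <= l)%N -> cn (wt x k0 l + 1/2) <= 1/20.
  move=> hl; have Nl : (N <= l)%N by apply: leq_trans hl; rewrite /k; plia.
  have := hN l Nl; rewrite subn0 => g.
  have := cn_tri (wt x k0 l) (y 0%N) (1/2).
  by move: g; plra.
 have tk : (t <= tm k0 k)%N by apply: hk1; rewrite /k; plia.
 have qq i : ww x (tm k0 k + i)%N = iter i quad (wt x k0 k).
  elim: i => [|i IH]; first by rewrite addn0.
  rewrite addnS iterS skew1 (zz_zero (leq_trans tk (leq_addr i _)) zt) IH.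
  by rewrite expr0n mulr0 addr0.
 have := w20 k.+1 (leqnSn k); rewrite tmS //; last by rewrite /k; plia.
 rewrite qq leNgt; apply/negP/negPn; apply: no_return; first exact: w20.
 by apply: hk2; rewrite /k; plia.
split.
 apply: track_exists => //; first exact: zz_step.
 by move=> e e0; have [N hN] := hc e 0%N e0; exists N => t; have [hz _] := hN x (boxxx x (ltW d0)); exact: hz.
move=> tau tr; have h0 (e : R) : 0 < e -> exists N, forall k, (N <= k)%N -> cn (wt x k0 k - y 0%N) <= e.
 by move=> /(h 0%N)[N hN]; exists N => k /hN; rewrite subn0.
have := limit_exit tr h0 y20 => lim.
by move=> j; apply: (limits_unique h (y' := fun j => E j (exitY tau (y 0%N)))).
Qed.

(** By [limits_exit] the limits at nearby points are again exit sequences, with phase and first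
    point close to those at [x]; [chain_open] does the rest. *)
Lemma limits_chain_near k0 m x y : converges_near k0 x -> limits k0 x y -> chain m y -> cn (y 0%N + 1/2) < 1/20 ->
 exists2 d : R, 0 < d & forall q y', box x d q -> converges_near k0 q -> limits k0 q y' ->
  chain m y' /\ cn (y' 0%N + 1/2) < 1/20.
Proof.
move=> cx hy ch y20; have [[tau tr] ht] := limits_exit cx hy y20.
have a0 : 0 < a%:R :> R by rewrite ltr0n ltnW // abs_gt1.
have chE : chain m (fun j => E j (exitY tau (y 0%N))).
 by rewrite (_ : (fun j => _) = y) //; apply/funext => j; rewrite -ht.
have [dc dc0 hc] := chain_open chE.
pose e := Num.min ((1/20 - cn (y 0%N + 1/2))/2) (dc/(4*a%:R)).
have e0 : 0 < e by rewrite lt_min !divr_gt0 ?subr_gt0 ?mulr_gt0.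
have [d1 d10 h1] := tracked_near tr e0; have [d2 d20 h2] := limits_near 0 cx hy e0.
exists (Num.min d1 d2); first by rewrite lt_min d10.
move=> q y' hq cq hy'.
have [|tau' tr' tt] := h1 q; first by apply: box_le hq; rewrite ge_min lexx.
have := h2 q y' _ hy'; rewrite le_min => /(_ _)/andP[|w1 w2].
 by apply: box_le hq; rewrite ge_min lexx orbT.
have y20' : cn (y' 0%N + 1/2) < 1/20.
 have := cn_tri (y' 0%N) (y 0%N) (1/2).
 by move: w1 y20; plra.
split=> //; have [_ ht'] := limits_exit cq hy' y20'.
have -> : y' = (fun j => E j (exitY tau' (y' 0%N))) by apply/funext => j; exact: ht'.
apply: hc; last by rewrite -(ht' tau' tr' 0%N) ltW.
apply: le_trans (exitY_lip _ _ (ltW y20') (ltW y20)) _.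
have t1 : cn (tau'-tau) <= dc/(4*a%:R) by apply: le_trans tt _; rewrite /e ge_min lexx orbT.
have : 2*a%:R*(cn (tau'-tau) + cn (y' 0%N - y 0%N)) <= 2*a%:R*(dc/(4*a%:R) + dc/(4*a%:R)).
 by apply: ler_wpM2l; [rewrite mulr_ge0 // ltW|exact: lerD].
by move/le_trans; apply; rewrite le_eqVlt; apply/orP; left; apply/eqP; field; rewrite gt_eqF.
Qed.

(** The closed condition with [1/40] sits strictly inside the disc of radius [1/20] where the stage
    analysis is valid. *)
Definition chained k0 m x := exists y, [/\ limits k0 x y, chain m y & cn (y 0%N + 1/2) <= 1/40].

(** Strict inequalities survive the limit: [Im y_1 = 0] would force [Re y_0 >= -1/4], the later
    imaginary parts are then nonzero as well, and [Re y_j = -1/2] would make the preceding point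
    real. *)
Lemma chained_closed k0 m x : converges_near k0 x ->
 (forall d : R, 0 < d -> exists q, box x d q /\ chained k0 m q) -> chained k0 m x.
Proof.
move=> cx hx; have [y hy] := limits_exist cx; have yq := limits_quad cx hy.
have app j (e : R) : 0 < e -> exists y', [/\ chain m y', cn (y' 0%N + 1/2) <= 1/40 & cn (y' j - y j) <= e].
 move=> e0; have [d d0 hd] := limits_near j cx hy e0.
 by have [q [bq [y' [h1 h2 h3]]]] := hx d d0; exists y'; split=> //; exact: hd bq h1.
have y40 : cn (y 0%N + 1/2) <= 1/40.
 apply/ler_addgt0Pl => e /(app 0%N)[y' [_ h1 h2]].
 have := cnB (y' 0%N + 1/2) (y' 0%N - y 0%N); rewrite opprB addrC addrA subrK.
 by move: h1 h2; plra.
have im1 : Im (y 1%N) != 0.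
 apply/eqP => h0; have := congr1 (@complex.Re R) (yq 0%N).
 have := le_trans (cn_ge_Re _) y40; rewrite ler_norml Re_half /quad => /andP[_].
 rewrite cReD expr2 cReM h0 mul0r subr0.
 move: (Re (y 0%N)) (Re (y 1%N)) => u v h e; have := sqr_ge0 (v+1/2); move: h; rewrite e expr2; plra.
have imj j : (1 <= j)%N -> Im (y j) != 0.
 elim: j => // [[//|j]] IH _; apply: contra (IH isT) => /eqP h0.
 by rewrite yq /quad cImD expr2 cImM h0 !(mul0r, mulr0, addr0).
have re2 j : (2 <= j)%N -> Re (y j) != - (1/2).
 case: j => [//|j] j1; apply: contra (imj j j1) => /eqP h0.
 by rewrite yq /quad cImD expr2 cImM h0; apply/eqP; move: (Im _) => v; field.
exists y; split=> //; split=> //.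
- by apply: le_trans y40 _; plra.
- rewrite lt_def im1 /=; apply/ler_addgt0Pl => e /(app 1%N)[y' [[_ _ h1 _ _] _ h2]].
 have := le_trans (cn_ge_Im _) h2; rewrite cImB ler_norml => /andP[_].
 by move: h1; plra.
- move=> j /andP[j2 jm]; rewrite lt_def eq_sym re2 //=; apply/ler_addgt0Pl => e /(app j)[y' [[_ _ _ h1 _] _ h2]].
 have := h1 j; rewrite j2 jm => /(_ isT); have := le_trans (cn_ge_Re _) h2; rewrite cReB ler_norml => /andP[h3 _].
 by move: h3; plra.
move=> j jm; rewrite lt_def re2 /=; last by move: jm; plia.
apply/ler_addgt0Pl => e /(app j)[y' [[_ _ _ _ h1] _ h2]].
have := h1 j jm; have := le_trans (cn_ge_Re _) h2; rewrite cReB ler_norml => /andP[_ h3].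
by move: h3; plra.
Qed.

(** At distance about [1/40] from the critical point the sum [(w+1/2) + (w'+1/2)] has modulus at
    least [4/100]; the factor 3 of [entry_lip] and [a >= 2] turn this into [24/100]. *)
Lemma entry_expand (g w w' : C) tau : cn (g+1/2) = 1/40 -> cn (w-g) <= 1/200 -> cn (w'-g) <= 1/200 ->
 1/5*cn (w-w') <= cn (exitY tau w - exitY tau w').
Proof.
move=> hg h1 h2.
have d20 v : cn (v-g) <= 1/200 -> cn (v+1/2) <= 1/20.
 by move=> h; have := cn_tri v g (1/2); rewrite hg; move: h; plra.
have -> : exitY tau w - exitY tau w' = - (a%:R*(entry w - entry w')) by ring.
rewrite cnN cnM cn_nat; have /andP[h _] := entry_lip (d20 _ h1) (d20 _ h2).
rewrite subr_sqr cnM (_ : w + 1/2 - (w'+1/2) = w - w') in h; last by ring.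
have h4 : 4/100 <= cn (w + 1/2 + (w'+1/2)).
 have := cn_sub_ge (2*(g+1/2)) (- ((w-g) + (w'-g))); rewrite cnM cn_nat hg cnN opprK.
 have -> : 2*(g+1/2) + (w - g + (w'-g)) = w + 1/2 + (w'+1/2) by field.
 by have := cnD (w-g) (w'-g); move: h1 h2; plra.
have a2 : 2 <= a%:R :> R by rewrite ler_nat; exact: abs_gt1.
have := cn_ge0 (w-w'); have := cn_ge0 (entry w - entry w').
move: h h4; move: (cn (w-w')) (cn (entry w - _)) (cn (w+_+_)) => u v t; clear -a2; nra.
Qed.

Lemma fiber_stage k0 x tau (e : R) : tracked (a^k0) (zz x) tau -> 0 < e -> exists k1, forall k, (k1 <= k)%N ->
 forall p : T, p 0 0 = zz x (tm k0 k) -> cn (p 0 1 + 1/2) <= 1/20 ->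
 cn (ww p (tm k0 k.+1 - tm k0 k)%N - E 0 (exitY tau (p 0 1))) <= e.
Proof.
move=> [z0 [D hD]] e0; have [eta eta0 [A [k1 h1]]] := exit_stage_law S 0 (cn_ge0 tau) e0.
have [k2 hk2] := tm_ge k0 (Num.bound (`|D| / eta)).
exists (k0+k1+k2)%N => k hk p p0 p1.
have k0k : (k0 <= k)%N by move: hk; plia.
have k1k : (k1 <= k)%N by move: hk; plia.
have k2k : (k2 <= k)%N by move: hk; plia.
have sh i : zz p i = zz x (tm k0 k + i)%N by rewrite addnC iterD; apply: skew_iter_fiber.
have zp i : zz p i != 0 by rewrite sh.
have [|g _ _] := h1 k k1k p tau zp _ (lexx _) p1.
 move=> i; rewrite sh; have -> : (a^k+i)%N = (a^k0 + (tm k0 k + i))%N.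
  by have := pow_le k0k; plia.
 apply: le_trans (hD _) _; apply: le_trans (_ : `|D| / (tm k0 k).+1%:R <= _).
  apply: le_trans (ler_wpM2r _ (ler_norm D)) _ => //.
  by apply: ler_wpM2l => //; rewrite lef_pV2 ?posrE ?ltr0n // ler_nat ltnS leq_addr.
 rewrite ler_pdivrMr ?ltr0n // [eta*_]mulrC -ler_pdivrMr //.
 have := archi_boundP (divr_ge0 (normr_ge0 D) (ltW eta0)) => /ltW/le_trans; apply.
 by rewrite ler_nat; apply: leq_trans (hk2 k k2k) _.
by rewrite tmS // addKn; rewrite subn0 in g.
Qed.

(** Supplied by [chain_sep] for large [m]. Against the [1/5] of [entry_expand], the [1/40] leaves an
    expansion by 8. *)
Definition separating m := forall Y Y', chain m (fun j => E j Y) -> chain m (fun j => E j Y') ->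
 cn (Y-Y') <= 1/40*cn (E 0 Y - E 0 Y').

(** * Exclusion of the boundary circle *)

Section Strict.
Variables (k0 m : nat) (x : T) (y : nat -> C) (d0 : R).
Hypothesis separated : separating m.
Hypothesis d00 : 0 < d0.
Hypothesis cnv : forall q, box x d0 q -> converges_near k0 q.
Hypothesis hy : limits k0 x y.
Hypothesis ch : chain m y.
Hypothesis y40 : cn (y 0%N + 1/2) = 1/40.
Local Notation g := (y 0%N).
Local Notation vert s := (x + s *: delta_mx 0 1 : T).

Lemma boundary_cnv : converges_near k0 x.
Proof. exact/cnv/boxxx/ltW. Qed.
Lemma boundary_disc : cn (g+1/2) < 1/20.
Proof. by rewrite y40; lra. Qed.

Lemma vert_box s (d : R) : cn s <= d -> box x d (vert s).
Proof.
move=> hs j; rewrite !mxE [x 0 j + _]addrC addrK cnM; apply: le_trans (_ : cn s*1 <= _); last by rewrite mulr1.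
by apply: ler_wpM2l; [exact: cn_ge0|have [->|->] := ord2 j; rewrite /= ?cn0 ?cn1].
Qed.

(* On the vertical line through [x] the parameter [tau] is constant, so the separation of chains and the expansion
  of [entry] away from its critical point pull in opposite directions. *)
Lemma vert_constant : exists2 d : R, 0 < d & forall s, cn s <= d ->
 converges_near k0 (vert s) /\ forall y', limits k0 (vert s) y' -> y' 0%N = g.
Proof.
have [[tau tr] ht] := limits_exit boundary_cnv hy boundary_disc.
have [d1 d10 h1] := limits_chain_near boundary_cnv hy ch boundary_disc.
have e0 : 0 < 1/200 :> R by rewrite divr_gt0 ?ltr0n.
have [d2 d20 h2] := limits_near 0 boundary_cnv hy e0.
exists (Num.min d0 (Num.min d1 d2)); first by rewrite !lt_min d00 d10.
move=> s; rewrite !le_min => /and3P[/vert_box s0 /vert_box s1 /vert_box s2].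
have cq := cnv s0; split=> // y' hy'.
have [ch' boundary_disc'] := h1 _ y' s1 cq hy'; have g1 := h2 _ y' s2 hy'.
have [_ ht'] := limits_exit cq hy' boundary_disc'.
have f0 i : zz (vert s) i = zz x i by apply: skew_iter_fiber; rewrite !mxE mulr0 addr0.
have tr' : tracked (a^k0) (zz (vert s)) tau.
 by case: tr => [z0 [D hD]]; split=> [i|]; [rewrite f0|exists D => i; rewrite f0].
have eE : (fun j => E j (exitY tau g)) = y by apply/funext => j; rewrite -ht.
have eE' : (fun j => E j (exitY tau (y' 0%N))) = y' by apply/funext => j; rewrite -ht'.
have gg : cn (g-g) <= 1/200 by rewrite subrr cn0 ltW.
have := entry_expand tau y40 g1 gg.
have := @separated (exitY tau (y' 0%N)) (exitY tau g); rewrite eE eE' => /(_ ch' ch).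
rewrite -(ht' tau tr') -(ht tau tr) => u v; apply/eqP; rewrite -subr_eq0 -cn_eq0 eq_le cn_ge0 andbT.
by move: u v; lra.
Qed.

Lemma stage_map_expand tau : tracked (a^k0) (zz x) tau -> exists2 rho : R, 0 < rho <= 1/200 &
 forall w w', cn (w-g) <= rho -> cn (w'-g) <= rho ->
  8*cn (w-w') <= cn (E 0 (exitY tau w) - E 0 (exitY tau w')).
Proof.
move=> tr; have [_ ht] := limits_exit boundary_cnv hy boundary_disc.
have chE : chain m (fun j => E j (exitY tau g)).
 by rewrite (_ : (fun j => _) = y) //; apply/funext => j; rewrite -ht.
have [dc dc0 hc] := chain_open chE.
have [L L0 hL] := stage_map_lip 0 (cn_ge0 tau).
have a0 : 0 < a%:R :> R by rewrite ltr0n ltnW // abs_gt1.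
pose rho := Num.min (1/200) (Num.min (dc/(2*a%:R)) (1/40/L)).
exists rho; first by rewrite !lt_min !divr_gt0 ?mulr_gt0 ?a0 ?ltr0n // ge_min lexx.
have near w : cn (w-g) <= rho -> cn (w-g) <= 1/200 /\ chain m (fun j => E j (exitY tau w)).
 rewrite !le_min => /and3P[w1 w2 w3]; split=> //.
 have w20 : cn (w+1/2) <= 1/20.
  have := cn_tri w g (1/2); rewrite y40; move: w1; lra.
 apply: hc.
  apply: le_trans (exitY_lip _ _ w20 (ltW boundary_disc)) _; rewrite subrr cn0 add0r.
  by move: w2; rewrite ler_pdivlMr ?mulr_gt0 // mulrC.
 have := hL tau tau w g (lexx _) (lexx _) w20 (ltW boundary_disc); rewrite subrr cn0 add0r -(ht tau tr 0%N) => g1.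
 have g2 : L*cn (w-g) <= 1/40 by move: w3; rewrite ler_pdivlMr // mulrC.
 have := cn_tri (E 0 (exitY tau w)) g (1/2); rewrite y40.
 by move: g1 g2; lra.
move=> w w' /near[w1 c1] /near[w2 c2].
have := separated c1 c2; have := entry_expand tau y40 w1 w2; plra.
Qed.

Local Notation fib k w := ((\row_(j < 2) (if j == 0 then zz x (tm k0 k) else w)) : T).
Local Notation G k w := (ww (fib k w) (tm k0 k.+1 - tm k0 k)%N).

(* The fibre maps are polynomials close to the expanding map [w |-> E 0 (exitY tau w)]; by Cauchy's estimate
  the differences of two of them have small Lipschitz constant. *)
Lemma fiber_map_expand tau : tracked (a^k0) (zz x) tau -> exists2 rho : R, 0 < rho <= 1/200 & exists k1,
 forall k, (k1 <= k)%N -> forall w w', cn (w-g) <= rho -> cn (w'-g) <= rho ->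
  2*cn (w-w') <= cn (G k w - G k w').
Proof.
move=> tr; have [rho /andP[rho0 rho1] hE] := stage_map_expand tr.
have e0 : 0 < rho/8 by rewrite divr_gt0.
have st (e : R) : 0 < e -> exists k1, forall k, (k1 <= k)%N -> forall w, cn (w-g) <= rho ->
  cn (G k w - E 0 (exitY tau w)) <= e.
 move=> /(fiber_stage tr)[k1 hk1]; exists k1 => k hk w hw.
 have := hk1 k hk (fib k w); rewrite !mxE /= => /(_ erefl); apply.
 have := cn_tri w g (1/2); rewrite y40; move: hw rho1; plra.
have [k1 h1] := st _ e0; exists (rho/2).
 by rewrite divr_gt0 //=; move: rho1 rho0; lra.
exists k1 => k hk w w' hw hw'.
have rw : cn (w-g) <= rho by move: hw rho0; lra.
have rw' : cn (w'-g) <= rho by move: hw' rho0; lra.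
have poly l : exists f : {poly C}, forall s, f.[s] = G l (g+s).
 have [f hf] := skew_iter_poly alpha (tm k0 l.+1 - tm k0 l) (fib l g) (delta_mx 0 1 : T).
 exists (f 1) => s; rewrite -hf; congr (fun_of_matrix (iter _ _ _) 0 1); apply/rowP => j; rewrite !mxE.
 by have [->|->] := ord2 j; rewrite /= ?mulr0 ?mulr1 ?addr0.
have [f hf] := poly k.
(* Both fibre maps are within [rho/8] of the limit map, so their difference is at most [rho/4] on
   the disc and, by [poly_lip], 1-Lipschitz on the half disc. *)
have lip l : (k1 <= l)%N -> cn ((G k w - G l w) - (G k w' - G l w')) <= cn (w-w').
 move=> hl; have [f' hf'] := poly l.
 have ev v : G k v - G l v = (f-f').[v - g] by rewrite hornerD hornerN hf hf' [g + _]addrC subrK.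
 have := @poly_lip R (f-f') rho (rho/4) rho0 _ (w-g) (w'-g) hw hw'.
 rewrite -!ev (_ : w - g - (w'-g) = w - w'); last by ring.
 rewrite (_ : 4*(rho/4)/rho = 1) ?mul1r; last by field; rewrite gt_eqF.
 apply=> s hs; rewrite hornerD hornerN hf hf'.
 have sg : cn (g+s-g) <= rho by rewrite [g + s]addrC addrK.
 have := cnB (G k (g+s) - E 0 (exitY tau (g+s))) (G l (g+s) - E 0 (exitY tau (g+s))).
 rewrite opprB addrA subrK; have := h1 k hk _ sg; have := h1 l hl _ sg.
 by plra.
rewrite -[leRHS]addr0; apply/ler_addgt0Pl => e e00.
have e2 : 0 < e/2 by rewrite divr_gt0.
have [k2 h2] := st _ e2; pose l := (k1+k2)%N.
have u1 := lip l (leq_addr _ _); have u2 := h2 l (leq_addl _ _) w rw; have u3 := h2 l (leq_addl _ _) w' rw'.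
have u4 := hE w w' rw rw'; have u5 := cn_ge0 (w-w').
rewrite -/l in u1 u2 u3.
move: u1 u2 u3 u4; set A := G l w; set B := G l w'; set A' := E 0 _; set B' := E 0 _.
move=> u1 u2 u3 u4.
have v1 := cn_via A' B' A B; rewrite (cnBC A' A) (cnBC B' B) in v1.
have := cnB (G k w - G k w') (G k w - A - (G k w' - B)).
rewrite [X in cn X <= _](_ : _ = A - B); last by ring.
by move: u1 u2 u3 u4 u5 v1; plra.
Qed.

(** Along the vertical line all limits equal [g], so from some stage on the orbits stay within [rho]
    of [g], although the fibre maps double their distances at every stage. They must coincide at
    stage [M], and an iterate would be constant on a vertical disc. *)
Lemma boundary_absurd : False.
Proof.
have [[tau tr] _] := limits_exit boundary_cnv hy boundary_disc.
have [rho /andP[rho0 rho1] [k1 h1]] := fiber_map_expand tr.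
have [d1 d10 hd1] := vert_constant.
have [d2 d20 hc] := boundary_cnv; have r2 : 0 < rho/2 by rewrite divr_gt0.
have [N hN] := hc (rho/2) 0%N r2.
pose d := Num.min d1 d2; have d_0 : 0 < d by rewrite lt_min d10.
have near s k : cn s <= d -> (N <= k)%N -> cn (wt (vert s) k0 k - g) <= rho.
 rewrite le_min => /andP[s1 s2] hk; have [cq hq] := hd1 s s1.
 have [y' hy'] := limits_exist cq; have eg := hq y' hy'.
 have [_ cc] := hN _ (vert_box s2); have [N' hN'] := hy' 0%N _ r2.
 have := cc k (N+N')%N hk (leq_addr _ _); have := hN' (N+N')%N (leq_addl _ _).
 rewrite eg !subn0.
 have := cn_tri (wt (vert s) k0 k) (wt (vert s) k0 (N+N')) (- g).
 by plra.
have x0 : vert 0 = x by rewrite scale0r addr0.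
pose M := (k0+k1+N)%N.
have Gs s k : (k0 <= k)%N -> G k (wt (vert s) k0 k) = wt (vert s) k0 k.+1.
 move=> hk; have -> : fib k (wt (vert s) k0 k) = iter (tm k0 k) P (vert s).
  apply/rowP => j; rewrite mxE; have [->|->] := ord2 j; rewrite //=.
  by apply/esym/skew_iter_fiber; rewrite !mxE mulr0 addr0.
 by rewrite -iterD subnK // tm_le.
have c00 : cn (0 : C) <= d by rewrite cn0 ltW.
have grow s n : cn s <= d -> 2^+n*cn (wt (vert s) k0 M - wt x k0 M) <=
  cn (wt (vert s) k0 (M+n) - wt x k0 (M+n)).
 move=> hs; elim: n => [|n IH]; first by rewrite expr0 mul1r addn0.
 have hk0 : (k0 <= M + n)%N by rewrite /M; plia.
 have hk1 : (k1 <= M + n)%N by rewrite /M; plia.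
 have hkN : (N <= M + n)%N by rewrite /M; plia.
 have n1 := near s _ hs hkN; have n2 := near 0 _ c00 hkN.
 have := h1 (M+n)%N hk1 _ _ n1 n2; rewrite !Gs // x0 addnS.
 by move: IH; rewrite exprS; plra.
apply: (@fiber_nonconst R alpha (tm k0 M) x d d_0) => s hs; apply/eqP; rewrite -subr_eq0 -cn_eq0.
have [//|n0] := eqVneq (cn (wt (vert s) k0 M - wt x k0 M)) 0.
set D := cn _ in n0; have D0 : 0 < D by rewrite lt_def n0 cn_ge0.
have b0 : 0 <= 2*rho/D by rewrite divr_ge0 ?mulr_ge0 // ltW.
have [n v4] : exists n, 2*rho/D < n%:R by exists (Num.bound (2*rho/D)); exact: archi_boundP.
have hn : (N <= M + n)%N by rewrite /M; plia.
have := grow s n hs; rewrite -/D => u.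
have v1 := near s _ hs hn; have := near 0 _ c00 hn; rewrite x0 => v2.
have v3 := cnB (wt (vert s) k0 (M+n) - g) (wt x k0 (M+n) - g).
rewrite opprB addrA subrK in v3.
rewrite ltr_pdivrMr // in v4.
have v5 : n%:R*D <= 2^+n*D.
 by apply: ler_wpM2r; [exact: ltW|rewrite -natrX ler_nat ltnW // ltn_expl].
have := lt_le_trans v4 (le_trans v5 (le_trans u (le_trans v3 (lerD v1 v2)))).
by rewrite -[2]/(1+1) mulrDl mul1r ltxx.
Qed.
End Strict.

(** Closedness is [chained_closed]. Openness could fail only where [|y_0 + 1/2| = 1/40], which
    [boundary_absurd] excludes; elsewhere [limits_chain_near] and [limits_near] apply. *)
Lemma component_chained k0 m (Om : set T) q0 : 
 separating m ->
 open Om -> connected Om -> (forall x, Om x -> converges_near k0 x) -> Om q0 -> chained k0 m q0 ->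
 forall x, Om x -> chained k0 m x.
Proof.
move=> sep oO cO cnv Oq0 c0; apply: (conn_ind cO _ Oq0 c0) => x Ox.
have [d d0 hd] := open_box oO Ox.
have [cx|ncx] := pselect (chained k0 m x); last first.
 apply: contrapT => h; apply: ncx; apply: chained_closed; first exact: cnv.
 move=> e e0; apply: contrapT => h'; apply: h; exists e => // y y' _ _ by_ _ cy.
 by exfalso; apply: h'; exists y.
have [y [h1 h2 h3]] := cx.
have strict : cn (y 0%N + 1/2) < 1/20 by apply: le_lt_trans h3 _; lra.
have lt40 : cn (y 0%N + 1/2) < 1/40.
 rewrite lt_def h3 andbT; apply/eqP => e40.
 exact: (boundary_absurd sep d0 (fun q hq => cnv q (hd q hq)) h1 h2 (esym e40)).
have [d1 d10 hd1] := limits_chain_near (cnv x Ox) h1 h2 strict.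
have e0 : 0 < 1/40 - cn (y 0%N + 1/2) by rewrite subr_gt0.
have [d2 d20 hd2] := limits_near 0 (cnv x Ox) h1 e0.
exists (Num.min d1 d2); first by rewrite lt_min d10.
move=> _ q _ Oq _ hq _; have [y' hy'] := limits_exist (cnv q Oq).
have hq1 : box x d1 q by apply: box_le hq; rewrite ge_min lexx.
have hq2 : box x d2 q by apply: box_le hq; rewrite ge_min lexx orbT.
have [c1 _] := hd1 q y' hq1 (cnv q Oq) hy'.
have := hd2 q y' hq2 hy' => u.
exists y'; split=> //.
have := cn_tri (y' 0%N) (y 0%N) (1/2); move: u.
by plra.
Qed.

(** * Wandering, invariance of [m] and rank *)

Lemma chain_inj m m' (y : nat -> C) : chain m y -> chain m' y -> m = m'.
Proof.
move=> [_ _ _ h1 h2] [_ _ _ h1' h2'].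
have aux n n' : (n < n')%N -> (forall j, (n.+1 < j)%N -> - (1/2) < Re (y j)) ->
  (forall j, (2 <= j <= n'.+1)%N -> Re (y j) < - (1/2)) -> False.
 by move=> nn g1 g2; have := lt_trans (g1 n.+2 (leqnn _)) (g2 n.+2 nn); rewrite ltxx.
by case: (ltngtP m m') => // h; exfalso; [exact: aux h h2 h1'|exact: aux h h2' h1].
Qed.

(* Reading both orbits at the times [a^k] minus a constant, the chains of the two points agree up to a shift of
  the index; a nonzero shift would bring the [quad]-orbit of a point of the disc back into the disc. *)
Lemma chained_meet k1 k2 m1 m2 n1 n2 x1 x2 : chained k1 m1 x1 -> chained k2 m2 x2 ->
 converges_near k1 x1 -> converges_near k2 x2 -> iter n1 P x1 = iter n2 P x2 ->
 m1 = m2 /\ (a^k1 + n1 = a^k2 + n2)%N.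
Proof.
wlog hle : k1 k2 m1 m2 n1 n2 x1 x2 / (a^k1 + n1 <= a^k2 + n2)%N.
 move=> hw c1 c2 v1 v2 e; have [h|/ltnW h] := leqP (a^k1+n1) (a^k2+n2); first exact: hw c1 c2 v1 v2 e.
 by have [-> ->] := hw _ _ _ _ _ _ _ _ h c2 c1 v2 v1 (esym e).
move=> [y1 [l1 c1 d1]] [y2 [l2 c2 d2]] v1 v2 e.
have [d hd] : exists d, (a^k2 + n2 = a^k1 + n1 + d)%N by exists (a^k2 + n2 - (a^k1+n1))%N; rewrite subnKC.
have shift j : y1 (j+d)%N = y2 j.
 apply/eqP; rewrite -subr_eq0 -cn_eq0 eq_le cn_ge0 andbT; apply/ler_addgt0Pl => ep e0; rewrite addr0.
 have e2 : 0 < ep/2 by rewrite divr_gt0.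
 have [N1 h1] := l1 (j+d)%N _ e2; have [N2 h2] := l2 j _ e2.
 pose k := (N1 + N2 + (a^k1+a^k2+n1+n2+j+d))%N.
 have g1 := h1 k _; have g2 := h2 k _.
 have {}g1 := g1 (leq_trans (leq_addr N2 _) (leq_addr _ _)).
 have {}g2 := g2 (leq_trans (leq_addl N1 _) (leq_addr _ _)).
 have kk := pow_ge k.
 have kb : (a^k1 + a^k2 + n1 + n2 + j + d <= k)%N by rewrite /k leq_addl.
 have [i ei] : exists i, (a^k = i + j + (a^k2+n2))%N.
  exists (a^k - (j + (a^k2+n2)))%N; rewrite -addnA subnK //.
  by move: kk kb; move: (a^k)%N (a^k1)%N (a^k2)%N (k) (d); plia.
 have t1 : (tm k1 k - (j+d))%N = (i+n1)%N.
  rewrite ei hd -subnDA [(a^k1+n1)%N]addnC; move: (a^k1)%N (d); plia.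
 have t2 : (tm k2 k - j)%N = (i+n2)%N.
  rewrite ei -subnDA; move: (a^k2)%N; plia.
 rewrite t1 iterD e -iterD in g1; rewrite t2 in g2; set w := ww x2 _ in g1 g2.
 have -> : y1 (j+d)%N - y2 j = (w - y2 j) - (w - y1 (j+d)%N) by ring.
 by apply: cnB_le; move: g1 g2; plra.
have q1 := limits_quad v1 l1.
have d0 : d = 0%N.
 apply/eqP; rewrite -leqn0 leqNgt; apply/negP => dpos.
 have it n : iter n quad (y1 n) = y1 0%N by elim: n => // n IH; rewrite iterSr -q1.
 have := it d; rewrite -[d in y1 d]add0n shift => e0.
 have w20 (w : C) : cn (w+1/2) <= 1/40 -> cn (w+1/2) <= 1/20 by plra.
 by have := no_return (w20 _ d2) dpos; rewrite e0 ltNge w20.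
split; last by rewrite hd d0 addn0.
apply: chain_inj c1 _; rewrite (_ : y1 = y2) //; apply/funext => j.
by rewrite -shift d0 addn0.
Qed.

Lemma chained_wandering k0 m (Om : set T) : fatou_component P Om -> (forall x, Om x -> converges_near k0 x) ->
 (forall x, Om x -> chained k0 m x) -> wandering_domain P Om.
Proof.
move=> fO cv ch; split=> // k n n1; apply/seteqP; split=> // p [[x1 O1 e1] [x2 O2 e2]].
have [] := chained_meet (ch _ O1) (ch _ O2) (cv _ O1) (cv _ O2) (etrans e1 (esym e2)).
by move: n1; move: (a ^ _)%N => q; plia.
Qed.

(** The first coordinate tends to 0 near every point, so every limit function takes its values on
    [z = 0]. *)
Lemma chained_rank_le k0 (Om : set T) : (forall x, Om x -> converges_near k0 x) ->
 forall h x, fatou_limit P Om h -> Om x -> (\rank ('J h x) <= 1)%N.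
Proof.
move=> cv h x [phi p1 lh] Ox; have [d d0 hd] := luc_box lh Ox; have [d1 d10 hd1] := cv x Ox.
apply: (@jacobian_coord0 _ h x (Num.min d d1)); first by rewrite lt_min d0.
move=> q hq; have hq1 : box x d q by apply: box_le hq; rewrite ge_min lexx.
have hq2 : box x d1 q by apply: box_le hq; rewrite ge_min lexx orbT.
apply/eqP; rewrite -cn_eq0 eq_le cn_ge0 andbT; apply/ler_addgt0Pl => e e0; rewrite addr0.
have e2 : 0 < e/2 by rewrite divr_gt0.
have [N hN] := hd1 _ 0%N e2; have [hz _] := hN q hq2.
have [N' _ hN'] := hd _ e2.
have phi_ge n : (n <= phi n)%N by elim: n => // n IH; apply: leq_ltn_trans IH _; exact: p1.
have g1 := hz (phi (N+N')%N) (leq_trans (leq_addr N' N) (phi_ge _)).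
have := hN' (N+N')%N (leq_addl _ _) q hq1 0.
have := cnB (zz q (phi (N+N')%N)) (zz q (phi (N+N')%N) - h q 0 0); rewrite opprB addrC subrK.
by move: g1; plra.
Qed.

(* [y 0] depends only on the first coordinate near the centre, and depends on it effectively: by separation of chains
  it determines [tau], hence [z], with a Lipschitz bound. *)
Section Eta.
Variables (k0 m : nat) (tau0 : C) (rho ep D B d : R) (q0 : T).
Hypothesis separated : separating m.
Hypothesis rho1 : 0 < rho <= 1/40.
Hypothesis st : stable_at m tau0 rho ep.
Hypothesis B0 : 0 <= B.
Hypothesis D0 : 0 <= D.
Hypothesis d0 : 0 < d.
Hypothesis k04 : (4 <= a^k0)%N.
Hypothesis hbox : forall q, box q0 d q -> cn ((q 0 0)^-1 - (X (a^k0))%:C) <= (X (a^k0) - 1)/4 /\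
 exists tau, centered k0 tau0 rho ep D B q tau.

Lemma box_converges q : box q0 (d/2) q -> converges_near k0 q.
Proof.
move=> hq; exists (d/2); first by rewrite divr_gt0.
move=> e j e0; have [N1 h1] := centered_z_small k0 tau0 rho ep B D0 e0.
have [N2 h2] := centered_cauchy_back k0 D rho1 st B0 j e0.
exists (N1+N2)%N => q' hq'; have /hbox[_ [tau cq]] : box q0 d q' by rewrite [d]splitr; exact: box_trans hq hq'.
split; first by move=> t ht; apply: h1 cq _ (leqDl ht).
by move=> k l hk hl; apply: h2 cq _ _ (leqDr hk) (leqDr hl).
Qed.

Lemma box_half q : box q0 (d/2) q -> box q0 d q.
Proof. by apply: box_le; rewrite ler_pdivrMr // ler_peMr ?ler1n // ltW. Qed.

Lemma box_limits q y : box q0 (d/2) q -> limits k0 q y ->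
 exists tau, [/\ centered k0 tau0 rho ep D B q tau, cn (y 0%N + 1/2) <= rho, chain m y & forall tau', tracked (a^k0) (zz q) tau' ->
  forall j, y j = E j (exitY tau' (y 0%N))].
Proof.
move=> hq hy; have [_ [tau ct]] := hbox (box_half hq); exists tau.
have yr : cn (y 0%N + 1/2) <= rho.
 apply/ler_addgt0Pl => e /(hy 0%N)[N hN]; have g1 := hN (N+k0)%N (leq_addr _ _).
 have [_ _ _ _ hw] := ct; have g2 := hw (N+k0)%N (leq_addl _ _); rewrite subn0 in g1.
 set w := ww q _ in g1 g2; have -> : y 0%N + 1/2 = (w+1/2) - (w - y 0%N) by ring.
 by apply: cnB_le; rewrite addrC lerD.
have r20 : cn (y 0%N + 1/2) < 1/20.
 by apply: le_lt_trans yr _; case/andP: rho1 => _ /le_lt_trans; apply; rewrite ltr_pdivrMr // mulrAC ltr_pdivlMr // !mul1r ltr_nat.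
have [_ he] := limits_exit (box_converges hq) hy r20; split=> //.
have [z0 hz _ te _] := ct; have tr : tracked (a^k0) (zz q) tau by split=> //; exists D.
have [h _ _] := st te yr.
have -> : y = fun j => E j (exitY tau (y 0%N)) by apply/funext => j; exact: he.
by apply: h; rewrite -(he tau tr) ltW.
Qed.

(** Equal first coordinates have a common phase, and then both values are fixed points of one
    contraction. *)
Lemma eta_fiber q q' y y' : box q0 (d/2) q -> box q0 (d/2) q' -> limits k0 q y -> limits k0 q' y' ->
 q 0 0 = q' 0 0 -> y 0%N = y' 0%N.
Proof.
move=> hq hq' hy hy' e.
have [tau [ct yr _ he]] := box_limits hq hy; have [tau1 [_ yr' _ he']] := box_limits hq' hy'.
have [z0 hz _ te _] := ct; have tr : tracked (a^k0) (zz q) tau by split=> //; exists D.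
have tr' : tracked (a^k0) (zz q') tau.
 by split=> [i|]; [rewrite -(skew_iter_fiber alpha i e)|exists D => i; rewrite -(skew_iter_fiber alpha i e)].
have [_ _ /(_ _ yr')] := st te yr; rewrite -(he tau tr 0%N) -(he' tau tr' 0%N) => h.
apply/eqP; rewrite -subr_eq0 -cn_eq0 eq_le cn_ge0 andbT; move: h (cn_ge0 (y 0%N - y' 0%N)).
by move: (cn _) => u; lra.
Qed.

(** The value [y_0] controls the offset by [separating], the offset controls [tau] once the [entry]
    term is subtracted, and [tau] controls the first coordinate by [tracked_separation]. *)
Lemma eta_sep q q' y y' : box q0 (d/2) q -> box q0 (d/2) q' -> limits k0 q y -> limits k0 q' y' ->
 cn (q 0 0 - q' 0 0) <= 2*(1+2*a%:R)*cn (y 0%N - y' 0%N).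
Proof.
move=> hq hq' hy hy'.
have [tau [[z0 hz _ _ _] yr ch he]] := box_limits hq hy; have [tau1 [[z0' hz' _ _ _] yr' ch' he']] := box_limits hq' hy'.
have tr : tracked (a^k0) (zz q) tau by split=> //; exists D.
have tr' : tracked (a^k0) (zz q') tau1 by split=> //; exists D.
have [x1 _] := hbox (box_half hq); have [x1' _] := hbox (box_half hq').
have := tracked_separation k04 (zz_step alpha q) (zz_step alpha q') x1 x1' tr tr'.
have z1 (x : T) : x 0 0 != 0 -> cn ((x 0 0)^-1 - (X (a^k0))%:C) <= (X (a^k0) - 1)/4 -> cn (x 0 0) <= 1.
 move=> x0 /near_real[h1 _ _]; have := cn_ge_Re (x 0 0)^-1; rewrite ler_norml => /andP[_ h2].
 have h3 : 1 <= cn (x 0 0)^-1 by have := refX_ge2 R (a^k0); move: h1 h2; move: (X _) => u; lra.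
 by rewrite -[leRHS]invr1 -[leLHS]invrK lef_pV2 ?posrE ?invr_gt0 ?cn_gt0 // -cnV.
have zq := z1 q (z0 0%N) x1; have zq' := z1 q' (z0' 0%N) x1'.
have -> : (zz q 0%N)^-1 - (zz q' 0%N)^-1 = (q' 0 0 - q 0 0)/(q 0 0*q' 0 0).
 by have := z0 0%N; have := z0' 0%N; rewrite /= => n1 n2; field; rewrite n1 n2.
rewrite cn_div cnM [cn (q' 0 0 - _)]cnBC => h1.
have h2 : cn (q 0 0 - q' 0 0) <= cn (q 0 0 - q' 0 0)/(cn (q 0 0)*cn (q' 0 0)).
 rewrite ler_peMr ?cn_ge0 // -invr1 lef_pV2 ?posrE ?mulr_gt0 ?cn_gt0 //; [|exact: (z0 0%N)|exact: (z0' 0%N)].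
 by rewrite mulr_ile1 ?cn_ge0.
apply: le_trans h2 (le_trans h1 _); rewrite -mulrA ler_pM2l //.
have w20 v : cn (v+1/2) <= rho -> cn (v+1/2) <= 1/20.
 by move=> /le_trans; apply; case/andP: rho1 => _ /le_trans; apply; lra.
have eE : (fun j => E j (exitY tau (y 0%N))) = y by apply/funext => j; rewrite -he.
have eE' : (fun j => E j (exitY tau1 (y' 0%N))) = y' by apply/funext => j; rewrite -he'.
have := @separated (exitY tau (y 0%N)) (exitY tau1 (y' 0%N)); rewrite eE eE' => /(_ ch ch').
rewrite -(he tau tr 0%N) -(he' tau1 tr' 0%N) => s1.
have := exitY_lip 0 0 (w20 _ yr) (w20 _ yr'); rewrite subrr cn0 add0r => s2.
have s3 : cn ((a%:R-1)*(tau-tau1)) <= (1/40+2*a%:R)*cn (y 0%N - y' 0%N).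
 have -> : (a%:R-1)*(tau-tau1) = (exitY tau (y 0%N) - exitY tau1 (y' 0%N)) - (exitY 0 (y 0%N) - exitY 0 (y' 0%N)) by ring.
 by apply: cnB_le; rewrite [leRHS]mulrDl; exact: lerD.
have a1 : 1 <= cn (a%:R - 1 : C).
 have -> : a%:R - 1 = (a.-1)%:R :> C by rewrite -subn1 natrB // ltnW // abs_gt1.
 by rewrite cn_nat ler1n -ltnS prednK ?abs_gt1 // ltnW // abs_gt1.
rewrite cnM in s3; apply: le_trans (_ : cn (a%:R - 1 : C)*cn (tau-tau1) <= _); first by rewrite ler_peMl ?cn_ge0.
apply: le_trans s3 _; apply: ler_wpM2r; first exact: cn_ge0.
by rewrite lerD2r; lra.
Qed.

Lemma center_chained : chained k0 m q0.
Proof.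
have hq : box q0 (d/2) q0 by apply: boxxx; rewrite divr_ge0 // ltW.
have [y hy] := limits_exist (box_converges hq); have [tau [_ yr ch _]] := box_limits hq hy.
by exists y; split=> //; apply: le_trans yr _; case/andP: rho1.
Qed.
Local Notation horiz s := (q0 + s *: delta_mx 0 0 : T).

Lemma horiz_box s (e : R) : cn s <= e -> box q0 e (horiz s).
Proof.
move=> hs j; rewrite !mxE [q0 0 j + _]addrC addrK cnM; apply: le_trans (_ : cn s*1 <= _); last by rewrite mulr1.
by apply: ler_wpM2l; [exact: cn_ge0|have [->|->] := ord2 j; rewrite /= ?cn0 ?cn1].
Qed.

Lemma horiz0 s : (horiz s) 0 0 = q0 0 0 + s.
Proof. by rewrite !mxE mulr1. Qed.

(* The polynomials [s |-> wt (horiz s) k0 k] are uniformly bounded, so their limit has a first order expansion. *)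
Lemma eta_taylor : exists b : C, forall s y y0, cn s <= d/4 -> limits k0 (horiz s) y -> limits k0 q0 y0 ->
 cn (y 0%N - y0 0%N - b*s) <= 8/d^+2*cn s^+2.
Proof.
have d2 : 0 < d/2 by rewrite divr_gt0.
pose f k := projT1 (cid (skew_iter_poly alpha (tm k0 k) q0 (delta_mx 0 0 : T))) 1.
have fE k s : (f k).[s] = wt (horiz s) k0 k by rewrite /f; case: cid => g /= ->.
have cen s : cn s <= d/2 -> exists tau, centered k0 tau0 rho ep D B (horiz s) tau.
 by move=> hs; have [_] := hbox (box_half (horiz_box hs)).
have fb k s : (k0 <= k)%N -> cn s <= d/2 -> cn (f k).[s] <= 1.
 move=> hk /cen[tau ct]; rewrite fE; have /entry_disc/andP[_] := centered_w20 rho1 ct hk.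
 by lra.
have [b hb] : exists b : C, forall e : R, 0 < e -> exists N, forall k, (N <= k)%N -> cn ((f k)`_1 - b) <= e.
 apply: complex_cauchy_lim => e e0; have [N hN] := centered_cauchy k0 D rho1 st B0 (mulr_gt0 e0 d2).
 exists N => k l hk hl; rewrite -coefB.
 have -> : e = e*(d/2)*(d/2)^-1^+1 by rewrite expr1 mulfK ?gt_eqF.
 apply: coef_bound_disc => // s /cen[tau ct]; rewrite hornerD hornerN !fE; exact: hN ct _ _ hk hl.
exists b => s y y0 hs hy hy0; apply/ler_addgt0Pl => e e0.
have e4 : 0 < e/4 by rewrite divr_gt0.
have es : 0 < e/4/(cn s + 1) by rewrite divr_gt0 // ltr_wpDl // cn_ge0.
have [N1 h1] := hy 0%N _ e4; have [N2 h2] := hy0 0%N _ e4; have [N3 h3] := hb _ es.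
pose k := (k0+N1+N2+N3)%N.
have hk0 : (k0 <= k)%N by rewrite /k -!addnA leq_addr.
have g1 := h1 k _; have {}g1 := g1 (leq_trans (leq_addl k0 N1) (leq_trans (leq_addr N2 _) (leq_addr N3 _))).
have g2 := h2 k _; have {}g2 := g2 (leq_trans (leq_addl _ N2) (leq_addr N3 _)).
have g3 := h3 k (leq_addl _ _).
have hs4 : cn s <= d/2/2 by apply: le_trans hs _; lra.
have g4 := poly_taylor d2 (fun s => fb k s hk0) hs4.
have h0 : horiz 0 = q0 by rewrite scale0r addr0.
rewrite !fE h0 in g4; rewrite !subn0 in g1 g2.
have -> : 8/d^+2*cn s^+2 = 2*1/(d/2)^+2*cn s^+2 by field; rewrite gt_eqF.
have g5 : cn (((f k)`_1 - b)*s) <= e/4.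
 rewrite cnM; apply: le_trans (_ : e/4/(cn s + 1)*cn s <= _); first by apply: ler_wpM2r; rewrite ?cn_ge0.
 by rewrite mulrC; apply: mul_frac_le; rewrite ?cn_ge0 ?ltW.
move: g1 g2 g4; set w := ww (horiz s) _; set w0 := ww q0 _ => g1 g2 g4.
have -> : y 0%N - y0 0%N - b*s = (w - w0 - (f k)`_1*s) + ((f k)`_1 - b)*s - (w - y 0%N) + (w0 - y0 0%N) by ring.
have v1 := cnD ((w - w0 - (f k)`_1*s) + ((f k)`_1 - b)*s - (w - y 0%N)) (w0 - y0 0%N).
have v2 := cnB ((w - w0 - (f k)`_1*s) + ((f k)`_1 - b)*s) (w - y 0%N).
have v3 := cnD (w - w0 - (f k)`_1*s) (((f k)`_1 - b)*s).
apply: le_trans v1 _; apply: le_trans (lerD (le_trans v2 (lerD (le_trans v3 (lerD g4 g5)) g1)) g2) _.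
by move: (2*1/_*_) => u; move: e0; plra.
Qed.

(** With slope 0 only the quadratic error would remain, against the linear lower bound of
    [eta_sep]. *)
Lemma eta_slope (b : C) (M : R) : 0 <= M -> (forall s y y0, cn s <= d/4 -> limits k0 (horiz s) y -> limits k0 q0 y0 ->
 cn (y 0%N - y0 0%N - b*s) <= M*cn s^+2) -> b != 0.
Proof.
move=> M0 hb; apply/eqP => b0.
pose Ke : R := 2*(1+2*a%:R).
have Ke0 : 0 < Ke by rewrite mulr_gt0 // ltr_wpDr.
pose t := Num.min (d/4) (1/(2*(Ke*M+1))).
have KM : 0 < Ke*M + 1 by rewrite ltr_wpDl // mulr_ge0 // ltW.
have t0 : 0 < t by rewrite lt_min !divr_gt0 ?mulr_gt0.
have ct : cn (t%:C : C) = t by rewrite cn_real gtr0_norm.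
have td : cn (t%:C : C) <= d/4 by rewrite ct ge_min lexx.
have d2 : d/4 <= d/2 by rewrite ler_pM2l // lef_pV2 ?posrE // ler_nat.
have hq : box q0 (d/2) (horiz t%:C) by apply: horiz_box; apply: le_trans td d2.
have hq0 : box q0 (d/2) q0 by apply: boxxx; rewrite divr_ge0 // ltW.
have [y hy] := limits_exist (box_converges hq); have [y0 hy0] := limits_exist (box_converges hq0).
have := eta_sep hq hq0 hy hy0; have := hb _ _ _ td hy hy0.
rewrite b0 mul0r subr0 horiz0 [q0 0 0 + _]addrC addrK ct -/Ke => g1 g2.
have g3 : t <= Ke*(M*t^+2) by apply: le_trans g2 _; rewrite ler_pM2l.
have g4 : (Ke*M+1)*t <= 1/2.
 have : t <= 1/(2*(Ke*M+1)) by rewrite ge_min lexx orbT.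
 by rewrite ler_pdivlMr ?mulr_gt0 //; move: (Ke*M+1) (t) => u v; lra.
have g5 : 1 <= Ke*M*t by rewrite -(ler_pM2r t0) mul1r; move: g3; rewrite expr2 !mulrA.
by move: g4 g5 t0; rewrite mulrDl mul1r; move: (Ke*M*t) => u; lra.
Qed.

(** The limit along the stage times is [(0, y_0)]; near the centre it depends on the first
    coordinate alone, with derivative [b] different from 0. *)
Lemma center_rank (Om : set T) : open Om -> Om q0 -> (forall x, Om x -> converges_near k0 x) ->
 exists2 h, fatou_limit P Om h & \rank ('J h q0) = 1%N.
Proof.
move=> oO Oq0 cv.
have lim q : exists l : C, forall y, limits k0 q y -> y 0%N = l.
 have [[y hy]|n] := pselect (exists y, limits k0 q y); last by exists 0 => y hy; exfalso; apply: n; exists y.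
 by exists (y 0%N) => y' hy'; exact: limits_unique hy' hy 0%N.
pose h (q : T) : T := \row_(j < 2) (if j == 0 then 0 else projT1 (cid (lim q))).
have h1 q y : limits k0 q y -> h q 0 1 = y 0%N.
 by move=> hy; rewrite mxE /=; case: cid => l /= /(_ y hy).
have h0 q : h q 0 0 = 0 by rewrite mxE.
exists h.
 exists (fun n => tm k0 (k0+n)).
  move=> n n' nn; apply: ltn_sub2r; rewrite ltn_exp2l ?abs_gt1 //; last by rewrite ltn_add2l.
  by apply: leq_ltn_trans (leq_addr n k0) _; rewrite ltn_add2l.
 apply: box_luc => x Ox; have [d1 d10 hd1] := cv x Ox; have [d2 d20 hd2] := open_box oO Ox.
 exists (Num.min d1 d2); first by rewrite lt_min d10.
 move=> e e0; have e2 : 0 < e/2 by rewrite divr_gt0.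
 have [N hN] := hd1 _ 0%N e2; have [k1 hk1] := tm_ge k0 N.
 exists (N+k1)%N => // n /= hn q hq.
 have hq1 : box x d1 q by apply: box_le hq; rewrite ge_min lexx.
 have hq2 : Om q by apply: hd2; apply: box_le hq; rewrite ge_min lexx orbT.
 have [hz hw] := hN q hq1; have [y hy] := limits_exist (cv q hq2).
 move=> j; have [->|->] := ord2 j.
  rewrite h0 subr0; apply: le_trans (hz _ _) _; last by lra.
  by apply: hk1; apply: leq_trans (leq_addl k0 n); exact: leqDr hn.
 rewrite (h1 q y hy); have [N' hN'] := hy 0%N _ e2.
 have g1 := hN' (N+N')%N (leq_addl _ _).
 have Nn : (N <= k0 + n)%N by apply: leq_trans (leq_addl k0 n); exact: leqDl hn.
 have g2 := hw (k0+n)%N (N+N')%N Nn (leq_addr _ _); rewrite !subn0 in g1 g2.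
 set w := wt q k0 (k0+n) in g2 *; set w' := ww q _ in g1 g2.
 have -> : w - y 0%N = (w-w') + (w' - y 0%N) by ring.
 by apply: cnD_le; move: g1 g2; lra.
have [b hb] := eta_taylor.
have M0 : 0 <= 8/d^+2 by rewrite divr_ge0 // exprn_ge0 // ltW.
have b0 := eta_slope M0 hb.
have d4 : 0 < d/4 by rewrite divr_gt0.
apply: (jacobian_shear (b := b) (M := 8/d^+2) d4 b0) => v hv.
have d2 : d/4 <= d/2 by rewrite ler_pM2l // lef_pV2 ?posrE // ler_nat.
have hq : box q0 (d/2) (v+q0) by move=> j; rewrite !mxE addrK; apply: le_trans (hv j) d2.
have hq' : box q0 (d/2) (horiz (v 0 0)) by apply: horiz_box; apply: le_trans (hv 0) d2.
have hq0 : box q0 (d/2) q0 by apply: boxxx; rewrite divr_ge0 // ltW.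
have [y hy] := limits_exist (box_converges hq); have [y' hy'] := limits_exist (box_converges hq').
have [y0 hy0] := limits_exist (box_converges hq0).
have ef : y 0%N = y' 0%N by apply: eta_fiber hq hq' hy hy' _; rewrite horiz0 mxE addrC.
have sub (A B' : T) j : (A-B') 0 j = A 0 j - B' 0 j by rewrite !mxE.
split; first by rewrite sub !h0 subrr.
by rewrite sub (h1 _ y hy) (h1 _ y0 hy0) ef; exact: hb (hv 0) hy' hy0.
Qed.
End Eta.

(** * Construction of the domains and conclusion *)

Lemma domain_exists : exists m1, forall m, (m1 <= m)%N -> exists k0 (Om : set T),
 [/\ fatou_component P Om, has_rank P Om 1, forall x, Om x -> converges_near k0 x & forall x, Om x -> chained k0 m x].
Proof.
have [ma hma] := chain_lim (exit_ref_gt0 S) (exit_refS S); have [mb hmb] := chain_sep (exit_ref S).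
have e40 : 0 < 1/40 :> R by rewrite divr_gt0.
(* From here on [100*(17/20)^m] is at most [1/40], as [separating] demands. *)
have [mc hmc] := geom_small 100 e40.
exists (ma+mb+mc)%N => m hm.
have hm1 : (ma <= m)%N by move: hm; plia.
have hm2 : (mb <= m)%N by move: hm; plia.
have hm3 : (mc <= m)%N by move: hm; plia.
have sep : separating m.
 move=> Y Y' c1 c2; apply: le_trans (hmb m _ _ Y Y' hm2 c1 c2 (exit_lim_exit_map _ _ _) (exit_lim_exit_map _ _ _)) _.
 by apply: ler_wpM2r; [exact: cn_ge0|exact: hmc].
have ich := ideal_chainP R m; have [Y hY] := hma m _ hm1 ich.
have eY := exit_map_backward (exit_ref_gt0 S) (exit_refS S) (fun j => let: And5 h _ _ _ _ := ich in h j) hY.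
have a1 : a%:R - 1 != 0 :> C.
 have -> : a%:R - 1 = (a.-1)%:R :> C by rewrite -subn1 natrB // ltnW // abs_gt1.
 by rewrite pnatr_eq0 -lt0n -ltnS prednK ?abs_gt1 // ltnW // abs_gt1.
(* Since [entry (-1/2) = 0], this phase makes the exit offset of [-1/2] equal to that of the ideal
   chain, and [-1/2] a fixed point of the stage map. *)
pose tau0 := (a%:R-1)^-1*Y.
have eY0 : (a%:R-1)*tau0 = Y by rewrite /tau0 mulVKf.
have ch0 : chain m (fun j => E j ((a%:R-1)*tau0)).
 by rewrite eY0 (_ : (fun j => _) = ideal_chain R m) //; apply/funext => j; exact: eY.
have e0 : E 0 ((a%:R-1)*tau0) = - (1/2) by rewrite eY0 eY.
have [rho [ep [rho1 ep1 st]]] := center_constants ch0 e0.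
have [k0 [q0 [d [D [B [d0 B0 D0 k04 hbox]]]]]] := center_box rho1 ep1 st.
have hb' q : box q0 d q -> exists tau, centered k0 tau0 rho ep D B q tau by move=> /hbox[].
have fq := center_fatou rho1 st B0 D0 d0 hb'.
pose Om := connected_component (fatou_set P) q0.
have fO : fatou_component P Om by exists q0.
have Oq0 : Om q0 by exact: connected_component_refl.
have hq0 : box q0 (d/2) q0 by apply: boxxx; rewrite divr_ge0 // ltW.
have [tau ct] := hb' q0 (boxxx q0 (ltW d0)).
have [B1 hB1] := centered_bounded rho1 D0 ct.
have cv := component_converges fO Oq0 hB1 (box_converges rho1 st B0 D0 d0 hbox hq0).
have cc := center_chained rho1 st B0 D0 d0 hbox.
have oO := fatou_component_open fO.
have ch := component_chained sep oO (fatou_component_connected fO) cv Oq0 cc.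
exists k0, Om; split=> //; split; last exact: chained_rank_le cv.
have [h fl rk] := center_rank sep rho1 st B0 D0 d0 k04 hbox oO Oq0 cv.
by exists h, q0.
Qed.
End Setting.

Theorem theorem1p11 (R : realType) (alpha0 : int) (halpha0 : 1 < alpha0) :
 let P := @skew_map R alpha0 in
 ([set grand_orbit P Om | Om in
  [set Om | wandering_domain P Om /\ has_rank P Om 1]] #= [set: nat])%card.
Proof.
cbv zeta; set P := @skew_map R alpha0; have [S] := exit_data_exists R halpha0.
have [m1 hm1] := domain_exists S halpha0.
have ex m : exists Om k0, [/\ fatou_component P Om, has_rank P Om 1,
  forall x, Om x -> converges_near alpha0 k0 x & forall x, Om x -> chained alpha0 k0 (m1+m) x].
 by have [k0 [Om h]] := hm1 (m1+m)%N (leq_addr _ _); exists Om, k0.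
pose dom m := projT1 (cid (ex m)).
have domP m : exists k0, [/\ fatou_component P (dom m), has_rank P (dom m) 1,
  forall x, dom m x -> converges_near alpha0 k0 x & forall x, dom m x -> chained alpha0 k0 (m1+m) x].
 by rewrite /dom; case: cid.
apply/card_eqPle; split.
 (* Upper bound: grand orbits are images of components, of which there are countably many. *)
 apply: (sub_countable (card_image_le _ _)).
 apply: (sub_countable _ (countable_components P)); apply: subset_card_le => Om [[fO _] _].
 exact: fO.
(* Lower bound: the grand orbits of the domains [dom m] are pairwise distinct. *)
apply: (@card_le_trans _ _ _ ((fun m => grand_orbit P (dom m)) @` [set: nat])).
 have : ((fun m => grand_orbit P (dom m)) @` [set: nat] #= [set: nat])%card.
  apply: inj_card_eq => m m' _ _ e.
  have [k0 [fO rk cv ch]] := domP m; have [k0' [fO' rk' cv' ch']] := domP m'.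
  (* A component lies in its own grand orbit, with both exponents 0, so equal grand orbits give a
     common iterated image of the two domains, and [chained_meet] compares their [m]. *)
  have [_ [n1 [n2 en]]] : grand_orbit P (dom m') (dom m).
   by rewrite -e; split=> //; exists 0%N, 0%N.
  have [x fx ex'] := fO'.
  have Ox : dom m' x by rewrite ex'; exact: connected_component_refl.
  have [y Oy ey] : (iter n2 P @` dom m) (iter n1 P x) by rewrite -en; exists x.
  have [em _] := chained_meet halpha0 (ch _ Oy) (ch' _ Ox) (cv _ Oy) (cv' _ Ox) ey.
  by apply/eqP; rewrite -(eqn_add2l m1) em.
 by move/card_eqPle => [].
apply: subset_card_le => _ [m _ <-]; have [k0 [fO rk cv ch]] := domP m.
have wd : wandering_domain P (dom m) by apply: (chained_wandering halpha0 fO cv ch).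
by exists (dom m).
Qed.
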